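(* Let $\Lambda$ be a superpartition and let $n\geq 1$ (for $e_n$), resp. $n\geq 0$ (for $\tilde e_n$). Then $$e_n\,P_\Lambda^{(\alpha)}=\sum_\Omega v_{\Lambda\Omega}(\alpha)\,P_\Omega^{(\alpha)},\qquad \tilde e_n\,P_\Lambda^{(\alpha)}=\sum_\Omega \tilde v_{\Lambda\Omega}(\alpha)\,P_\Omega^{(\alpha)},$$ where the first sum is over all superpartitions $\Omega$ such that $\Omega/\Lambda$ is a vertical $n$-strip and the second over all $\Omega$ such that $\Omega/\Lambda$ is a vertical $\tilde n$-strip, and in both cases $$v_{\Lambda\Omega}(\alpha)=(-1)^{\#(\Omega/\Lambda)}\,\psi'_{\Omega/\Lambda}\,\mathrm{Det}_{\Omega/\Lambda},\qquad \tilde v_{\Lambda\Omega}(\alpha)=(-1)^{\#(\Omega/\Lambda)}\,\psi'_{\Omega/\Lambda}\,\mathrm{Det}_{\Omega/\Lambda},$$ with $\#(\Omega/\Lambda)$, $\psi'_{\Omega/\Lambda}$ and $\mathrm{Det}_{\Omega/\Lambda}$ as defined in the context.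
   Context: Partitions and diagrams: a partition $\lambda$ is identified with its Ferrers diagram; the cell $(i,j)$ lies in row $i$ (rows numbered from top to bottom) and column $j$. For a cell $s=(i,j)$ and a partition $\lambda$, the arm is $a_\lambda(s)=\lambda_i-j$ and the leg is $\ell_\lambda(s)=\lambda'_j-i$, where $\lambda'$ is the conjugate partition. $\lambda/\mu$ is a vertical (resp. horizontal) $n$-strip if $\mu\subseteq\lambda$, $|\lambda|-|\mu|=n$ and no two cells of $\lambda/\mu$ lie in the same row (resp. column). Superpartitions: a superpartition $\Lambda$ of degree $(n|m)$ is a pair $(\Lambda^\circledast,\Lambda^* )$ of partitions with $\Lambda^*\subseteq\Lambda^\circledast$, $|\Lambda^*|=n$, and $\Lambda^\circledast/\Lambda^*$ both a horizontal and a vertical $m$-strip; $m$ is the fermionic degree. Its diagram is the diagram of $\Lambda^*$ (squares) together with circles in the cells of $\Lambda^\circledast/\Lambda^*$. Equivalently $\Lambda=(\Lambda^a;\Lambda^s)=(\Lambda_1,\dots,\Lambda_m;\Lambda_{m+1},\dots)$ where $\Lambda^a$ (strictly decreasing, possibly containing $0$) consists of the parts $\Lambda^*_i$ with $\Lambda^\circledast_i\neq\Lambda^*_i$ and $\Lambda^s$ of the parts $\Lambda^*_i$ with $\Lambda^\circledast_i=\Lambda^*_i$. Dominance order: $\Omega\le\Lambda$ iff they have the same degree, $\Omega^*\le\Lambda^*$ and $\Omega^\circledast\le\Lambda^\circledast$ in the usual dominance order of partitions. Symmetric functions in superspace: polynomials in commuting $z_1,\dots,z_N$ and anticommuting $\theta_1,\dots,\theta_N$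 invariant under simultaneous permutation of $(z_i,\theta_i)$, over $\mathbb Q(\alpha)$ (with $N$ arbitrary/large). Monomials: $m_\Lambda=\sum'_{\sigma\in S_N}\theta_{\sigma(1)}\cdots\theta_{\sigma(m)}z_{\sigma(1)}^{\Lambda_1}\cdots z_{\sigma(N)}^{\Lambda_N}$, the sum over permutations giving distinct terms. Set $e_n=m_{(\emptyset;1^n)}$ and $\tilde e_n=m_{(0;1^n)}$. Power sums: $\tilde p_k=\sum_i\theta_iz_i^k$ ($k\ge0$), $p_r=\sum_iz_i^r$ ($r\ge1$), $p_\Lambda=\tilde p_{\Lambda_1}\cdots\tilde p_{\Lambda_m}p_{\Lambda_{m+1}}\cdots p_{\Lambda_\ell}$. Scalar product: $\langle\langle p_\Lambda,p_\Omega\rangle\rangle_\alpha=\delta_{\Lambda\Omega}\alpha^{\ell(\Lambda^s)}z_{\Lambda^s}$ with $z_\lambda=\prod_i i^{n_i(\lambda)}n_i(\lambda)!$. The Jack polynomials in superspace $P^{(\alpha)}_\Lambda$ form the unique basis with $P_\Lambda^{(\alpha)}=m_\Lambda+$ (combination of $m_\Omega$, $\Omega<\Lambda$) and $\langle\langle P_\Lambda^{(\alpha)},P_\Omega^{(\alpha)}\rangle\rangle_\alpha=0$ for $\Lambda\neq\Omega$. Strips: $\Omega/\Lambda$ is a vertical $n$-strip if $\Omega^*/\Lambda^*$ and $\Omega^\circledast/\Lambda^\circledast$ are both vertical $n$-strips; it is a vertical $\tilde n$-strip if $\Omega^*/\Lambda^*$ is a vertical $n$-strip and $\Omega^\circledast/\Lambda^\circledast$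 a vertical $(n+1)$-strip. For such a strip: preexisting squares are the squares of $\Lambda^*$; new squares are the cells of $\Omega^*/\Lambda^*$ not in $\Lambda^\circledast$; bumping squares are the cells of $\Omega^*/\Lambda^*$ that are circles of $\Lambda$; preexisting circles are circles of $\Lambda$ that are still circles of $\Omega$; new circles are circles of $\Omega$ that are not circles of $\Lambda$. New squares, bumping squares and new circles are called non-preexisting cells. Hook-lengths: for a superpartition $\Gamma$ and a cell $s$, $h_\Gamma^{(\alpha)}(s)=\ell_{\Gamma^\circledast}(s)+\alpha(a_{\Gamma^*}(s)+1)$ and $h^\Gamma_{(\alpha)}(s)=\ell_{\Gamma^*}(s)+1+\alpha\,a_{\Gamma^\circledast}(s)$, where $h^\Gamma_{(\alpha)}$ of an empty cell (a cell that is not a square of $\Gamma^*$) is defined to be $1$. Put $A(s)=h_\Lambda^{(\alpha)}(s)/h_\Omega^{(\alpha)}(s)$, $B(s)=h^\Omega_{(\alpha)}(s)/h^\Lambda_{(\alpha)}(s)$, $C(s)=A(s)B(s)$. Factorized part: let $\mathrm{col}_{\Omega/\Lambda}$ be the set of cells of $\Lambda^\circledast$ lying in a column of $\Omega$ that contains a non-preexisting cell. Then $\psi'_{\Omega/\Lambda}=\prod_{s\in\mathrm{col}_{\Omega/\Lambda}}c(s)$ where, according to the non-preexisting cells in the row of $s$: $c(s)=C(s)$ if the row contains no non-preexisting cell; $c(s)=A(s)$ if it contains only a new circle; $c(s)=B(s)$ if it contains only a bumping square; $c(s)=1$ if it contains a new square, or a bumping square together with a new circle. Determinant: label the bumping squares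 and new squares from top to bottom $x_1,\dots,x_n$, and the new circles and new squares from top to bottom $y_1,\dots,y_n$ (vertical $n$-strip) resp. $y_1,\dots,y_{n+1}$ (vertical $\tilde n$-strip); a new square thus carries both an $x$ and a $y$ label. A label on the cell in row $a$, column $b$ takes the value $\alpha b-a$. Define $[x_i;y_j]_\alpha=\frac{\alpha}{(x_i-y_j+\alpha)(x_i-y_j)}$ if there is no $y$ label in the row of $x_i$; $=1$ if $x_i$ and $y_j$ are in the same row; $=0$ if there is a label $y_\ell\neq y_j$ in the row of $x_i$. For a vertical $n$-strip, $\mathrm{Det}_{\Omega/\Lambda}=\det([x_i;y_j]_\alpha)_{1\le i,j\le n}$; for a vertical $\tilde n$-strip, $\mathrm{Det}_{\Omega/\Lambda}$ is the determinant of the $(n+1)\times(n+1)$ matrix whose first row is $(1,\dots,1)$ and whose row $i+1$ is $([x_i;y_1]_\alpha,\dots,[x_i;y_{n+1}]_\alpha)$, $1\le i\le n$. Sign: $\#(\Omega/\Lambda)$ is the sum, over each new circle and each bumping square, of the number of preexisting circles and new squares lying above it. *)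

(* Defs.v *)
From HB Require Import structures.
From mathcomp Require Import all_boot all_order all_fingroup all_algebra fraction.
From mathcomp Require Import mpoly.

Set Implicit Arguments.
Unset Strict Implicit.
Unset Printing Implicit Defensive.

Import GRing.Theory.
Local Open Scope ring_scope.

(** * Superpolynomials over a commutative ring *)

(* The superpolynomial with coefficient family [f] stands for the sum over S
   of [f S * theta_S], where [theta_S] is the product of the [theta_i], [i \in S],
   in increasing order of [i]. The alias hides the pointwise ring structure that
   finite functions carry. *)
Definition superpoly (N : nat) (K : comNzRingType) : Type :=
  {ffun {set 'I_N} -> {mpoly K[N]}}.

HB.instance Definition _ N (K : comNzRingType) :=
  GRing.Lmodule.copy (superpoly N K) {ffun {set 'I_N} -> {mpoly K[N]}}.

Section Superpoly.
Variables (N : nat) (K : comNzRingType).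
Local Notation sp := (superpoly N K).
Implicit Types (A B C S T : {set 'I_N}) (f g h : sp).

(* theta_A * theta_B = (-1) ^ ninv A B * theta_(A :|: B) for disjoint A, B. *)
Definition ninv A B : nat := #|[set p in setX A B | (p.2 < p.1)%N]|.

Definition spone : sp := [ffun S => if S == set0 then 1 else 0].

Definition spmul f g : sp :=
  [ffun S : {set 'I_N} =>
    \sum_(A : {set 'I_N} | A \subset S)
      (-1) ^+ ninv A (S :\: A) * (f A * g (S :\: A))].

Lemma ninv0l B : ninv set0 B = 0%N.
Proof. by apply/eqP; rewrite cards_eq0; apply/eqP/setP=> p; rewrite !inE. Qed.

Lemma ninv0r A : ninv A set0 = 0%N.
Proof.
by apply/eqP; rewrite cards_eq0; apply/eqP/setP=> p; rewrite !inE andbF.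
Qed.

Lemma ninvUl A B C : [disjoint A & B] ->
  ninv (A :|: B) C = (ninv A C + ninv B C)%N.
Proof.
move=> dAB; rewrite /ninv -cardsUI [X in (_ + X)%N](_ : _ = 0%N) ?addn0.
  by apply: eq_card => p; rewrite !inE -!andb_orl.
apply/eqP; rewrite cards_eq0; apply/eqP/setP=> -[x y]; rewrite !inE /=.
apply/negP=> /andP[/andP[/andP[xA _] _] /andP[/andP[xB _] _]].
by move/pred0P: dAB => /(_ x); rewrite /= xA xB.
Qed.

Lemma ninvUr A B C : [disjoint A & B] ->
  ninv C (A :|: B) = (ninv C A + ninv C B)%N.
Proof.
move=> dAB; rewrite /ninv -cardsUI [X in (_ + X)%N](_ : _ = 0%N) ?addn0.
  by apply: eq_card => p; rewrite !inE andb_orr -!andb_orl.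
apply/eqP; rewrite cards_eq0; apply/eqP/setP=> -[x y]; rewrite !inE /=.
apply/negP=> /andP[/andP[/andP[_ yA] _] /andP[/andP[_ yB] _]].
by move/pred0P: dAB => /(_ y); rewrite /= yA yB.
Qed.

Lemma spmulA : associative spmul.
Proof.
move=> f g h; apply/ffunP=> S; rewrite !ffunE.
transitivity (\sum_(A : {set 'I_N} | A \subset S)
  \sum_(B : {set 'I_N} | B \subset S :\: A)
   (-1) ^+ (ninv A B + ninv A (S :\: A :\: B) + ninv B (S :\: A :\: B))%N *
    (f A * g B * h (S :\: A :\: B))).
  apply: eq_bigr => A AS; rewrite ffunE mulr_sumr mulr_sumr.
  apply: eq_bigr => B BSA.
  rewrite -[in ninv A (S :\: A)](setID (S :\: A) B) (setIidPr BSA) ninvUr.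
    by rewrite !exprD [f A * (_ * _)]mulrCA !mulrA.
  by apply/pred0P=> x /=; rewrite !inE; case: (x \in B).
symmetry.
transitivity (\sum_(T : {set 'I_N} | T \subset S)
  \sum_(A : {set 'I_N} | A \subset T)
   (-1) ^+ (ninv A (T :\: A) + ninv T (S :\: T))%N *
    (f A * g (T :\: A) * h (S :\: T))).
  apply: eq_bigr => T TS; rewrite ffunE mulr_suml mulr_sumr.
  apply: eq_bigr => A AT.
  by rewrite addnC exprD !mulrA.
rewrite (exchange_big_dep (fun A => A \subset S)) /=; last first.
  by move=> T A TS AT; apply: subset_trans AT TS.
apply: eq_bigr => A AS.
rewrite (reindex_onto (fun B => A :|: B) (fun T => T :\: A)) /=; last first.
  by move=> T /andP[_ AT]; rewrite -{1}(setIidPr AT) setID.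
apply: eq_big => [B|B BSA].
  rewrite setDUl setDv set0U subUset AS subsetUl andbT /=.
  by rewrite subsetD; congr andb; apply/(sameP eqP setDidPl).
have dAB : [disjoint A & B].
  by move: BSA => /andP[_ /eqP]; rewrite setDUl setDv set0U => /setDidPl; rewrite disjoint_sym.
have -> : (A :|: B) :\: A = B.
  by move: BSA => /andP[_ /eqP].
by rewrite -setDDl ninvUl // addnA.
Qed.

Lemma spmul1l : left_id spone spmul.
Proof.
move=> f; apply/ffunP=> S; rewrite !ffunE (bigD1 set0) ?sub0set //=.
rewrite !ffunE eqxx ninv0l expr0 !mul1r setD0 big1 ?addr0 // => A /andP[_ A0].
by rewrite ffunE (negPf A0) mul0r mulr0.
Qed.

Lemma spmul1r : right_id spone spmul.
Proof.
move=> f; apply/ffunP=> S; rewrite !ffunE (bigD1 S) //=.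
rewrite !ffunE setDv eqxx ninv0r expr0 mul1r mulr1.
rewrite big1 ?addr0 // => A /andP[AS AnS].
rewrite ffunE setD_eq0; case: ifP => [SA|_]; last by rewrite !mulr0.
by rewrite eqEsubset AS SA in AnS.
Qed.

Lemma spmulDl : left_distributive spmul +%R.
Proof.
move=> f g h; apply/ffunP=> S; rewrite !ffunE -big_split /=.
by apply: eq_bigr => A _; rewrite ffunE mulrDl mulrDr.
Qed.

Lemma spmulDr : right_distributive spmul +%R.
Proof.
move=> f g h; apply/ffunP=> S; rewrite !ffunE -big_split /=.
by apply: eq_bigr => A _; rewrite ffunE !mulrDr.
Qed.

Lemma spone_neq0 : spone != 0.
Proof.
apply/eqP=> /ffunP/(_ set0); rewrite !ffunE eqxx => /eqP.
by rewrite oner_eq0.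
Qed.

HB.instance Definition _ := GRing.Zmodule_isNzRing.Build sp
  spmulA spmul1l spmul1r spmulDl spmulDr spone_neq0.

Lemma spscaleAl (k : K) f g : k *: (f * g) = (k *: f) * g.
Proof.
apply/ffunP=> S; rewrite !ffunE scaler_sumr; apply: eq_bigr => A _.
by rewrite ffunE -scalerAl -scalerAr.
Qed.

HB.instance Definition _ := GRing.Lmodule_isLalgebra.Build K sp spscaleAl.

Lemma spscaleAr (k : K) f g : k *: (f * g) = f * (k *: g).
Proof.
apply/ffunP=> S; rewrite !ffunE scaler_sumr; apply: eq_bigr => A _.
by rewrite ffunE -!scalerAr.
Qed.

HB.instance Definition _ := GRing.Lalgebra_isAlgebra.Build K sp spscaleAr.

Definition zvar (i : 'I_N) : sp := [ffun S => if S == set0 then 'X_i else 0].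
Definition theta (i : 'I_N) : sp := [ffun S => if S == [set i] then 1 else 0].
End Superpoly.

Arguments zvar {N K} i.
Arguments theta {N K} i.

(** * Partitions and their diagrams *)

Definition is_part (la : seq nat) : bool := sorted geq la && (0%N \notin la).

(* Rows and columns are numbered from 1, and [part la i] is 0 beyond the length
   of [la]; the conventions below are meaningful for i, j >= 1 only. *)
Definition part (la : seq nat) (i : nat) : nat := nth 0%N la i.-1.
Definition conj_part (la : seq nat) (j : nat) : nat := count (leq j) la.

Definition cell : Type := (nat * nat)%type.

(* The cells are listed row by row, from top to bottom. *)
Definition cells (la : seq nat) : seq cell :=
  [seq (i, j) | i <- iota 1 (size la), j <- iota 1 (part la i)].

Definition skew (la mu : seq nat) : seq cell :=
  [seq c <- cells la | c \notin cells mu].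

Definition contained (mu la : seq nat) : bool :=
  all (fun c => c \in cells la) (cells mu).

Definition vstrip_part (n : nat) (la mu : seq nat) : bool :=
  [&& contained mu la, sumn la == (sumn mu + n)%N
    & uniq [seq c.1 | c <- skew la mu]].

Definition hstrip_part (n : nat) (la mu : seq nat) : bool :=
  [&& contained mu la, sumn la == (sumn mu + n)%N
    & uniq [seq c.2 | c <- skew la mu]].

Definition dom_part (mu la : seq nat) : bool :=
  (sumn mu == sumn la) &&
  all (fun k => sumn (take k mu) <= sumn (take k la))%N
    (iota 0 (size mu + size la).+1).

(* Signed, since the arm in the smaller diagram of a circle is -1. *)
Definition arm (la : seq nat) (s : cell) : int := (part la s.1)%:Z - s.2%:Z.
Definition leg (la : seq nat) (s : cell) : int :=
  (conj_part la s.2)%:Z - s.1%:Z.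

Definition parts (n : nat) : seq (seq nat) :=
  [seq la <- undup [seq [seq k <- map val t | (0 < k)%N] | t : n.-tuple 'I_n.+1]
     | is_part la & sumn la == n].

Lemma mem_parts n la : (la \in parts n) = is_part la && (sumn la == n).
Proof.
rewrite mem_filter andb_idr // => /andP[/andP[_ la0] /eqP sla].
rewrite mem_undup; apply/imageP.
have le_la k : k \in la -> (k < n.+1)%N.
  rewrite ltnS -sla; elim: (la) => //= a s IH; rewrite inE.
  by case/predU1P=> [->|/IH/leq_trans->//]; rewrite ?leq_addr ?leq_addl.
have sz_la : (size la <= n)%N.
  rewrite -sla; elim: (la) la0 => //= a s IH; rewrite inE negb_or => /andP[a0 /IH].
  by move=> les; rewrite -add1n leq_add // lt0n eq_sym.
pose f k : 'I_n.+1 := inord k.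
have szt : size (map f (la ++ nseq (n - size la) 0%N)) == n.
  by rewrite size_map size_cat size_nseq subnKC.
exists (Tuple szt) => //=; rewrite -map_comp map_cat filter_cat.
rewrite [X in _ ++ X](_ : _ = [::]) ?cats0; last first.
  by elim: (n - size la)%N => //= k IH; rewrite inordK.
have -> : map (val \o f) la = la.
  rewrite -[RHS]map_id; apply/eq_in_map => k /le_la kn.
  by rewrite /= inordK.
apply/esym/all_filterP/allP=> k kla; rewrite lt0n.
by apply: contraNneq la0 => <-.
Qed.

(** * Superpartitions *)

(* The pair [p] is (Lambda^circledast, Lambda^star). *)
Definition is_spart (p : seq nat * seq nat) : bool :=
  let m := (sumn p.1 - sumn p.2)%N in
  [&& is_part p.1, is_part p.2, hstrip_part m p.1 p.2 & vstrip_part m p.1 p.2].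

Record spart : Type := SPart { spval : seq nat * seq nat; _ : is_spart spval }.
HB.instance Definition _ := [isSub for spval].
HB.instance Definition _ := [Choice of spart by <:].

Definition circ (La : spart) : seq nat := (spval La).1.
Definition star (La : spart) : seq nat := (spval La).2.

Definition deg (La : spart) : nat := sumn (star La).
Definition fdeg (La : spart) : nat := (sumn (circ La) - sumn (star La))%N.

(* The parts of Lambda^a and Lambda^s; Lambda^a may contain 0. *)
Definition fpart (La : spart) : seq nat :=
  [seq part (star La) i | i <- iota 1 (size (circ La))
     & part (circ La) i != part (star La) i].
Definition bpart (La : spart) : seq nat :=
  [seq part (star La) i | i <- iota 1 (size (circ La))
     & part (circ La) i == part (star La) i].

Definition sparts (n m : nat) : seq spart :=
  pmap insub [seq (c, s) | c <- parts (n + m), s <- parts n].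

Lemma mem_sparts n m La :
  (La \in sparts n m) = (deg La == n) && (fdeg La == m).
Proof.
rewrite mem_pmap_sub /deg /fdeg /star /circ.
case: La => -[c s] /= /and4P[pc ps /and3P[_ /eqP sz _] _] /=.
move: sz; set d := (sumn c - sumn s)%N => sz.
apply/allpairsP/andP => [[[c' s'] /= []]|[/eqP dn /eqP dm]].
  rewrite !mem_parts => /andP[_ /eqP cn] /andP[_ /eqP sn] [ec es].
  by move: sz; rewrite /d ec es sn cn eqxx => /addnI ->; rewrite addKn.
by exists (c, s); rewrite !mem_parts pc ps /= sz dn dm !eqxx.
Qed.

Lemma sparts_uniq n m : uniq (sparts n m).
Proof.
apply: pmap_sub_uniq; apply: allpairs_uniq; rewrite ?filter_uniq ?undup_uniq //.
by move=> [a b] [c d].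
Qed.

Definition sdom (Om La : spart) : bool :=
  [&& deg Om == deg La, fdeg Om == fdeg La,
      dom_part (star Om) (star La) & dom_part (circ Om) (circ La)].
Definition sdom_lt (Om La : spart) : bool := (Om != La) && sdom Om La.

(** * Symmetric functions in superspace over Q(alpha) *)

Notation Qa := {fraction {poly rat}}.
Definition alpha : Qa := tofrac ('X : {poly rat}).

(* A symmetric function in superspace is given by its versions in
   N = 0, 1, 2, ... pairs of variables (z_i, theta_i). *)
Definition sfun : Type := forall N : nat, superpoly N Qa.

Definition mterm (N : nat) (a s : seq nat) (w : 'S_N) : superpoly N Qa :=
  (\prod_(i < N | (i < size a)%N) theta (w i))
  * \prod_(i < N) zvar (w i) ^+ nth 0%N (a ++ s) i.

(* The monomial m_(a; s), a sum over distinct terms. It is 0 when there are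
   fewer variables than parts. *)
Definition mono (a s : seq nat) : sfun := fun N =>
  if (size (a ++ s) <= N)%N
  then \sum_(t <- undup [seq mterm a s w | w : 'S_N]) t else 0.

Definition smono (La : spart) : sfun := mono (fpart La) (bpart La).

Definition elem (n : nat) : sfun := mono [::] (nseq n 1%N).
Definition telem (n : nat) : sfun := mono [:: 0%N] (nseq n 1%N).

Definition psum (r : nat) : sfun := fun N => \sum_(i < N) zvar i ^+ r.
Definition tpsum (k : nat) : sfun := fun N =>
  \sum_(i < N) theta i * zvar i ^+ k.

Definition spsum (La : spart) : sfun := fun N =>
  (\prod_(k <- fpart La) tpsum k N) * (\prod_(r <- bpart La) psum r N).

Definition zee (la : seq nat) : nat :=
  (\prod_(i <- undup la) (i ^ count_mem i la * (count_mem i la)`!))%N.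

Definition spsum_norm (La : spart) : Qa :=
  alpha ^+ size (bpart La) * (zee (bpart La))%:R.

(* <<f, g>>_alpha = c, by bilinear extension from the power sums. *)
Definition scalar_product (f g : sfun) (c : Qa) : Prop :=
  exists (I : seq spart) (a b : spart -> Qa),
    [/\ uniq I,
        forall N, f N = \sum_(G <- I) a G *: spsum G N,
        forall N, g N = \sum_(G <- I) b G *: spsum G N
      & c = \sum_(G <- I) a G * b G * spsum_norm G].

(* The coefficients do not depend on the number of variables, so a family of
   Jack superpolynomials is stable in N. *)
Definition unitriangular (P : spart -> sfun) : Prop :=
  forall La, exists c : spart -> Qa, forall N,
    P La N = smono La N
      + \sum_(Om <- sparts (deg La) (fdeg La) | sdom_lt Om La)
          c Om *: smono Om N.

Definition is_jack (P : spart -> sfun) : Prop :=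
  unitriangular P /\
  forall La Om, La <> Om -> scalar_product (P La) (P Om) 0.

(** * Strips *)

Section Strip.
Variables Om La : spart.

Definition vstrip (n : nat) : bool :=
  vstrip_part n (star Om) (star La) && vstrip_part n (circ Om) (circ La).
Definition tvstrip (n : nat) : bool :=
  vstrip_part n (star Om) (star La) && vstrip_part n.+1 (circ Om) (circ La).

Definition circles (G : spart) : seq cell := skew (circ G) (star G).

Definition new_squares : seq cell :=
  [seq c <- skew (star Om) (star La) | c \notin cells (circ La)].
Definition bumping_squares : seq cell :=
  [seq c <- skew (star Om) (star La) | c \in circles La].
Definition preexisting_circles : seq cell :=
  [seq c <- circles La | c \in circles Om].
Definition new_circles : seq cell :=
  [seq c <- circles Om | c \notin circles La].
Definition non_preexisting : seq cell :=
  new_squares ++ bumping_squares ++ new_circles.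

Definition hook_lower (G : spart) (s : cell) : Qa :=
  (leg (circ G) s)%:~R + alpha * (arm (star G) s + 1)%:~R.
Definition hook_upper (G : spart) (s : cell) : Qa :=
  if s \in cells (star G)
  then (leg (star G) s + 1)%:~R + alpha * (arm (circ G) s)%:~R else 1.

Definition ratioA (s : cell) : Qa := hook_lower La s / hook_lower Om s.
Definition ratioB (s : cell) : Qa := hook_upper Om s / hook_upper La s.
Definition ratioC (s : cell) : Qa := ratioA s * ratioB s.

Definition same_row (c d : cell) : bool := c.1 == d.1.
Definition same_col (c d : cell) : bool := c.2 == d.2.

Definition col_cells : seq cell :=
  [seq s <- cells (circ La) | has (same_col s) non_preexisting].

Definition cfactor (s : cell) : Qa :=
  if has (same_row s) new_squares then 1 else
  match has (same_row s) bumping_squares, has (same_row s) new_circles with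
  | false, false => ratioC s
  | false, true => ratioA s
  | true, false => ratioB s
  | true, true => 1
  end.

Definition psi' : Qa := \prod_(s <- col_cells) cfactor s.

(* Labelled cells, from top to bottom since [cells] lists rows in that order. *)
Definition xcells : seq cell :=
  [seq c <- cells (circ Om) | (c \in bumping_squares) || (c \in new_squares)].
Definition ycells : seq cell :=
  [seq c <- cells (circ Om) | (c \in new_circles) || (c \in new_squares)].

Definition label_value (c : cell) : Qa := alpha * c.2%:R - c.1%:R.

Definition bracket (x y : cell) : Qa :=
  if ~~ has (same_row x) ycells then
    alpha / ((label_value x - label_value y + alpha)
             * (label_value x - label_value y))
  else if same_row x y then 1 else 0.

Definition bracket_at (i j : nat) : Qa :=
  bracket (nth (0, 0)%N xcells i) (nth (0, 0)%N ycells j).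

Definition stripDet (n : nat) : Qa :=
  \det (\matrix_(i < n, j < n) bracket_at i j).
Definition tstripDet (n : nat) : Qa :=
  \det (\matrix_(i < n.+1, j < n.+1)
          (if nat_of_ord i is i'.+1 then bracket_at i' j else 1)).

Definition strip_sign : nat :=
  (\sum_(c <- new_circles ++ bumping_squares)
     count (fun d : cell => d.1 < c.1)%N
       (preexisting_circles ++ new_squares))%N.

Definition pieri_coef (n : nat) : Qa :=
  (-1) ^+ strip_sign * psi' * stripDet n.
Definition tpieri_coef (n : nat) : Qa :=
  (-1) ^+ strip_sign * psi' * tstripDet n.

End Strip.

(* Main.v *)
(* The idea is to realise the symmetric functions in superspace as operators on the
   free module F spanned by the superpartitions, in such a way that P_Lambda becomes
   the basis vector Lambda.

   A superpartition is a sequence of rows, each with or without a circle. On F act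
   operators t and r that put a circle in row k, with coefficients the product over
   j < k of 1 - 1/(u_j - u_k), where u_k = alpha Lambda^star_k - k, r carrying the
   extra factor u_k, and an operator d that turns a circle into a square. By partial
   fractions these operators and their adjoints, for an explicit form in which the
   superpartitions are orthogonal, satisfy (anti)commutation relations from which one
   builds operators satisfying the relations of the multiplications by the p_k and
   the tilde p_k, with the same adjoints. Sending a product of power sums to the
   corresponding product of operators applied to the empty superpartition is thus
   well defined and, by the Gram matrix, faithful and orthogonal. Removing the first
   column of Lambda by some e_n or tilde e_n shows that the preimage of the vector
   Lambda is unitriangular on the monomials, whence it is P_Lambda.

   It remains to compute the operators X_n and Y_n of e_n and tilde e_n. They are
   determined by [r, X_n] = alpha (t X_n - Y_n) and d Y_n + Y_n d = (n + 1) X_{n+1}.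
   The candidate matrix coefficient of a strip is a product over pairs of rows times
   a minor of the matrix alpha / ((u_i - u_j) (u_i - u_j + alpha)), bordered by a row
   in the case of Y_n; expanding the minors reduces the relations to Lagrange
   interpolation. Finally the product over pairs of rows telescopes, column by
   column, to psi', and peeling off the rows and columns of the minor and of Det that
   have a single nonzero entry identifies them up to the sign (-1)^#. *)
From HB Require Import structures.
Require Import Defs.
From mathcomp Require Import all_boot all_order all_fingroup all_algebra fraction.
From mathcomp Require Import mpoly.
From mathcomp Require Import boolp zify ring.
Import Defs.
Set Implicit Arguments.
Unset Strict Implicit.
Unset Printing Implicit Defensive.
Import Order.TTheory GRing.Theory Num.Theory.
Local Open Scope ring_scope.

(** * Minors *)

(** Among the relations with [X_n] and [Y_n], those that produce [Y_n] from [X_n] and [X_(n+1)] from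
    [Y_n] hold by definition of these operators. Only the commutation of [t] with [X_n] has to be
    read off from explicit matrix coefficients; these are therefore found before the model is
    complete, not after it. The power-sum operators are never computed on coefficients: their
    brackets with [X_n] and [Y_n] vanish by Jacobi identities, and Newton's identities then express
    them through [X_n] and [Y_n], so that they (anti)commute among themselves. Three features shape
    the details. Adjoint coefficients have a factor for each of infinitely many empty rows; the
    products are cut after [N] rows and renormalised, hence the parameter [N] and the stability
    lemmas. Row operators pass through states that are no superpartitions; these are excluded
    because a coefficient vanishes where two contents differ by one. Adding a circle keeps
    Lambda^star while bumping keeps Lambda^circledast, so each minor is needed in two forms. About
    [alpha] only [al_gen] is used. *)

Section Minors.
Variable K : comNzRingType.
Implicit Types (A B : option nat -> option nat -> K) (r c D : seq (option nat)).

(* [None] indexes the bordering row or column. *)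
Definition minor (m : nat) A r c : K :=
  \det (\matrix_(i < m, j < m) A (nth None r i) (nth None c j)).

Lemma minor_tr m A r c : minor m A r c = minor m (fun i j => A j i) c r.
Proof. by rewrite /minor -det_tr; congr (\det _); apply/matrixP=> i j; rewrite !mxE. Qed.

Lemma nth_rem_index c k b : uniq c -> k \in c ->
  nth None (rem k c) b = nth None c (bump (index k c) b).
Proof.
elim: c b => //= x c IH b /andP[xc uc]; rewrite inE eq_sym.
case: eqVneq => [->|nxk] /=; first by [].
by move=> kc; case: b => [|b] //=; rewrite IH // /bump ltnS addnS.
Qed.

Lemma minor_cons m A i r c : uniq c -> size c = m.+1 ->
  minor m.+1 A (i :: r) c =
  \sum_(k <- c) (-1) ^+ index k c * A i k * minor m A r (rem k c).
Proof.
move=> uc sc; rewrite /minor (expand_det_row _ ord0).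
rewrite [RHS](big_nth None) sc big_mkord; apply: eq_bigr => j _.
rewrite mxE /= /cofactor add0n index_uniq ?sc // mulrA [A _ _ * _]mulrC.
congr (_ * \det _); apply/matrixP=> a b; rewrite !mxE /=.
by rewrite nth_rem_index ?mem_nth ?sc // index_uniq ?sc.
Qed.

Lemma eq_minor m A B r c : size r = m -> size c = m ->
  {in r & c, A =2 B} -> minor m A r c = minor m B r c.
Proof.
move=> sr sc AB; rewrite /minor; congr (\det _); apply/matrixP=> i j.
by rewrite !mxE AB // mem_nth ?sr ?sc.
Qed.

Lemma minor_swap m A r1 i k r2 c : ((size r1).+1 < m)%N ->
  minor m A (r1 ++ i :: k :: r2) c = - minor m A (r1 ++ k :: i :: r2) c.
Proof.
move=> lt1; have lt0 := ltnW lt1.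
pose a := Ordinal lt0; pose b := Ordinal lt1.
have ab : a != b by rewrite -val_eqE /= neq_ltn ltnSn.
rewrite /minor; set M := (X in _ = - \det X).
rewrite (_ : \matrix_(_, _) _ = xrow a b M); last first.
  apply/matrixP=> x y; rewrite !mxE; congr (A _ _).
  rewrite !nth_cat; case: tpermP => [->|->|nxa nxb] /=.
  - by rewrite ltnn subnn ltnNge leqnSn /= subSnn.
  - by rewrite ltnn subnn ltnNge leqnSn /= subSnn.
  case: ltnP => // le1.
  have : (x != size r1 :> nat) by rewrite (_ : size r1 = a) // val_eqE; apply/eqP.
  have : (x != (size r1).+1 :> nat) by rewrite (_ : (size r1).+1 = b) // val_eqE; apply/eqP.
  move=> n1 n0; have : (1 < x - size r1)%N by lia.
  by case: (x - size r1)%N => [|[|]].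
by rewrite xrowE det_mulmx det_perm odd_tperm ab /= expr1 mulN1r.
Qed.

Lemma minor_move m A r1 k r2 c : (size r1 < m)%N ->
  minor m A (r1 ++ k :: r2) c = (-1) ^+ size r1 * minor m A (k :: r1 ++ r2) c.
Proof.
elim/last_ind: r1 r2 => [|r1 i IH] r2 /=; first by rewrite mul1r.
rewrite size_rcons => lt; rewrite -cats1 -catA /= minor_swap // IH; last exact: ltnW.
by rewrite exprS mulN1r mulNr -!catA.
Qed.

Lemma minor_dup m A k r c : k \in r -> (index k r < m)%N -> minor m.+1 A (k :: r) c = 0.
Proof.
move=> kr lt; rewrite /minor.
pose b : 'I_m.+1 := Ordinal (lt : (index k r).+1 < m.+1)%N.
apply: (determinant_alternate (i1 := ord0) (i2 := b)) => // j.
by rewrite !mxE /= nth_index.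
Qed.

Lemma rem_index k r : uniq r -> k \in r ->
  exists r1 r2, [/\ r = r1 ++ k :: r2, rem k r = r1 ++ r2 & index k r = size r1].
Proof.
move=> ur kr; have ltk : (index k r < size r)%N by rewrite index_mem.
exists (take (index k r) r), (drop (index k r).+1 r); split.
- by rewrite -{1}(cat_take_drop (index k r) r) (drop_nth None) // nth_index.
- by rewrite remE.
by rewrite size_take ltk.
Qed.

Lemma minor_rem m A r c k : uniq r -> k \in r -> size r = m ->
  minor m A r c = (-1) ^+ index k r * minor m A (k :: rem k r) c.
Proof.
move=> ur kr sr; have [r1 [r2 [er -> ->]]] := rem_index ur kr.
by rewrite er minor_move // -sr er size_cat /= addnS ltnS leq_addr.
Qed.

(** Linearity in the first row. It folds a sum over the position of one more circle, with one minor
    for each position, into a single bordered minor; both orders of composition of two operators are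
    brought to that shape and then compared by their borders. *)
Lemma minor_lin m (I : Type) (s : seq I) (v : I -> K) (f : I -> option nat) A i r c :
  uniq c -> size c = m.+1 ->
  {in c, forall j, A i j = \sum_(x <- s) v x * A (f x) j} ->
  minor m.+1 A (i :: r) c = \sum_(x <- s) v x * minor m.+1 A (f x :: r) c.
Proof.
move=> uc sc Ai; rewrite minor_cons //.
under [RHS]eq_bigr do rewrite minor_cons // mulr_sumr.
rewrite exchange_big /= big_seq [RHS]big_seq; apply: eq_bigr => j jc.
rewrite (Ai _ jc); move: (minor _ _ _ _) => y.
rewrite mulr_sumr mulr_suml; apply: eq_bigr => x _.
by rewrite -!mulrA mulrCA.
Qed.

Lemma minor_unit_row m A r c d : uniq r -> uniq c -> d \in r -> d \in c ->
  size r = m.+1 -> size c = m.+1 -> {in c, forall j, A d j = (d == j)%:R} ->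
  minor m.+1 A r c = (-1) ^+ (index d r + index d c) * minor m A (rem d r) (rem d c).
Proof.
move=> ur uc dr dc sr sc Ad; rewrite (minor_rem _ _ ur dr sr) minor_cons //.
rewrite (bigD1_seq d) //= Ad // eqxx mulr1 big_seq_cond big1 ?addr0 ?mulrA -?exprD //.
by move=> j /andP[jc jd]; rewrite Ad // eq_sym (negPf jd) mulr0 mul0r.
Qed.

Lemma minor_unit_col m A r c d : uniq r -> uniq c -> d \in r -> d \in c ->
  size r = m.+1 -> size c = m.+1 -> {in r, forall i, A i d = (i == d)%:R} ->
  minor m.+1 A r c = (-1) ^+ (index d r + index d c) * minor m A (rem d r) (rem d c).
Proof.
move=> ur uc dr dc sr sc Ad; rewrite minor_tr (minor_unit_row (d := d)) //.
  by rewrite addnC [in RHS]minor_tr.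
by move=> j jr; rewrite Ad // eq_sym.
Qed.

(** Either alternative allows row and column [d] to be deleted, with the same sign. A label may be
    of one kind for one matrix and of the other kind for another. *)
Definition unit_at A r c d :=
  {in c, forall j, A d j = (d == j)%:R} \/ {in r, forall i, A i d = (i == d)%:R}.

Lemma minor_peel m A r c d : uniq r -> uniq c -> d \in r -> d \in c ->
  size r = m.+1 -> size c = m.+1 -> unit_at A r c d ->
  minor m.+1 A r c = (-1) ^+ (index d r + index d c) * minor m A (rem d r) (rem d c).
Proof. by move=> ? ? ? ? ? ? []; [apply: minor_unit_row | apply: minor_unit_col]. Qed.

Lemma unit_at_rem A r c d d' : uniq r -> uniq c -> unit_at A r c d ->
  unit_at A (rem d' r) (rem d' c) d.
Proof. by move=> ur uc [h|h]; [left|right] => x /mem_rem; apply: h. Qed.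

(** Deleting row and column [d] produces a sign that depends on the positions of the label only,
    hence the same one for [A] and [B]. Once all of [D] is deleted, only entries on which the
    matrices agree are left. *)
Lemma minor_congr m A B r c D : uniq r -> uniq c -> uniq D ->
  {subset D <= r} -> {subset D <= c} -> size r = m -> size c = m ->
  (forall d, d \in D -> unit_at A r c d /\ unit_at B r c d) ->
  (forall i j, i \in r -> j \in c -> i \notin D -> j \notin D -> A i j = B i j) ->
  minor m A r c = minor m B r c.
Proof.
elim: D m r c => [|d D IH] m r c ur uc uD sDr sDc sr sc un ag.
  by apply: eq_minor => // i j ir jc; apply: ag.
have dr : d \in r by apply: sDr; rewrite mem_head.
have dc : d \in c by apply: sDc; rewrite mem_head.
case: m sr sc => [|m] sr sc; first by move/size0nil: sr dr => ->.
have [uA uB] := un d (mem_head _ _).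
rewrite !(@minor_peel _ _ r c d) //; congr (_ * _).
move: uD => /= /andP[dD uD].
have sub s : uniq s -> {subset d :: D <= s} -> {subset D <= rem d s}.
  move=> us sD x xD; rewrite (rem_filter _ us) mem_filter /= sD ?andbT ?inE ?xD ?orbT //.
  by apply: contraNneq dD => <-.
apply: IH; rewrite ?rem_uniq ?size_rem ?sr ?sc //; try exact: sub.
  move=> x xD; have [|? ?] := un x; first by rewrite inE xD orbT.
  by split; apply: unit_at_rem.
move=> i j; rewrite !(rem_filter _ _) // !mem_filter /= => /andP[nid ir] /andP[njd jc] niD njD.
by apply: ag => //; rewrite inE negb_or ?nid ?njd.
Qed.

(* A unit row whose column is missing is a zero row. *)
Lemma minor_zero_row m A r c d : d \in r -> size r = m -> size c = m ->
  {in c, forall j, A d j = 0} -> minor m A r c = 0.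
Proof.
move=> dr sr sc A0; have ltd : (index d r < m)%N by rewrite -sr index_mem.
rewrite /minor (expand_det_row _ (Ordinal ltd)) big1 // => j _.
by rewrite mxE /= nth_index // A0 ?mul0r // mem_nth // sc.
Qed.

Lemma minor_zero_col m A r c d : d \in c -> size r = m -> size c = m ->
  {in r, forall i, A i d = 0} -> minor m A r c = 0.
Proof. by move=> dc sr sc A0; rewrite minor_tr (minor_zero_row (d := d)). Qed.

End Minors.

(** * Interpolation identities *)

Section Lagrange.
Variable K : fieldType.
Implicit Types (x : nat -> K) (s : seq nat).

(** The residue at [z = x i] of the rational function \prod_j (1 - 1/(x_j - z)). *)
Definition lag s x i : K := \prod_(j <- s | j != i) (1 - (x j - x i)^-1).

Lemma lag_head a s x : a \notin s ->
  lag (a :: s) x a = \prod_(j <- s) (1 - (x j - x a)^-1).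
Proof.
move=> as_; rewrite /lag big_cons eqxx big_seq_cond [RHS]big_seq.
by apply: eq_bigl => j; case: eqVneq => [->|]; rewrite ?andbT ?(negPf as_).
Qed.

Lemma lag_tail a s x i : a \notin s -> i \in s ->
  lag (a :: s) x i = (1 - (x a - x i)^-1) * lag s x i.
Proof. by move=> as_ is_; rewrite /lag big_cons ifT //; apply: contraNneq as_ => ->. Qed.

Lemma prod_partial_fraction s x z : uniq s -> {in s &, injective x} ->
  {in s, forall i, x i != z} ->
  \prod_(i <- s) (1 - (x i - z)^-1) = 1 - \sum_(i <- s) lag s x i / (x i - z).
Proof.
elim: s z => [|a s IH] z /=; first by rewrite !big_nil subr0.
move=> /andP[as_ us] injx nz; rewrite !big_cons lag_head //.
have injs : {in s &, injective x} by move=> i j si sj; apply: injx; rewrite inE ?si ?sj orbT.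
have nza : x a != z by rewrite nz ?mem_head.
have na i : i \in s -> x i != x a.
  move=> si; apply: contraNneq as_ => /injx <-; rewrite ?inE ?eqxx ?si ?orbT //.
rewrite (IH z) // ?(IH (x a)) // => [|i si]; last by rewrite nz // inE si orbT.
(* The factor of the new node is split so that the first sum is the one at [z] and the second the
   one at [x a]; both are known by induction. *)
have -> : \sum_(j <- s) lag (a :: s) x j / (x j - z) =
  \sum_(j <- s) (1 - (x a - z)^-1) * (lag s x j / (x j - z)) +
  \sum_(j <- s) (lag s x j / (x j - x a)) / (x a - z).
  rewrite -big_split /= big_seq [RHS]big_seq; apply: eq_bigr => i si.
  rewrite lag_tail //.
  have nzi : x i - z != 0 by rewrite subr_eq0 nz // inE si orbT.
  have nai : x i - x a != 0 by rewrite subr_eq0 na.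
  have nai' : x a - x i != 0 by rewrite subr_eq0 eq_sym na.
  have nza' : x a - z != 0 by rewrite subr_eq0.
  by field; rewrite nzi nai nai' nza'.
rewrite -mulr_sumr -mulr_suml; ring.
Qed.

(** Comparison of the coefficients of 1/z at infinity in [prod_partial_fraction]; [sum_lag_mul] is
    the comparison for 1/z^2, where the binomial counts the pairs of nodes. Both follow by induction
    on the nodes, without expansions. *)
Lemma sum_lag s x : uniq s -> {in s &, injective x} ->
  \sum_(i <- s) lag s x i = (size s)%:R.
Proof.
elim: s => [|a s IH] /=; first by rewrite big_nil.
move=> /andP[as_ us] injx; rewrite big_cons lag_head //.
have injs : {in s &, injective x} by move=> i j si sj; apply: injx; rewrite inE ?si ?sj orbT.
have na i : i \in s -> x i != x a.
  move=> si; apply: contraNneq as_ => /injx <-; rewrite ?inE ?eqxx ?si ?orbT //.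
rewrite prod_partial_fraction // -natr1 -IH //.
have -> : \sum_(j <- s) lag (a :: s) x j =
  \sum_(j <- s) lag s x j + \sum_(j <- s) lag s x j / (x j - x a).
  rewrite -big_split /= big_seq [RHS]big_seq; apply: eq_bigr => i si.
  by rewrite lag_tail // mulrBl mul1r -[x i - x a]opprB invrN mulrN mulrC.
ring.
Qed.

Lemma sum_lag_mul s x : uniq s -> {in s &, injective x} ->
  \sum_(i <- s) lag s x i * x i = \sum_(i <- s) x i + 'C(size s, 2)%:R.
Proof.
elim: s => [|a s IH] /=; first by rewrite !big_nil add0r.
move=> /andP[as_ us] injx; rewrite !big_cons lag_head //.
have injs : {in s &, injective x} by move=> i j si sj; apply: injx; rewrite inE ?si ?sj orbT.
have na i : i \in s -> x i != x a.
  move=> si; apply: contraNneq as_ => /injx <-; rewrite ?inE ?eqxx ?si ?orbT //.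
rewrite prod_partial_fraction // binS bin1 natrD -[(size s)%:R in RHS](sum_lag us injs).
have -> : \sum_(j <- s) lag (a :: s) x j * x j = \sum_(j <- s) lag s x j * x j +
   (\sum_(j <- s) lag s x j + \sum_(j <- s) lag s x j / (x j - x a) * x a).
  rewrite -!big_split /= big_seq [RHS]big_seq; apply: eq_bigr => i si.
  have nai : x i - x a != 0 by rewrite subr_eq0 na.
  have nai' : x a - x i != 0 by rewrite subr_eq0 eq_sym na.
  by rewrite lag_tail //; field; rewrite nai nai'.
rewrite IH // -mulr_suml; ring.
Qed.

End Lagrange.

(** * Row states and their operators *)

(* A superpartition is encoded by its rows, numbered from 0: the length of the row in
   Lambda^star and whether the row ends with a circle. *)
Definition rowstate := nat -> nat * bool.

Definition upd (s : rowstate) (k : nat) (v : nat * bool) : rowstate :=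
  fun j => if j == k then v else s j.

Lemma upd_same s k v : upd s k v k = v. Proof. by rewrite /upd eqxx. Qed.
Lemma upd_other s k v j : j != k -> upd s k v j = s j.
Proof. by rewrite /upd => /negPf->. Qed.

Lemma updC s k v j w : j != k -> upd (upd s k v) j w = upd (upd s j w) k v.
Proof.
move=> jk; apply/funext=> i; rewrite /upd; case: (eqVneq i j) => [->|//].
by rewrite (negPf jk).
Qed.

Lemma upd_upd s k v w : upd (upd s k v) k w = upd s k w.
Proof. by apply/funext=> i; rewrite /upd; case: (i == k). Qed.

Lemma upd_id s k : upd s k (s k) = s.
Proof. by apply/funext=> i; rewrite /upd; case: eqVneq => // ->. Qed.

Section RowModel.
Variables (K : fieldType) (al : K).
Implicit Types (s : rowstate) (g : rowstate -> K).

(* The content of the first cell to the right of row [k], in Lambda^star and in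
   Lambda^circledast. *)
Definition ustar s k : K := al * (s k).1%:R - k%:R.
Definition ucirc s k : K := al * ((s k).1 + (s k).2)%:R - k%:R.

(** The sign for moving an anticommuting variable into its place past those of the circled rows
    above. *)
Definition rsgn s k : K := (-1) ^+ (\sum_(j < k) (s j).2).

Definition add_coef s k : K := \prod_(j < k) (1 - (ustar s j - ustar s k)^-1).
Definition bump_coef s k : K := \prod_(j < k) (1 + (ucirc s j - ucirc s k)^-1).
(** Formally a product over all rows below [k]. An empty row [j] contributes (u + j + 1)/(u + j),
    with u the content of row [k], so the infinite product diverges; the division by u + N removes
    the telescoped part and makes the value independent of [N] ([add_adj_stab]). The last factor of
    [bump_adj] does the same there. *)
Definition add_adj N s k : K :=
  (\prod_(j < N | (k < j)%N) (1 + (ustar s k - ustar s j)^-1)) / (ustar s k + N%:R).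
Definition bump_adj N s k : K :=
  (\prod_(j < N | (k < j)%N) (1 - (ucirc s k - ucirc s j)^-1)) * (ucirc s k + N%:R - 1).

(** Vectors are functions on states, so the value at [s] is collected from the sources of [s]. [Q]
    and [f] therefore describe the move undone: the operator that adds a circle tests for one and
    removes it. *)
Definition row_op N (Q : pred (nat * bool)) (f : nat * bool -> nat * bool)
    (c : rowstate -> nat -> K) g s : K :=
  \sum_(k < N | Q (s k)) rsgn s k * c s k * g (upd s k (f (s k))).

Definition toggles (Q : pred (nat * bool)) (f : nat * bool -> nat * bool) :=
  forall v, Q v -> (f v).2 = ~~ v.2.

Lemma rsgn_upd_le s k v j : (j <= k)%N -> rsgn (upd s k v) j = rsgn s j.
Proof.
move=> jk; congr (_ ^+ _); apply: eq_bigr => i _; rewrite upd_other //.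
by rewrite neq_ltn (leq_trans (ltn_ord i) jk).
Qed.

Lemma rsgn_upd_gt s k v j : (k < j)%N -> v.2 = ~~ (s k).2 ->
  rsgn (upd s k v) j = - rsgn s j.
Proof.
move=> kj vk; rewrite /rsgn (bigD1 (Ordinal kj)) //= [in RHS](bigD1 (Ordinal kj)) //=.
rewrite upd_same vk !exprD -mulNr.
rewrite [X in _ * (-1) ^+ X](eq_bigr (fun i : 'I_j => nat_of_bool (s i).2)); last first.
  by move=> i ik; rewrite upd_other.
by case: (s k).2; rewrite /= ?expr0 ?expr1 ?opprK.
Qed.

Lemma rsgn_sqr s k : rsgn s k * rsgn s k = 1.
Proof. by rewrite /rsgn -exprD addnn -mul2n exprM sqrrN expr1n expr1n. Qed.

Lemma rsgn_anti s k v j w : j != k -> v.2 = ~~ (s k).2 -> w.2 = ~~ (s j).2 ->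
  rsgn s k * rsgn (upd s k v) j = - (rsgn s j * rsgn (upd s j w) k).
Proof.
move=> jk vk wj; case: (ltngtP j k) => [lt|lt|eq]; last by rewrite eq eqxx in jk.
- by rewrite (rsgn_upd_le _ _ (ltnW lt)) (rsgn_upd_gt lt wj) mulrN opprK mulrC.
by rewrite (rsgn_upd_le _ _ (ltnW lt)) (rsgn_upd_gt lt vk) mulrN mulrC.
Qed.

(** Moves in two different rows lead to the same state in both orders, with equal coefficients by
    hypothesis but opposite signs, since each move toggles a circle and exactly one of the two signs
    counts the circle of the other row. Only the terms that act twice on one row survive. *)
Lemma row_op_anti N Q1 f1 c1 Q2 f2 c2 g s :
  toggles Q1 f1 -> toggles Q2 f2 ->
  (forall k j, (k < N)%N -> (j < N)%N -> j != k -> Q1 (s k) -> Q2 (s j) ->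
     c1 s k * c2 (upd s k (f1 (s k))) j = c2 s j * c1 (upd s j (f2 (s j))) k) ->
  row_op N Q1 f1 c1 (row_op N Q2 f2 c2 g) s + row_op N Q2 f2 c2 (row_op N Q1 f1 c1 g) s =
  \sum_(k < N | Q1 (s k) && Q2 (f1 (s k)))
     c1 s k * c2 (upd s k (f1 (s k))) k * g (upd s k (f2 (f1 (s k)))) +
  \sum_(k < N | Q2 (s k) && Q1 (f2 (s k)))
     c2 s k * c1 (upd s k (f2 (s k))) k * g (upd s k (f1 (f2 (s k)))).
Proof.
move=> T1 T2 cc.
pose off Q f (c : rowstate -> nat -> K) Q' f' (c' : rowstate -> nat -> K) := \sum_(k < N | Q (s k)) \sum_(j < N | Q' (s j) && (j != k))
   (rsgn s k * rsgn (upd s k (f (s k))) j) * (c s k * c' (upd s k (f (s k))) j) *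
   g (upd (upd s k (f (s k))) j (f' (s j))) : K.
have split Q f c Q' f' c' : toggles Q f ->
  row_op N Q f c (row_op N Q' f' c' g) s =
  \sum_(k < N | Q (s k) && Q' (f (s k)))
     c s k * c' (upd s k (f (s k))) k * g (upd s k (f' (f (s k)))) + off Q f c Q' f' c'.
  move=> T; rewrite big_mkcondr /= -big_split /=; apply: eq_bigr => k Qk.
  rewrite /row_op mulr_sumr (bigID (fun j : 'I_N => j == k)) /=; congr (_ + _).
    rewrite big_mkcondl big_pred1_eq upd_same upd_upd rsgn_upd_le //.
    case: ifP => // _.
    rewrite -[RHS]mul1r -(rsgn_sqr s k); ring.
  apply: eq_big => [j|j /andP[_ jk]].
    by case: (eqVneq j k) => jk; rewrite ?andbF // upd_other.
  by rewrite upd_other //; ring.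
rewrite !split // addrACA [X in _ + X](_ : _ = 0) ?addr0 //.
rewrite /off (exchange_big_dep (fun j : 'I_N => Q2 (s j))) /=; last by move=> k j _ /andP[].
rewrite -big_split big1 //= => j Q2j.
rewrite [X in X + _](eq_bigl (fun k : 'I_N => Q1 (s k) && (k != j))); last first.
  by move=> k; rewrite Q2j eq_sym.
rewrite -big_split big1 //= => k /andP[Q1k kj].
have jk : j != k by rewrite eq_sym.
rewrite (rsgn_anti jk (T1 _ Q1k) (T2 _ Q2j)) (cc _ _ (ltn_ord k) (ltn_ord j) jk Q1k Q2j).
rewrite (updC _ _ _ jk); ring.
Qed.

Lemma ustar_upd_id s k (v : nat * bool) : v.1 = (s k).1 -> ustar (upd s k v) = ustar s.
Proof.
by move=> e; apply/funext=> j; rewrite /ustar /upd; case: eqVneq => [->|]; rewrite ?e.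
Qed.

Lemma ucirc_upd_id s k (v : nat * bool) : (v.1 + v.2 = (s k).1 + (s k).2)%N ->
  ucirc (upd s k v) = ucirc s.
Proof.
by move=> e; apply/funext=> j; rewrite /ucirc /upd; case: eqVneq => [->|]; rewrite ?e.
Qed.

Lemma ustar_upd_other s k v j : j != k -> ustar (upd s k v) j = ustar s j.
Proof. by move=> jk; rewrite /ustar upd_other. Qed.
Lemma ucirc_upd_other s k v j : j != k -> ucirc (upd s k v) j = ucirc s j.
Proof. by move=> jk; rewrite /ucirc upd_other. Qed.

Definition add_op N (h : K -> K) := row_op N (fun v => v.2) (fun v => (v.1, false))
  (fun s k => add_coef s k * h (ustar s k)).
Definition bump_op N := row_op N (fun v => ~~ v.2 && (0 < v.1)%N)
  (fun v => (v.1.-1, true)) bump_coef.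
Definition add_adj_op N (h : K -> K) := row_op N (fun v => ~~ v.2) (fun v => (v.1, true))
  (fun s k => add_adj N s k * h (ustar s k)).
Definition bump_adj_op N := row_op N (fun v => v.2) (fun v => (v.1.+1, false)) (bump_adj N).

Lemma add_op_anti N h h' g s :
  add_op N h (add_op N h' g) s + add_op N h' (add_op N h g) s = 0.
Proof.
rewrite row_op_anti; first by rewrite !big_pred0 ?addr0 // => k /=; rewrite andbF.
- by move=> v ->.
- by move=> v ->.
by move=> k j _ _ jk _ _; rewrite /add_coef !ustar_upd_id //; ring.
Qed.

Lemma bump_op_anti N g s : bump_op N (bump_op N g) s + bump_op N (bump_op N g) s = 0.
Proof.
have T : toggles (fun v => ~~ v.2 && (0 < v.1)%N) (fun v => (v.1.-1, true)).
  by move=> v /andP[/negPf->].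
rewrite row_op_anti //; first by rewrite !big_pred0 ?addr0 // => k /=; rewrite andbF.
move=> k j _ _ jk /andP[/negPf ek lk] /andP[/negPf ej lj].
by rewrite /bump_coef !ucirc_upd_id //= ?ek ?ej ?addn0 ?addn1 ?prednK //; ring.
Qed.

Lemma add_adj_add N h h' g s :
  add_adj_op N h (add_op N h' g) s + add_op N h' (add_adj_op N h g) s =
  g s * \sum_(k < N) add_coef s k * add_adj N s k * h (ustar s k) * h' (ustar s k).
Proof.
rewrite row_op_anti; first last.
- by move=> k j _ _ jk _ _; rewrite /add_coef /add_adj !ustar_upd_id //; ring.
- by move=> v ->.
- by move=> v /negPf->.
rewrite mulr_sumr [RHS](bigID (fun k : 'I_N => ~~ (s k).2)) /=; congr (_ + _).
  apply: eq_big => [k|k /andP[/negPf ek _]]; first by rewrite andbT.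
  by rewrite /add_coef /add_adj !ustar_upd_id //= -ek -surjective_pairing upd_id; ring.
apply: eq_big => [k|k /andP[ek _]]; first by rewrite negbK andbT.
by rewrite /add_coef /add_adj !ustar_upd_id //= -ek -surjective_pairing upd_id; ring.
Qed.

(** The two coefficients interact only when the circle concerned lies above the bumped row. With u
    the difference of the two contents, the operator listed first then carries 1 + 1/u and the other
    1 + 1/(u + al), in either order. *)
Lemma add_adj_bump N h g s : add_adj_op N h (bump_op N g) s + bump_op N (add_adj_op N h g) s = 0.
Proof.
rewrite row_op_anti; first last.
- move=> k j kN jN jk /= /negPf ek /andP[/negPf ej lj].
  rewrite /add_adj /bump_coef (ustar_upd_other _ _ (_ : k != j)) 1?eq_sym //.
  case: (ltngtP j k) => [lt|lt|eq]; last by rewrite eq eqxx in jk.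
    rewrite [RHS]mulrC; congr (_ / _ * _ * _).
      by apply: eq_bigr => i ki; rewrite ustar_upd_other // neq_ltn (ltn_trans lt ki) orbT.
    apply: eq_bigr => i _; rewrite ?ucirc_upd_other //.
    by rewrite neq_ltn (ltn_trans (ltn_ord i) lt).
  rewrite (bigD1 (Ordinal jN)) //= [in RHS](bigD1 (Ordinal jN)) //=.
  rewrite (bigD1 (Ordinal lt)) //= [in RHS](bigD1 (Ordinal lt)) //=.
  rewrite [X in _ * (_ * X) = _](eq_bigr (fun i : 'I_j => 1 + (ucirc s i - ucirc s j)^-1)); last first.
    by move=> i ik; rewrite !ucirc_upd_other.
  rewrite [X in _ = _ * (_ * X / _ * _)](eq_bigr (fun i : 'I_N => 1 + (ustar s k - ustar s i)^-1)); last first.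
    by move=> i /andP[_ ij]; rewrite ustar_upd_other.
  move: (\prod_(i < N | _) _) (\prod_(i < j | _) _) => A B.
  rewrite (ucirc_upd_other _ _ jk) /ucirc /ustar !upd_same /= ek ej !addn1 !addn0 -!natr1.
  have -> : (s j).1%:R = (s j).1.-1%:R + 1 :> K by rewrite natr1 prednK.
  rewrite [al * (_ + 1) - _ - (al * (_ + 1) - _)](_ : _ =
    al * (s k).1%:R - k%:R - (al * (s j).1.-1%:R - j%:R)); ring.
- by move=> v /andP[/negPf->].
- by move=> v /negPf->.
by rewrite !big_pred0 ?addr0 // => k /=; rewrite ?andbF.
Qed.

Lemma bump_adj_add N h g s : bump_adj_op N (add_op N h g) s + add_op N h (bump_adj_op N g) s = 0.
Proof.
rewrite row_op_anti; first last.
- move=> k j kN jN jk /= ek ej.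
  rewrite /bump_adj /add_coef (ucirc_upd_other _ _ (_ : k != j)) 1?eq_sym //.
  rewrite (ustar_upd_other _ _ jk).
  case: (ltngtP j k) => [lt|lt|eq]; last by rewrite eq eqxx in jk.
    rewrite [RHS]mulrC; congr (_ * _ * (_ * _)).
      by apply: eq_bigr => i ki; rewrite ucirc_upd_other // neq_ltn (ltn_trans lt ki) orbT.
    apply: eq_bigr => i _; rewrite ?ustar_upd_other //.
    by rewrite neq_ltn (ltn_trans (ltn_ord i) lt).
  rewrite (bigD1 (Ordinal jN)) //= [in RHS](bigD1 (Ordinal jN)) //=.
  rewrite (bigD1 (Ordinal lt)) //= [in RHS](bigD1 (Ordinal lt)) //=.
  rewrite [X in _ * (_ * X * _) = _](eq_bigr (fun i : 'I_j => 1 - (ustar s i - ustar s j)^-1)); last first.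
    by move=> i ik; rewrite !ustar_upd_other.
  rewrite [X in _ = _ * (_ * X * _)](eq_bigr (fun i : 'I_N => 1 - (ucirc s k - ucirc s i)^-1)); last first.
    by move=> i /andP[_ ij]; rewrite ucirc_upd_other.
  move: (\prod_(i < N | _) _) (\prod_(i < j | _) _) => A B.
  rewrite /ucirc /ustar !upd_same /= ek ej !addn1 ?addn0 -!natr1.
  rewrite [al * (_ + 1) - _ - (al * (_ + 1) - _)](_ : _ =
    al * (s k).1%:R - k%:R - (al * (s j).1%:R - j%:R)); ring.
- by move=> v ->.
- by move=> v ->.
by rewrite !big_pred0 ?addr0 // => k /=; rewrite ?andbF.
Qed.

Lemma bump_adj_bump N g s :
  bump_adj_op N (bump_op N g) s + bump_op N (bump_adj_op N g) s =
  g s * \sum_(k < N | (s k).2 || (0 < (s k).1)%N) bump_coef s k * bump_adj N s k.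
Proof.
rewrite row_op_anti; first last.
- move=> k j _ _ jk /= ek /andP[/negPf ej lj].
  by rewrite /bump_coef /bump_adj !ucirc_upd_id //= ?ek ?ej ?addn0 ?addn1 ?prednK //; ring.
- by move=> v /andP[/negPf->].
- by move=> v ->.
rewrite mulr_sumr [RHS](bigID (fun k : 'I_N => (s k).2)) /=; congr (_ + _).
  apply: eq_big => [k|k /andP[ek _]]; first by rewrite ltn0Sn andbT; case: (s k).2; rewrite ?andbF ?andbT.
  rewrite /bump_coef /bump_adj !ucirc_upd_id //= ?ek ?addn0 ?addn1 //.
  by rewrite -ek -surjective_pairing upd_id; ring.
apply: eq_big => [k|k /andP[/andP[/negPf ek lk] _]]; first by case: (s k).2; rewrite /= ?andbT ?andbF.
rewrite /bump_coef /bump_adj !ucirc_upd_id //= ?ek ?addn0 ?addn1 ?prednK //.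
by rewrite -ek -surjective_pairing upd_id; ring.
Qed.

End RowModel.

(** If both rows have the same length in Lambda^star, a circle at the end of the lower one would lie
    below a circle or below an empty cell. *)
Definition row_rel (a b : nat * bool) : bool :=
  (b.1 < a.1)%N || ((b.1 == a.1) && ~~ b.2).

Definition stacked (s : rowstate) : Prop := forall k, row_rel (s k) (s k.+1).
Definition vanishes_from (N : nat) (s : rowstate) : Prop :=
  forall k, (N <= k)%N -> s k = (0%N, false).

(** * Diagonal values of the anticommutators with the adjoints, and the states excluded by vanishing
    coefficients *)

Section RowSums.
Variables (K : fieldType) (al : K).
Hypothesis al_gen : forall a b : int, al * a%:~R + b%:~R = 0 -> a = 0 /\ b = 0.
Implicit Types (s : rowstate) (g : rowstate -> K).
Local Notation us := (ustar al).
Local Notation uc := (ucirc al).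

Lemma al_gen_nat (a b : nat) (c d : nat) :
  al * a%:R - c%:R = al * b%:R - d%:R -> a = b /\ c = d.
Proof.
move=> e; have /al_gen[] : al * (a%:Z - b%:Z)%:~R + (d%:Z - c%:Z)%:~R = 0.
  have -> : al * (a%:Z - b%:Z)%:~R + (d%:Z - c%:Z)%:~R = (al * a%:R - c%:R) - (al * b%:R - d%:R).
    by rewrite !rmorphB /=; ring.
  by rewrite e subrr.
by move=> /eqP; rewrite subr_eq0 => /eqP[->] /eqP; rewrite subr_eq0 => /eqP[->].
Qed.

Lemma ustar_inj s : injective (us s).
Proof. by move=> i j /al_gen_nat[]. Qed.

Lemma ucirc_inj s : injective (uc s).
Proof. by move=> i j /al_gen_nat[]. Qed.

Lemma natr_gen_eq0 n : (n%:R == 0 :> K) = (n == 0%N).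
Proof.
apply/idP/idP => [/eqP n0|/eqP->] //; have [] := @al_gen 0 n.
  by rewrite mulr0z mulr0 add0r -pmulrn n0.
by move=> _ [->].
Qed.

Lemma al_neq0 : al != 0.
Proof. by apply/eqP=> a0; have [] := @al_gen 1 0; rewrite ?a0 ?mul0r ?add0r. Qed.

Lemma big_iota_ord (R : Type) (idx : R) (op : Monoid.com_law idx) N (P : pred nat) F :
  \big[op/idx]_(j <- iota 0 N | P j) F j = \big[op/idx]_(j < N | P j) F j.
Proof. by rewrite -(big_mkord P F) /index_iota subn0. Qed.

Lemma prod_split_at (R : comNzRingType) N k (F : nat -> R) : (k < N)%N ->
  (\prod_(j < k) F j) * \prod_(j < N | (k < j)%N) F j = \prod_(j <- iota 0 N | j != k) F j.
Proof.
move=> kN; rewrite big_iota_ord [RHS](bigID (fun j : 'I_N => (j < k)%N)) /=.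
congr (_ * _); last by apply: eq_bigl => j; rewrite neq_ltn -leqNgt; case: ltngtP.
rewrite -(big_mkord xpredT F) (big_nat_widen _ _ _ _ _ (ltnW kN)) big_mkord.
by apply: eq_bigl => j /=; rewrite neq_ltn; case: ltnP; rewrite ?andbT ?andbF.
Qed.

Lemma add_coefM N s k : (k < N)%N ->
  add_coef al s k * add_adj al N s k = lag (iota 0 N) (us s) k / (us s k - - N%:R).
Proof.
move=> kN; rewrite /add_adj opprK mulrA; congr (_ / _).
rewrite /lag -prod_split_at //; congr (_ * _); apply: eq_bigr => j _.
by rewrite -[us s k - us s j]opprB invrN.
Qed.

Lemma bump_coefM N s k : (k < N)%N ->
  bump_coef al s k * bump_adj al N s k =
  lag (iota 0 N) (fun j => - uc s j) k * (uc s k + N%:R - 1).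
Proof.
move=> kN; rewrite /bump_adj mulrA; congr (_ * _).
rewrite /lag -prod_split_at //; congr (_ * _); apply: eq_bigr => j _.
  by rewrite -[ucirc al s j - uc s k]opprB invrN; congr (1 - _^-1); ring.
by congr (1 - _^-1); ring.
Qed.


Lemma ustar_oppN_neq N s k : (k < N)%N -> us s k != - N%:R.
Proof.
move=> kN; apply/eqP=> e; have [_ kN'] : (s k).1 = 0%N /\ k = N.
  by apply: al_gen_nat; rewrite mulr0 sub0r.
by rewrite kN' ltnn in kN.
Qed.

Lemma sum_add_coef N s (h : K -> K) :
  \sum_(k < N) add_coef al s k * add_adj al N s k * h (us s k) =
  \sum_(k <- iota 0 N) lag (iota 0 N) (us s) k / (us s k - - N%:R) * h (us s k).
Proof. by rewrite big_iota_ord; apply: eq_bigr => k _; rewrite add_coefM. Qed.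

Lemma sum_lag_ustar N s : \sum_(k <- iota 0 N) lag (iota 0 N) (us s) k = N%:R.
Proof.
by rewrite sum_lag ?iota_uniq ?size_iota // => i j _ _; apply: ustar_inj.
Qed.

(** Partial fractions at [z = - N]: the empty row [N - 1] has content 1 - N, so the product contains
    the factor 1 - 1/1 and vanishes. *)
Lemma sum_add1 N s : (0 < N)%N -> s N.-1 = (0%N, false) ->
  \sum_(k < N) add_coef al s k * add_adj al N s k = 1.
Proof.
move=> N0 sN; rewrite -(eq_bigr _ (fun k _ => mulr1 _)) (sum_add_coef _ _ (fun=> 1)).
under eq_bigr do rewrite mulr1.
apply/eqP; rewrite eq_sym -subr_eq0 -prod_partial_fraction ?iota_uniq //; first last.
- by move=> i; rewrite mem_iota add0n => /= /ustar_oppN_neq.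
- by move=> i j _ _; apply: ustar_inj.
rewrite (bigD1_seq N.-1) ?iota_uniq ?mem_iota ?add0n ?prednK //=.
rewrite [us s N.-1 - _](_ : _ = 1) ?invr1 ?subrr ?mul0r //.
by rewrite /ustar sN /= mulr0 sub0r opprK -{2}(prednK N0) -natr1 addKr.
Qed.

(** Since u/(u + N) = 1 - N/(u + N), the sum is the total [N] of the residues minus [N] times the
    sum in [sum_add1]. One more power of u leads in [sum_add3] to [sum_lag_mul], where the row
    numbers in the contents cancel the binomial. *)
Lemma sum_add2 N s : (0 < N)%N -> s N.-1 = (0%N, false) ->
  \sum_(k < N) add_coef al s k * add_adj al N s k * us s k = 0.
Proof.
move=> N0 sN; have := sum_add1 N0 sN; rewrite -(eq_bigr _ (fun k _ => mulr1 _)).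
rewrite !(sum_add_coef _ _ (fun=> 1)) (sum_add_coef _ _ id).
under eq_bigr do rewrite mulr1.
move=> e1; transitivity (\sum_(k <- iota 0 N) lag (iota 0 N) (us s) k -
   N%:R * \sum_(k <- iota 0 N) lag (iota 0 N) (us s) k / (us s k - - N%:R)).
  rewrite mulr_sumr -sumrB big_seq [RHS]big_seq; apply: eq_bigr => k.
  rewrite mem_iota add0n => /= /(ustar_oppN_neq s); rewrite -subr_eq0 => nz.
  by field.
by rewrite e1 sum_lag_ustar mulr1 subrr.
Qed.

Lemma sumr_iota N : \sum_(k < N) k%:R = 'C(N, 2)%:R :> K.
Proof. by rewrite -natr_sum -bin2_sum big_mkord. Qed.

Lemma bin2_double N : 'C(N, 2)%:R + 'C(N, 2)%:R = N%:R * N%:R - N%:R :> K.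
Proof.
rewrite -natrD -natrM; apply/eqP; rewrite eq_sym subr_eq -natrD; apply/eqP; congr (_%:R).
by elim: N => // N; rewrite binS bin1; lia.
Qed.

Lemma sum_add3 N s : (0 < N)%N -> s N.-1 = (0%N, false) ->
  \sum_(k < N) add_coef al s k * add_adj al N s k * (us s k * us s k) =
  al * (\sum_(k < N) (s k).1)%:R.
Proof.
move=> N0 sN; have := sum_add2 N0 sN.
rewrite (sum_add_coef _ _ id) (sum_add_coef _ _ (fun x => x * x)).
move=> e1; transitivity (\sum_(k <- iota 0 N) lag (iota 0 N) (us s) k * us s k -
   N%:R * \sum_(k <- iota 0 N) lag (iota 0 N) (us s) k / (us s k - - N%:R) * us s k).
  rewrite mulr_sumr -sumrB big_seq [RHS]big_seq; apply: eq_bigr => k.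
  rewrite mem_iota add0n => /= /(ustar_oppN_neq s); rewrite -subr_eq0 => nz.
  by field.
rewrite e1 mulr0 subr0 sum_lag_mul ?iota_uniq ?size_iota //; last by move=> i j _ _; exact: ustar_inj.
rewrite big_iota_ord sumrB sumr_iota natr_sum mulr_sumr; ring.
Qed.

Lemma row_rel_zero b : row_rel (0%N, false) b -> b = (0%N, false).
Proof. by rewrite /row_rel ltn0 /=; case: b => [b c] /andP[/eqP/= ->]; case: c. Qed.

Lemma stacked_zero s k : stacked s -> s k = (0%N, false) -> vanishes_from k s.
Proof.
move=> st sk j; elim: j => [|j IH]; first by rewrite leqn0 => /eqP e; move: sk; rewrite e.
rewrite leq_eqVlt => /predU1P[<- //|/IH e]; apply: row_rel_zero.
by rewrite -e; apply: st.
Qed.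

Lemma bump_adj0 N s k : stacked s -> s N.-1 = (0%N, false) -> (k < N)%N ->
  s k = (0%N, false) -> bump_adj al N s k = 0.
Proof.
move=> st sN kN sk; have van := stacked_zero st sk.
rewrite /bump_adj; case: (ltnP k.+1 N) => [k1N|].
  rewrite (bigD1 (Ordinal k1N)) //= /ucirc !van ?leqnSn //= mulr0 !sub0r opprK.
  by rewrite -[k.+1%:R]natr1 addKr invr1 subrr !mul0r.
move=> Nk; have -> : N = k.+1 by apply/eqP; rewrite eqn_leq kN Nk.
by rewrite /ucirc sk /= mulr0 sub0r -addn1 natrD addKr subrr mulr0.
Qed.

Lemma sum_bump N s : stacked s -> s N.-1 = (0%N, false) ->
  \sum_(k < N | (s k).2 || (0 < (s k).1)%N) bump_coef al s k * bump_adj al N s k =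
  al * (\sum_(k < N) ((s k).1 + (s k).2))%:R.
Proof.
move=> st sN; transitivity (\sum_(k < N) bump_coef al s k * bump_adj al N s k).
  rewrite big_mkcond /=; apply: eq_bigr => k _; case: ifP => // /negbT.
  rewrite negb_or -eqn0Ngt => /andP[e0 /eqP l0]; rewrite bump_adj0 ?mulr0 //.
  by rewrite -l0 -(negPf e0) -surjective_pairing.
transitivity (\sum_(k <- iota 0 N) ((N%:R - 1) * lag (iota 0 N) (fun j => - uc s j) k -
    lag (iota 0 N) (fun j => - uc s j) k * - uc s k)).
  by rewrite big_iota_ord; apply: eq_bigr => k _; rewrite bump_coefM //; ring.
have inj : {in iota 0 N &, injective (fun j => - uc s j)}.
  by move=> i j _ _ /oppr_inj; apply: ucirc_inj.
rewrite sumrB -mulr_sumr sum_lag ?sum_lag_mul ?iota_uniq // size_iota.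
rewrite big_iota_ord sumrN sumrB sumr_iota natr_sum mulr_sumr.
rewrite [(N%:R - 1) * _](_ : _ = N%:R * N%:R - N%:R); last by ring.
rewrite -bin2_double; ring.
Qed.

(* Circles can only be added in the rows where the coefficient does not vanish. *)
Lemma add_coef_stacked s k : (s k).2 -> stacked (upd s k ((s k).1, false)) ->
  add_coef al s k != 0 -> stacked s.
Proof.
move=> ek st c0 i; have := st i; rewrite /upd.
case: (eqVneq i.+1 k) => [e|_]; last first.
  by case: eqVneq => // ->; rewrite /row_rel /=.
rewrite (negPf _ : (i == k) = false); last by rewrite -e neq_ltn ltnSn.
rewrite /row_rel /= andbT e => /orP[-> //|/eqP eq1].
case/eqP: c0; rewrite /add_coef.
have ik : (i < k)%N by rewrite -e.
rewrite (bigD1 (Ordinal ik)) //= [us s i - _](_ : _ = 1) ?invr1 ?subrr ?mul0r //.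
by rewrite /ustar eq1 -e -[i.+1%:R]natr1; ring.
Qed.

Lemma bump_stacked s k : ~~ (s k).2 -> (0 < (s k).1)%N ->
  stacked (upd s k ((s k).1.-1, true)) -> stacked s.
Proof.
move=> ek lk st i; have := st i; rewrite /upd.
case: (eqVneq i.+1 k) => [e|_]; last first.
  by case: (eqVneq i k) => // ->; rewrite /row_rel /=; lia.
by subst k; rewrite (ltn_eqF (ltnSn i)) /row_rel /= andbF orbF; lia.
Qed.

Lemma add_adj_stacked s k : ~~ (s k).2 -> stacked (upd s k ((s k).1, true)) -> stacked s.
Proof.
move=> ek st i; have := st i; rewrite /upd.
case: (eqVneq i.+1 k) => [e|_]; last by case: (eqVneq i k) => // ->; rewrite /row_rel /=.
by subst k; rewrite (ltn_eqF (ltnSn i)) /row_rel /= andbF orbF => ->.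
Qed.

(** The only possible obstruction is that row [k + 1], circle included, is as long as row [k]. Their
    circled contents then differ by one, and the corresponding factor of [bump_adj] is 1 - 1/1. *)
Lemma bump_adj_stacked N s k : vanishes_from N s -> (s k).2 ->
  stacked (upd s k ((s k).1.+1, false)) -> bump_adj al N s k != 0 -> stacked s.
Proof.
move=> van ek st c0 i; have := st i; rewrite /upd.
case: (eqVneq i.+1 k) => [e|_].
  by subst k; rewrite (ltn_eqF (ltnSn i)) /row_rel /= andbT; lia.
case: (eqVneq i k) => // ->; rewrite /row_rel /= => rel.
apply: contraNT c0 => nrel; apply/eqP.
have ecirc : ((s k).1 + (s k).2 = (s k.+1).1 + (s k.+1).2)%N.
  by move: rel nrel; rewrite ek; case: (s k.+1) => a [] /=; lia.
have k1N : (k.+1 < N)%N.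
  by rewrite ltnNge; apply: contraNN nrel => /van->; rewrite /= andbT; case: ltngtP.
rewrite /bump_adj (bigD1 (Ordinal k1N)) //= [uc s k - _](_ : _ = 1).
  by rewrite invr1 subrr !mul0r.
by rewrite /ucirc ecirc -[k.+1%:R]natr1; ring.
Qed.

End RowSums.

(** * Matrix coefficients of strips *)

Section PairProducts.
Variable R : comNzRingType.
Implicit Types (P : nat -> nat -> R).

Definition pair_prod N P : R := \prod_(i < N) \prod_(j < i) P i j.

Lemma pair_prod_split N k P : (k < N)%N ->
  pair_prod N P = (\prod_(j < k) P k j) * (\prod_(i < N | (k < i)%N) P i k) *
     \prod_(i < N | i != k :> nat) \prod_(j < i | j != k :> nat) P i j.
Proof.
move=> kN; rewrite /pair_prod (bigD1 (Ordinal kN)) //= -mulrA; congr (_ * _).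
rewrite (bigID (fun i : 'I_N => (k < i)%N)) /= [X in _ = _ * X](bigID (fun i : 'I_N => (k < i)%N)) /=.
rewrite mulrA; congr (_ * _).
  rewrite [X in _ = X * _](eq_bigl (fun i : 'I_N => (i != k :> nat) && (k < i)%N)); last first.
    by move=> i; case: ltngtP.
  rewrite -big_split /=; apply: eq_bigr => i /andP[_ ki].
  by rewrite (bigD1 (Ordinal ki)).
apply: eq_big => [i|i]; first by [].
rewrite -leqNgt => /andP[_ ik]; apply: eq_bigl => j.
by rewrite (ltn_eqF (leq_trans (ltn_ord j) ik)).
Qed.

(** A move in row [k] affects only the pairs containing [k]. Pairs with rows above are combined with
    the coefficient of the move, pairs with rows below are not, yet both leave a correction [A] of
    the same shape: a product over j < k becomes one over all rows but [k], as interpolation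
    requires. *)
Lemma pair_prod_change N k P P' (T T' A : nat -> R) : (k < N)%N ->
  (forall i j, (j < i < N)%N -> i != k -> j != k -> P' i j = P i j) ->
  (forall j, (j < k)%N -> T j * P' k j = T' j * P k j * A j) ->
  (forall i, (k < i < N)%N -> P' i k = P i k * A i) ->
  (\prod_(j < k) T j) * pair_prod N P' =
  (\prod_(j < k) T' j) * pair_prod N P * \prod_(i <- iota 0 N | i != k) A i.
Proof.
move=> kN eP eT eA; rewrite !(pair_prod_split _ kN) -prod_split_at //.
rewrite [X in _ * (_ * X)](eq_bigr (fun i : 'I_N => \prod_(j < i | j != k :> nat) P i j)); last first.
  by move=> i ik; apply: eq_bigr => j jk; rewrite eP ?ltn_ord.
move: (\prod_(i < N | _) \prod_(j < i | _) _) => C.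
rewrite [X in _ * (_ * X * _)](eq_bigr (fun i : 'I_N => P i k * A i)); last first.
  by move=> i ki; rewrite eA // ki ltn_ord.
rewrite big_split /= !mulrA -big_split /=.
rewrite (eq_bigr (fun j : 'I_k => T' j * P k j * A j)); last by move=> j _; rewrite eT.
rewrite !big_split /=; ring.
Qed.

End PairProducts.

Definition circ_len (s : rowstate) (i : nat) : nat := ((s i).1 + (s i).2)%N.

Definition strip_row (a b : nat * bool) : bool :=
  (a.1 <= b.1 <= a.1.+1)%N && (a.1 + a.2 <= b.1 + b.2 <= (a.1 + a.2).+1)%N.
Definition strip_at (s s' : rowstate) (i : nat) : bool := strip_row (s i) (s' i).
Definition strip N s s' := all (strip_at s s') (iota 0 N).
Definition star_inc (s s' : rowstate) (i : nat) : bool := (s' i).1 == (s i).1.+1.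
Definition circ_inc (s s' : rowstate) (i : nat) : bool :=
  ((s' i).1 + (s' i).2 == ((s i).1 + (s i).2).+1)%N.

Definition strip_off N s s' k := all (fun i => (i == k) || strip_at s s' i) (iota 0 N).

Lemma strip_split N s s' k : (k < N)%N -> strip N s s' = strip_off N s s' k && strip_at s s' k.
Proof.
move=> kN; apply/allP/andP => [h|[/allP h hk] i iN].
  by split; [apply/allP => i /h ->; rewrite orbT | apply: h; rewrite mem_iota].
by have /predU1P[->|] := h i iN.
Qed.

Lemma strip_off_updr N s s' k v : strip_off N s (upd s' k v) k = strip_off N s s' k.
Proof.
by apply: eq_in_all => i _; rewrite /strip_at /upd; case: eqVneq.
Qed.

Lemma strip_off_updl N s s' k v : strip_off N (upd s k v) s' k = strip_off N s s' k.
Proof.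
by apply: eq_in_all => i _; rewrite /strip_at /upd; case: eqVneq.
Qed.

Definition circ_rows N (s : rowstate) : seq nat := [seq k <- iota 0 N | (s k).2].

Lemma circ_rows_uniq N s : uniq (circ_rows N s).
Proof. by rewrite filter_uniq ?iota_uniq. Qed.

Lemma mem_circ_rows N (s : rowstate) k : (k \in circ_rows N s) = (s k).2 && (k < N)%N.
Proof. by rewrite mem_filter mem_iota. Qed.

Lemma index_filter_iota (p : pred nat) N k : (k < N)%N -> p k ->
  index k [seq j <- iota 0 N | p j] = (\sum_(j < k) p j)%N.
Proof.
move=> kN pk; rewrite -(subnKC (ltnW kN)) iotaD add0n filter_cat index_cat.
rewrite mem_filter mem_iota ltnn !andbF.
case: (N - k)%N (subn_gt0 k N) kN => [<- //|m _ kN].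
rewrite /= pk /= eqxx addn0 size_filter -sum1_count big_mkcond /=.
by rewrite (big_iota_ord _ _ xpredT); apply: eq_bigr => j _; case: (p j).
Qed.

Lemma index_map_Some k (r : seq nat) : index (Some k) (map Some r) = index k r.
Proof. by rewrite index_map // => i j []. Qed.

Lemma circ_rows_rm N (s : rowstate) k a : (s k).2 -> circ_rows N (upd s k (a, false)) = rem k (circ_rows N s).
Proof.
move=> ek; rewrite rem_filter ?circ_rows_uniq // /circ_rows -filter_predI.
by apply: eq_filter => j; rewrite /upd /=; case: eqVneq.
Qed.

Lemma circ_rows_add N (s : rowstate) k a : (k < N)%N -> ~~ (s k).2 ->
  circ_rows N s = rem k (circ_rows N (upd s k (a, true))).
Proof.
move=> kN ek; rewrite -(@circ_rows_rm _ _ _ (s k).1) ?upd_same // upd_upd.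
by rewrite -(negPf ek) -surjective_pairing upd_id.
Qed.

Lemma map_Some_rem k (r : seq nat) : map Some (rem k r) = rem (Some k) (map Some r).
Proof. by rewrite !remE index_map_Some map_cat map_take map_drop. Qed.

Section Amplitudes.
Variables (K : fieldType) (al : K).
Hypothesis al_gen : forall a b : int, al * a%:~R + b%:~R = 0 -> a = 0 /\ b = 0.
Implicit Types (s : rowstate) (X Y : pred nat).
Local Notation us := (ustar al).
Local Notation uc := (ucirc al).

Lemma rsgn_index N s k : (k < N)%N -> (s k).2 ->
  (-1) ^+ index (Some k) (map Some (circ_rows N s)) = rsgn K s k.
Proof. by move=> kN ek; rewrite index_map_Some index_filter_iota. Qed.

(** Row [j] lies above row [i]. The first factor is the change of the lower hook in the cell of row
    [j] in the column where row [i] grows in Lambda^circledast; the second is that of the upper hook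
    in the column where row [i] grows in Lambda^star ([col_productE]). *)
Definition strip_factor s X Y i j : K :=
  (if Y i && ~~ X j then 1 - (us s j - uc s i)^-1 else 1) *
  (if X i && ~~ Y j then 1 + (uc s j - us s i - al)^-1 else 1).

Definition strip_prod N s s' : K :=
  pair_prod N (strip_factor s (star_inc s s') (circ_inc s s')).

(** Equal to 1/u - 1/(u + al) with u the difference of contents: one term comes from the partial
    fractions before the squares of the strip are added, the other from those after. *)
Definition move_coef s i j : K := al / ((us s i - us s j) * (us s i - us s j + al)).

(** Rows are indexed by the circles of the source, columns by those of the target. The entry is the
    weight for a circle to pass from row [i] to row [j]; it can leave only a row that gains a cell
    of Lambda^star, for one that does not. *)
Definition star_mx s X (v : nat -> K) (i j : option nat) : K :=
  match i, j with
  | Some i, Some j => if X i && ~~ X j then move_coef s i j else (i == j)%:R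
  | None, Some j => v j
  | _, _ => 0
  end.

Definition star_num N s s' : nat := count (star_inc s s') (iota 0 N).

Definition star_minor N s s' v : K :=
  minor (size (circ_rows N s')) (star_mx s (star_inc s s') v)
    (None :: map Some (circ_rows N s)) (map Some (circ_rows N s')).

Definition elem_amp N n s s' : K :=
  if [&& strip N s s', star_num N s s' == n & size (circ_rows N s') == size (circ_rows N s)]
  then strip_prod N s s' * minor (size (circ_rows N s)) (star_mx s (star_inc s s') (fun=> 0))
     (map Some (circ_rows N s)) (map Some (circ_rows N s'))
  else 0.

(** Expanding along the border chooses the row of the additional circle, with weight 1 for each row
    that gains no cell of Lambda^star. *)
Definition telem_amp N n s s' : K :=
  if [&& strip N s s', star_num N s s' == n & size (circ_rows N s') == (size (circ_rows N s)).+1]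
  then strip_prod N s s' * star_minor N s s' (fun j => (~~ star_inc s s' j)%:R) else 0.

Lemma uniq_map_Some (r : seq nat) : uniq (map Some r) = uniq r.
Proof. by rewrite map_inj_uniq // => i j []. Qed.

Lemma star_minorE N s s' v : size (circ_rows N s') = (size (circ_rows N s)).+1 ->
  star_minor N s s' v = \sum_(k < N | (s' k).2) rsgn K s' k * v k *
    minor (size (circ_rows N s)) (star_mx s (star_inc s s') (fun=> 0))
     (map Some (circ_rows N s)) (map Some (rem (nat_of_ord k) (circ_rows N s'))).
Proof.
move=> sz; rewrite /star_minor sz minor_cons ?uniq_map_Some ?circ_rows_uniq ?size_map //.
rewrite big_map -(big_iota_ord _ _ (fun k => (s' k).2) (fun k => rsgn K s' k * v k * minor _ _ _ (map Some (rem k _)))).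
rewrite big_filter big_seq_cond [RHS]big_seq_cond; apply: eq_bigr => k.
rewrite mem_iota add0n => /= /andP[kN ek]; rewrite rsgn_index // map_Some_rem; congr (_ * _).
apply: eq_minor; rewrite ?size_map // ?size_rem ?size_map ?sz //.
  by rewrite mem_map ?mem_circ_rows ?ek // => i j [].
by move=> i j /mapP[i' _ ->] _.
Qed.


(** For [k] in [X] this is the residue at the node [k], for the other rows the value at their
    content, of one and the same product over the rows that gain a square. *)
Definition star_before N s X k : K :=
  \prod_(i <- iota 0 N | i != k) (if X i then 1 - (us s i - us s k)^-1 else 1).

Lemma star_before_filter N s X k : star_before N s X k =
  \prod_(i <- [seq i <- iota 0 N | X i] | i != k) (1 - (us s i - us s k)^-1).
Proof.
rewrite big_filter_cond /star_before -big_mkcondr /=.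
by apply: eq_bigl => i; rewrite andbC.
Qed.

Lemma stripP N s s' k : strip N s s' -> (k < N)%N -> strip_at s s' k.
Proof. by move=> /allP h kN; apply: h; rewrite mem_iota. Qed.

Lemma us_inc s s' k : strip_at s s' k -> us s' k = us s k + al * (star_inc s s' k)%:R.
Proof.
move=> /andP[st _]; rewrite /ustar.
have -> : (s' k).1 = ((s k).1 + star_inc s s' k)%N by rewrite /star_inc; move: st; case: eqP => /=; lia.
by rewrite natrD; ring.
Qed.

Section StarVectors.
Variables (N : nat) (s s' : rowstate).
Hypothesis st : strip N s s'.
Local Notation X := (star_inc s s').
Local Notation B := (star_before N s X).
Local Notation A := (star_before N s' X).
Local Notation xs := [seq i <- iota 0 N | X i].

Lemma mem_xs i : (i \in xs) = X i && (i < N)%N.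
Proof. by rewrite mem_filter mem_iota. Qed.

Lemma star_after_in j : (j < N)%N -> X j -> A j = B j.
Proof.
move=> jN Xj; rewrite !star_before_filter big_seq_cond [RHS]big_seq_cond.
apply: eq_bigr => i; rewrite mem_xs => /andP[/andP[Xi iN] _].
by rewrite (us_inc (stripP st iN)) (us_inc (stripP st jN)) Xi Xj; congr (1 - _^-1); ring.
Qed.

Lemma lag_xs i : lag xs (us s) i = B i.
Proof. by rewrite star_before_filter. Qed.

Lemma B_out j : (j < N)%N -> ~~ X j -> B j = 1 - \sum_(k <- xs) B k / (us s k - us s j).
Proof.
move=> jN Xj; under eq_bigr do rewrite -lag_xs.
rewrite -prod_partial_fraction ?filter_uniq ?iota_uniq //; first last.
- by move=> i; rewrite mem_xs => /andP[Xi _]; apply: contraNneq Xj => /ustar_inj <-.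
- by move=> i k _ _; apply: ustar_inj.
rewrite star_before_filter big_seq_cond [RHS]big_seq; apply: eq_bigl => i.
by rewrite mem_xs; case: eqVneq => [->|]; rewrite ?(negPf Xj) ?andbT.
Qed.

Lemma us_shift_neq k j : k != j -> us s k - us s j + al != 0.
Proof.
move=> kj; rewrite addrAC subr_eq0; apply: contraNneq kj => e.
have [_ ->//] : (s k).1.+1 = (s j).1 /\ k = j.
by apply: (al_gen_nat al_gen); move: e; rewrite /ustar => <-; rewrite -natr1; ring.
Qed.

Lemma us_neq k j : k != j -> us s k - us s j != 0.
Proof. by move=> kj; rewrite subr_eq0; apply: contraNneq kj => /ustar_inj ->. Qed.

Lemma A_out j : (j < N)%N -> ~~ X j ->
  A j = 1 - \sum_(k <- xs) B k / (us s k - us s j + al).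
Proof.
move=> jN Xj.
transitivity (1 - \sum_(k <- xs) lag xs (us s) k / (us s k - (us s j - al))); last first.
  by congr (1 - _); apply: eq_bigr => k _; rewrite lag_xs opprB addrA addrAC.
have neq i : i \in xs -> i != j by rewrite mem_xs => /andP[Xi _]; apply: contraNneq Xj => <-.
rewrite -prod_partial_fraction ?filter_uniq ?iota_uniq //; first last.
- move=> i /neq/us_shift_neq; apply: contraNneq => ->.
  by rewrite addrAC subrK subrr.
- by move=> i k _ _; apply: ustar_inj.
rewrite star_before_filter big_seq_cond [RHS]big_seq; apply: eq_big => [i|i].
  by case ix: (i \in xs) => //=; apply: neq.
move=> /andP[]; rewrite mem_xs => /andP[Xi iN] _.
by rewrite (us_inc (stripP st iN)) (us_inc (stripP st jN)) Xi (negPf Xj) mulr1 mulr0 addr0; congr (1 - _^-1); ring.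
Qed.

Lemma star_mx_col (h : K -> K) j v : (j < N)%N ->
  \sum_(k < N) B k * h (us s k) * star_mx s X v (Some (k : nat)) (Some j) =
  B j * h (us s j) + (if X j then 0 else \sum_(k <- xs) B k * h (us s k) * move_coef s k j).
Proof.
move=> jN; rewrite (bigD1 (Ordinal jN)) //= andbN eqxx mulr1; congr (_ + _).
case: ifP => Xj.
  rewrite big1 // => k kj; rewrite andbF; case: eqP => [[e]|]; last by rewrite mulr0.
  by case/eqP: kj; apply: val_inj.
rewrite big_filter (big_iota_ord _ _ X) big_mkcond [RHS]big_mkcond /=.
apply: eq_bigr => k _; case: (eqVneq k (Ordinal jN)) => [->|kj] /=; first by rewrite Xj.
case: (X k) => //=; case: eqP => [[e]|]; last by rewrite mulr0.
by case/eqP: kj; apply: val_inj.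
Qed.

(** Adding the squares shifts all nodes in [X] by [al] and so keeps the residues. The partial
    fractions of [A j] and [B j] thus differ by the sum of [B k] times [move_coef]: the matrix
    transports the coefficients of [t] before the strip to those after it, which is the commutation
    of [t] with [X_n]. *)
Lemma star_vec1 j v : (j < N)%N ->
  \sum_(k < N) B k * 1 * star_mx s X v (Some (k : nat)) (Some j) = A j.
Proof.
move=> jN; rewrite (star_mx_col (fun=> 1)) // mulr1.
case: ifP => Xj; first by rewrite addr0 star_after_in.
rewrite A_out ?Xj // B_out ?Xj // -addrA; congr (_ + _).
rewrite -sumrN -big_split /= -sumrN big_seq [RHS]big_seq; apply: eq_bigr => k.
rewrite mem_xs mulr1 => /andP[Xk _].
have kj : k != j by apply: contraFneq Xj => <-.
have n1 := us_neq kj; have n2 := us_shift_neq kj.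
by rewrite /move_coef; field; rewrite n1 n2.
Qed.

(** With one more factor of the content the transport has the defect [al] times [A j] minus an
    indicator. The first part becomes [t X_n], and the indicator is the border that defines
    [Y_n]. *)
Lemma star_vec2 j v : (j < N)%N ->
  \sum_(k < N) B k * us s k * star_mx s X v (Some (k : nat)) (Some j) =
  A j * us s' j - al * (A j - (~~ X j)%:R).
Proof.
move=> jN; rewrite (star_mx_col id) // (us_inc (stripP st jN)).
case: ifP => Xj /=; first by rewrite star_after_in // mulr1; ring.
have := A_out jN (negbT Xj); have := star_vec1 v jN.
rewrite (star_mx_col (fun=> 1)) // mulr1 Xj => <- /eqP.
set b := B j; rewrite eq_sym -subr_eq0 => /eqP e.
rewrite mulr0 addr0 /=; apply/eqP; rewrite -subr_eq0; apply/eqP.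
(* The difference of the two sides is - [al] times the relation [e], obtained from [A_out] and
   [star_vec1]. *)
transitivity (al * (1 - \sum_(k <- xs) B k / (us s k - us s j + al) -
    (b + \sum_(k <- xs) B k * 1 * move_coef s k j)) * -1); last by rewrite e mulr0 mul0r.
have -> : \sum_(k <- xs) B k * us s k * move_coef s k j =
   us s j * (\sum_(k <- xs) B k * 1 * move_coef s k j) +
   al * \sum_(k <- xs) B k / (us s k - us s j + al).
  rewrite !mulr_sumr -big_split /= big_seq [RHS]big_seq; apply: eq_bigr => k.
  rewrite mem_xs mulr1 => /andP[Xk _].
  have kj : k != j by apply: contraFneq Xj => <-.
  have n1 := us_neq kj; have n2 := us_shift_neq kj.
  by rewrite /move_coef; field; rewrite n1 n2.
ring.
Qed.

End StarVectors.

(** The matrix coefficient of an adding operator composed with [X_n], the circle being added after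
    the strip; in [add_before] it is added before the strip. *)
Definition add_after N n h s s' := \sum_(k < N | (s' k).2)
  rsgn K s' k * (add_coef al s' k * h (us s' k)) *
  elem_amp N n s (upd s' k ((s' k).1, false)).
Definition add_before N n h s s' := \sum_(k < N | ~~ (s k).2)
  rsgn K s k * (add_coef al s k * h (us s k)) *
  elem_amp N n (upd s k ((s k).1, true)) s'.

Lemma star_inc_updr s s' k b : star_inc s (upd s' k ((s' k).1, b)) = star_inc s s'.
Proof. by apply/funext=> i; rewrite /star_inc /upd; case: (eqVneq i k) => // ->. Qed.
Lemma star_inc_updl s s' k b : star_inc (upd s k ((s k).1, b)) s' = star_inc s s'.
Proof. by apply/funext=> i; rewrite /star_inc /upd; case: (eqVneq i k) => // ->. Qed.

Lemma star_mx_upd s X v k b : star_mx (upd s k ((s k).1, b)) X v = star_mx s X v.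
Proof. by rewrite /star_mx /move_coef ustar_upd_id. Qed.

Lemma size_circ_rm N (s : rowstate) k a : (k < N)%N -> (s k).2 ->
  size (circ_rows N s) = (size (circ_rows N (upd s k (a, false)))).+1.
Proof.
move=> kN ek; rewrite circ_rows_rm // size_rem ?mem_circ_rows ?ek // prednK //.
by have : k \in circ_rows N s by [rewrite mem_circ_rows ek]; case: (circ_rows N s).
Qed.

Lemma size_circ_add N (s : rowstate) k a : (k < N)%N -> ~~ (s k).2 ->
  size (circ_rows N (upd s k (a, true))) = (size (circ_rows N s)).+1.
Proof.
move=> kN ek; rewrite (@size_circ_rm _ _ k (s k).1) ?upd_same // upd_upd.
by rewrite -(negPf ek) -surjective_pairing upd_id.
Qed.

Lemma strip_row_rm a b : strip_row a b -> b.2 -> strip_row a (b.1, false) = (b.1 + b.2 == (a.1 + a.2).+1)%N.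
Proof. by rewrite /strip_row; case: a b => a [] [b []] //=; lia. Qed.
Lemma strip_row_add a b : strip_row a b -> ~~ a.2 -> strip_row (a.1, true) b = (b.1 + b.2 == (a.1 + a.2).+1)%N.
Proof. by rewrite /strip_row; case: a b => a [] [b []] //=; lia. Qed.

Section StripCase.
Variables (N n : nat) (s s' : rowstate).
Hypothesis st : strip N s s'.
Local Notation X := (star_inc s s').
Local Notation Y := (circ_inc s s').

Lemma strip_rm k : (k < N)%N -> (s' k).2 -> strip N s (upd s' k ((s' k).1, false)) = Y k.
Proof.
move=> kN ek; move: st; rewrite !(strip_split _ _ kN) strip_off_updr => /andP[-> st_k].
by rewrite /strip_at upd_same strip_row_rm.
Qed.

Lemma strip_add k : (k < N)%N -> ~~ (s k).2 -> strip N (upd s k ((s k).1, true)) s' = Y k.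
Proof.
move=> kN ek; move: st; rewrite !(strip_split _ _ kN) strip_off_updl => /andP[-> st_k].
by rewrite /strip_at upd_same strip_row_add.
Qed.

Lemma rows_cases k : (k < N)%N -> strip_row (s k) (s' k). Proof. exact: stripP. Qed.

Lemma strip_prod_rm k : (k < N)%N -> (s' k).2 -> Y k ->
  add_coef al s' k * strip_prod N s (upd s' k ((s' k).1, false)) =
  strip_prod N s s' * star_before N s' X k.
Proof.
move=> kN ek Yk; rewrite /add_coef /strip_prod star_inc_updr.
have Y' i : circ_inc s (upd s' k ((s' k).1, false)) i = Y i && (i != k).
  rewrite /circ_inc /upd; case: (eqVneq i k) => [->|]; rewrite ?andbT //.
  by move: Yk; rewrite /circ_inc andbF ek /=; lia.
have uck : uc s k = us s' k.
  move: Yk; rewrite /circ_inc ek addn1 /ucirc /ustar => /eqP[->//].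
have := @pair_prod_change _ N k (strip_factor s X Y) (strip_factor s X _)
  (fun j => 1 - (us s' j - us s' k)^-1) (fun=> 1)
  (fun i => if X i then 1 - (us s' i - us s' k)^-1 else 1) kN.
rewrite [\prod_(j < k) 1]big1 // mul1r; apply.
- by move=> i j _ ik jk; rewrite /strip_factor !Y' ik jk !andbT.
- move=> j jk; have jN := ltn_trans jk kN.
  have sj := us_inc (stripP st jN).
  rewrite /strip_factor !Y' eqxx andbF Yk (ltn_eqF jk) /= andbT uck mul1r !mul1r.
  case Xj: (X j) sj => /= sj; first by ring.
  by rewrite sj mulr0 addr0; ring.
move=> i /andP[ki iN]; have si := us_inc (stripP st iN).
rewrite /strip_factor !Y' eqxx andbF Yk (gtn_eqF ki) !andbT /= uck.
case Xi: (X i) si => /= si; last by rewrite !mulr1.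
rewrite mulr1 si mulr1; congr (_ * _).
by rewrite -[X in X^-1]opprB invrN; congr (1 - _^-1); ring.
Qed.

Lemma strip_prod_add k : (k < N)%N -> ~~ (s k).2 -> Y k ->
  add_coef al s k * strip_prod N (upd s k ((s k).1, true)) s' =
  strip_prod N s s' * star_before N s X k.
Proof.
move=> kN ek Yk; rewrite /add_coef /strip_prod star_inc_updl.
have Y' i : circ_inc (upd s k ((s k).1, true)) s' i = Y i && (i != k).
  rewrite /circ_inc /upd; case: (eqVneq i k) => [->|]; rewrite ?andbT //.
  by move: Yk; rewrite /circ_inc andbF (negPf ek) /=; lia.
have uck : uc s k = us s k by rewrite /ucirc /ustar (negPf ek) addn0.
have uck' : uc (upd s k ((s k).1, true)) k = us s k + al.
  by rewrite /ucirc upd_same /ustar natrD /=; ring.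
have := @pair_prod_change _ N k (strip_factor s X Y) (strip_factor _ X _)
  (fun j => 1 - (us s j - us s k)^-1) (fun=> 1)
  (fun i => if X i then 1 - (us s i - us s k)^-1 else 1) kN.
rewrite [\prod_(j < k) 1]big1 // mul1r; apply.
- move=> i j _ ik jk; rewrite /strip_factor !Y' ik jk !andbT ustar_upd_id //.
  by rewrite !ucirc_upd_other.
- move=> j jk.
  rewrite /strip_factor !Y' eqxx andbF Yk (ltn_eqF jk) /= andbT uck mul1r.
  rewrite ustar_upd_id // ucirc_upd_other ?(ltn_eqF jk) //.
  by case Xj: (X j) => /=; ring.
move=> i /andP[ki iN].
rewrite /strip_factor !Y' eqxx andbF Yk (gtn_eqF ki) !andbT /= ustar_upd_id // uck'.
rewrite ucirc_upd_other ?(gtn_eqF ki) //.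
case Xi: (X i) => /=; last by rewrite !mulr1.
rewrite mulr1; congr (_ * _).
by rewrite -[X in X^-1]opprB invrN; congr (1 - _^-1); ring.
Qed.


Hypothesis num : star_num N s s' == n.
Hypothesis sz : size (circ_rows N s') = (size (circ_rows N s)).+1.

(** The summands are the cofactor expansion of the bordered minor: undoing the circle of row [k]
    deletes column [k], and [strip_prod_rm] turns the coefficient of the move into the border
    entry. *)
Lemma add_after_strip h : add_after N n h s s' =
  strip_prod N s s' * star_minor N s s' (fun j => star_before N s' X j * h (us s' j)).
Proof.
rewrite star_minorE // mulr_sumr; apply: eq_bigr => k ek.
have kN := ltn_ord k; rewrite /elem_amp /star_num star_inc_updr strip_rm //.
have := size_circ_rm (s' k).1 kN ek; rewrite sz => -[<-]; rewrite eqxx.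
rewrite (eqP (num : count X _ == n)) eqxx !andbT circ_rows_rm //.
case: ifP => Yk.
  rewrite [RHS](_ : _ = rsgn K s' k * h (us s' k) * (strip_prod N s s' * star_before N s' X k) *
    minor (size (circ_rows N s)) (star_mx s X (fun=> 0)) (map Some (circ_rows N s))
    (map Some (rem (k : nat) (circ_rows N s')))); last by ring.
  by rewrite -strip_prod_rm //; ring.
(* Row [k] does not grow in Lambda^circledast, so its circle is already present in the source. The
   amplitude is zero for lack of a strip, the minor because row [k] is a unit row whose column has
   been deleted. *)
rewrite (minor_zero_row (d := Some (k : nat))) ?mulr0 ?size_map ?size_rem ?mem_circ_rows ?ek ?sz //.
  rewrite mem_map ?mem_circ_rows ?kN ?andbT => [|i j [] //].
  by move: (rows_cases kN) Yk; rewrite /circ_inc /strip_row ek; case: (s k).2 => //=; lia.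
have /negPf nX : ~~ X k.
  by move: (rows_cases kN) Yk; rewrite /star_inc /circ_inc /strip_row ek; case: (s k).2 => //=; lia.
move=> _ /mapP[j + ->]; rewrite rem_filter ?circ_rows_uniq // mem_filter /= nX /= => /andP[jk _].
by case: eqP => // -[e]; rewrite e eqxx in jk.
Qed.

Lemma add_before_strip h : add_before N n h s s' =
  strip_prod N s s' * star_minor N s s' (fun j =>
     \sum_(k < N) star_before N s X k * h (us s k) * star_mx s X (fun=> 0) (Some (k : nat)) (Some j)).
Proof.
rewrite /star_minor sz (@minor_lin _ _ 'I_N (index_enum _) (fun k : 'I_N => star_before N s X k * h (us s k))
  (fun k : 'I_N => Some (k : nat))) ?uniq_map_Some ?circ_rows_uniq ?size_map //; last first.
  by move=> _ /mapP[j _ ->].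
(* No circle can be added where there is one; on the side of the minor such a row is repeated. *)
rewrite [X in _ * X](bigID (fun k : 'I_N => ~~ (s k).2)) /= [X in _ * (_ + X)]big1 ?addr0; last first.
  move=> k /negbNE ek; rewrite minor_dup ?mulr0 //.
    by rewrite mem_map ?mem_circ_rows ?ek ?ltn_ord // => i j [].
  by rewrite index_map_Some index_mem mem_circ_rows ek ltn_ord.
rewrite mulr_sumr; apply: eq_bigr => k ek.
have kN := ltn_ord k; rewrite /elem_amp /star_num star_inc_updl strip_add // star_mx_upd.
rewrite size_circ_add // sz eqxx (eqP (num : count X _ == n)) eqxx !andbT.
set r := circ_rows N (upd s k _).
have ur : uniq (map Some r) by rewrite uniq_map_Some circ_rows_uniq.
have kr : (k : nat) \in r by rewrite mem_circ_rows upd_same kN.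
have er : map Some (circ_rows N s) = rem (Some (k : nat)) (map Some r).
  by rewrite (@circ_rows_add _ _ k (s k).1) // map_Some_rem.
have mE : minor (size (circ_rows N s)).+1 (star_mx s X (fun=> 0)) (map Some r) (map Some (circ_rows N s')) =
   rsgn K s k * minor (size (circ_rows N s)).+1 (star_mx s X (fun=> 0))
      (Some (k : nat) :: map Some (circ_rows N s)) (map Some (circ_rows N s')).
  rewrite (minor_rem _ _ ur (k := Some (k : nat))) ?size_map ?size_circ_add //.
    by rewrite er rsgn_index ?upd_same // rsgn_upd_le.
  by rewrite mem_map // => i j [].
have eqm : minor (size (circ_rows N s)).+1 (star_mx s X (fun j =>
     \sum_(k0 < N) star_before N s X k0 * h (us s k0) * star_mx s X (fun=> 0) (Some (k0 : nat)) (Some j)))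
     (Some (k : nat) :: map Some (circ_rows N s)) (map Some (circ_rows N s')) =
   minor (size (circ_rows N s)).+1 (star_mx s X (fun=> 0))
     (Some (k : nat) :: map Some (circ_rows N s)) (map Some (circ_rows N s')).
  apply: eq_minor; rewrite /= ?size_map ?sz //.
  by move=> i j; rewrite inE => /predU1P[->|/mapP[i' _ ->]] /mapP[j' _ ->].
rewrite eqm; case: ifP => Yk.
  rewrite mE [RHS](_ : _ = h (us s k) * (strip_prod N s s' * star_before N s X k) *
    (rsgn K s k * rsgn K s k) *
    minor (size (circ_rows N s)).+1 (star_mx s X (fun=> 0)) (Some (k : nat) :: map Some (circ_rows N s))
    (map Some (circ_rows N s'))); last by rewrite rsgn_sqr; ring.
  by rewrite -strip_prod_add //; ring.
have /negPf nX : ~~ X k.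
  by move: (rows_cases kN) Yk; rewrite /star_inc /circ_inc /strip_row (negPf ek); case: (s' k).2 => //=; lia.
have nS' : (s' k).2 = false.
  by move: (rows_cases kN) Yk; rewrite /circ_inc /strip_row (negPf ek); case: (s' k).2 => //=; lia.
rewrite (minor_zero_row (d := Some (k : nat))) ?mulr0 ?mem_head //= ?size_map ?sz //.
move=> _ /mapP[j + ->]; rewrite mem_circ_rows /= nX /= => /andP[ej _].
by case: eqP => // -[e]; rewrite -e nS' in ej.
Qed.

End StripCase.

Lemma star_minor_lin N s s' (f g h : nat -> K) a :
  size (circ_rows N s') = (size (circ_rows N s)).+1 ->
  (forall j, (j < N)%N -> f j = g j + a * h j) ->
  star_minor N s s' f = star_minor N s s' g + a * star_minor N s s' h.
Proof.
move=> sz e; rewrite !star_minorE // mulr_sumr -big_split /=; apply: eq_bigr => k _.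
by rewrite e //; ring.
Qed.

Lemma eq_star_minor N s s' (f g : nat -> K) :
  size (circ_rows N s') = (size (circ_rows N s)).+1 ->
  (forall j, (j < N)%N -> f j = g j) -> star_minor N s s' f = star_minor N s s' g.
Proof.
move=> sz e; rewrite (@star_minor_lin N s s' f g (fun=> 0) 0) ?mul0r ?addr0 //.
by move=> j jN; rewrite e ?mulr0 ?addr0.
Qed.

Section Commute.
Variables (N n : nat) (s s' : rowstate).

Lemma add_strip_size h : strip N s s' ->
  (star_num N s s' == n) && (size (circ_rows N s') == (size (circ_rows N s)).+1) = false ->
  add_after N n h s s' = 0 /\ add_before N n h s s' = 0.
Proof.
move=> st ns; split; apply: big1 => k ek; rewrite /elem_amp /star_num ?star_inc_updr ?star_inc_updl.
  move: ns; rewrite (size_circ_rm (s' k).1 (ltn_ord k) ek) eqSS /star_num => ns.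
  by case: ifP; rewrite ?mulr0 // => /and3P[_ c d]; rewrite c d in ns.
move: ns; rewrite size_circ_add // /star_num => ns.
by case: ifP; rewrite ?mulr0 // => /and3P[_ c d]; rewrite c d in ns.
Qed.

(* A square and then a circle added to the same row do not form a strip; only the
   position of the intermediate diagram differs between the two orders. *)
Definition double_step k :=
  [&& strip_off N s s' k, s k == ((s k).1, false) & s' k == ((s k).1.+1, true)].

Lemma not_strip_after k : ~~ strip N s s' -> (k < N)%N -> (s' k).2 -> ~~ double_step k ->
  elem_amp N n s (upd s' k ((s' k).1, false)) = 0 :> K.
Proof.
move=> nst kN ek; rewrite /double_step; move: nst; rewrite (strip_split _ _ kN) /elem_amp.
rewrite (strip_split _ _ kN) strip_off_updr; case: (strip_off N s s' k) => //=.
rewrite /strip_at upd_same; case: ifP => // /andP[+ _] + +; rewrite /strip_row.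
case: (s k) (s' k) ek => a [] [b []] //= _; rewrite !xpair_eqE ?andbF ?andbT //=; lia.
Qed.

Lemma not_strip_before k : ~~ strip N s s' -> (k < N)%N -> ~~ (s k).2 -> ~~ double_step k ->
  elem_amp N n (upd s k ((s k).1, true)) s' = 0 :> K.
Proof.
move=> nst kN ek; rewrite /double_step; move: nst; rewrite (strip_split _ _ kN) /elem_amp.
rewrite (strip_split _ _ kN) strip_off_updl; case: (strip_off N s s' k) => //=.
rewrite /strip_at upd_same; case: ifP => // /andP[+ _] + +; rewrite /strip_row.
case: (s k) (s' k) ek => a [] [b []] //= _; rewrite !xpair_eqE ?andbF ?andbT //=; lia.
Qed.

(** The intermediate states differ in row [k] only, one having the square and the other the circle.
    The pair factors agree after the coefficients of the moves are included, and deleting the unit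
    column [k] from the larger minor accounts for the two signs. *)
Lemma double_amp k : (k < N)%N -> double_step k ->
  rsgn K s' k * add_coef al s' k * elem_amp N n s (upd s' k ((s' k).1, false)) =
  rsgn K s k * add_coef al s k * elem_amp N n (upd s k ((s k).1, true)) s'.
Proof.
move=> kN /and3P[off /eqP sk /eqP s'k].
have {sk s'k}[a [sk s'k]] : exists a, s k = (a, false) /\ s' k = (a.+1, true).
  by exists (s k).1.
have ek : ~~ (s k).2 by rewrite sk.
have ek' : (s' k).2 by rewrite s'k.
set X := star_inc s s'; have Xk : X k by rewrite /X /star_inc s'k sk.
have X1 := star_inc_updr s s' k false; have X2 := star_inc_updl s s' k true.
rewrite s'k sk -/X /= in X1 X2.
set Y := circ_inc s (upd s' k (a.+1, false)).
have Yk : Y k by rewrite /Y /circ_inc upd_same sk /= !addn0.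
have Y' : circ_inc (upd s k (a, true)) s' = Y.
  apply/funext=> i; rewrite /Y /circ_inc /upd; case: (eqVneq i k) => [->|//].
  by rewrite s'k sk /= !addn1 !addn0.
have sz := size_circ_rm (s' k).1 kN ek'.
rewrite s'k sk /= in sz *.
rewrite /elem_amp /star_num X1 X2 size_circ_add // sz eqSS.
rewrite !(strip_split _ _ kN) !strip_off_updr !strip_off_updl off /strip_at !upd_same.
rewrite /strip_row s'k sk /= !addn0 !addn1 !leqnn !leqnSn /=.
case: ifP => [/andP[_ /eqP eqsz]|_]; last by rewrite !mulr0.
have Pf : add_coef al s' k * strip_prod N s (upd s' k (a.+1, false)) =
   add_coef al s k * strip_prod N (upd s k (a, true)) s'.
  rewrite /strip_prod X1 X2 Y' -/Y.
  have usj j : j != k -> (j < N)%N -> us s' j = us s j + al * (X j)%:R.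
    move=> jk jN; apply: us_inc; move/allP: off => /(_ j).
    by rewrite mem_iota add0n (negPf jk); apply.
  have usk : us s' k = us s k + al by rewrite /ustar s'k sk -natr1 /=; ring.
  have uck : uc s k = us s k by rewrite /ucirc /ustar sk addn0.
  have uck' : uc (upd s k (a, true)) k = us s k + al.
    by rewrite /ucirc upd_same /ustar sk natrD /=; ring.
  have := @pair_prod_change _ N k (strip_factor (upd s k (a, true)) X Y) (strip_factor s X Y)
    (fun j => 1 - (us s' j - us s' k)^-1) (fun j => 1 - (us s j - us s k)^-1) (fun=> 1) kN.
  rewrite [\prod_(_ <- _ | _) 1]big1 // mulr1; apply.
  - move=> i j /andP[ji iN] ik jk; rewrite /strip_factor ustar_upd_id ?sk //.
    by rewrite !ucirc_upd_other.
  - move=> j jk; have jk' : j != k by rewrite (ltn_eqF jk).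
    rewrite /strip_factor Yk Xk /= ustar_upd_id ?sk // (ucirc_upd_other _ _ _ jk') uck' uck.
    rewrite usj ?(ltn_trans jk) // usk mulr1.
    case: (X j); rewrite ?mulr1 ?mulr0 ?addr0 /=.
      by rewrite [us s j + al - _](_ : _ = us s j - us s k); ring.
    by ring.
  by move=> i _; rewrite /strip_factor Xk Yk !andbF mulr1.
have mE : minor (size (circ_rows N s)).+1 (star_mx s X (fun=> 0))
    (map Some (circ_rows N (upd s k (a, true)))) (map Some (circ_rows N s')) =
  rsgn K s k * rsgn K s' k * minor (size (circ_rows N s)) (star_mx s X (fun=> 0))
    (map Some (circ_rows N s)) (map Some (circ_rows N (upd s' k (a.+1, false)))).
  rewrite (minor_unit_col (d := Some k)) ?uniq_map_Some ?circ_rows_uniq ?size_map //; first last.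
  - by move=> _ /mapP[i _ ->] /=; rewrite Xk andbF.
  - by rewrite sz eqsz.
  - by rewrite size_circ_add.
  - by rewrite mem_map ?mem_circ_rows ?ek' // => i j [].
  - by rewrite mem_map ?mem_circ_rows ?upd_same // => i j [].
  rewrite exprD !rsgn_index ?upd_same // rsgn_upd_le //.
  by rewrite -!map_Some_rem -circ_rows_add // circ_rows_rm.
rewrite [star_mx (upd _ _ _) _ _](_ : _ = star_mx s X (fun=> 0)); last first.
  by rewrite -[a]/(a, false).1 -sk star_mx_upd.
rewrite mE -[rsgn K s' k * _ * _]mulrA [add_coef al s' k * _]mulrA Pf.
rewrite [LHS](_ : _ = (rsgn K s k * rsgn K s k) * (rsgn K s' k * add_coef al s k *
  strip_prod N (upd s k (a, true)) s' * minor (size (circ_rows N s)) (star_mx s X (fun=> 0))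
    (map Some (circ_rows N s)) (map Some (circ_rows N (upd s' k (a.+1, false)))))).
  by ring.
by rewrite rsgn_sqr mul1r; ring.
Qed.

Lemma add_not_strip h : ~~ strip N s s' ->
  add_after N n h s s' = \sum_(k < N | double_step k) rsgn K s' k * add_coef al s' k *
     elem_amp N n s (upd s' k ((s' k).1, false)) * h (us s k + al) /\
  add_before N n h s s' = \sum_(k < N | double_step k) rsgn K s' k * add_coef al s' k *
     elem_amp N n s (upd s' k ((s' k).1, false)) * h (us s k).
Proof.
move=> nst; split.
  rewrite /add_after [LHS]big_mkcond [RHS]big_mkcond; apply: eq_bigr => k _.
  case: ifP => [ek|/negbT nek]; last first.
    by case: ifP => // /and3P[_ _ /eqP e]; rewrite e in nek.
  case: ifP => [/and3P[_ _ /eqP e]|/negbT nd]; last by rewrite not_strip_after ?mulr0.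
  have -> : us s' k = us s k + al by rewrite /ustar e -natr1 /=; ring.
  by ring.
rewrite /add_before [LHS]big_mkcond [RHS]big_mkcond; apply: eq_bigr => k _.
case: ifP => [ek|/negbT nek]; last first.
  by case: ifP => // /and3P[_ /eqP e _]; rewrite e in nek.
case: ifP => [d|/negbT nd]; last by rewrite not_strip_before ?mulr0.
by rewrite double_amp //; ring.
Qed.

Theorem add_elem_comm : add_after N n (fun=> 1) s s' = add_before N n (fun=> 1) s s'.
Proof.
have [st|nst] := boolP (strip N s s'); last first.
  by have [-> ->] := add_not_strip (fun=> 1) nst.
have [/andP[num /eqP sz]|/negbTE ns] :=
  boolP ((star_num N s s' == n) && (size (circ_rows N s') == (size (circ_rows N s)).+1)); last first.
  by have [-> ->] := add_strip_size (fun=> 1) st ns.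
rewrite add_after_strip // add_before_strip //; congr (_ * _).
by apply: eq_star_minor => // j jN; rewrite mulr1 star_vec1.
Qed.

Theorem weighted_elem_comm : add_after N n id s s' - add_before N n id s s' =
  al * (add_after N n (fun=> 1) s s' - telem_amp N n s s').
Proof.
have [st|nst] := boolP (strip N s s'); last first.
  (* Outside the strips both orders pass through double steps. The circle is added at content us +
     al in one order and at us in the other; this difference is the factor [al] on the right. *)
  have [-> _] := add_not_strip (fun=> 1) nst; have [-> ->] := add_not_strip id nst.
  rewrite /telem_amp (negPf nst) subr0 mulr_sumr -sumrB; apply: eq_bigr => k _; ring.
have [/andP[num /eqP sz]|/negbTE ns] :=
  boolP ((star_num N s s' == n) && (size (circ_rows N s') == (size (circ_rows N s)).+1)); last first.
  have [-> _] := add_strip_size (fun=> 1) st ns; have [-> ->] := add_strip_size id st ns.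
  by rewrite /telem_amp ns andbF !subr0 mulr0.
rewrite !add_after_strip // add_before_strip // /telem_amp st num sz eqxx /=.
rewrite -mulrBr -mulrBr mulrCA; congr (_ * _).
set M := star_minor N s s'; set X := star_inc s s'.
have -> : M (fun j => star_before N s' X j * us s' j) = M (fun j =>
     \sum_(k < N) star_before N s X k * us s k * star_mx s X (fun=> 0) (Some (k : nat)) (Some j)) +
   al * M (fun j => star_before N s' X j - (~~ X j)%:R).
  by apply: star_minor_lin => // j jN; rewrite star_vec2 // mulrBr; ring.
rewrite addrAC subrr add0r; congr (_ * _).
rewrite -[in RHS]mulN1r; apply: star_minor_lin => // j _; ring.
Qed.

End Commute.

End Amplitudes.

(** * The minors in terms of circled contents, and the relation with the bumping operator *)

Section DualAmplitudes.
Variables (K : fieldType) (al : K).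
Hypothesis al_gen : forall a b : int, al * a%:~R + b%:~R = 0 -> a = 0 /\ b = 0.
Implicit Types (s : rowstate) (X Y : pred nat).
Local Notation us := (ustar al).
Local Notation uc := (ucirc al).

(** The dual form of [star_mx]. Bumping changes Lambda^star, so [star_mx] would be different for
    every intermediate state, whereas this matrix depends on Lambda^circledast and stays fixed. The
    border column [w] and the corner [c] are free, for folding both compositions into one minor. *)
Definition circ_mx s Y (w : nat -> K) (c : K) (i j : option nat) : K :=
  match i, j with
  | Some i, Some j => if Y j && ~~ Y i
      then al / ((uc s i - uc s j - al) * (uc s i - uc s j)) else (i == j)%:R
  | None, Some j => (Y j)%:R
  | Some i, None => w i
  | None, None => c
  end.

Definition bump_after N n s s' := \sum_(k < N | ~~ (s' k).2 && (0 < (s' k).1)%N)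
  rsgn K s' k * bump_coef al s' k * telem_amp al N n s (upd s' k ((s' k).1.-1, true)).
Definition bump_before N n s s' := \sum_(k < N | (s k).2)
  rsgn K s k * bump_coef al s k * telem_amp al N n (upd s k ((s k).1.+1, false)) s'.

Definition circ_before N s Y k : K :=
  \prod_(i <- iota 0 N | i != k) (if Y i then 1 + (uc s i - uc s k)^-1 else 1).

Lemma uc_inc s s' k : strip_at s s' k -> uc s' k = uc s k + al * (circ_inc s s' k)%:R.
Proof.
move=> /andP[_ st]; rewrite /ucirc.
have -> : ((s' k).1 + (s' k).2 = (s k).1 + (s k).2 + circ_inc s s' k)%N.
  by rewrite /circ_inc; move: st; case: eqP => /=; lia.
by rewrite natrD; ring.
Qed.

Section CircVectors.
Variables (N : nat) (s s' : rowstate).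
Hypothesis st : strip N s s'.
Local Notation Y := (circ_inc s s').
Local Notation B := (circ_before N s Y).
Local Notation A := (circ_before N s' Y).
Local Notation ys := [seq i <- iota 0 N | Y i].

Lemma mem_ys i : (i \in ys) = Y i && (i < N)%N.
Proof. by rewrite mem_filter mem_iota. Qed.

Lemma opp_uc_inj t : injective (fun j => - uc t j).
Proof. by move=> i j /oppr_inj; apply: ucirc_inj. Qed.

Lemma circ_before_filter t k : circ_before N t Y k =
  \prod_(i <- ys | i != k) (1 - (- uc t i - - uc t k)^-1).
Proof.
rewrite big_filter_cond /circ_before -big_mkcondr /=.
apply: eq_big => [i|i _]; first by rewrite andbC.
by rewrite -[uc t i - uc t k]opprB invrN; congr (1 - _^-1); ring.
Qed.

Lemma lag_ys i : lag ys (fun j => - uc s j) i = B i.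
Proof. by rewrite circ_before_filter. Qed.

Lemma circ_after_in j : (j < N)%N -> Y j -> A j = B j.
Proof.
move=> jN Yj; rewrite !circ_before_filter big_seq_cond [RHS]big_seq_cond.
apply: eq_bigr => i; rewrite mem_ys => /andP[/andP[Yi iN] _].
by rewrite (uc_inc (stripP st iN)) (uc_inc (stripP st jN)) Yi Yj; congr (1 - _^-1); ring.
Qed.

(** Source of the factor n + 1 in the relation between [d] and [Y_n]: the residues at the rows that
    grow in Lambda^circledast add up to the number of these rows. *)
Lemma sum_circ_after : \sum_(k <- ys) A k = (size ys)%:R.
Proof.
rewrite -(@sum_lag _ ys (fun j => - uc s j)) ?filter_uniq ?iota_uniq //; last first.
  by move=> i j _ _; apply: opp_uc_inj.
rewrite big_seq [RHS]big_seq; apply: eq_bigr => k; rewrite mem_ys => /andP[Yk kN].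
by rewrite lag_ys circ_after_in.
Qed.

Lemma circB_out j : (j < N)%N -> ~~ Y j -> B j = 1 - \sum_(k <- ys) B k / (uc s j - uc s k).
Proof.
move=> jN Yj.
transitivity (1 - \sum_(k <- ys) lag ys (fun j => - uc s j) k / (- uc s k - - uc s j)); last first.
  by congr (1 - _); apply: eq_bigr => k _; rewrite lag_ys opprK addrC.
rewrite -prod_partial_fraction ?filter_uniq ?iota_uniq //; first last.
- by move=> i; rewrite mem_ys => /andP[Yi _]; apply: contraNneq Yj => /opp_uc_inj <-.
- by move=> i k _ _; apply: opp_uc_inj.
rewrite circ_before_filter big_seq_cond [RHS]big_seq; apply: eq_bigl => i.
by rewrite mem_ys; case: eqVneq => [->|]; rewrite ?(negPf Yj) ?andbT.
Qed.

Lemma uc_neq k j : k != j -> uc s j - uc s k != 0.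
Proof. by move=> kj; rewrite subr_eq0; apply: contraNneq kj => /ucirc_inj ->. Qed.

Lemma uc_shift_neq k j : k != j -> uc s j - uc s k - al != 0.
Proof.
move=> kj; rewrite -addrA -opprD subr_eq0; apply: contraNneq kj => e.
have [_ ->//] : ((s k).1 + (s k).2).+1 = ((s j).1 + (s j).2)%N /\ k = j.
by apply: (al_gen_nat al_gen); move: e; rewrite /ucirc => ->; rewrite -natr1; ring.
Qed.

Lemma circA_out j : (j < N)%N -> ~~ Y j ->
  A j = 1 - \sum_(k <- ys) B k / (uc s j - uc s k - al).
Proof.
move=> jN Yj.
transitivity (1 - \sum_(k <- ys) lag ys (fun j => - uc s j) k /
    (- uc s k - (al - uc s j))); last first.
  by congr (1 - _); apply: eq_bigr => k _; rewrite lag_ys; congr (_ / _); ring.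
have neq i : i \in ys -> i != j by rewrite mem_ys => /andP[Yi _]; apply: contraNneq Yj => <-.
rewrite -prod_partial_fraction ?filter_uniq ?iota_uniq //; first last.
- move=> i /neq/uc_shift_neq; apply: contraNneq => e.
  by rewrite -addrA e; apply/eqP; ring.
- by move=> i k _ _; apply: opp_uc_inj.
rewrite circ_before_filter big_seq_cond [RHS]big_seq; apply: eq_big => [i|i].
  by case iy: (i \in ys) => //=; apply: neq.
move=> /andP[]; rewrite mem_ys => /andP[Yi iN] _.
rewrite (uc_inc (stripP st iN)) (uc_inc (stripP st jN)) Yi (negPf Yj) mulr1 mulr0 addr0.
by congr (1 - _^-1); ring.
Qed.

Lemma circ_vec j w c : (j < N)%N ->
  \sum_(k < N) A k * circ_mx s Y w c (Some j) (Some (k : nat)) = B j.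
Proof.
move=> jN; rewrite (bigD1 (Ordinal jN)) //= andbN eqxx mulr1.
have [Yj|nYj] := boolP (Y j).
  rewrite circ_after_in // big1 ?addr0 // => k kj; rewrite andbF.
  by case: eqP => [e|]; [case/eqP: kj; apply: val_inj | rewrite mulr0].
transitivity (A j + \sum_(k <- ys) B k * (al / ((uc s j - uc s k - al) * (uc s j - uc s k)))).
  congr (_ + _); rewrite big_filter (big_iota_ord _ _ Y) big_mkcond [RHS]big_mkcond /=.
  apply: eq_bigr => k _; case: (eqVneq k (Ordinal jN)) => [->|kj] /=; first by rewrite (negPf nYj).
  case Yk: (Y k) => /=; first by rewrite circ_after_in.
  by case: eqP => [e|]; [case/eqP: kj; apply: val_inj | rewrite mulr0].
rewrite circA_out // circB_out // -addrA; congr (_ + _).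
rewrite -sumrN -big_split /= -sumrN big_seq [RHS]big_seq; apply: eq_bigr => k.
rewrite mem_ys => /andP[Yk _].
have kj : k != j by apply: contraNneq nYj => <-.
have n1 := uc_neq kj; have n2 := uc_shift_neq kj.
by field; rewrite n1 n2.
Qed.

End CircVectors.

Section MinorDual.
Variables (N : nat) (s s' : rowstate).
Hypothesis st : strip N s s'.
Local Notation X := (star_inc s s').
Local Notation Y := (circ_inc s s').
Local Notation S := (circ_rows N s).
Local Notation S' := (circ_rows N s').

Lemma fixed_rows d : d \in S -> d \in S' -> X d = Y d.
Proof.
rewrite !mem_circ_rows /star_inc /circ_inc => /andP[-> dN] /andP[-> _].
by rewrite !addn1 eqSS.
Qed.

Lemma moved_out d : d \in S -> d \notin S' -> X d /\ Y d = false.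
Proof.
rewrite !mem_circ_rows /star_inc /circ_inc => /andP[e dN]; rewrite dN andbT.
by move: (stripP st dN); rewrite /strip_at /strip_row e; case: (s' d).2 => //=; lia.
Qed.

Lemma moved_in d : d \notin S -> d \in S' -> X d = false /\ Y d.
Proof.
rewrite !mem_circ_rows /star_inc /circ_inc => + /andP[e dN]; rewrite dN andbT e.
by move: (stripP st dN); rewrite /strip_at /strip_row e; case: (s d).2 => //=; lia.
Qed.

(** In the row that a circle leaves, the circled content exceeds the starred one by [al]; in the row
    that it enters the two coincide. Hence u + al in one form is u in the other. *)
Lemma move_coef_dual i j w c v : i \in S -> i \notin S' -> j \notin S -> j \in S' ->
  star_mx al s X v (Some i) (Some j) = circ_mx s Y w c (Some i) (Some j).
Proof.
move=> iS iS' jS jS'; have [Xi Yi] := moved_out iS iS'; have [Xj Yj] := moved_in jS jS'.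
rewrite /= Xi Xj Yi Yj /= /move_coef.
have -> : uc s i = us s i + al.
  by move: iS; rewrite mem_circ_rows /ucirc /ustar => /andP[-> _]; rewrite addn1 -natr1; ring.
have -> : uc s j = us s j.
  move: jS jS'; rewrite !mem_circ_rows /ucirc /ustar => + /andP[_ jN].
  by rewrite jN andbT => /negPf->; rewrite addn0.
by congr (_ / (_ * _)); ring.
Qed.

Let fixed := map Some [seq d <- S | d \in S'].

Lemma mem_fixed d : (Some d \in fixed) = (d \in S) && (d \in S').
Proof. by rewrite mem_map ?mem_filter 1?andbC // => i j []. Qed.

(** A row circled on both sides grows in both diagrams or in neither, which makes its label a unit
    column or a unit row of both matrices. On the remaining labels the entries coincide by
    [move_coef_dual]. *)
Lemma minor_dual v w c : size S' = size S ->
  minor (size S) (star_mx al s X v) (map Some S) (map Some S') =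
  minor (size S) (circ_mx s Y w c) (map Some S) (map Some S').
Proof.
move=> sz; apply: (@minor_congr _ _ _ _ _ _ fixed);
  rewrite ?uniq_map_Some ?filter_uniq ?circ_rows_uniq ?iota_uniq ?size_map //.
- by move=> _ /mapP[d + ->]; rewrite mem_filter mem_map => [/andP[]//|i j []].
- by move=> _ /mapP[d + ->]; rewrite mem_filter mem_map => [/andP[]//|i j []].
- move=> _ /mapP[d + ->]; rewrite mem_filter => /andP[dS' dS].
  have XY := fixed_rows dS dS'; split; case Yd: (Y d).
  + by right=> _ /mapP[i _ ->] /=; rewrite XY Yd andbF.
  + by left=> _ /mapP[j _ ->] /=; rewrite XY Yd.
  + by left=> _ /mapP[j _ ->] /=; rewrite Yd andbF.
  by right=> _ /mapP[i _ ->] /=; rewrite Yd.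
move=> _ _ /mapP[i iS ->] /mapP[j jS' ->]; rewrite !mem_fixed iS jS' andbT => iS' jS.
exact: move_coef_dual.
Qed.

Lemma minor_dual_border w c : size S' = (size S).+1 ->
  star_minor al N s s' (fun j => (~~ X j)%:R) =
  minor (size S') (circ_mx s Y w c) (None :: map Some S) (map Some S').
Proof.
move=> sz; apply: (@minor_congr _ _ _ _ _ _ fixed);
  rewrite /= ?uniq_map_Some ?filter_uniq ?circ_rows_uniq ?iota_uniq ?size_map //.
- by rewrite andbT; apply/mapP=> -[].
- by move=> _ /mapP[d + ->]; rewrite mem_filter inE mem_map => [/andP[]//|i j []].
- by move=> _ /mapP[d + ->]; rewrite mem_filter mem_map => [/andP[]//|i j []].
- move=> _ /mapP[d + ->]; rewrite mem_filter => /andP[dS' dS].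
  have XY := fixed_rows dS dS'; split; case Yd: (Y d).
  + by right=> i; rewrite inE => /predU1P[->|/mapP[i' _ ->]] /=; rewrite XY Yd ?andbF.
  + by left=> _ /mapP[j _ ->] /=; rewrite XY Yd.
  + by left=> _ /mapP[j _ ->] /=; rewrite Yd andbF.
  by right=> i; rewrite inE => /predU1P[->|/mapP[i' _ ->]] /=; rewrite Yd.
move=> i _ + /mapP[j jS' ->]; rewrite inE mem_fixed jS' andbT => /predU1P[->|/mapP[i' iS ->]].
  by move=> _ jS; have [Xj Yj] := moved_in jS jS'; rewrite /= Xj Yj.
by rewrite mem_fixed iS => iS' jS; apply: move_coef_dual.
Qed.

Lemma circ_num : (count Y (iota 0 N) + size S = count X (iota 0 N) + size S')%N.
Proof.
have cntE (p : pred nat) : count p (iota 0 N) = (\sum_(i < N) p i)%N.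
  rewrite -sum1_count big_mkcond (big_iota_ord _ _ xpredT) /=.
  by apply: eq_bigr => i _; case: (p i).
rewrite /circ_rows !size_filter !cntE -!big_split /=; apply: eq_bigr => i _.
move: (stripP st (ltn_ord i)); rewrite /strip_at /strip_row /star_inc /circ_inc.
by case: (s i) (s' i) => a [] [b []] /=; lia.
Qed.

End MinorDual.

Lemma strip_row_bump a b : strip_row a b -> a.2 ->
  strip_row (a.1.+1, false) b = (b.1 == a.1.+1).
Proof. by rewrite /strip_row; case: a b => a [] [b []] //=; lia. Qed.
Lemma strip_row_unbump a b : strip_row a b -> ~~ b.2 && (0 < b.1)%N ->
  strip_row a (b.1.-1, true) = (b.1 == a.1.+1).
Proof. by rewrite /strip_row; case: a b => a [] [b []] //=; lia. Qed.

Lemma circ_inc_unbump s s' k : ~~ (s' k).2 -> (0 < (s' k).1)%N ->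
  circ_inc s (upd s' k ((s' k).1.-1, true)) = circ_inc s s'.
Proof.
move=> /negPf ek lk; apply/funext=> i; rewrite /circ_inc /upd.
by case: (eqVneq i k) => // ->; rewrite ek addn1 addn0 prednK.
Qed.

Lemma circ_inc_bump s s' k : (s k).2 -> circ_inc (upd s k ((s k).1.+1, false)) s' = circ_inc s s'.
Proof.
move=> ek; apply/funext=> i; rewrite /circ_inc /upd.
by case: (eqVneq i k) => // ->; rewrite ek addn1 addn0.
Qed.

Lemma uc_bump s k : (s k).2 -> uc (upd s k ((s k).1.+1, false)) = uc s.
Proof. by move=> ek; rewrite ucirc_upd_id //= ek addn1 addn0. Qed.

Lemma star_num_rm N X X' k n : (k < N)%N -> X k -> (forall i, X' i = X i && (i != k)) ->
  (count X' (iota 0 N) == n) = (count X (iota 0 N) == n.+1).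
Proof.
move=> kN Xk e; have -> : count X (iota 0 N) = (count X' (iota 0 N)).+1; last by [].
have := count_predUI (fun i => X i && (i != k)) (pred1 k) (iota 0 N).
rewrite (count_uniq_mem _ (iota_uniq _ _)) mem_iota kN /= [in X in (_ + X)%N](eq_count (a2 := pred0)); last first.
  by move=> i /=; case: eqVneq; rewrite ?andbF ?andbT.
rewrite count_pred0 addn0 addn1 (eq_count (a2 := X)) => [->|i /=]; last first.
  by case: (eqVneq i k) => [->|]; rewrite ?andbT ?orbF ?andbF.
by rewrite (eq_count e).
Qed.

Section StripBump.
Variables (N n : nat) (s s' : rowstate).
Hypothesis st : strip N s s'.
Local Notation X := (star_inc s s').
Local Notation Y := (circ_inc s s').
Local Notation S := (circ_rows N s).
Local Notation S' := (circ_rows N s').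

Lemma strip_unbump k : (k < N)%N -> ~~ (s' k).2 && (0 < (s' k).1)%N ->
  strip N s (upd s' k ((s' k).1.-1, true)) = X k.
Proof.
move=> kN ek; move: st; rewrite !(strip_split _ _ kN) strip_off_updr => /andP[-> st_k].
by rewrite /strip_at upd_same strip_row_unbump.
Qed.

Lemma strip_bump k : (k < N)%N -> (s k).2 -> strip N (upd s k ((s k).1.+1, false)) s' = X k.
Proof.
move=> kN ek; move: st; rewrite !(strip_split _ _ kN) strip_off_updl => /andP[-> st_k].
by rewrite /strip_at upd_same strip_row_bump.
Qed.

Lemma star_inc_unbump k i : X k -> star_inc s (upd s' k ((s' k).1.-1, true)) i = X i && (i != k).
Proof.
move=> Xk; rewrite /star_inc /upd; case: (eqVneq i k) => [->|]; rewrite ?andbT ?andbF //.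
by move: Xk; rewrite /star_inc /=; lia.
Qed.

Lemma star_inc_bump k i : X k -> star_inc (upd s k ((s k).1.+1, false)) s' i = X i && (i != k).
Proof.
move=> Xk; rewrite /star_inc /upd; case: (eqVneq i k) => [->|]; rewrite ?andbT ?andbF //.
by move: Xk; rewrite /star_inc /=; lia.
Qed.

Lemma strip_prod_unbump k : (k < N)%N -> ~~ (s' k).2 && (0 < (s' k).1)%N -> X k ->
  bump_coef al s' k * strip_prod al N s (upd s' k ((s' k).1.-1, true)) =
  strip_prod al N s s' * circ_before N s' Y k.
Proof.
move=> kN /andP[ek lk] Xk; rewrite /bump_coef /strip_prod circ_inc_unbump //.
have X' i := star_inc_unbump i Xk.
have usk : uc s' k = us s k + al.
  by move: Xk; rewrite /star_inc /ucirc /ustar (negPf ek) addn0 => /eqP->; rewrite -natr1; ring.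
have := @pair_prod_change _ N k (strip_factor al s X Y)
  (strip_factor al s (star_inc s (upd s' k ((s' k).1.-1, true))) Y)
  (fun j => 1 + (uc s' j - uc s' k)^-1) (fun=> 1)
  (fun i => if Y i then 1 + (uc s' i - uc s' k)^-1 else 1) kN.
rewrite [\prod_(j < k) 1]big1 // mul1r; apply.
- by move=> i j _ ik jk; rewrite /strip_factor !X' ik jk !andbT.
- move=> j jk; have jN := ltn_trans jk kN.
  have sj := uc_inc (stripP st jN).
  rewrite /strip_factor !X' eqxx andbF Xk (ltn_eqF jk) /= andbT usk.
  case Yj: (Y j) sj => /= sj; first by ring.
  rewrite sj mulr0 addr0 [uc s j - (us s k + al)](_ : _ = uc s j - us s k - al); ring.
move=> i /andP[ki iN]; have si := uc_inc (stripP st iN).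
rewrite /strip_factor !X' eqxx andbF Xk (gtn_eqF ki) !andbT /= usk.
case Yi: (Y i) si => /= si; last by rewrite !mulr1.
rewrite si mulr1 mul1r mulrC; congr (_ * _).
by rewrite -[X in X^-1]opprB invrN opprK; congr (1 + _^-1); ring.
Qed.

Lemma strip_prod_bump k : (k < N)%N -> (s k).2 -> X k ->
  bump_coef al s k * strip_prod al N (upd s k ((s k).1.+1, false)) s' =
  strip_prod al N s s' * circ_before N s Y k.
Proof.
move=> kN ek Xk; rewrite /bump_coef /strip_prod circ_inc_bump //.
have X' i := star_inc_bump i Xk.
have usk : uc s k = us s k + al by rewrite /ucirc /ustar ek addn1 -natr1; ring.
have usk' : us (upd s k ((s k).1.+1, false)) k = us s k + al.
  by rewrite /ustar upd_same /= -natr1; ring.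
have := @pair_prod_change _ N k (strip_factor al s X Y)
  (strip_factor al (upd s k ((s k).1.+1, false)) (star_inc (upd s k ((s k).1.+1, false)) s') Y)
  (fun j => 1 + (uc s j - uc s k)^-1) (fun=> 1)
  (fun i => if Y i then 1 + (uc s i - uc s k)^-1 else 1) kN.
rewrite [\prod_(j < k) 1]big1 // mul1r; apply.
- move=> i j _ ik jk; rewrite /strip_factor !X' ik jk !andbT uc_bump //.
  by rewrite !ustar_upd_other.
- move=> j jk; have jk' : j != k by rewrite (ltn_eqF jk).
  rewrite /strip_factor !X' eqxx andbF Xk jk' /= andbT uc_bump // usk (ustar_upd_other _ _ _ jk').
  case Yj: (Y j) => /=; first by ring.
  rewrite [uc s j - (us s k + al)](_ : _ = uc s j - us s k - al); ring.
move=> i /andP[ki iN]; have ik : i != k by rewrite (gtn_eqF ki).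
rewrite /strip_factor !X' eqxx andbF Xk ik !andbT /= uc_bump // usk usk' (ustar_upd_other _ _ _ ik).
case Yi: (Y i) => /=; last by rewrite !mulr1.
rewrite mul1r mulrC; congr (_ * _).
by rewrite -[X in X^-1]opprB invrN opprK.
Qed.


Hypothesis num : star_num N s s' == n.+1.
Hypothesis sz : size S' = size S.
Let M := circ_mx s Y (circ_before N s Y) (n.+1)%:R.

Lemma num_circ : size [seq i <- iota 0 N | Y i] = n.+1.
Proof.
move: (circ_num st) num; rewrite sz /star_num => /addIn + /eqP <-.
by rewrite size_filter.
Qed.

Lemma fixed_no_square k : k \notin S' -> (k < N)%N -> ~~ X k -> k \notin S /\ Y k = false.
Proof.
rewrite !mem_circ_rows /star_inc /circ_inc => + kN; rewrite kN !andbT => ek' nX.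
by move: (stripP st kN) nX; rewrite /strip_at /strip_row (negPf ek'); case: (s k).2 => //=; lia.
Qed.

Lemma fixed_no_square' k : k \in S -> ~~ X k -> k \in S' /\ Y k = false.
Proof.
rewrite !mem_circ_rows /star_inc /circ_inc => /andP[ek kN] nX; rewrite kN andbT ek.
by move: (stripP st kN) nX; rewrite /strip_at /strip_row ek; case: (s' k).2 => //=; lia.
Qed.

(** By [circ_vec], and by [sum_circ_after] in the corner, the border column is a combination of the
    other columns [Some k] of the matrix with weights [circ_before N s' Y k]. Linearity replaces it
    by these columns, one for each row that can be bumped last. *)
Lemma bump_after_strip : bump_after N n s s' =
  strip_prod al N s s' * minor (size S).+1 M (None :: map Some S) (None :: map Some S').
Proof.
rewrite minor_tr (@minor_lin _ _ 'I_N (index_enum _) (fun k : 'I_N => circ_before N s' Y k)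
  (fun k : 'I_N => Some (k : nat))) //=; first last.
- move=> j; rewrite inE => /predU1P[->|/mapP[i + ->]] /=; last first.
    by rewrite mem_circ_rows => /andP[_ iN]; rewrite circ_vec.
  rewrite -num_circ -(sum_circ_after st) big_filter (big_iota_ord _ _ Y) big_mkcond /=.
  by apply: eq_bigr => k _; case: (Y k); rewrite ?mulr1 ?mulr0.
- by rewrite size_map.
- by rewrite uniq_map_Some circ_rows_uniq andbT; apply/mapP=> -[].
rewrite [X in _ * X](bigID (fun k : 'I_N => ~~ (s' k).2 && (0 < (s' k).1)%N)) /=.
rewrite [X in _ * (_ + X)]big1 ?addr0; last first.
  move=> k; rewrite negb_and negbK => h; case ek: (s' k).2.
    rewrite minor_dup ?mulr0 //.
      by rewrite mem_map ?mem_circ_rows ?ek ?ltn_ord // => i j [].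
    by rewrite index_map_Some -sz index_mem mem_circ_rows ek ltn_ord.
  have nX : ~~ X k by move: h; rewrite ek /star_inc -eqn0Ngt => /eqP->.
  have kS' : (k : nat) \notin S' by rewrite mem_circ_rows ek.
  have [kS nY] := fixed_no_square kS' (ltn_ord k) nX.
  rewrite (minor_zero_row (d := Some (k : nat))) ?mulr0 ?mem_head //= ?size_map ?sz //.
  move=> j; rewrite inE => /predU1P[->|/mapP[i iS ->]] /=; rewrite nY //=.
  by case: eqP => // -[e]; rewrite -e iS in kS.
rewrite mulr_sumr; apply: eq_bigr => k ek.
have kN := ltn_ord k; rewrite /telem_amp strip_unbump //.
have [ek1 ek2] := andP ek.
have szk := size_circ_add (s' k).1.-1 kN ek1.
rewrite szk sz eqxx andbT.
case: ifP => [/andP[Xk /eqP numk]|bad]; last first.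
  rewrite (minor_zero_row (d := Some (k : nat))) ?mulr0 ?mem_head //= ?size_map ?sz //.
  have nX : ~~ X k.
    apply/negP=> Xk; move: bad; rewrite Xk /star_num.
    by rewrite (star_num_rm _ kN Xk (fun i => star_inc_unbump i Xk)) num.
  have kS' : (k : nat) \notin S' by rewrite mem_circ_rows (negPf ek1).
  have [kS nY] := fixed_no_square kS' kN nX.
  move=> j; rewrite inE => /predU1P[->|/mapP[i iS ->]] /=; rewrite nY //=.
  by case: eqP => // -[e]; rewrite -e iS in kS.
set r := circ_rows N (upd s' k _) in szk *.
have ur : uniq (map Some r) by rewrite uniq_map_Some circ_rows_uniq.
have kr : (k : nat) \in r by rewrite mem_circ_rows upd_same kN.
have er : map Some S' = rem (Some (k : nat)) (map Some r).
  by rewrite (@circ_rows_add _ _ k (s' k).1.-1) // map_Some_rem.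
rewrite (minor_dual_border _ (circ_before N s Y) (n.+1)%:R) ?strip_unbump //; last by rewrite szk sz.
rewrite circ_inc_unbump // -/M szk sz minor_tr.
rewrite (minor_rem _ _ ur (k := Some (k : nat))) ?size_map ?szk ?sz //; last first.
  by rewrite mem_map // => i j [].
rewrite er rsgn_index ?upd_same // rsgn_upd_le //.
rewrite [LHS](_ : _ = (rsgn K s' k * rsgn K s' k) *
  (bump_coef al s' k * strip_prod al N s (upd s' k ((s' k).1.-1, true))) *
  minor (size S).+1 (fun i j => M j i) (Some (k : nat) :: rem (Some (k : nat)) (map Some r))
    (None :: map Some S)); last by ring.
by rewrite rsgn_sqr strip_prod_unbump //; ring.
Qed.

Lemma bump_before_strip : bump_before N n s s' =
  - (strip_prod al N s s' * \sum_(k <- S) (-1) ^+ (index k S).+1 * circ_before N s Y k *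
     minor (size S) M (None :: map Some (rem k S)) (map Some S')).
Proof.
rewrite /bump_before big_filter (big_iota_ord _ _ (fun k => (s k).2)) -mulrN -sumrN mulr_sumr.
apply: eq_bigr => k ek; have kN := ltn_ord k; rewrite /telem_amp strip_bump //.
have szk := size_circ_rm (s k).1.+1 kN ek.
rewrite sz szk eqxx andbT.
have kS : (k : nat) \in S by rewrite mem_circ_rows ek.
case: ifP => [/andP[Xk /eqP numk]|bad]; last first.
  have nX : ~~ X k.
    apply/negP=> Xk; move: bad; rewrite Xk /star_num.
    by rewrite (star_num_rm _ kN Xk (fun i => star_inc_bump i Xk)) num.
  have [kS' nY] := fixed_no_square' kS nX.
  rewrite (minor_zero_col (d := Some (k : nat))) ?mulr0 ?oppr0 ?mulr0 //=.
  - by rewrite mem_map // => i j [].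
  - by rewrite size_map size_rem // szk.
  - by rewrite size_map sz szk.
  move=> j; rewrite inE => /predU1P[->|/mapP[i + ->]] /=; rewrite nY //=.
  rewrite rem_filter ?circ_rows_uniq // mem_filter /= => /andP[ik _].
  by case: eqP => // -[e]; rewrite e eqxx in ik.
rewrite (minor_dual_border _ (circ_before N s Y) (n.+1)%:R) ?strip_bump //; last by rewrite sz szk.
rewrite circ_inc_bump // [circ_mx _ _ _ _](_ : _ = M); last by rewrite /circ_mx /M uc_bump.
rewrite sz szk circ_rows_rm // exprS mulN1r -(index_map_Some k) rsgn_index //.
rewrite [LHS](_ : _ = rsgn K s k *
  (bump_coef al s k * strip_prod al N (upd s k ((s k).1.+1, false)) s') *
  minor (size (rem (k : nat) S)).+1 M
     (None :: map Some (rem (k : nat) S)) (map Some S')); last by ring.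
by rewrite strip_prod_bump //; ring.
Qed.

(** Expansion of the doubly bordered minor along its border column: the corner n + 1 yields the
    right-hand side, the other entries yield minus the sum in [bump_before]. *)
Lemma bump_strip : bump_after N n s s' + bump_before N n s s' =
  n.+1%:R * elem_amp al N n.+1 s s'.
Proof.
rewrite bump_after_strip bump_before_strip /elem_amp st num sz eqxx /= minor_tr.
rewrite minor_cons /= ?size_map //; last first.
  by rewrite uniq_map_Some circ_rows_uniq andbT; apply/mapP=> -[].
rewrite big_cons big_map /= expr0 mul1r.
rewrite (minor_dual st _ (circ_before N s Y) (n.+1)%:R) // -/M -[in LHS]minor_tr mulrDr -addrA.
rewrite [X in _ + X](_ : _ = 0) ?addr0 1?mulrCA // -mulrBr.
rewrite [X in _ * X](_ : _ = 0) ?mulr0 // -sumrB big_seq big1 // => k kS.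
by rewrite index_map_Some -minor_tr map_Some_rem subrr.
Qed.

End StripBump.

Section Anticommute.
Variables (N n : nat) (s s' : rowstate).

Lemma bump_strip_size : strip N s s' ->
  (star_num N s s' == n.+1) && (size (circ_rows N s') == size (circ_rows N s)) = false ->
  bump_after N n s s' = 0 /\ bump_before N n s s' = 0.
Proof.
move=> st ns; split; apply: big1 => k ek; rewrite /telem_amp.
  have [ek1 ek2] := andP ek.
  rewrite strip_unbump // size_circ_add // eqSS; case: ifP; rewrite ?mulr0 // => /and3P[Xk].
  rewrite /star_num (star_num_rm _ (ltn_ord k) Xk (fun i => star_inc_unbump st i Xk)) => c d.
  by move: ns; rewrite /star_num c d.
rewrite strip_bump // -(size_circ_rm _ (ltn_ord k) ek); case: ifP; rewrite ?mulr0 // => /and3P[Xk].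
rewrite /star_num (star_num_rm _ (ltn_ord k) Xk (fun i => star_inc_bump st i Xk)) => c d.
by move: ns; rewrite /star_num c d.
Qed.

Definition double_bump k :=
  [&& strip_off N s s' k, s k == ((s k).1, true) & s' k == ((s k).1.+2, false)].

Lemma not_strip_unbump k : ~~ strip N s s' -> (k < N)%N -> ~~ (s' k).2 && (0 < (s' k).1)%N ->
  ~~ double_bump k -> telem_amp al N n s (upd s' k ((s' k).1.-1, true)) = 0 :> K.
Proof.
move=> nst kN ek; rewrite /double_bump; move: nst; rewrite (strip_split _ _ kN) /telem_amp.
rewrite (strip_split _ _ kN) strip_off_updr; case: (strip_off N s s' k) => //=.
rewrite /strip_at upd_same; case: ifP => // /andP[+ _] + +; rewrite /strip_row.
case: (s k) (s' k) ek => a [] [b []] //= b0; rewrite !xpair_eqE ?andbF ?andbT //=; lia.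
Qed.

Lemma not_strip_bump k : ~~ strip N s s' -> (k < N)%N -> (s k).2 ->
  ~~ double_bump k -> telem_amp al N n (upd s k ((s k).1.+1, false)) s' = 0 :> K.
Proof.
move=> nst kN ek; rewrite /double_bump; move: nst; rewrite (strip_split _ _ kN) /telem_amp.
rewrite (strip_split _ _ kN) strip_off_updl; case: (strip_off N s s' k) => //=.
rewrite /strip_at upd_same; case: ifP => // /andP[+ _] + +; rewrite /strip_row.
case: (s k) (s' k) ek => a [] [b []] //= _; rewrite !xpair_eqE ?andbF ?andbT //=; lia.
Qed.

Lemma double_bump_amp k : (k < N)%N -> double_bump k ->
  rsgn K s' k * bump_coef al s' k * telem_amp al N n s (upd s' k ((s' k).1.-1, true)) =
  - (rsgn K s k * bump_coef al s k * telem_amp al N n (upd s k ((s k).1.+1, false)) s').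
Proof.
move=> kN /and3P[off /eqP sk /eqP s'k].
have {sk s'k}[a [sk s'k]] : exists a, s k = (a, true) /\ s' k = (a.+2, false).
  by exists (s k).1.
have ek : (s k).2 by rewrite sk.
have ek' : ~~ (s' k).2 by rewrite s'k.
have lk' : (0 < (s' k).1)%N by rewrite s'k.
have sz := size_circ_rm (s k).1.+1 kN ek.
have sz' := size_circ_add (s' k).1.-1 kN ek'.
have cr := circ_rows_rm N a.+1 ek.
have cr' := circ_rows_add a.+1 kN ek'.
have Y1 := circ_inc_unbump s ek' lk'; have Y2 := circ_inc_bump s' ek.
have uc2 := uc_bump ek.
rewrite s'k sk /= in sz sz' Y1 Y2 uc2 *.
set X := star_inc s (upd s' k (a.+1, true)).
have Xk : X k by rewrite /X /star_inc upd_same sk.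
have X2 : star_inc (upd s k (a.+1, false)) s' = X.
  apply/funext=> i; rewrite /X /star_inc /upd; case: (eqVneq i k) => [->|//].
  by rewrite s'k sk /= !eqxx.
set Y := circ_inc s s' in Y1 Y2; have Yk : Y k by rewrite /Y /circ_inc s'k sk /= addn1 addn0.
have X1 : star_inc s (upd s' k (a.+1, true)) = X by [].
rewrite /telem_amp /star_num X2 X1 sz sz' eqSS.
rewrite !(strip_split _ _ kN) !strip_off_updr !strip_off_updl off /strip_at !upd_same.
rewrite /strip_row s'k sk /= !addn0 !addn1 !leqnn !leqnSn /=.
case: ifP => [/andP[_ /eqP eqsz]|_]; last by rewrite !mulr0 oppr0.
have Pf : bump_coef al s' k * strip_prod al N s (upd s' k (a.+1, true)) =
   bump_coef al s k * strip_prod al N (upd s k (a.+1, false)) s'.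
  rewrite /strip_prod X1 X2 Y1 Y2.
  have ucj j : j != k -> (j < N)%N -> uc s' j = uc s j + al * (Y j)%:R.
    move=> jk jN; apply: uc_inc; move/allP: off => /(_ j).
    by rewrite mem_iota add0n (negPf jk); apply.
  have uck : uc s k = us s k + al by rewrite /ucirc /ustar sk addn1 -natr1 /=; ring.
  have uck' : uc s' k = us s k + al + al.
    by rewrite /ucirc /ustar s'k sk addn0 -natr1 -natr1 /=; ring.
  have usk' : us (upd s k (a.+1, false)) k = us s k + al.
    by rewrite /ustar upd_same sk -natr1 /=; ring.
  have := @pair_prod_change _ N k (strip_factor al (upd s k (a.+1, false)) X Y)
    (strip_factor al s X Y)
    (fun j => 1 + (uc s' j - uc s' k)^-1) (fun j => 1 + (uc s j - uc s k)^-1) (fun=> 1) kN.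
  rewrite [\prod_(_ <- _ | _) 1]big1 // mulr1; apply.
  - move=> i j /andP[ji iN] ik jk; rewrite /strip_factor uc2.
    by rewrite !ustar_upd_other.
  - move=> j jk; have jk' : j != k by rewrite (ltn_eqF jk).
    rewrite /strip_factor Yk Xk /= (ustar_upd_other _ _ _ jk') uc2 uck usk'.
    rewrite ucj ?(ltn_trans jk) // uck' mulr1.
    case: (Y j); rewrite ?mulr1 ?mulr0 ?addr0 /=.
      by rewrite [uc s j + al - _](_ : _ = uc s j - (us s k + al)); ring.
    rewrite [uc s j - us s k - al](_ : _ = uc s j - (us s k + al)); last by ring.
    by rewrite [uc s j - (us s k + al) - al](_ : _ = uc s j - (us s k + al + al)); ring.
  by move=> i _; rewrite /strip_factor Xk Yk !andbF mulr1.
have mE : star_minor al N s (upd s' k (a.+1, true)) (fun j => (~~ X j)%:R) =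
  - (rsgn K s k * rsgn K s' k *
     star_minor al N (upd s k (a.+1, false)) s' (fun j => (~~ X j)%:R)).
  rewrite /star_minor X1 X2 sz' (minor_unit_col (d := Some k)); first last.
  - by move=> i; rewrite inE => /predU1P[->|/mapP[i' _ ->]] /=; rewrite Xk ?andbF.
  - by rewrite size_map.
  - by rewrite /= size_map sz eqsz.
  - by rewrite mem_map ?mem_circ_rows ?upd_same // => i j [].
  - by rewrite inE mem_map ?mem_circ_rows ?ek // => i j [].
  - by rewrite uniq_map_Some circ_rows_uniq.
  - by rewrite /= uniq_map_Some circ_rows_uniq andbT; apply/mapP=> -[].
  (* The border row shifts the row position by one. This is the sign that makes the two orders
     cancel here, where they agreed for added circles. *)
  rewrite /= exprS mulN1r exprD !rsgn_index ?upd_same // rsgn_upd_le // mulNr.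
  congr (- (_ * _)); rewrite -!map_Some_rem -cr' -cr.
  apply: eq_minor; rewrite /= ?size_map ?eqsz //.
  move=> i j; rewrite inE => iR /mapP[j' + ej]; rewrite ej => j'S'.
  have jk : j' != k by apply: contraNneq ek' => <-; move: j'S'; rewrite mem_circ_rows => /andP[].
  case/predU1P: iR => [->//|/mapP[i' + ->]].
  rewrite mem_circ_rows => /andP[+ _]; case: (eqVneq i' k) => [->|ik _] /=.
    by rewrite upd_same.
  by rewrite /move_coef !ustar_upd_other.
rewrite mE -[rsgn K s' k * _ * _]mulrA [bump_coef al s' k * _]mulrA Pf.
rewrite [LHS](_ : _ = (rsgn K s' k * rsgn K s' k) * - (rsgn K s k * bump_coef al s k *
  strip_prod al N (upd s k (a.+1, false)) s' *
  star_minor al N (upd s k (a.+1, false)) s' (fun j => (~~ X j)%:R))); last by ring.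
by rewrite rsgn_sqr mul1r; ring.
Qed.

Theorem bump_telem : bump_after N n s s' + bump_before N n s s' =
  n.+1%:R * elem_amp al N n.+1 s s'.
Proof.
have [st|nst] := boolP (strip N s s'); last first.
  rewrite /elem_amp (negPf nst) mulr0.
  have -> : bump_after N n s s' = \sum_(k < N | double_bump k) rsgn K s' k * bump_coef al s' k *
     telem_amp al N n s (upd s' k ((s' k).1.-1, true)).
    rewrite /bump_after [LHS]big_mkcond [RHS]big_mkcond; apply: eq_bigr => k _.
    case: ifP => [ek|/negbT nek]; last first.
      by case: ifP => // /and3P[_ _ /eqP e]; rewrite e in nek.
    by case: ifP => [//|/negbT nd]; rewrite not_strip_unbump ?mulr0.
  have -> : bump_before N n s s' = \sum_(k < N | double_bump k) rsgn K s k * bump_coef al s k *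
     telem_amp al N n (upd s k ((s k).1.+1, false)) s'.
    rewrite /bump_before [LHS]big_mkcond [RHS]big_mkcond; apply: eq_bigr => k _.
    case: ifP => [ek|/negbT nek]; last first.
      by case: ifP => // /and3P[_ /eqP e _]; rewrite e in nek.
    by case: ifP => [//|/negbT nd]; rewrite not_strip_bump ?mulr0.
  by rewrite -big_split big1 //= => k d; rewrite double_bump_amp // addNr.
have [/andP[num /eqP sz]|/negbTE ns] :=
  boolP ((star_num N s s' == n.+1) && (size (circ_rows N s') == size (circ_rows N s))); last first.
  by have [-> ->] := bump_strip_size st ns; rewrite /elem_amp ns andbF addr0 mulr0.
exact: bump_strip.
Qed.

End Anticommute.

End DualAmplitudes.

(** * The norm of a row state *)

Section Norm.
Variables (K : fieldType) (al : K).
Hypothesis al_gen : forall a b : int, al * a%:~R + b%:~R = 0 -> a = 0 /\ b = 0.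
Implicit Types (s : rowstate).
Local Notation us := (ustar al).
Local Notation uc := (ucirc al).

Definition gap_factor (v : K) : K := (v + 1) * (v + al - 1) / (v * (v + al)).

(** Row [j] is above row [i]. The first product has one factor for each column by which row [j]
    exceeds row [i] in Lambda^star, so that bumping appends or removes a single factor; everything
    is chosen to make [add_norm] and [bump_norm] hold. *)
Definition pair_norm s i j : K :=
  (\prod_(r < (s j).1 - (s i).1) gap_factor (al * r%:R + (i - j)%:R)) *
  (if (s j).2 then (us s j - us s i + 1) / (us s j - us s i) else 1) *
  (if (s i).2 then (us s j - us s i) / (us s j - us s i - 1) else 1).

Definition row_norm N s i : K :=
  (\prod_(r < (s i).1) ((al * r.+1%:R - i%:R + N%:R - 1) / (al * r%:R - i%:R + N%:R))) *
  (if (s i).2 then (us s i + N%:R)^-1 else 1).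

Definition state_norm N s : K :=
  pair_prod N (pair_norm s) * \prod_(i < N) row_norm N s i.

Lemma stacked_le s j i : stacked s -> (j <= i)%N -> ((s i).1 <= (s j).1)%N.
Proof.
move=> st; elim: i => [|i IH]; first by rewrite leqn0 => /eqP->.
rewrite leq_eqVlt ltnS => /predU1P[->//|/IH]; apply: leq_trans.
by have := st i; rewrite /row_rel => /orP[/ltnW//|/andP[/eqP->]].
Qed.

Lemma us_sub_neq1 s j i : stacked s -> (s i).2 -> us s j - us s i - 1 != 0.
Proof.
move=> st ei; apply/eqP=> e.
have [eqlam eqi] : (s j).1 = (s i).1 /\ j.+1 = i.
  apply: (al_gen_nat al_gen); apply/eqP; rewrite -subr_eq0; apply/eqP.
  by rewrite -e /ustar -natr1; ring.
by have := st j; rewrite /row_rel eqi eqlam ltnn eqxx ei.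
Qed.

Lemma us_sub_neq0 s j i : j != i -> us s j - us s i != 0.
Proof. by move=> ji; rewrite subr_eq0; apply: contraNneq ji => /ustar_inj ->. Qed.

Lemma us_N_neq0 N s i : (i < N)%N -> us s i + N%:R != 0.
Proof. by move=> iN; rewrite -[N%:R]opprK subr_eq0 ustar_oppN_neq. Qed.

Lemma gap_sub s j i : (j <= i)%N -> ((s i).1 <= (s j).1)%N ->
  al * ((s j).1 - (s i).1)%:R + (i - j)%:R = us s j - us s i.
Proof. by move=> ji le; rewrite !natrB // /ustar; ring. Qed.

Lemma us_addal_neq0 s j i a : (j < i)%N -> ((s i).1 <= (s j).1 + a)%N ->
  (0 < a)%N -> us s j - us s i + al * a%:R != 0.
Proof.
move=> ji le a0; apply/eqP=> e.
have [_ eq] : ((s j).1 + a)%N = (s i).1 /\ j = i.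
  apply: (al_gen_nat al_gen); apply/eqP; rewrite -subr_eq0; apply/eqP.
  by rewrite -e /ustar natrD; ring.
by rewrite eq ltnn in ji.
Qed.

Lemma us_addal_sub1_neq0 s j i : (j < i)%N -> ((s i).1 <= (s j).1)%N ->
  us s j - us s i + al - 1 != 0.
Proof.
move=> ji le; apply/eqP=> e.
have [eq _] : ((s j).1.+1)%N = (s i).1 /\ j.+1 = i.
  apply: (al_gen_nat al_gen); apply/eqP; rewrite -subr_eq0; apply/eqP.
  by rewrite -e /ustar -!natr1; ring.
by move: le; rewrite -eq ltnn.
Qed.

(** Adjointness for a single move. The pairs with rows above absorb [add_coef], those with rows
    below leave the product in [add_adj], and the row's own factor leaves the division by its
    content plus [N]. *)
Lemma add_norm N s k : (k < N)%N -> ~~ (s k).2 -> stacked (upd s k ((s k).1, true)) ->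
  add_coef al s k * state_norm N (upd s k ((s k).1, true)) =
  state_norm N s * add_adj al N s k.
Proof.
move=> kN ek st; set s' := upd s k _.
have us' : us s' = us s by rewrite ustar_upd_id.
have row i : i != k -> s' i = s i by move=> ik; rewrite /s' upd_other.
have rowk : s' k = ((s k).1, true) by rewrite /s' upd_same.
have lam i : (s' i).1 = (s i).1 by rewrite /s' /upd; case: (eqVneq i k) => [->|].
rewrite /state_norm /add_coef mulrA.
rewrite (@pair_prod_change _ N k (pair_norm s) (pair_norm s')
    (fun j => 1 - (us s j - us s k)^-1) (fun=> 1)
    (fun i => if (k < i)%N then 1 + (us s k - us s i)^-1 else 1) kN); first last.
- move=> i /andP[ki iN]; have ik : i != k by rewrite (gtn_eqF ki).
  have n0 := us_sub_neq0 s (_ : k != i); rewrite eq_sym in n0.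
  by rewrite /pair_norm us' !lam (row i) // rowk (negPf ek) ki /=; field; rewrite n0.
- move=> j jk; have jk' : j != k by rewrite (ltn_eqF jk).
  have n0 := us_sub_neq0 s jk'.
  have ek1 : (s' k).2 by rewrite rowk.
  have n1 := us_sub_neq1 j st ek1; rewrite us' in n1.
  rewrite /pair_norm us' !lam (row j) // rowk (negPf ek) ltnNge (ltnW jk) /=.
  case: (s j).2; move: (\prod_(_ < _) _) => G; first by field; rewrite n0 n1.
  by field; rewrite n0 n1.
- by move=> i j _ ik jk; rewrite /pair_norm us' !lam !row.
rewrite [\prod_(j < k) 1]big1 // mul1r.
have -> : \prod_(i <- iota 0 N | i != k) (if (k < i)%N then 1 + (us s k - us s i)^-1 else 1) =
   \prod_(i < N | (k < i)%N) (1 + (us s k - us s i)^-1).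
  rewrite big_iota_ord big_mkcond [RHS]big_mkcond; apply: eq_bigr => i _.
  by case: ltngtP.
have -> : \prod_(i < N) row_norm N s' i = (\prod_(i < N) row_norm N s i) / (us s k + N%:R).
  rewrite (bigD1 (Ordinal kN)) // [in RHS](bigD1 (Ordinal kN)) //=.
  rewrite (eq_bigr (fun i : 'I_N => row_norm N s i)); last first.
    by move=> i ik; rewrite /row_norm us' row.
  rewrite /row_norm us' rowk (negPf ek) /=; ring.
rewrite /add_adj; ring.
Qed.

Lemma bump_norm N s k : (k < N)%N -> (s k).2 -> stacked s ->
  stacked (upd s k ((s k).1.+1, false)) ->
  bump_coef al s k * state_norm N (upd s k ((s k).1.+1, false)) =
  state_norm N s * bump_adj al N s k.
Proof.
move=> kN ek st st'; set s' := upd s k _ in st' *.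
have us' i : i != k -> us s' i = us s i by move=> ik; rewrite ustar_upd_other.
have usk : us s' k = us s k + al by rewrite /ustar /s' upd_same /= -natr1; ring.
have row i : i != k -> s' i = s i by move=> ik; rewrite /s' upd_other.
have rowk : s' k = ((s k).1.+1, false) by rewrite /s' upd_same.
have uck : uc s k = us s k + al by rewrite /ucirc /ustar ek addn1 -natr1; ring.
rewrite /state_norm /bump_coef mulrA.
rewrite (@pair_prod_change _ N k (pair_norm s) (pair_norm s')
    (fun j => 1 + (uc s j - uc s k)^-1) (fun=> 1)
    (fun i => if (k < i)%N then 1 - (uc s k - uc s i)^-1 else 1) kN); first last.
- move=> i /andP[ki iN]; have ik : i != k by rewrite (gtn_eqF ki).
  have ki' : k != i by rewrite eq_sym.
  have n0 := us_sub_neq0 s ki'.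
  have le := stacked_le st (ltnW ki).
  have n2 : us s k - us s i + al != 0.
    by have := @us_addal_neq0 s k i 1 ki; rewrite mulr1; apply=> //; lia.
  rewrite /pair_norm (us' i ik) usk (row i) // rowk ek ki /= uck subSn // big_ord_recr /=.
  rewrite gap_sub ?(ltnW ki) // /gap_factor mulr1.
  have -> : uc s i = us s i + al * (s i).2%:R by rewrite /ucirc /ustar natrD; ring.
  case ei: (s i).2; rewrite ?mulr0 ?mulr1 ?addr0.
    have n1 := us_sub_neq1 k st ei.
    rewrite [us s k + al - (us s i + al)](_ : _ = us s k - us s i); last by ring.
    rewrite [us s k + al - us s i](_ : _ = us s k - us s i + al); last by ring.
    have n3 := us_addal_sub1_neq0 ki le.
    by move: (\prod_(_ < _) _) => G; field; rewrite n0 n1 n2 n3.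
  rewrite [us s k + al - us s i](_ : _ = us s k - us s i + al); last by ring.
  by move: (\prod_(_ < _) _) => G; field; rewrite n0 n2.
- move=> j jk; have jk' : j != k by rewrite (ltn_eqF jk).
  have n0 := us_sub_neq0 s jk'; have n1 := us_sub_neq1 j st ek.
  have n0' := us_sub_neq0 s' jk'; rewrite (us' j jk') usk in n0'.
  have le := stacked_le st' (ltnW jk); rewrite rowk (row j jk') /= in le.
  have gapE := gap_sub (ltnW jk) (_ : ((s' k).1 <= (s' j).1)%N).
  rewrite (us' j jk') usk (row j jk') rowk /= in gapE.
  rewrite /pair_norm (us' j jk') usk (row j) // rowk ek /= mul1r ltnNge (ltnW jk) /= !mulr1.
  rewrite -(subnSK le) big_ord_recr /= (gapE le) /gap_factor uck.
  have -> : uc s j = us s j + al * (s j).2%:R by rewrite /ucirc /ustar natrD; ring.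
  rewrite [us s j - (us s k + al) + al](_ : _ = us s j - us s k); last by ring.
  case ej: (s j).2; rewrite ?mulr0 ?mulr1 ?addr0.
    rewrite [us s j + al - (us s k + al)](_ : _ = us s j - us s k); last by ring.
    by move: (\prod_(_ < _) _) => G; field; rewrite n0 n1 n0'.
  by move: (\prod_(_ < _) _) => G; field; rewrite n0 n1 n0'.
- by move=> i j _ ik jk; rewrite /pair_norm !us' // !row.
rewrite [\prod_(j < k) 1]big1 // mul1r.
have -> : \prod_(i <- iota 0 N | i != k) (if (k < i)%N then 1 - (uc s k - uc s i)^-1 else 1) =
   \prod_(i < N | (k < i)%N) (1 - (uc s k - uc s i)^-1).
  rewrite big_iota_ord big_mkcond [RHS]big_mkcond; apply: eq_bigr => i _.
  by case: ltngtP.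
have -> : \prod_(i < N) row_norm N s' i = (\prod_(i < N) row_norm N s i) * (uc s k + N%:R - 1).
  rewrite (bigD1 (Ordinal kN)) // [in RHS](bigD1 (Ordinal kN)) //=.
  rewrite (eq_bigr (fun i : 'I_N => row_norm N s i)); last first.
    by move=> i ik; rewrite /row_norm us' // row.
  rewrite /row_norm rowk ek /= big_ord_recr /= uck /ustar -natr1; ring.
rewrite /bump_adj; ring.
Qed.

Lemma al_mul_neq0 (a : nat) (b : int) : (a != 0%N) || (b != 0) -> al * a%:R + b%:~R != 0.
Proof. by move=> ab; apply/eqP => /(@al_gen a b)[[a0] b0]; rewrite a0 b0 in ab. Qed.

Lemma state_norm_neq0 N s : stacked s -> state_norm N s != 0.
Proof.
move=> st; rewrite mulf_neq0 //; apply/prodf_neq0 => i _.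
  apply/prodf_neq0 => j _; have ji : (j < i)%N := ltn_ord j.
  have nji : (j : nat) != i by rewrite (ltn_eqF ji).
  have n0 := us_sub_neq0 s nji.
  rewrite /pair_norm !mulf_neq0 //.
  - apply/prodf_neq0 => r _; rewrite /gap_factor.
    have c1 : al * r%:R + (i - j)%:R + 1 != 0.
      by rewrite -addrA natr1 [(_).+1%:R]pmulrn; apply: al_mul_neq0; rewrite orbT.
    have c2 : al * r%:R + (i - j)%:R + al - 1 != 0.
      rewrite [_ - 1](_ : _ = al * r.+1%:R + ((i - j)%:Z - 1)%:~R); first exact: al_mul_neq0.
      by rewrite rmorphB /= -natr1; ring.
    have c3 : al * r%:R + (i - j)%:R != 0.
      by rewrite [(i - j)%:R]pmulrn; apply: al_mul_neq0; rewrite eqz_nat subn_eq0 -ltnNge ji orbT.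
    have c4 : al * r%:R + (i - j)%:R + al != 0.
      rewrite [_ + al](_ : _ = al * r.+1%:R + ((i - j)%:Z)%:~R); first exact: al_mul_neq0.
      by rewrite -natr1; ring.
    by rewrite mulf_neq0 ?mulf_neq0 ?invr_neq0 ?mulf_neq0.
  - case: (s j).2; rewrite ?oner_eq0 //.
    rewrite mulf_neq0 ?invr_neq0 //.
    apply/eqP=> e; have [_ eq] : (s j).1 = (s i).1 /\ j = i.+1 :> nat.
      apply: (al_gen_nat al_gen); apply/eqP; rewrite -subr_eq0; apply/eqP.
      by rewrite -e /ustar -natr1; ring.
    by rewrite eq ltnNge leqnSn in ji.
  by case ei: (s i).2; rewrite ?oner_eq0 // mulf_neq0 ?invr_neq0 // us_sub_neq1.
have iN := ltn_ord i; rewrite /row_norm mulf_neq0 //; last first.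
  by case: (s i).2; rewrite ?oner_eq0 // invr_neq0 // us_N_neq0.
apply/prodf_neq0 => r _; rewrite mulf_neq0 ?invr_neq0 //.
  rewrite [_ - 1](_ : _ = al * r.+1%:R + (N%:Z - i%:Z - 1)%:~R); first exact: al_mul_neq0.
  by rewrite !rmorphB /=; ring.
rewrite [_ + _](_ : _ = al * r%:R + ((N - i)%N%:Z)%:~R); last by rewrite -pmulrn natrB 1?ltnW //; ring.
by apply: al_mul_neq0; rewrite eqz_nat subn_eq0 -ltnNge iN orbT.
Qed.

End Norm.

(** * Superpartitions as row states *)

Lemma mem_cells la (c : cell) :
  (c \in cells la) = [&& 0 < c.1, 0 < c.2 & c.2 <= part la c.1]%N.
Proof.
case: c => i j /=; apply/allpairsPdep/and3P => [[i' [j' [+ + [-> ->]]]]|[i0 j0 jle]].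
  by rewrite !mem_iota => /andP[-> _] /andP[-> jle]; split; rewrite // -ltnS.
exists i, j; split=> //; rewrite !mem_iota ?i0 ?j0 ?add1n ?ltnS //=.
rewrite leqNgt; apply: contraTN jle => lt.
by rewrite /part nth_default -?ltnNge // -ltnS prednK.
Qed.

Lemma mem_skew la mu (c : cell) :
  (c \in skew la mu) = [&& 0 < c.1, part mu c.1 < c.2 & c.2 <= part la c.1]%N.
Proof.
rewrite mem_filter !mem_cells; case: (c.1) => //= i.
by lia.
Qed.

Lemma cells_uniq la : uniq (cells la).
Proof.
apply: allpairs_uniq_dep; rewrite ?iota_uniq //; first by move=> i _; exact: iota_uniq.
by move=> [i j] [i' j'] _ _ /= [-> ->].
Qed.

Lemma skew_uniq la mu : uniq (skew la mu).
Proof. by rewrite filter_uniq ?cells_uniq. Qed.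

Lemma uniq_map_in (T U : eqType) (f : T -> U) (s : seq T) :
  uniq s -> uniq (map f s) -> {in s &, injective f}.
Proof.
elim: s => //= x s IH /andP[xs us] /andP[fx ufs] a b; rewrite !inE.
move=> /predU1P[->|as_] /predU1P[->|bs] // e; last exact: IH e.
  by rewrite e map_f in fx.
by rewrite -e map_f in fx.
Qed.

Lemma uniq_map_inE (T U : eqType) (f : T -> U) (s : seq T) : uniq s ->
  {in s &, injective f} -> uniq (map f s).
Proof. by move=> us inj; rewrite map_inj_in_uniq. Qed.

Lemma containedP mu la : reflect (forall k, nth 0 mu k <= nth 0 la k)%N (contained mu la).
Proof.
apply: (iffP allP) => [h k|h [i j]].
  case: (posnP (nth 0%N mu k)) => [->//|pos].
  have /h : (k.+1, nth 0%N mu k) \in cells mu by rewrite mem_cells /= pos leqnn.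
  by rewrite mem_cells => /and3P[].
rewrite !mem_cells /= => /and3P[-> -> /leq_trans->//]; exact: h.
Qed.

Lemma rows_uniqP la mu :
  reflect (forall k, nth 0 la k <= (nth 0 mu k).+1)%N (uniq [seq c.1 | c <- skew la mu]).
Proof.
apply: (iffP idP) => [u k|h].
  rewrite leqNgt; apply/negP=> lt.
  have inj := uniq_map_in (skew_uniq _ _) u.
  have [] // : (k.+1, (nth 0%N mu k).+1) = (k.+1, (nth 0%N mu k).+2).
    by apply: inj; rewrite // mem_skew /= ?leqnn ?leqnSn //= /part /=; lia.
  by move=> /eqP; rewrite -[X in X == _]addn0 -[X in _ == X]addn1 eqn_add2l.
apply: uniq_map_inE; rewrite ?skew_uniq // => -[i j] [i' j'].
rewrite !mem_skew /= => /and3P[_ l1 u1] /and3P[_ l2 u2] e; move: l2 u2; rewrite -e => l2 u2.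
by congr (_, _); have := h i.-1; rewrite /part in l1 u1 l2 u2; lia.
Qed.

Lemma sumn_nth la N : (size la <= N)%N -> sumn la = (\sum_(k < N) nth 0 la k)%N.
Proof.
move=> sz; rewrite sumnE (big_nth 0%N) big_mkord (big_ord_widen _ (fun k => nth 0%N la k) sz).
rewrite [RHS](bigID (fun k : 'I_N => (k < size la)%N)) /= [X in (_ + X)%N]big1 ?addn0 //.
by move=> k; rewrite -leqNgt => le; rewrite nth_default.
Qed.

Lemma leq_sumn mu la : (forall k, nth 0 mu k <= nth 0 la k)%N -> (sumn mu <= sumn la)%N.
Proof.
move=> h; rewrite (@sumn_nth mu (maxn (size mu) (size la))) ?leq_maxl //.
by rewrite (@sumn_nth la (maxn (size mu) (size la))) ?leq_maxr // leq_sum.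
Qed.

Lemma geq_trans : transitive geq.
Proof. by move=> a b c ab bc; apply: leq_trans bc ab. Qed.

Lemma part_nth_anti la i j : is_part la -> (i <= j)%N -> (nth 0 la j <= nth 0 la i)%N.
Proof.
move=> /andP[so _] ij; case: (ltnP j (size la)) => [lj|le]; last by rewrite nth_default.
apply: (sorted_leq_nth geq_trans leqnn 0%N so) (ij); rewrite ?inE //.
exact: leq_ltn_trans ij lj.
Qed.

Lemma is_spartP c s : reflect [/\ is_part c, is_part s &
  forall k, (nth 0 s k <= nth 0 c k <= (nth 0 s k).+1) && (nth 0 c k.+1 <= nth 0 s k)]%N
  (is_spart (c, s)).
Proof.
apply: (iffP and4P) => /= [[pc ps /and3P[cont _ hu] /and3P[_ _ vu]]|[pc ps h]].
  split=> // k; rewrite (containedP _ _ cont) (rows_uniqP _ _ vu) /=.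
  rewrite leqNgt; apply/negP=> lt.
  have inj := uniq_map_in (skew_uniq _ _) hu.
  have c1 := part_nth_anti pc (leqnSn k); have s1 := part_nth_anti ps (leqnSn k).
  (* A circled row longer than the row above it in Lambda^star would put two cells of the horizontal
     strip into one column. *)
  have [] // : (k.+1, (nth 0%N s k).+1) = (k.+2, (nth 0%N s k).+1).
    by apply: inj; rewrite // mem_skew /= /part /=; lia.
  by move=> /eqP; rewrite -[X in X == _]addn0 -[X in _ == X]addn1 eqn_add2l.
have cont : contained s c by apply/containedP => k; have /andP[/andP[]] := h k.
have sums : sumn c == (sumn s + (sumn c - sumn s))%N.
  by rewrite subnKC //; apply: leq_sumn => k; have /andP[/andP[]] := h k.
split=> //; apply/and3P; split=> //; last first.
  by apply/rows_uniqP => k; have /andP[/andP[]] := h k.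
apply: uniq_map_inE; rewrite ?skew_uniq // => -[i j] [i' j'].
rewrite !mem_skew /= => /and3P[i0 l1 u1] /and3P[i0' l2 u2] e; move: l2 u2; rewrite -e => l2 u2.
congr (_, _); case: (ltngtP i i') => // lt.
  have /andP[_ q] := h i.-1; have := part_nth_anti pc (_ : (i.-1.+1 <= i'.-1)%N).
  by rewrite /part in l1 u1 l2 u2; lia.
have /andP[_ q] := h i'.-1; have := part_nth_anti pc (_ : (i'.-1.+1 <= i.-1)%N).
by rewrite /part in l1 u1 l2 u2; lia.
Qed.

Definition rows (La : spart) : rowstate := fun k =>
  (nth 0%N (star La) k, nth 0%N (star La) k != nth 0%N (circ La) k).

Lemma spart_nth La k : ((nth 0 (star La) k <= nth 0 (circ La) k <= (nth 0 (star La) k).+1) &&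
  (nth 0 (circ La) k.+1 <= nth 0 (star La) k))%N.
Proof.
by case: La => -[c s] /= i; have := i => /is_spartP[_ _]; apply.
Qed.

Lemma star_part La : is_part (star La).
Proof. by case: La => -[c s] /= i; have := i => /is_spartP[]. Qed.
Lemma circ_part La : is_part (circ La).
Proof. by case: La => -[c s] /= i; have := i => /is_spartP[]. Qed.

Lemma rows_circ La k : ((rows La k).1 + (rows La k).2)%N = nth 0%N (circ La) k.
Proof. by rewrite /=; have /andP[] := spart_nth La k; case: eqP => /=; lia. Qed.

Lemma rows_stacked La : stacked (rows La).
Proof.
move=> k; rewrite /row_rel /=.
have /andP[p1 q1] := spart_nth La k; have /andP[p2 q2] := spart_nth La k.+1.
by case: eqP => /=; lia.
Qed.

Lemma size_star_circ La : (size (star La) <= size (circ La))%N.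
Proof.
rewrite leqNgt; apply/negP=> lt; have /andP[_ n0] := star_part La.
have := spart_nth La (size (circ La)); rewrite [X in (_ <= X)%N](nth_default _ (leqnn _)).
rewrite leqn0 => /andP[/andP[/eqP e _] _].
by rewrite -e mem_nth in n0.
Qed.

Lemma rows_vanish La : vanishes_from (size (circ La)) (rows La).
Proof.
move=> k le; rewrite /rows !nth_default ?(leq_trans (size_star_circ La)) //.
Qed.

Lemma part_eq la mu : is_part la -> is_part mu -> nth 0%N la =1 nth 0%N mu -> la = mu.
Proof.
move=> /andP[_ l0] /andP[_ m0] e; have sz : size la = size mu.
  case: (ltngtP (size la) (size mu)) => // lt.
    by have := e (size la); rewrite [LHS]nth_default // => e'; rewrite e' mem_nth in m0.
  by have := e (size mu); rewrite [RHS]nth_default // => e'; rewrite -e' mem_nth in l0.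
by apply: (eq_from_nth (x0 := 0%N)) => // i _; apply: e.
Qed.

Lemma rows_inj : injective rows.
Proof.
move=> La Om e; have es k : nth 0%N (star La) k = nth 0%N (star Om) k.
  by have := congr1 (fun f => (f k).1) e.
have ec k : nth 0%N (circ La) k = nth 0%N (circ Om) k by rewrite -!rows_circ e.
apply: val_inj; rewrite [LHS]surjective_pairing [RHS]surjective_pairing.
by congr (_, _); apply: part_eq; rewrite ?star_part ?circ_part.
Qed.

Definition trim (f : nat -> nat) N : seq nat := [seq x <- mkseq f N | (0 < x)%N].

Lemma nth_trim f N k : (forall i, (f i.+1 <= f i)%N) -> (forall i, (N <= i)%N -> f i = 0%N) ->
  nth 0%N (trim f N) k = f k.
Proof.
move=> dec van; have zero i j : (i <= j)%N -> f i = 0%N -> f j = 0%N.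
  move=> + fi; elim: j => [|j IH]; first by rewrite leqn0 => /eqP e; move: fi; rewrite e.
  rewrite leq_eqVlt => /predU1P[<-//|/IH fj]; apply/eqP; rewrite -leqn0 -fj; exact: dec.
suff main n a k' : N = (a + n)%N ->
    nth 0%N [seq x <- [seq f i | i <- iota a n] | (0 < x)%N] k' = f (a + k')%N.
  exact: main.
elim: n a k' => [|n IH] a k' eN /=; first by rewrite nth_nil van // eN addn0 leq_addr.
case: posnP => [fa|fa]; last first.
  by case: k' => [|k'] /=; rewrite ?addn0 // IH ?addSnnS.
rewrite (zero a) ?leq_addr //.
have -> : [seq x <- [seq f i | i <- iota a.+1 n] | (0 < x)%N] = [::].
  apply/eqP; rewrite -[_ == _]negbK -has_filter; apply/hasPn => _ /mapP[i + ->].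
  by rewrite mem_iota => /andP[ai _]; rewrite (zero a) // ltnW.
by rewrite nth_nil.
Qed.

Lemma trim_part f N : (forall i, (f i.+1 <= f i)%N) -> is_part (trim f N).
Proof.
move=> dec; rewrite /is_part mem_filter ltnn /= andbT.
apply: sorted_filter; first exact: geq_trans.
by apply/(sortedP 0%N) => i; rewrite size_mkseq => lt; rewrite !nth_mkseq ?(ltnW lt) //=; apply: dec.
Qed.

Lemma rows_surj s N : stacked s -> vanishes_from N s -> exists La, rows La = s.
Proof.
move=> st van.
pose fs k := (s k).1; pose fc k := ((s k).1 + (s k).2)%N.
have rel k := st k.
have ds i : (fs i.+1 <= fs i)%N by have := rel i; rewrite /row_rel /fs; lia.
have dc i : (fc i.+1 <= fs i)%N.
  by have := rel i; rewrite /row_rel /fc /fs; case: (s i.+1) => a [] /=; lia.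
have dc' i : (fc i.+1 <= fc i)%N by rewrite (leq_trans (dc i)) // leq_addr.
have vs i : (N <= i)%N -> fs i = 0%N by move=> /van; rewrite /fs => ->.
have vc i : (N <= i)%N -> fc i = 0%N by move=> /van; rewrite /fc => ->.
have sp : is_spart (trim fc N, trim fs N).
  apply/is_spartP; split; rewrite ?trim_part // => k.
  by rewrite !nth_trim // dc andbT /fc /fs; case: (s k).2; lia.
exists (SPart sp); apply/funext => k; rewrite /rows /star /circ /= !nth_trim // /fs /fc.
by case: (s k) => a [] /=; congr (_, _); lia.
Qed.

Lemma degE La N : (size (circ La) <= N)%N -> deg La = (\sum_(k < N) (rows La k).1)%N.
Proof. by move=> le; rewrite /deg (@sumn_nth _ N) // (leq_trans (size_star_circ La)). Qed.

Lemma tdegE La N : (size (circ La) <= N)%N ->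
  (deg La + fdeg La)%N = (\sum_(k < N) ((rows La k).1 + (rows La k).2))%N.
Proof.
move=> le; rewrite /deg /fdeg subnKC; last first.
  by apply: leq_sumn => k; have /andP[/andP[]] := spart_nth La k.
by rewrite (@sumn_nth _ N) //; apply: eq_bigr => k _; rewrite rows_circ.
Qed.

Lemma fdegE La N : (size (circ La) <= N)%N -> fdeg La = (\sum_(k < N) (rows La k).2)%N.
Proof.
move=> le; apply/(@addnI (deg La)); rewrite (tdegE le) (degE le) -big_split //.
Qed.

Lemma size_circ_le La : (size (circ La) <= deg La + fdeg La)%N.
Proof.
rewrite (tdegE (leqnn _)) -[X in (X <= _)%N]card_ord -sum1_card leq_sum // => k _.
rewrite rows_circ lt0n; have /andP[_] := circ_part La.
by apply: contraNneq => <-; rewrite mem_nth.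
Qed.

(** * Endomorphisms of the space of superpartitions *)

Section Endomorphisms.
Variable K : fieldType.

(** Operators act on all functions, finitely supported or not, and so form an algebra without side
    conditions. The price is that a linear map need not be determined by its matrix; [local_endo]
    repairs this. *)
Record endo := Endo { efun :> (spart -> K) -> spart -> K;
  _ : forall a f g, efun (fun L => a * f L + g L) = (fun L => a * efun f L + efun g L) }.

Lemma endoL (A : endo) a f g L :
  A (fun L => a * f L + g L) L = a * A f L + A g L.
Proof. by case: A => A /= ->. Qed.

Lemma endoP (A B : endo) : (forall f L, A f L = B f L) -> A = B.
Proof.
case: A B => [A a] [B b] /= AB; have eAB : A = B.
  by apply/funext=> f; apply/funext=> L; apply: AB.
by case: B / eAB b {AB} => b; congr Endo; apply: Prop_irrelevance.
Qed.

Lemma endo0 (A : endo) L : A (fun=> 0) L = 0.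
Proof.
have e : (fun L : spart => 1 * 0 + 0) = (fun=> 0 : K) by apply/funext=> x; rewrite mul1r addr0.
have := endoL A 1 (fun=> 0) (fun=> 0) L; rewrite e mul1r.
by move=> /eqP; rewrite -subr_eq0 opprD addrA subrr sub0r oppr_eq0 => /eqP.
Qed.

Lemma endoD (A : endo) f g L : A (fun L => f L + g L) L = A f L + A g L.
Proof.
by rewrite -[A f L]mul1r -endoL; congr (A _ L); apply/funext=> x; rewrite mul1r.
Qed.

Lemma endoZ (A : endo) a f L : A (fun L => a * f L) L = a * A f L.
Proof.
rewrite -[RHS]addr0 -(endo0 A L) -endoL; congr (A _ L).
by apply/funext=> x; rewrite addr0.
Qed.

Lemma endo_sum (A : endo) (I : Type) (s : seq I) (c : I -> K) (f : I -> spart -> K) L :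
  A (fun L => \sum_(i <- s) c i * f i L) L = \sum_(i <- s) c i * A (f i) L.
Proof.
elim: s => [|i s IH].
  by rewrite big_nil -[RHS](endo0 A L); congr (A _ L); apply/funext=> x; rewrite big_nil.
rewrite big_cons -IH -endoL; congr (A _ L).
by apply/funext=> x; rewrite big_cons.
Qed.

Fact endo_zero_sub a (f g : spart -> K) : (fun L : spart => 0) = (fun L => a * 0 + 0) :> (spart -> K).
Proof. by apply/funext=> L; rewrite mulr0 addr0. Qed.
Definition endo_zero := Endo endo_zero_sub.

Fact endo_opp_sub (A : endo) a f g :
  (fun L => - A (fun L => a * f L + g L) L) = (fun L => a * - A f L + - A g L).
Proof. by apply/funext=> L; rewrite endoL opprD mulrN. Qed.
Definition endo_opp A := Endo (endo_opp_sub A).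

Fact endo_add_sub (A B : endo) a f g :
  (fun L => A (fun L => a * f L + g L) L + B (fun L => a * f L + g L) L) =
  (fun L => a * (A f L + B f L) + (A g L + B g L)).
Proof. by apply/funext=> L; rewrite !endoL mulrDr addrACA. Qed.
Definition endo_add A B := Endo (endo_add_sub A B).

Fact endo_one_sub a (f g : spart -> K) :
  (fun L => a * f L + g L) = (fun L => a * f L + g L).
Proof. by []. Qed.
Definition endo_one := Endo endo_one_sub.

Fact endo_mul_sub (A B : endo) a f g :
  A (B (fun L => a * f L + g L)) = (fun L => a * A (B f) L + A (B g) L).
Proof.
apply/funext=> L; rewrite -endoL; congr (A _ L).
by apply/funext=> M; rewrite endoL.
Qed.
Definition endo_mul A B := Endo (endo_mul_sub A B).

Fact endo_scale_sub b (A : endo) a f g :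
  (fun L => b * A (fun L => a * f L + g L) L) = (fun L => a * (b * A f L) + b * A g L).
Proof. by apply/funext=> L; rewrite endoL mulrDr mulrCA. Qed.
Definition endo_scale b A := Endo (endo_scale_sub b A).

HB.instance Definition _ := gen_eqMixin endo.
HB.instance Definition _ := gen_choiceMixin endo.

Fact endo_addA : associative endo_add.
Proof. by move=> A B C; apply: endoP => f L /=; rewrite addrA. Qed.
Fact endo_addC : commutative endo_add.
Proof. by move=> A B; apply: endoP => f L /=; rewrite addrC. Qed.
Fact endo_add0 : left_id endo_zero endo_add.
Proof. by move=> A; apply: endoP => f L /=; rewrite add0r. Qed.
Fact endo_addN : left_inverse endo_zero endo_opp endo_add.
Proof. by move=> A; apply: endoP => f L /=; rewrite addNr. Qed.

HB.instance Definition _ := GRing.isZmodule.Build endo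
  endo_addA endo_addC endo_add0 endo_addN.

Fact endo_mulA : associative endo_mul.
Proof. by move=> A B C; apply: endoP. Qed.
Fact endo_mul1l : left_id endo_one endo_mul.
Proof. by move=> A; apply: endoP. Qed.
Fact endo_mul1r : right_id endo_one endo_mul.
Proof. by move=> A; apply: endoP. Qed.
Fact endo_mulDl : left_distributive endo_mul +%R.
Proof. by move=> A B C; apply: endoP. Qed.
Fact endo_mulDr : right_distributive endo_mul +%R.
Proof. by move=> A B C; apply: endoP => f L /=; rewrite endoD. Qed.

Definition zero_rows : rowstate := fun=> (0%N, false).

Lemma empty_spart : exists La, rows La = zero_rows.
Proof. by apply: (@rows_surj _ 0). Qed.

Fact endo_one_neq0 : endo_one != 0.
Proof.
have [La _] := empty_spart; apply/eqP=> /(congr1 (fun A : endo => A (fun=> 1) La)) /= e.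
by have := oner_neq0 K; rewrite [X in X != _]e eqxx.
Qed.

HB.instance Definition _ := GRing.Zmodule_isNzRing.Build endo
  endo_mulA endo_mul1l endo_mul1r endo_mulDl endo_mulDr endo_one_neq0.

Fact endo_scaleA a b A : endo_scale a (endo_scale b A) = endo_scale (a * b) A.
Proof. by apply: endoP => f L /=; rewrite mulrA. Qed.
Fact endo_scale1 : left_id 1 endo_scale.
Proof. by move=> A; apply: endoP => f L /=; rewrite mul1r. Qed.
Fact endo_scaleDr : right_distributive endo_scale +%R.
Proof. by move=> a A B; apply: endoP => f L /=; rewrite mulrDr. Qed.
Fact endo_scaleDl A : {morph endo_scale^~ A : a b / a + b}.
Proof. by move=> a b; apply: endoP => f L /=; rewrite mulrDl. Qed.

HB.instance Definition _ := GRing.Zmodule_isLmodule.Build K endo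
  endo_scaleA endo_scale1 endo_scaleDr endo_scaleDl.

Fact endo_scaleAl (k : K) (A B : endo) : k *: (A * B) = (k *: A) * B.
Proof. by apply: endoP. Qed.
HB.instance Definition _ := GRing.Lmodule_isLalgebra.Build K endo endo_scaleAl.

Fact endo_scaleAr (k : K) (A B : endo) : k *: (A * B) = A * (k *: B).
Proof. by apply: endoP => f L /=; rewrite endoZ. Qed.
HB.instance Definition _ := GRing.Lalgebra_isAlgebra.Build K endo endo_scaleAr.

End Endomorphisms.

Lemma endo_addE (K : fieldType) (A B : endo K) f L : (A + B) f L = A f L + B f L.
Proof. by []. Qed.

(** * Lifting row operators to operators on superpartitions *)

Definition of_rows (s : rowstate) : option spart :=
  if pselect (exists La, rows La = s) is left h then Some (projT1 (cid h)) else None.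

Lemma of_rowsK La : of_rows (rows La) = Some La.
Proof.
rewrite /of_rows; case: pselect => [h|[]]; last by exists La.
by congr Some; apply: rows_inj; case: (cid h).
Qed.

Lemma of_rowsP s La : of_rows s = Some La <-> rows La = s.
Proof.
split=> [|<-]; last exact: of_rowsK.
by rewrite /of_rows; case: pselect => // h [<-]; case: (cid h).
Qed.

Lemma of_rows_stacked s N : stacked s -> vanishes_from N s -> exists La, of_rows s = Some La.
Proof. by move=> st van; have [La e] := rows_surj st van; exists La; apply/of_rowsP. Qed.

Lemma size_circ_vanish La N : vanishes_from N (rows La) -> (size (circ La) <= N)%N.
Proof.
move=> van; rewrite leqNgt; apply/negP=> lt; have /andP[_] := circ_part La.
have := rows_circ La N; rewrite van //= => e.
by rewrite [X in X \notin _]e mem_nth.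
Qed.

Lemma vanishes_le N M s : (N <= M)%N -> vanishes_from N s -> vanishes_from M s.
Proof. by move=> NM van k Mk; apply: van; apply: leq_trans NM Mk. Qed.

Section Lift.
Variables (K : fieldType) (al : K).
Hypothesis al_gen : forall a b : int, al * a%:~R + b%:~R = 0 -> a = 0 /\ b = 0.
Implicit Types (s : rowstate) (g : rowstate -> K) (f : spart -> K).

(** Extension by zero to the states that are no superpartitions, where row operators may look for
    values. *)
Definition ext f s : K := oapp f 0 (of_rows s).

Lemma ext_rows f La : ext f (rows La) = f La. Proof. by rewrite /ext of_rowsK. Qed.

Definition stack_supp g := forall s, g s != 0 -> stacked s.

Lemma ext_supp f : stack_supp (ext f).
Proof.
move=> s; rewrite /ext; case e: (of_rows s) => [La|] /=; last by rewrite eqxx.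
by move=> _; have /of_rowsP <- := e; apply: rows_stacked.
Qed.

(** Together with [size_stable] this lets a family of row operators descend to superpartitions: no
    value may leak onto states that are not stacked, and the number of rows may not matter once the
    last one is empty. Only then is a product of lifts the lift of the product ([lift_mul]). *)
Definition supp_stable (o : nat -> (rowstate -> K) -> rowstate -> K) := forall N g s,
  vanishes_from N s -> stack_supp g -> o N g s != 0 -> stacked s.
Definition size_stable (o : nat -> (rowstate -> K) -> rowstate -> K) := forall N g s,
  (0 < N)%N -> stack_supp g -> stacked s -> vanishes_from N.-1 s -> o N.+1 g s = o N g s.

Section One.
Variables (Q : pred (nat * bool)) (fv : nat * bool -> nat * bool) (c : nat -> rowstate -> nat -> K).
Local Notation o := (fun N => row_op N Q fv (c N)).
Hypothesis supp : supp_stable o.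
Hypothesis stab : size_stable o.

Fact lift_sub a f f' :
  (fun La => o (size (circ La)).+1 (ext (fun L => a * f L + f' L)) (rows La)) =
  (fun La => a * o (size (circ La)).+1 (ext f) (rows La) + o (size (circ La)).+1 (ext f') (rows La)).
Proof.
apply/funext=> La; rewrite /row_op mulr_sumr -big_split /=; apply: eq_bigr => k _.
rewrite /ext; case: (of_rows _) => [L|] /=; ring.
Qed.
Definition lift_op : endo K := Endo lift_sub.

Lemma lift_at N f La : (size (circ La) < N)%N -> lift_op f La = o N (ext f) (rows La).
Proof.
rewrite /lift_op /=; elim: N => // N IH; rewrite ltnS leq_eqVlt => /predU1P[<-//|lt].
rewrite IH // -stab //; first exact: leq_ltn_trans lt.
- exact: ext_supp.
- exact: rows_stacked.
by apply: vanishes_le (@rows_vanish La); rewrite -ltnS (ltn_predK lt).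
Qed.

Lemma ext_lift N f s : (0 < N)%N -> vanishes_from N s ->
  (stacked s -> vanishes_from N.-1 s) -> ext (lift_op f) s = o N (ext f) s.
Proof.
move=> N0 van vanp; rewrite {1}/ext; case e: (of_rows s) => [La|] /=.
  have /of_rowsP es := e; rewrite -[LHS]/(lift_op f La) (@lift_at N) ?es //.
  rewrite -(prednK N0) ltnS; apply: size_circ_vanish.
  by rewrite es; apply: vanp; rewrite -es; apply: rows_stacked.
apply/esym/eqP; apply: contraT => nz.
have st := supp van (@ext_supp f) nz.
by have [La] := of_rows_stacked st van; rewrite e.
Qed.

End One.

(** A nonempty row [N] below the empty row [N - 1] is not stacked. After one move a stacked state
    thus still leaves an empty row for the second operator; hence the three rows more than the
    diagram has in [lift_mul]. *)
Lemma upd_stacked_vanish La k v N : (size (circ La)).+2 = N -> (k <= N)%N ->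
  vanishes_from N.+1 (upd (rows La) k v) /\
  (stacked (upd (rows La) k v) -> vanishes_from N (upd (rows La) k v)).
Proof.
move=> eN kN; have vanLa := @rows_vanish La.
have van i : (N < i)%N -> upd (rows La) k v i = (0%N, false).
  by move=> Ni; rewrite upd_other ?vanLa //; [lia | apply/eqP; lia].
split=> // st i; rewrite leq_eqVlt => /predU1P[<-|]; last exact: van.
case: (eqVneq k N) => [kN'|]; last first.
  by move=> nk; rewrite upd_other ?vanLa // 1?eq_sym //; lia.
apply: row_rel_zero; have := st (size (circ La)).+1; rewrite -eN.
by rewrite (upd_other _ _ (_ : (size (circ La)).+1 != k)) ?vanLa // kN' -eN ltn_eqF.
Qed.

Lemma lift_mul Q1 (v1 : nat * bool -> nat * bool) c1 Q2 (v2 : nat * bool -> nat * bool) c2 f La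
  (supp1 : supp_stable (fun N => row_op N Q1 v1 (c1 N)))
  (stab1 : size_stable (fun N => row_op N Q1 v1 (c1 N)))
  (supp2 : supp_stable (fun N => row_op N Q2 v2 (c2 N)))
  (stab2 : size_stable (fun N => row_op N Q2 v2 (c2 N)))  :
  (lift_op Q1 v1 c1 * lift_op Q2 v2 c2) f La =
  row_op (size (circ La)).+3 Q1 v1 (c1 (size (circ La)).+3)
   (row_op (size (circ La)).+3 Q2 v2 (c2 (size (circ La)).+3) (ext f)) (rows La).
Proof.
rewrite [LHS](lift_at stab1 (N := (size (circ La)).+3)); last by rewrite ltnS !leqW.
apply: eq_bigr => k Qk; congr (_ * _).
have [van vanp] := @upd_stacked_vanish La k (v1 (rows La k)) _ erefl (leq_ord k).
exact: (ext_lift supp2 stab2).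
Qed.

Section Stability.
Implicit Types (h : K -> K).

Lemma row_op_suppP N (Q : pred (nat * bool)) fv (c : rowstate -> nat -> K) g s : stack_supp g ->
  (forall k, (k < N)%N -> Q (s k) -> c s k != 0 -> stacked (upd s k (fv (s k))) -> stacked s) ->
  row_op N Q fv c g s != 0 -> stacked s.
Proof.
move=> supp H; case: (pselect (stacked s)) => // nst.
rewrite /row_op big1 ?eqxx // => k Qk.
have [-> |ck] := eqVneq (c s k) 0; first by rewrite mulr0 mul0r.
have [-> |gk] := eqVneq (g (upd s k (fv (s k)))) 0; first by rewrite mulr0.
by case: nst; apply: (H k) => //; apply: supp.
Qed.

Lemma add_supp h : supp_stable (fun N => add_op al N h).
Proof.
move=> N g s van sg; apply: row_op_suppP => // k kN ek; rewrite mulf_eq0 negb_or => /andP[c0 _] st.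
exact: add_coef_stacked c0.
Qed.

Lemma bump_supp : supp_stable (bump_op al).
Proof.
move=> N g s van sg; apply: row_op_suppP => // k kN /andP[ek lk] _ st.
exact: bump_stacked st.
Qed.

Lemma add_adj_supp h : supp_stable (fun N => add_adj_op al N h).
Proof.
move=> N g s van sg; apply: row_op_suppP => // k kN ek _ st.
exact: add_adj_stacked st.
Qed.

Lemma bump_adj_supp : supp_stable (bump_adj_op al).
Proof.
move=> N g s van sg; apply: row_op_suppP => // k kN ek c0 st.
exact: bump_adj_stacked c0.
Qed.

Lemma row_op_stabP N (Q : pred (nat * bool)) fv (c : nat -> rowstate -> nat -> K) g s :
  (Q (s N) -> g (upd s N (fv (s N))) = 0) ->
  (forall k, (k < N)%N -> Q (s k) -> c N.+1 s k = c N s k) ->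
  row_op N.+1 Q fv (c N.+1) g s = row_op N Q fv (c N) g s.
Proof.
move=> gN cN; rewrite /row_op big_mkcond big_ord_recr /= [RHS]big_mkcond /=.
rewrite [X in _ + X](_ : _ = 0) ?addr0; last by case: ifP => // /gN->; rewrite mulr0.
by apply: eq_bigr => k _; case: ifP => // Qk; rewrite cN.
Qed.

Lemma add_stab h : size_stable (fun N => add_op al N h).
Proof.
move=> N g s N0 sg st van; apply: (row_op_stabP (c := fun _ s k => _)) => //.
by rewrite van ?leq_pred.
Qed.

Lemma bump_stab : size_stable (bump_op al).
Proof.
move=> N g s N0 sg st van; apply: (row_op_stabP (c := fun _ s k => _)) => //.
by rewrite van ?leq_pred.
Qed.

Lemma us_N s N : s N = (0%N, false) -> ustar al s N = - N%:R.
Proof. by rewrite /ustar => ->; rewrite mulr0 sub0r. Qed.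
Lemma uc_N s N : s N = (0%N, false) -> ucirc al s N = - N%:R.
Proof. by rewrite /ucirc => ->; rewrite mulr0 sub0r. Qed.

Lemma prod_gt_recr N k (F : nat -> K) : (k < N)%N ->
  \prod_(j < N.+1 | (k < j)%N) F j = (\prod_(j < N | (k < j)%N) F j) * F N.
Proof. by move=> kN; rewrite big_mkcond big_ord_recr /= kN -big_mkcond. Qed.

Lemma add_adj_stab h : size_stable (fun N => add_adj_op al N h).
Proof.
move=> N g s N0 sg st van.
apply: (row_op_stabP (c := fun N s k => add_adj al N s k * h (ustar al s k))) => [_|k kN _].
  (* The summand of the extra row [N] looks at a state with a circle there, below the empty row
     [N - 1]. *)
  apply/eqP/negPn/negP => /sg/(_ N.-1).
  rewrite prednK // upd_same upd_other ?ltn_eqF ?prednK //.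
  by rewrite /row_rel /= !van ?leq_pred.
congr (_ * _); rewrite /add_adj (@prod_gt_recr N k (fun j => 1 + (ustar al s k - ustar al s j)^-1)) // (us_N (van _ (leq_pred N))).
have n0 := us_N_neq0 al_gen s kN; have n1 := us_N_neq0 al_gen s (ltnW kN : (k < N.+1)%N).
rewrite -natr1 addrA in n1 *; rewrite opprK.
by move: (\prod_(_ < _ | _) _) => P; field; rewrite n0 n1.
Qed.

Lemma bump_adj_stab : size_stable (bump_adj_op al).
Proof.
move=> N g s N0 sg st van.
apply: (row_op_stabP (c := bump_adj al)) => [|k kN ek]; first by rewrite van ?leq_pred.
rewrite /bump_adj (@prod_gt_recr N k (fun j => 1 - (ucirc al s k - ucirc al s j)^-1)) // (uc_N (van _ (leq_pred N))) opprK -natr1.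
have n0 : ucirc al s k + N%:R != 0.
  rewrite -[N%:R]opprK subr_eq0; apply/eqP=> e.
  have [_ kN'] : ((s k).1 + (s k).2)%N = 0%N /\ k = N.
    by apply: (al_gen_nat al_gen); rewrite mulr0 sub0r.
  by rewrite kN' ltnn in kN.
by move: (\prod_(_ < _ | _) _) => P; field; rewrite n0.
Qed.

End Stability.

Definition add_endo h := lift_op (fun v => v.2) (fun v => (v.1, false))
  (fun=> fun s k => add_coef al s k * h (ustar al s k)).
Definition bump_endo := lift_op (fun v => ~~ v.2 && (0 < v.1)%N)
  (fun v => (v.1.-1, true)) (fun=> bump_coef al).
Definition add_adj_endo h := lift_op (fun v => ~~ v.2) (fun v => (v.1, true))
  (fun N s k => add_adj al N s k * h (ustar al s k)).
Definition bump_adj_endo := lift_op (fun v => v.2) (fun v => (v.1.+1, false)) (bump_adj al).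

Fact diag_sub (w : spart -> K) a f f' :
  (fun L => w L * (a * f L + f' L)) = (fun L => a * (w L * f L) + w L * f' L).
Proof. by apply/funext=> L; ring. Qed.
Definition diag_endo w : endo K := Endo (diag_sub w).

Lemma add_endo_anti h h' : add_endo h * add_endo h' + add_endo h' * add_endo h = 0.
Proof.
apply: endoP => f La; rewrite endo_addE.
rewrite (lift_mul _ _ (@add_supp h) (@add_stab h) (@add_supp h') (@add_stab h')).
rewrite (lift_mul _ _ (@add_supp h') (@add_stab h') (@add_supp h) (@add_stab h)).
exact: add_op_anti.
Qed.

Lemma bump_endo_sqr : bump_endo * bump_endo = 0.
Proof.
have : bump_endo * bump_endo + bump_endo * bump_endo = 0.
  apply: endoP => f La; rewrite endo_addE.
  rewrite (lift_mul _ _ (@bump_supp) (@bump_stab) (@bump_supp) (@bump_stab)).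
  exact: bump_op_anti.
move=> e2; apply: endoP => f La; rewrite -[LHS]mul1r -(@mulVf _ 2%:R) ?(natr_gen_eq0 al_gen) //.
rewrite -mulrA mulr_natl mulr2n -[X in _ * X]/((bump_endo * bump_endo + bump_endo * bump_endo) f La).
by rewrite e2 mulr0.
Qed.

Lemma add_adj_bump_endo h : add_adj_endo h * bump_endo + bump_endo * add_adj_endo h = 0.
Proof.
apply: endoP => f La; rewrite endo_addE.
rewrite (lift_mul _ _ (@add_adj_supp h) (@add_adj_stab h) (@bump_supp) (@bump_stab)).
rewrite (lift_mul _ _ (@bump_supp) (@bump_stab) (@add_adj_supp h) (@add_adj_stab h)).
exact: add_adj_bump.
Qed.

Lemma bump_adj_add_endo h : bump_adj_endo * add_endo h + add_endo h * bump_adj_endo = 0.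
Proof.
apply: endoP => f La; rewrite endo_addE.
rewrite (lift_mul _ _ (@bump_adj_supp) (@bump_adj_stab) (@add_supp h) (@add_stab h)).
rewrite (lift_mul _ _ (@add_supp h) (@add_stab h) (@bump_adj_supp) (@bump_adj_stab)).
exact: bump_adj_add.
Qed.

Lemma bump_adj_bump_endo : bump_adj_endo * bump_endo + bump_endo * bump_adj_endo =
  al *: diag_endo (fun L => (deg L + fdeg L)%:R).
Proof.
apply: endoP => f La; rewrite endo_addE.
rewrite (lift_mul _ _ (@bump_adj_supp) (@bump_adj_stab) (@bump_supp) (@bump_stab)).
rewrite (lift_mul _ _ (@bump_supp) (@bump_stab) (@bump_adj_supp) (@bump_adj_stab)).
rewrite [LHS]bump_adj_bump ext_rows sum_bump //; last by rewrite rows_vanish //= leqW.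
  rewrite -tdegE; last by do 3!apply: leqW.
  by rewrite mulrC -mulrA; congr (_ * _); rewrite mulrC.
exact: rows_stacked.
Qed.

Lemma add_adj_add_endo h h' f La :
  (add_adj_endo h * add_endo h' + add_endo h' * add_adj_endo h) f La =
  f La * \sum_(k < (size (circ La)).+3) add_coef al (rows La) k *
    add_adj al (size (circ La)).+3 (rows La) k * h (ustar al (rows La) k) * h' (ustar al (rows La) k).
Proof.
rewrite endo_addE.
rewrite (lift_mul _ _ (@add_adj_supp h) (@add_adj_stab h) (@add_supp h') (@add_stab h')).
rewrite (lift_mul _ _ (@add_supp h') (@add_stab h') (@add_adj_supp h) (@add_adj_stab h)).
by rewrite [LHS]add_adj_add ext_rows.
Qed.

Section AddPairs.
Variable La : spart.
Local Notation N := (size (circ La)).+3.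

Fact last_row_empty : rows La N.-1 = (0%N, false).
Proof. by rewrite /= rows_vanish // leqW. Qed.

End AddPairs.

Lemma add_adj_add_one :
  add_adj_endo (fun=> 1) * add_endo (fun=> 1) + add_endo (fun=> 1) * add_adj_endo (fun=> 1) = 1.
Proof.
apply: endoP => f La; rewrite add_adj_add_endo -[RHS]mulr1; congr (_ * _).
apply: etrans (sum_add1 al_gen _ (last_row_empty La)) => //.
by apply: eq_bigr => k _; rewrite !mulr1.
Qed.

Lemma add_adj_add_id1 :
  add_adj_endo id * add_endo (fun=> 1) + add_endo (fun=> 1) * add_adj_endo id = 0.
Proof.
apply: endoP => f La; rewrite add_adj_add_endo -[RHS](mulr0 (f La)); congr (_ * _).
apply: etrans (sum_add2 al_gen _ (last_row_empty La)) => //.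
by apply: eq_bigr => k _; rewrite !mulr1.
Qed.

Lemma add_adj_add_1id :
  add_adj_endo (fun=> 1) * add_endo id + add_endo id * add_adj_endo (fun=> 1) = 0.
Proof.
apply: endoP => f La; rewrite add_adj_add_endo -[RHS](mulr0 (f La)); congr (_ * _).
apply: etrans (sum_add2 al_gen _ (last_row_empty La)) => //.
by apply: eq_bigr => k _; rewrite !mulr1.
Qed.

Lemma add_adj_add_idid :
  add_adj_endo id * add_endo id + add_endo id * add_adj_endo id = al *: diag_endo (fun L => (deg L)%:R).
Proof.
apply: endoP => f La; rewrite add_adj_add_endo.
transitivity (f La * (al * (deg La)%:R)); last by rewrite /= mulrCA [f La * _]mulrC.
congr (_ * _); rewrite (@degE _ (size (circ La)).+3); last by do 3!apply: leqW.
rewrite -(sum_add3 al_gen _ (last_row_empty La)) //.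
by apply: eq_bigr => k _; rewrite !mulrA.
Qed.

Lemma of_rows_upd La k v L : of_rows (upd (rows La) k v) = Some L ->
  [/\ (deg L + (rows La k).1 = deg La + v.1)%N,
      (fdeg L + (rows La k).2 = fdeg La + v.2)%N &
      (deg L + fdeg L + ((rows La k).1 + (rows La k).2) = deg La + fdeg La + (v.1 + v.2))%N].
Proof.
move=> /of_rowsP e; pose N := (maxn k.+1 (maxn (size (circ La)) (size (circ L)))).
have kN : (k < N)%N by rewrite leq_max leqnn.
have LN : (size (circ L) <= N)%N by rewrite !leq_max leqnn !orbT.
have LaN : (size (circ La) <= N)%N by rewrite !leq_max leqnn !orbT.
have eq_upd (F : nat * bool -> nat) :
    ((\sum_(j < N) F (rows L j)) + F (rows La k) = (\sum_(j < N) F (rows La j)) + F v)%N.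
  rewrite (bigD1 (Ordinal kN)) //= [in RHS](bigD1 (Ordinal kN)) //= e upd_same.
  have -> : (\sum_(j < N | j != Ordinal kN) F (upd (rows La) k v j) =
    \sum_(j < N | j != Ordinal kN) F (rows La j))%N.
    by apply: eq_bigr => j jk; rewrite upd_other.
  by rewrite addnAC [RHS]addnAC [(F v + _)%N]addnC.
have e1 := eq_upd fst; have e2 := eq_upd (fun v => nat_of_bool v.2).
rewrite (degE LN) (degE LaN) (fdegE LN) (fdegE LaN) /= in e1 e2 *.
by split=> //; lia.
Qed.

(* The operator shifts the grading [w] by [b - a]; two naturals avoid signs. *)
Lemma lift_grade (Q : pred (nat * bool)) (fv : nat * bool -> nat * bool) c (w : spart -> nat) (a b : nat) :
  (forall La k L, Q (rows La k) -> of_rows (upd (rows La) k (fv (rows La k))) = Some L ->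
     (w La + a = w L + b)%N) ->
  let A := lift_op Q fv c in
  diag_endo (fun L => (w L)%:R) * A + a%:R *: A = A * diag_endo (fun L => (w L)%:R) + b%:R *: A.
Proof.
move=> gr A; apply: endoP => f La; rewrite !endo_addE.
rewrite -[LHS]/((w La)%:R * A f La + a%:R * A f La).
rewrite -[RHS]/(A (fun L => (w L)%:R * f L) La + b%:R * A f La).
rewrite -mulrDl -natrD /A /lift_op /= /row_op !mulr_sumr -big_split /=; apply: eq_bigr => k Qk.
rewrite /ext; case e: (of_rows _) => [L|] /=; last by rewrite !mulr0 addr0.
by rewrite (gr _ _ _ Qk e) natrD; ring.
Qed.

End Lift.

(** * Values on basis vectors, and operators determined by them *)

Section MatrixElements.
Variables (K : fieldType) (al : K).
Hypothesis al_gen : forall a b : int, al * a%:~R + b%:~R = 0 -> a = 0 /\ b = 0.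
Implicit Types (s : rowstate) (A B : endo K) (f : spart -> K).

Definition state_delta s : spart -> K := fun Om => `[< rows Om = s >]%:R.

Lemma state_delta_eq La Om : state_delta (rows La) Om = (Om == La)%:R.
Proof.
rewrite /state_delta; congr (nat_of_bool _)%:R; apply/asboolP/eqP => [|->//].
exact: rows_inj.
Qed.

Lemma state_delta_unstacked s : ~ stacked s -> state_delta s = fun=> 0.
Proof.
move=> ns; apply/funext=> Om; rewrite /state_delta asboolF // => e.
by apply: ns; rewrite -e; apply: rows_stacked.
Qed.

Lemma sum_recr_false N (P : pred nat) (F : nat -> K) : ~~ P N ->
  \sum_(k < N.+1 | P k) F k = \sum_(k < N | P k) F k.
Proof. by move=> /negPf PN; rewrite big_mkcond big_ord_recr /= PN addr0 [RHS]big_mkcond. Qed.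

(** Finiteness of each row of the matrix. It allows a vector of infinite support to be replaced by a
    finite combination of basis vectors. *)
Definition local_endo A := forall Om, exists I : seq spart,
  forall f g, (forall L, L \in I -> f L = g L) -> A f Om = A g Om.

Lemma local_mul A B : local_endo A -> local_endo B -> local_endo (A * B).
Proof.
move=> lA lB Om; have [I hI] := lA Om.
have [J hJ] : exists J : seq spart, forall f g, (forall L, L \in J -> f L = g L) ->
    forall L, L \in I -> B f L = B g L.
  elim: I {hI} => [|L I [J hJ]]; first by exists [::].
  have [I' hI'] := lB L; exists (I' ++ J) => f g e M; rewrite inE => /predU1P[->|MI].
    by apply: hI' => x xI; apply: e; rewrite mem_cat xI.
  by apply: hJ MI => x xJ; apply: e; rewrite mem_cat xJ orbT.
exists J => f g e; exact: (hI (B f) (B g) (hJ f g e)).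
Qed.

Lemma local_add A B : local_endo A -> local_endo B -> local_endo (A + B).
Proof.
move=> lA lB Om; have [I hI] := lA Om; have [J hJ] := lB Om.
exists (I ++ J) => f g e; rewrite !endo_addE (hI _ g) ?(hJ _ g) // => L LI; apply: e.
  by rewrite mem_cat LI orbT.
by rewrite mem_cat LI.
Qed.

Lemma local_scale (c : K) A : local_endo A -> local_endo (c *: A).
Proof.
by move=> lA Om; have [I hI] := lA Om; exists I => f g e; congr (_ * _); apply: hI.
Qed.

Lemma local_opp A : local_endo A -> local_endo (- A).
Proof. by rewrite -scaleN1r; apply: local_scale. Qed.

Lemma local_one : local_endo 1.
Proof. by move=> Om; exists [:: Om] => f g; apply; rewrite mem_head. Qed.

Lemma local_lift (Q : pred (nat * bool)) fv c : local_endo (lift_op Q fv c : endo K).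
Proof.
move=> Om; exists (pmap (fun k => of_rows (upd (rows Om) k (fv (rows Om k)))) (iota 0 (size (circ Om)).+1)).
move=> f g e; apply: eq_bigr => k _; congr (_ * _).
rewrite /ext; case ek: (of_rows _) => [L|] //=; apply: e.
rewrite mem_pmap; apply/mapP; exists (k : nat); first by rewrite mem_iota ltn_ord.
by rewrite ek.
Qed.

Lemma local_eq0 A : local_endo A -> (forall La Om, A (state_delta (rows La)) Om = 0) -> A = 0.
Proof.
move=> lA A0; apply: endoP => f Om; have [I hI] := lA Om.
transitivity (A (fun M => \sum_(L <- undup I) f L * state_delta (rows L) M) Om).
  apply: hI => M MI; rewrite (bigD1_seq M) ?undup_uniq ?mem_undup //= state_delta_eq eqxx mulr1.
  by rewrite big1 ?addr0 // => L LM; rewrite state_delta_eq eq_sym (negPf LM) mulr0.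
by rewrite endo_sum big1 // => L _; rewrite A0 mulr0.
Qed.

Definition inverse_moves (Q Q' : pred (nat * bool)) (f f' : nat * bool -> nat * bool) :=
  (forall v, Q v -> Q' (f v) /\ f' (f v) = v) /\ (forall v, Q' v -> Q (f' v) /\ f (f' v) = v).

(** A move from [s] to [s'] is the inverse of one from [s'] to [s] in the same row. This exchanges
    source and target, both for values on basis vectors and for adjoints. *)
Lemma move_swap (Q Q' : pred (nat * bool)) (f f' : nat * bool -> nat * bool) N s s' (F : nat -> K) : inverse_moves Q Q' f f' ->
  \sum_(k < N | Q (s k)) F k * `[< upd s k (f (s k)) = s' >]%:R =
  \sum_(k < N | Q' (s' k)) F k * `[< upd s' k (f' (s' k)) = s >]%:R.
Proof.
move=> [inv inv']; rewrite big_mkcond [RHS]big_mkcond; apply: eq_bigr => k _ /=.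
have [e|ne] := pselect (Q (s k) /\ upd s k (f (s k)) = s').
  case: e => Qk <-; have [Q'k fk] := inv _ Qk; rewrite Qk upd_same Q'k upd_upd fk upd_id.
  by rewrite !asboolT.
have ne' : ~ (Q' (s' k) /\ upd s' k (f' (s' k)) = s).
  move=> [Q'k es]; apply: ne; have [Qk fk] := inv' _ Q'k.
  by rewrite -es upd_same upd_upd fk upd_id.
transitivity (0 : K).
  by case: ifP => // Qk; rewrite asboolF ?mulr0 // => e; apply: ne.
by case: ifP => // Qk; rewrite asboolF ?mulr0 // => e; apply: ne'.
Qed.

Lemma ext_delta s s' : stacked s \/ stacked s' -> (exists N, vanishes_from N s /\ vanishes_from N s') ->
  ext (state_delta s) s' = `[< s' = s >]%:R.
Proof.
move=> st [N [van van']]; rewrite /ext; case e: (of_rows s') => [L|] /=.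
  by move/of_rowsP: e => <-.
rewrite asboolF // => e'; subst s'; have st' : stacked s by case: st.
by have [L] := of_rows_stacked st' van; rewrite e.
Qed.

Section LiftDelta.
Variables (Q Q' : pred (nat * bool)) (f f' : nat * bool -> nat * bool).
Variable (c : nat -> rowstate -> nat -> K).
Hypothesis inv : inverse_moves Q Q' f f'.
Hypothesis supp : supp_stable (fun N => row_op N Q f (c N)).
Hypothesis stab : size_stable (fun N => row_op N Q f (c N)).

Lemma vanishes_upd N k s v : (k < N)%N -> vanishes_from N s -> vanishes_from N (upd s k v).
Proof.
by move=> kN van j Nj; rewrite upd_other ?van // gtn_eqF // (leq_trans kN Nj).
Qed.

Lemma upd_far La N k v : vanishes_from N (rows La) -> (N < k)%N -> v != (0%N, false) ->
  ~ stacked (upd (rows La) k v).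
Proof.
case: k => // j van; rewrite ltnS => Nj v0 /(_ j).
rewrite upd_same (upd_other _ _ (negbT (ltn_eqF (ltnSn j)))) van //.
by case: v v0 => [[|n] []].
Qed.

(* The value at [Om] of the coefficient, rewritten through [Om]'s preimage [La]. *)
Lemma lift_delta N La : vanishes_from N (rows La) ->
  (forall v, Q' v -> f' v != (0%N, false)) ->
  (forall N, c N = c 0) ->
  lift_op Q f c (state_delta (rows La)) =
  (fun Om => \sum_(k < N.+1 | Q' (rows La k))
     (rsgn K (upd (rows La) k (f' (rows La k))) k * c 0 (upd (rows La) k (f' (rows La k))) k) *
     state_delta (upd (rows La) k (f' (rows La k))) Om).
Proof.
move=> van f0 c0; apply/funext=> Om.
pose M := maxn N.+1 (size (circ Om)).+1.
rewrite (@lift_at _ Q f c stab M) ?leq_maxr // /row_op.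
transitivity (\sum_(k < M | Q (rows Om k)) rsgn K (rows Om) k * c 0 (rows Om) k *
   `[< upd (rows Om) k (f (rows Om k)) = rows La >]%:R).
  apply: eq_bigr => k _; rewrite c0; congr (_ * _); rewrite ext_delta //.
    by left; apply: rows_stacked.
  exists M; split; first by apply: vanishes_le van; rewrite leq_max leqW.
  apply: vanishes_upd (ltn_ord k) _; apply: vanishes_le (@rows_vanish Om).
  by rewrite leq_max leqnSn orbT.
rewrite (move_swap _ _ _ (fun k => rsgn K (rows Om) k * c 0 (rows Om) k) inv).
rewrite (big_ord_widen_cond M (fun k => Q' (rows La k)) (fun k =>
     (rsgn K (upd (rows La) k (f' (rows La k))) k * c 0 (upd (rows La) k (f' (rows La k))) k) *
     state_delta (upd (rows La) k (f' (rows La k))) Om)) ?leq_maxl //.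
rewrite [LHS]big_mkcond [RHS]big_mkcond; apply: eq_bigr => k _ /=; case: ifP => //= Q'k.
case: ifP => kN.
  rewrite /state_delta; have [e|ne] := pselect (rows Om = upd (rows La) k (f' (rows La k))).
    by rewrite -e.
  by rewrite !asboolF ?mulr0 // => e; apply: ne.
rewrite asboolF ?mulr0 // => e; move/negbT: kN; rewrite -leqNgt => kN.
by apply: (upd_far van kN (f0 _ Q'k)); rewrite e; apply: rows_stacked.
Qed.

End LiftDelta.

Lemma add_inverse : inverse_moves (fun v => v.2) (fun v => ~~ v.2)
  (fun v => (v.1, false)) (fun v => (v.1, true)).
Proof. by split; case=> a [] //=. Qed.

Lemma bump_inverse : inverse_moves (fun v => ~~ v.2 && (0 < v.1)%N) (fun v => v.2)
  (fun v => (v.1.-1, true)) (fun v => (v.1.+1, false)).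
Proof. by split; case=> [[|a] []] //=. Qed.

Lemma add_endo_delta h N La : vanishes_from N (rows La) ->
  add_endo al h (state_delta (rows La)) =
  (fun Om => \sum_(k < N.+1 | ~~ (rows La k).2)
     (rsgn K (rows La) k * (add_coef al (rows La) k * h (ustar al (rows La) k))) *
     state_delta (upd (rows La) k ((rows La k).1, true)) Om).
Proof.
move=> van; rewrite [LHS](lift_delta add_inverse (@add_stab _ al h) van) //; last by case=> [[|a] []].
apply/funext=> Om; apply: eq_bigr => k _; congr (_ * _).
by rewrite rsgn_upd_le // /add_coef ustar_upd_id.
Qed.

Lemma bump_endo_delta N La : vanishes_from N (rows La) ->
  bump_endo al (state_delta (rows La)) =
  (fun Om => \sum_(k < N | (rows La k).2)
     (rsgn K (rows La) k * bump_coef al (rows La) k) *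
     state_delta (upd (rows La) k ((rows La k).1.+1, false)) Om).
Proof.
move=> van; rewrite [LHS](lift_delta bump_inverse (@bump_stab _ al) van) //.
apply/funext=> Om.
rewrite (sum_recr_false (P := fun k => (rows La k).2) (fun k =>
  rsgn K (upd (rows La) k ((rows La k).1.+1, false)) k *
  bump_coef al (upd (rows La) k ((rows La k).1.+1, false)) k *
  state_delta (upd (rows La) k ((rows La k).1.+1, false)) Om)); last by rewrite (van N).
apply: eq_bigr => k ek; congr (_ * _).
rewrite rsgn_upd_le // /bump_coef ucirc_upd_id //.
by move: ek; case: (rows La k) => a [] //= _; rewrite addn0 addn1.
Qed.

Lemma lift_at_vanish (Q : pred (nat * bool)) fv c
  (stab : size_stable (fun N => row_op N Q fv (c N : rowstate -> nat -> K))) N g Om :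
  ~~ Q (0%N, false) -> (forall N, c N = c 0) -> vanishes_from N (rows Om) ->
  lift_op Q fv c g Om = row_op N Q fv (c 0) (ext g) (rows Om).
Proof.
move=> Q0 c0 van; rewrite (@lift_at _ Q fv c stab N.+1) ?ltnS ?size_circ_vanish // c0.
rewrite /row_op (sum_recr_false (P := fun k => Q (rows Om k)) (fun k =>
  rsgn K (rows Om) k * c 0 (rows Om) k * ext g (upd (rows Om) k (fv (rows Om k))))) //.
by rewrite van.
Qed.

Lemma add_endo_at h N g Om : vanishes_from N (rows Om) ->
  add_endo al h g Om = add_op al N h (ext g) (rows Om).
Proof. by move=> van; rewrite [LHS](lift_at_vanish (@add_stab _ al h) _ _ _ van). Qed.

Lemma bump_endo_at N g Om : vanishes_from N (rows Om) ->
  bump_endo al g Om = bump_op al N (ext g) (rows Om).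
Proof. by move=> van; rewrite [LHS](lift_at_vanish (@bump_stab _ al) _ _ _ van). Qed.


(** Row [k + 1] grows in Lambda^circledast past the end of row [k], which gains no square. The
    contents [us s k] and [uc s k.+1] then differ by one and the factor of this pair is 1 - 1/1. An
    intermediate target that is not stacked is thus excluded by the formula itself. *)
Lemma strip_prod_unstacked N s s' k : stacked s -> (k.+1 < N)%N -> strip N s s' ->
  ((s' k.+1).1 + (s' k.+1).2 = (s' k).1.+1)%N -> strip_prod al N s s' = 0.
Proof.
move=> st kN /allP str e.
have str1 := str k.+1; rewrite mem_iota /= kN in str1; have {str1}/andP[_ str1] := str1 isT.
have str0 := str k; rewrite mem_iota /= (ltnW kN) in str0; have {str0}/andP[str0 _] := str0 isT.
have es : ((s k).1 = (s k.+1).1 + (s k.+1).2)%N.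
  move: (st k) str1 str0 e; rewrite /row_rel.
  by case: (s k) (s k.+1) (s' k) (s' k.+1) => [a []] [b []] [c []] [d []] /=; lia.
have Y1 : circ_inc s s' k.+1.
  move: (st k) str1 str0 e; rewrite /row_rel /circ_inc.
  by case: (s k) (s k.+1) (s' k) (s' k.+1) => [a []] [b []] [c []] [d []] /=; lia.
have X0 : star_inc s s' k = false.
  move: (st k) str1 str0 e; rewrite /row_rel /star_inc.
  by case: (s k) (s k.+1) (s' k) (s' k.+1) => [a []] [b []] [c []] [d []] /=; lia.
rewrite /strip_prod /pair_prod (bigD1 (Ordinal kN)) //= (bigD1 (Ordinal (ltnSn k))) //=.
rewrite {1}/strip_factor Y1 X0 /= /ustar /ucirc es.
rewrite [X in 1 - X^-1](_ : _ = 1) ?invr1 ?subrr ?mul0r ?mul0r //.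
by rewrite -natr1; ring.
Qed.

End MatrixElements.

(** * The operators of the elementary functions *)

Arguments rows : simpl never.

Section ElementaryOperators.
Variables (K : fieldType) (al : K).
Hypothesis al_gen : forall a b : int, al * a%:~R + b%:~R = 0 -> a = 0 /\ b = 0.
Implicit Types (s : rowstate) (A B : endo K) (f : spart -> K).
Local Notation t := (add_endo al (fun=> 1)).
Local Notation r := (add_endo al id).
Local Notation d := (bump_endo al).

Lemma minor_id m (c : seq (option nat)) : uniq c -> size c = m ->
  minor m (fun i j => (i == j)%:R : K) c c = 1.
Proof.
move=> uc sc; transitivity (\det (1%:M : 'M[K]_m)); last exact: det1.
congr (\det _); apply/matrixP=> i j.
by rewrite !mxE nth_uniq ?sc ?ltn_ord // val_eqE.
Qed.

Lemma elem_amp_refl N s : elem_amp al N 0 s s = 1.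
Proof.
have X0 : star_inc s s =1 xpred0 by move=> i; rewrite /star_inc; lia.
have Y0 : circ_inc s s =1 xpred0 by move=> i; rewrite /circ_inc; lia.
rewrite /elem_amp /star_num (eq_count X0) count_pred0 !eqxx !andbT.
have -> : strip N s s by apply/allP => i _; rewrite /strip_at /strip_row !leqnn !leqnSn.
rewrite /strip_prod /pair_prod big1 ?mul1r; last first.
  by move=> i _; apply: big1 => j _; rewrite /strip_factor !X0 !Y0 /= mulr1.
rewrite (eq_minor (B := fun i j => (i == j)%:R)) ?size_map ?minor_id ?size_map //.
  by rewrite map_inj_uniq ?circ_rows_uniq // => i j [].
move=> i j /mapP[i' _ ->] /mapP[j' _ ->]; rewrite /star_mx X0 /=.
by congr (nat_of_bool _)%:R; apply/eqP/eqP => [->|[]].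
Qed.

(** In a strip without squares no circle can disappear, and the number of circles is preserved. *)
Lemma elem_amp0_neq N s s' : vanishes_from N s -> vanishes_from N s' ->
  elem_amp al N 0 s s' != 0 -> s = s'.
Proof.
move=> van van'; rewrite /elem_amp; case: ifP => [/and3P[/allP st /eqP n0 /eqP sz] _|]; last by rewrite eqxx.
have noX i : (i < N)%N -> ~~ star_inc s s' i.
  by move=> iN; apply: contra_eqN n0 => Xi; rewrite -lt0n -has_count; apply/hasP; exists i; rewrite ?mem_iota.
have st' i : (i < N)%N -> (s' i).1 = (s i).1 /\ ((s i).2 -> (s' i).2).
  move=> iN; have := noX i iN; have := st i; rewrite mem_iota /= iN /strip_at /strip_row /star_inc => /(_ isT).
  by case: (s i) (s' i) => [a []] [b []] /=; lia.
have sub : {subset circ_rows N s <= circ_rows N s'}.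
  move=> i; rewrite !mem_circ_rows => /andP[ei iN]; rewrite iN andbT.
  by have [_ ->] := st' i iN.
have [_ eqC] := uniq_min_size (circ_rows_uniq N s) sub (eq_leq sz).
apply/funext=> i; case: (ltnP i N) => iN; last by rewrite van ?van'.
have := eqC i; rewrite !mem_circ_rows iN !andbT => e2; have [e1 _] := st' i iN.
by rewrite [LHS]surjective_pairing [RHS]surjective_pairing e1 e2.
Qed.

Lemma strip_rows_le N s s' k : strip N s s' -> (k < N)%N ->
  ((s k).1 <= (s' k).1)%N /\ ((s k).1 + (s k).2 <= (s' k).1 + (s' k).2)%N.
Proof.
by move=> /allP/(_ k) h kN; move: h; rewrite mem_iota kN => /(_ isT)/andP[/andP[-> _] /andP[-> _]].
Qed.

Lemma elem_amp_strip N n s s' : elem_amp al N n s s' != 0 -> strip N s s'.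
Proof. by rewrite /elem_amp; case: (strip N s s'); rewrite //= eqxx. Qed.
Lemma telem_amp_strip N n s s' : telem_amp al N n s s' != 0 -> strip N s s'.
Proof. by rewrite /telem_amp; case: (strip N s s'); rewrite //= eqxx. Qed.

Lemma amp_unstacked N n s s' k : stacked s -> (k.+1 < N)%N ->
  ((s' k.+1).1 + (s' k.+1).2 = (s' k).1.+1)%N ->
  elem_amp al N n s s' = 0 /\ telem_amp al N n s s' = 0.
Proof.
move=> st kN e; split; apply/eqP/negPn/negP => nz.
  have := nz; rewrite /elem_amp; case: ifP => _; last by rewrite eqxx.
  by rewrite (strip_prod_unstacked al st kN) ?mul0r ?eqxx // (elem_amp_strip nz).
have := nz; rewrite /telem_amp; case: ifP => _; last by rewrite eqxx.
by rewrite (strip_prod_unstacked al st kN) ?mul0r ?eqxx // (telem_amp_strip nz).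
Qed.

Lemma stacked_upd s k v : stacked s -> (forall a, row_rel a (s k) -> row_rel a v) ->
  row_rel v (s k.+1) -> stacked (upd s k v).
Proof.
move=> st le1 le2 i; have := st i; rewrite /upd.
case: (eqVneq i.+1 k) => [e|_]; first by subst k; rewrite ltn_eqF //; apply: le1.
by case: (eqVneq i k) => // ->.
Qed.

(* [elem_endo] solves [r X - X r = al (t X - Y)] for [Y] and
   [d Y + Y d = (n + 1) X'] for the next [X']. *)
Definition telem_step A := t * A - al^-1 *: (r * A - A * r).
Fixpoint elem_endo n : endo K :=
  if n is n'.+1 then
    n%:R^-1 *: (d * telem_step (elem_endo n') + telem_step (elem_endo n') * d)
  else 1.
Definition telem_endo n := telem_step (elem_endo n).

(** Required for every number [N] of rows that contains both diagrams: an intermediate state may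
    have one row more. *)
Definition has_elem A (amp : nat -> rowstate -> rowstate -> K) := forall N La Om,
  vanishes_from N (rows La) -> vanishes_from N (rows Om) ->
  A (state_delta K (rows La)) Om = amp N (rows La) (rows Om).

Lemma add_after_elem A n h N La Om : has_elem A (fun N => elem_amp al N n) ->
  vanishes_from N (rows La) -> vanishes_from N (rows Om) ->
  (add_endo al h * A) (state_delta K (rows La)) Om = add_after al N n h (rows La) (rows Om).
Proof.
move=> hA van van'; rewrite [LHS](add_endo_at al h _ van').
apply: eq_bigr => k ek; rewrite !mulrA; congr (_ * _).
have st : stacked (upd (rows Om) k ((rows Om k).1, false)).
  apply: stacked_upd (@rows_stacked Om) _ _.
    by move: ek; case: (rows Om k) => [a []] //= _ [b c]; rewrite /row_rel /=; lia.
  by have := @rows_stacked Om k; rewrite /row_rel.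
have vanu := vanishes_upd ((rows Om k).1, false) (ltn_ord k) van'.
have [L eL] := of_rows_stacked st vanu.
by rewrite /ext eL /=; have /of_rowsP eR := eL; rewrite -eR; apply: hA; rewrite ?eR.
Qed.

Lemma endo_sum_cond A (I : finType) (P : pred I) (c : I -> K) (f : I -> spart -> K) L :
  A (fun L => \sum_(i | P i) c i * f i L) L = \sum_(i | P i) c i * A (f i) L.
Proof.
rewrite -[RHS]big_filter -endo_sum; congr (A _ L).
by apply/funext=> x; rewrite big_filter.
Qed.

Lemma add_before_elem A n h N La Om : has_elem A (fun N => elem_amp al N n) ->
  vanishes_from N (rows La) -> vanishes_from N (rows Om) ->
  (A * add_endo al h) (state_delta K (rows La)) Om = add_before al N n h (rows La) (rows Om).
Proof.
move=> hA van van'; rewrite -[LHS]/(A (add_endo al h (state_delta K (rows La))) Om).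
rewrite (add_endo_delta al h van).
rewrite (endo_sum_cond A (fun k : 'I_N.+1 => ~~ (rows La k).2) (fun k : 'I_N.+1 =>
  rsgn K (rows La) k * (add_coef al (rows La) k * h (ustar al (rows La) k)))
  (fun k : 'I_N.+1 => state_delta K (upd (rows La) k ((rows La k).1, true)))).
rewrite big_mkcond big_ord_recr /= -big_mkcond /=.
(* A circle placed in row [N] cannot be lost again, since rows only grow in a strip, whereas row [N]
   of [Om] is empty. *)
set last := if _ then _ else _; have -> : last = 0.
  rewrite {}/last; case: ifP => // _.
  have [st|nst] := pselect (stacked (upd (rows La) N ((rows La N).1, true))); last first.
    by rewrite state_delta_unstacked ?endo0 ?mulr0.
  have vanu : vanishes_from N.+1 (upd (rows La) N ((rows La N).1, true)).
    by apply: vanishes_upd => //; apply: vanishes_le van.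
  have [L eL] := rows_surj st vanu; rewrite -eL (hA N.+1) ?eL //; last exact: vanishes_le van'.
  apply/eqP/negPn/negP; rewrite mulf_eq0 negb_or => /andP[_ /elem_amp_strip/strip_rows_le].
  by move=> /(_ N (ltnSn N))[_]; rewrite upd_same van' //= addn1.
rewrite addr0; apply: eq_bigr => k ek; rewrite mulrA.
have vanu := vanishes_upd ((rows La k).1, true) (ltn_ord k) van.
have [st|nst] := pselect (stacked (upd (rows La) k ((rows La k).1, true))).
  by have [L eL] := rows_surj st vanu; rewrite -eL (hA N) ?eL.
rewrite state_delta_unstacked // endo0 mulr0.
have [-> |c0] := eqVneq (add_coef al (rows La) k) 0; first by rewrite mulr0 !mul0r.
case: nst; apply: (@add_coef_stacked K al _ k); rewrite ?upd_same //.
  rewrite upd_upd (_ : (_, false) = rows La k) ?upd_id; first exact: rows_stacked.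
  by rewrite [RHS]surjective_pairing (negPf ek : (rows La k).2 = false).
by rewrite /add_coef ustar_upd_id.
Qed.

Lemma bump_after_telem A n N La Om : has_elem A (fun N => telem_amp al N n) ->
  vanishes_from N (rows La) -> vanishes_from N (rows Om) ->
  (d * A) (state_delta K (rows La)) Om = bump_after al N n (rows La) (rows Om).
Proof.
move=> hA van van'; rewrite [LHS](bump_endo_at al _ van').
apply: eq_bigr => k /andP[ek lk]; congr (_ * _).
have vanu := vanishes_upd ((rows Om k).1.-1, true) (ltn_ord k) van'.
have [st|nst] := pselect (stacked (upd (rows Om) k ((rows Om k).1.-1, true))).
  have [L eL] := of_rows_stacked st vanu.
  by rewrite /ext eL /=; have /of_rowsP eR := eL; rewrite -eR; apply: hA; rewrite ?eR.
rewrite /ext; case eL: (of_rows _) => [L|] /=.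
  by case: nst; have /of_rowsP <- := eL; apply: rows_stacked.
(* On a state that is not stacked the operator contributes 0, so the amplitude has to vanish as
   well. Undoing the bump breaks stackedness only if row [k + 1], circle included, is as long as row
   [k]. *)
have rel := @rows_stacked Om k.
have kN : (k.+1 < N)%N.
  rewrite ltnNge; apply/negP=> Nk; apply: nst.
  apply: stacked_upd (@rows_stacked Om) _ _.
    by move: lk ek; case: (rows Om k) => [[|a] []] //= _ _ [b c]; rewrite /row_rel /=; lia.
  by rewrite (van' k.+1 Nk); case: (_.-1).
have bad : ((rows Om k.+1).1 + (rows Om k.+1).2 = (rows Om k).1)%N.
  apply/eqP; apply: contraT => ne; case: nst.
  apply: stacked_upd (@rows_stacked Om) _ _.
    by move: lk ek; case: (rows Om k) => [[|a] []] //= _ _ [b c]; rewrite /row_rel /=; lia.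
  move: rel ne lk ek; rewrite /row_rel.
  by case: (rows Om k) (rows Om k.+1) => [[|a] []] [b []] //=; lia.
apply/esym; apply: (proj2 (@amp_unstacked N n _ _ k (@rows_stacked La) kN _)).
by rewrite upd_same (upd_other _ _ (negbT (gtn_eqF (ltnSn k)))) bad prednK.
Qed.

Lemma bump_before_telem A n N La Om : has_elem A (fun N => telem_amp al N n) ->
  vanishes_from N (rows La) -> vanishes_from N (rows Om) ->
  (A * d) (state_delta K (rows La)) Om = bump_before al N n (rows La) (rows Om).
Proof.
move=> hA van van'; rewrite -[LHS]/(A (d (state_delta K (rows La))) Om).
rewrite (bump_endo_delta al van).
rewrite (endo_sum_cond A (fun k : 'I_N => (rows La k).2) (fun k : 'I_N =>
  rsgn K (rows La) k * bump_coef al (rows La) k)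
  (fun k : 'I_N => state_delta K (upd (rows La) k ((rows La k).1.+1, false)))).
apply: eq_bigr => k ek; congr (_ * _).
have vanu := vanishes_upd ((rows La k).1.+1, false) (ltn_ord k) van.
have st : stacked (upd (rows La) k ((rows La k).1.+1, false)).
  apply: stacked_upd (@rows_stacked La) _ _.
    by move: ek; case: (rows La k) => [a []] //= _ [b c]; rewrite /row_rel /=; lia.
  by have := @rows_stacked La k; rewrite /row_rel /=; lia.
by have [L eL] := rows_surj st vanu; rewrite -eL; apply: hA; rewrite ?eL.
Qed.

(** The amplitudes satisfy the recursion that defines the operators: [weighted_elem_comm] gives
    [Y_n] from [X_n], and [bump_telem] gives [X_(n+1)] from [Y_n]. *)
Lemma elem_endo_amp n : has_elem (elem_endo n) (fun N => elem_amp al N n) /\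
  has_elem (telem_endo n) (fun N => telem_amp al N n).
Proof.
have telemP m : has_elem (elem_endo m) (fun N => elem_amp al N m) ->
    has_elem (telem_endo m) (fun N => telem_amp al N m).
  move=> hX N La Om van van'.
  rewrite -[LHS]/((t * elem_endo m) (state_delta K (rows La)) Om - al^-1 *
   ((r * elem_endo m) (state_delta K (rows La)) Om - (elem_endo m * r) (state_delta K (rows La)) Om)).
  rewrite !(add_after_elem _ hX van van') (add_before_elem _ hX van van').
  rewrite (weighted_elem_comm al_gen) mulKf ?(al_neq0 al_gen) //; ring.
suff hX : has_elem (elem_endo n) (fun N => elem_amp al N n) by split=> //; apply: telemP.
elim: n => [|n /telemP hY] N La Om van van'.
  rewrite -[LHS]/(state_delta K (rows La) Om) /state_delta.
  have [e|ne] := pselect (rows Om = rows La); first by rewrite asboolT // e elem_amp_refl.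
  rewrite asboolF //; apply/esym/eqP/negPn/negP => nz; case: ne.
  by rewrite (elem_amp0_neq van van' nz).
rewrite -[LHS]/(n.+1%:R^-1 * ((d * telem_endo n) (state_delta K (rows La)) Om +
  (telem_endo n * d) (state_delta K (rows La)) Om)).
rewrite (bump_after_telem hY van van') (bump_before_telem hY van van').
by rewrite (bump_telem al_gen) mulKf // (natr_gen_eq0 al_gen).
Qed.

Lemma local_elem n : local_endo (elem_endo n).
Proof.
elim: n => [|n IH] /=; first exact: local_one.
have lY : local_endo (telem_step (elem_endo n)).
  apply: local_add; first by apply: local_mul IH; apply: local_lift.
  apply: local_opp; apply: local_scale; apply: local_add; last apply: local_opp.
    by apply: local_mul IH; apply: local_lift.
  by apply: local_mul => //; apply: local_lift.
by apply: local_scale; apply: local_add; apply: local_mul => //; apply: local_lift.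
Qed.

(** The relation that is not built into the definition of [elem_endo]. It is verified on basis
    vectors, which suffices because all operators involved are local. *)
Lemma elem_endo_add_comm n : t * elem_endo n = elem_endo n * t.
Proof.
apply/eqP; rewrite -subr_eq0; apply/eqP; apply: local_eq0.
  apply: local_add; last apply: local_opp; apply: local_mul; try exact: local_elem; exact: local_lift.
move=> La Om; pose N := maxn (size (circ La)) (size (circ Om)).
have van : vanishes_from N (rows La) by apply: vanishes_le (@rows_vanish La); rewrite leq_maxl.
have van' : vanishes_from N (rows Om) by apply: vanishes_le (@rows_vanish Om); rewrite leq_maxr.
rewrite -[LHS]/((t * elem_endo n) (state_delta K (rows La)) Om - (elem_endo n * t) (state_delta K (rows La)) Om).
have [hX _] := elem_endo_amp n.
by rewrite (add_after_elem _ hX van van') (add_before_elem _ hX van van') (add_elem_comm al_gen) subrr.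
Qed.

End ElementaryOperators.

(** * Power sums from brackets in a noncommutative ring *)

(* Reflexive normalisation in noncommutative rings: expressions are flattened to
   integer combinations of words in the atoms. *)
Inductive nexp := NVar of nat | NZero | NOne | NAdd of nexp & nexp | NOpp of nexp | NMul of nexp & nexp.

Section NcRing.
Variables (A : nzRingType) (env : seq A).

Fixpoint nval e : A := match e with
  | NVar i => env`_i | NZero => 0 | NOne => 1 | NAdd a b => nval a + nval b
  | NOpp a => - nval a | NMul a b => nval a * nval b end.

Fixpoint nform e : seq (int * seq nat) := match e with
  | NVar i => [:: (1, [:: i])] | NZero => [::] | NOne => [:: (1, [::])]
  | NAdd a b => nform a ++ nform b
  | NOpp a => [seq (- m.1, m.2) | m <- nform a]
  | NMul a b => [seq (m.1 * m'.1, m.2 ++ m'.2) | m <- nform a, m' <- nform b] end.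

Definition word_val (m : int * seq nat) : A := (\prod_(i <- m.2) env`_i) *~ m.1.

Lemma nform_val e : nval e = \sum_(m <- nform e) word_val m.
Proof.
elim: e => [i|||a IHa b IHb|a IHa|a IHa b IHb] /=.
- by rewrite big_seq1 /word_val /= big_seq1.
- by rewrite big_nil.
- by rewrite big_seq1 /word_val /= big_nil.
- by rewrite big_cat IHa IHb.
- by rewrite big_map IHa -sumrN; apply: eq_bigr => m _; rewrite /word_val /= mulrNz.
rewrite IHa IHb mulr_suml big_allpairs_dep; apply: eq_bigr => m _.
rewrite mulr_sumr; apply: eq_bigr => m' _.
by rewrite /word_val /= big_cat /= mulrzAl mulrzAr -mulrzA mulrC.
Qed.

Definition nform_zero (l : seq (int * seq nat)) : bool :=
  all (fun w => foldr (fun m c => if m.2 == w then m.1 + c else c) 0 l == 0) (map snd l).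

Lemma nform_zeroP l : nform_zero l -> \sum_(m <- l) word_val m = 0.
Proof.
move=> /allP l0; transitivity (\sum_(w <- undup (map snd l)) \sum_(m <- l | m.2 == w) word_val m).
  rewrite (exchange_big_dep xpredT) //= big_seq [RHS]big_seq; apply: eq_bigr => m ml.
  rewrite -big_filter (_ : [seq _ <- _ | _] = [:: m.2]) ?big_seq1 //.
  rewrite -(filter_pred1_uniq (undup_uniq (map snd l))) ?mem_undup ?map_f //.
  by apply: eq_filter => w /=; rewrite eq_sym.
rewrite big_seq big1 // => w; rewrite mem_undup => /l0/eqP e0.
transitivity ((\prod_(i <- w) env`_i) *~ foldr (fun m c => if m.2 == w then m.1 + c else c) 0 l); last by rewrite e0.
elim: l {l0 e0} => [|m l IH] /=; first by rewrite big_nil.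
by rewrite big_cons IH; case: eqP => // <-; rewrite mulrzDr.
Qed.

Lemma ncring_correct a b : nform_zero (nform (NAdd a (NOpp b))) -> nval a = nval b.
Proof.
by move=> /nform_zeroP; rewrite -nform_val /= => /eqP; rewrite subr_eq0 => /eqP.
Qed.

End NcRing.

Ltac nc_index x l :=
  match l with
  | x :: _ => constr:(0%N)
  | _ :: ?l' => let n := nc_index x l' in constr:(n.+1)
  end.
Ltac nc_mem x l :=
  match l with
  | x :: _ => constr:(true)
  | _ :: ?l' => nc_mem x l'
  | _ => constr:(false)
  end.
Ltac nc_atoms e l :=
  match e with
  | (?a + ?b)%R => let l := nc_atoms a l in nc_atoms b l
  | (?a * ?b)%R => let l := nc_atoms a l in nc_atoms b l
  | (- ?a)%R => nc_atoms a l
  | (0)%R => l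
  | (1)%R => l
  | _ => let m := nc_mem e l in match m with true => l | false => constr:(e :: l) end
  end.
Ltac nc_reify e l :=
  match e with
  | (?a + ?b)%R => let x := nc_reify a l in let y := nc_reify b l in constr:(NAdd x y)
  | (?a * ?b)%R => let x := nc_reify a l in let y := nc_reify b l in constr:(NMul x y)
  | (- ?a)%R => let x := nc_reify a l in constr:(NOpp x)
  | (0)%R => constr:(NZero)
  | (1)%R => constr:(NOne)
  | _ => let n := nc_index e l in constr:(NVar n)
  end.
Ltac ncring :=
  match goal with |- @eq ?T ?a ?b =>
    let l := nc_atoms a (@nil T) in let l := nc_atoms b l in
    let x := nc_reify a l in let y := nc_reify b l in
    apply: (@ncring_correct _ l x y); vm_compute; exact isT
  end.

Section SuperBrackets.
Variables (K : fieldType) (A : algType K).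
Implicit Types (a b c : A) (e f g : bool).

(* The commutator for [e = false], the anticommutator for [e = true]. *)
Definition sbr e a b : A := if e then a * b + b * a else a * b - b * a.

(** One flag for each pair: [e] for [a], [b], then [f] for [a], [c], then [g] for [b], [c]. No
    parity is attached to the elements themselves, so the identity holds in any algebra and for
    every choice of flags. *)
Lemma sbr_jacobi e f g a b c :
  sbr (e (+) f) a (sbr g b c) =
  sbr (f (+) g) (sbr e a b) c + (-1) ^+ e * sbr (e (+) g) b (sbr f a c).
Proof. by case: e f g => [] [] []; rewrite /= ?expr0 ?expr1 /sbr; ncring. Qed.


Lemma sbrC e a b : sbr e b a = - (-1) ^+ e * sbr e a b.
Proof. by case: e; rewrite /sbr ?expr0 ?expr1; ncring. Qed.

Lemma sbr_sym e a b : sbr e a b = 0 -> sbr e b a = 0.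
Proof. by move=> ab; rewrite sbrC ab mulr0. Qed.

Lemma sbrMr e f a b c : sbr (e (+) f) a (b * c) = sbr e a b * c + (-1) ^+ e * (b * sbr f a c).
Proof. by case: e f => [] []; rewrite /= ?expr0 ?expr1 /sbr; ncring. Qed.

Lemma commMl a b c : sbr false (a * b) c = a * sbr false b c + sbr false a c * b.
Proof. by rewrite /sbr; ncring. Qed.

Lemma sbrZr e a k b : sbr e a (k *: b) = k *: sbr e a b.
Proof. by case: e; rewrite /sbr -scalerAr -scalerAl -?scalerBr -?scalerDr. Qed.

Lemma sbrZl e a k b : sbr e (k *: a) b = k *: sbr e a b.
Proof. by case: e; rewrite /sbr -scalerAr -scalerAl -?scalerBr -?scalerDr. Qed.

Lemma sbrDr e a b c : sbr e a (b + c) = sbr e a b + sbr e a c.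
Proof. by case: e; rewrite /sbr; ncring. Qed.

Lemma sbrNr e a b : sbr e a (- b) = - sbr e a b.
Proof. by case: e; rewrite /sbr; ncring. Qed.

Lemma sbrNl e a b : sbr e (- a) b = - sbr e a b.
Proof. by case: e; rewrite /sbr; ncring. Qed.

Lemma sbrDl e a b c : sbr e (a + b) c = sbr e a c + sbr e b c.
Proof. by case: e; rewrite /sbr; ncring. Qed.

Lemma sbr0r e a : sbr e a 0 = 0.
Proof. by case: e; rewrite /sbr; ncring. Qed.

Lemma sbr0l e a : sbr e 0 a = 0.
Proof. by case: e; rewrite /sbr; ncring. Qed.

Lemma sbr_sumr e a (I : Type) (s : seq I) (P : pred I) (F : I -> A) :
  sbr e a (\sum_(i <- s | P i) F i) = \sum_(i <- s | P i) sbr e a (F i).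
Proof. by apply: big_morph => [b c|]; [apply: sbrDr | apply: sbr0r]. Qed.

Lemma sbr_nil e a b : a * a = 0 -> sbr (~~ e) a (sbr e a b) = 0.
Proof.
move=> aa; have -> : sbr (~~ e) a (sbr e a b) = a * a * b - b * (a * a).
  by case: e; rewrite /= /sbr; ncring.
by rewrite aa mul0r mulr0 subr0.
Qed.

Lemma comm1 a : sbr false a 1 = 0.
Proof. by rewrite /sbr; ncring. Qed.

End SuperBrackets.

Arguments sbr {K A} e a b : simpl never.

Section NewtonRelations.
Variables (K : fieldType) (A : algType K) (al : K) (t d r : A) (X Y : nat -> A).
Hypothesis al0 : al != 0.
Hypothesis char0 : forall n, n.+1%:R != 0 :> K.
Hypotheses (tt0 : t * t = 0) (dd0 : d * d = 0) (rr0 : r * r = 0) (tr0 : sbr true t r = 0).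
Hypothesis X0 : X 0 = 1.
Hypothesis tX : forall n, sbr false t (X n) = 0.
Hypothesis rX : forall n, sbr false r (X n) = al *: (t * X n - Y n).
Hypothesis dY : forall n, sbr true d (Y n) = n.+1%:R *: X n.+1.

(** [tpow k] plays the role of tilde p_k and [pow k] that of p_(k+1). The constant is the one in
    [r, p_k] = al k tilde p_k. *)
Fixpoint tpow k : A :=
  if k is k'.+1 then (al * k%:R)^-1 *: sbr false r (sbr true d (tpow k')) else t.
Definition pow k : A := sbr true d (tpow k).

Lemma comm_r_pow k : sbr false r (pow k) = (al * k.+1%:R) *: tpow k.+1.
Proof. by rewrite /= scalerA divff ?scale1r // mulf_neq0. Qed.

Lemma Y0 : Y 0 = t.
Proof.
apply/esym/eqP; rewrite -subr_eq0 -[t]mulr1 -X0 -(inj_eq (scalerI al0)) scaler0 -rX X0.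
by rewrite comm1.
Qed.

Lemma comm_d_X n : sbr false d (X n) = 0.
Proof.
case: n => [|n]; first by rewrite X0 comm1.
by apply: (scalerI (char0 n)); rewrite scaler0 -sbrZr -dY (sbr_nil true).
Qed.

Lemma scaled_Y n : al *: Y n = al *: (t * X n) - sbr false r (X n).
Proof. by rewrite rX scalerBr opprB addrC subrK. Qed.

Lemma anti_t_Y n : sbr true t (Y n) = 0.
Proof.
apply: (scalerI al0); rewrite scaler0 -sbrZr scaled_Y sbrDr sbrNr sbrZr.
rewrite (sbr_jacobi true false false) tr0 tX sbr0r sbr0l mulr0 addr0 subr0.
by rewrite (sbrMr true false) tX mulr0 mulr0 addr0 /sbr tt0 addr0 mul0r scaler0.
Qed.

Lemma anti_r_Y n : sbr true r (Y n) = al *: (t * Y n).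
Proof.
apply: (scalerI al0); rewrite -sbrZr scaled_Y sbrDr sbrNr sbrZr (sbr_nil false) // subr0.
rewrite (sbrMr true false) (sbr_sym tr0) mul0r add0r expr1 mulN1r rX -scalerAr -scalerN.
by rewrite mulrBr mulrA tt0 mul0r sub0r opprK.
Qed.

Lemma anti_r_tpow k : sbr true r (tpow k) = 0.
Proof.
by case: k => [|k] /=; [rewrite (sbr_sym tr0) | rewrite sbrZr (sbr_nil false) ?scaler0].
Qed.

Lemma comm_d_pow k : sbr false d (pow k) = 0.
Proof. by rewrite (sbr_nil true). Qed.

(** Jacobi identities move [X n] or [Y n] past the [r] and [d] of the recursion. The relations [rX],
    [dY] and their consequences produce only [X], [Y] and [t] again, whose brackets with the
    previous step vanish; [t] is covered as [Y 0]. *)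
Lemma XY_pow k : [/\ forall n, sbr false (X n) (tpow k) = 0, forall n, sbr true (Y n) (tpow k) = 0,
  forall n, sbr false (X n) (pow k) = 0 & forall n, sbr false (Y n) (pow k) = 0].
Proof.
have step j : (forall n, sbr false (X n) (tpow j) = 0) -> (forall n, sbr true (Y n) (tpow j) = 0) ->
    (forall n, sbr false (X n) (pow j) = 0) /\ (forall n, sbr false (Y n) (pow j) = 0).
  move=> Xj Yj; split=> n.
    rewrite /pow (sbr_jacobi false false true) Xj sbr0r mulr0 addr0.
    by rewrite (sbr_sym (comm_d_X n)) sbr0l.
  rewrite /pow (sbr_jacobi true true true) Yj sbr0r mulr0 addr0.
  by rewrite (sbrC true d) dY expr1 opprK mul1r sbrZl /= Xj scaler0.
elim: k => [|k [Xt Yt Xp Yp]].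
  have Xt n : sbr false (X n) (tpow 0) = 0 by apply: sbr_sym; apply: tX.
  have Yt n : sbr true (Y n) (tpow 0) = 0 by apply: sbr_sym; apply: anti_t_Y.
  by have [Xp Yp] := step 0 Xt Yt.
have tp0 : sbr false t (pow k) = 0 by rewrite -Y0.
have Xt' n : sbr false (X n) (tpow k.+1) = 0.
  rewrite /= sbrZr -/(pow k) (sbr_jacobi false false false) Xp sbr0r mulr0 addr0.
  rewrite (sbrC false r) rX expr0 mulN1r -scalerN sbrZl sbrNl sbrDl sbrNl Yp commMl Xp tp0.
  by rewrite mulr0 mul0r addr0 subr0 oppr0 !scaler0.
have Yt' n : sbr true (Y n) (tpow k.+1) = 0.
  rewrite /= sbrZr -/(pow k) (sbr_jacobi true false false) Yp sbr0r mulr0 addr0.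
  rewrite (sbrC true r) anti_r_Y expr1 opprK mul1r sbrZl commMl Yp tp0.
  by rewrite mulr0 mul0r addr0 !scaler0.
by have [Xp' Yp'] := step _ Xt' Yt'.
Qed.

Definition newton n := Y n = \sum_(j < n.+1) (-1) ^+ j *: (tpow j * X (n - j)).

Lemma newton_pow n : newton n ->
  n.+1%:R *: X n.+1 = \sum_(j < n.+1) (-1) ^+ j *: (pow j * X (n - j)).
Proof.
move=> Nn; rewrite -dY Nn sbr_sumr; apply: eq_bigr => j _; rewrite sbrZr.
by rewrite (sbrMr true false) comm_d_X !mulr0 addr0.
Qed.

(** Newton's formula for [Y i] ends with [tpow i * X 0 = tpow i] up to sign, so it can be solved for
    [tpow i]: what brackets to zero with all [X] and [Y] does so with [tpow i]. *)
Lemma newton_comm e c i : (forall n, sbr false c (X n) = 0) -> (forall n, sbr e c (Y n) = 0) ->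
  (forall m, (m <= i)%N -> newton m) -> sbr e c (tpow i) = 0.
Proof.
move=> cX cY; elim/ltn_ind: i => i IH Nm.
have tX' j : sbr e c (tpow j * X (i - j)) = sbr e c (tpow j) * X (i - j).
  by rewrite -[e in LHS]addbF sbrMr cX !mulr0 addr0.
have := cY i; rewrite (Nm i (leqnn i)) sbr_sumr big_ord_recr /= big1 => [|j _].
  rewrite add0r sbrZr tX' subnn X0 mulr1 => /eqP; rewrite scaler_eq0 signr_eq0 /=.
  by move/eqP.
rewrite sbrZr tX' IH ?mul0r ?scaler0 // => m mj; apply: Nm.
exact: leq_trans mj (ltnW (ltn_ord j)).
Qed.

Lemma triangle_exchange (n : nat) (F : nat -> nat -> A) :
  \sum_(j < n.+1) \sum_(i < (n - j).+1) F i j = \sum_(i < n.+1) \sum_(j < (n - i).+1) F i j.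
Proof.
have widen (G : nat -> A) m : (m <= n)%N -> \sum_(i < (n - m).+1) G i = \sum_(i < n.+1 | (i + m <= n)%N) G i.
  move=> mn; rewrite (big_ord_widen n.+1 G) ?ltnS ?leq_subr //.
  by apply: eq_bigl => i; rewrite ltnS; lia.
rewrite (eq_bigr (fun j : 'I_n.+1 => \sum_(i < n.+1 | (i + j <= n)%N) F i j)); last first.
  by move=> j _; rewrite (widen (fun i => F i j)) // -ltnS.
rewrite [RHS](eq_bigr (fun i : 'I_n.+1 => \sum_(j < n.+1 | (j + i <= n)%N) F i j)); last first.
  by move=> i _; rewrite (widen (F i)) // -ltnS.
rewrite (exchange_big_dep xpredT) //=; apply: eq_bigr => i _; apply: eq_bigl => j.
by rewrite addnC.
Qed.

(** Bracket with [r] the formula for (n + 1) X_(n+1) that follows from the case n. This turns each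
    [pow j] into [tpow j.+1] and each [X] into [t X - Y]; the terms with [t] reassemble to t X_(n+1)
    and cancel, and the inner [Y] are expanded by induction and resummed. The commutation of [pow j]
    with [tpow i], i <= n, that this requires comes from the lower cases through [newton_comm]. *)
Theorem newtonP n : newton n.
Proof.
elim/ltn_ind: n => -[_|n IH]; first by rewrite /newton big_ord1 expr0 scale1r Y0 X0 mulr1.
have Npow m : (m <= n)%N -> m.+1%:R *: X m.+1 = \sum_(j < m.+1) (-1) ^+ j *: (pow j * X (m - j)).
  by move=> mn; apply/newton_pow/IH.
have comm j i : (i <= n)%N -> pow j * tpow i = tpow i * pow j.
  move=> le; have [_ _ cX cY] := XY_pow j; apply/eqP; rewrite -subr_eq0; apply/eqP.
  apply: (@newton_comm false) => [m|m|m mi]; [exact: sbr_sym|exact: sbr_sym|apply: IH].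
  by rewrite ltnS (leq_trans mi).
pose S := \sum_(i < n.+1) (-1) ^+ i *: ((n.+1 - i)%:R *: (tpow i * X (n.+1 - i))).
pose T := \sum_(j < n.+1) (-1) ^+ j *: (j.+1%:R *: (tpow j.+1 * X (n - j))).
have SE : \sum_(j < n.+1) (-1) ^+ j *: (pow j * Y (n - j)) = S.
  rewrite (eq_bigr (fun j : 'I_n.+1 => \sum_(i < (n - j).+1)
     (-1) ^+ i *: (tpow i * ((-1) ^+ j *: (pow j * X (n - i - j)))))); last first.
    move=> j _; rewrite (IH (n - j)%N) ?ltnS ?leq_subr // mulr_sumr scaler_sumr.
    apply: eq_bigr => i _; rewrite -!scalerAr !scalerA mulrC mulrA comm -?mulrA.
      by rewrite subnAC.
    by rewrite (leq_trans _ (leq_subr j n)) // -ltnS.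
  rewrite (triangle_exchange n (fun i j => (-1) ^+ i *: (tpow i * ((-1) ^+ j *: (pow j * X (n - i - j)))))).
  apply: eq_bigr => i _; rewrite -scaler_sumr -mulr_sumr -Npow ?leq_subr //.
  by rewrite -scalerAr subSn // -ltnS.
have E : n.+1%:R *: Y n.+1 = S - T.
  have := congr1 (sbr false r) (Npow n (leqnn n)); rewrite sbr_sumr sbrZr rX.
  rewrite (eq_bigr (fun j : 'I_n.+1 => al *: ((-1) ^+ j *: (j.+1%:R *: (tpow j.+1 * X (n - j))) +
     (t * ((-1) ^+ j *: (pow j * X (n - j))) - (-1) ^+ j *: (pow j * Y (n - j)))))); last first.
    move=> j _; rewrite sbrZr (sbrMr false false) comm_r_pow rX expr0 mul1r.
    rewrite -scalerAl -scalerA -[pow j * (al *: _)]scalerAr -scalerDr scalerA [_ * al]mulrC -scalerA.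
    rewrite scalerDr mulrBr scalerBr mulrA (comm j 0%N) // -mulrA.
    by rewrite -[t * (_ *: _)]scalerAr.
  rewrite -scaler_sumr scalerA mulrC -scalerA => /(scalerI al0).
  rewrite big_split sumrB -mulr_sumr -Npow // SE -/T scalerBr scalerAr /= -scalerAr => e.
  have fin (P U V W : A) : P - U = V + (P - W) -> U = W - V.
    by move=> q; transitivity (P - (P - U)); [ncring | rewrite q; ncring].
  exact: fin e.
apply: (scalerI (char0 n)); rewrite E scaler_sumr.
(* The factor n + 1 is split as (n + 1 - j) + j; the two parts are [S] and - [T]. *)
rewrite (eq_bigr (fun j : 'I_n.+2 => (-1) ^+ j *: ((n.+1 - j)%:R *: (tpow j * X (n.+1 - j))) +
  (-1) ^+ j *: (j%:R *: (tpow j * X (n.+1 - j))))); last first.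
  move=> j _; have le : (j <= n.+1)%N by rewrite -ltnS.
  have swap (a b : K) (x : A) : a *: (b *: x) = b *: (a *: x) by rewrite !scalerA mulrC.
  by rewrite [LHS]swap -scalerDr -scalerDl -natrD (subnK le).
rewrite big_split [RHS]/=; congr (_ + _).
  by rewrite big_ord_recr /= subnn scale0r scaler0 addr0.
rewrite big_ord_recl scale0r scaler0 add0r /T -sumrN; apply: eq_bigr => j _.
by rewrite lift0 subSS exprS mulN1r scaleNr.
Qed.

Lemma tpow_anti i j : sbr true (tpow i) (tpow j) = 0.
Proof.
have [cX cY _ _] := XY_pow i.
by apply: newton_comm => [m|m|m _]; [exact: sbr_sym|exact: sbr_sym|exact: newtonP].
Qed.

Lemma pow_tpow i j : sbr false (pow i) (tpow j) = 0.
Proof.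
have [_ _ cX cY] := XY_pow i.
by apply: newton_comm => [m|m|m _]; [exact: sbr_sym|exact: sbr_sym|exact: newtonP].
Qed.

Lemma pow_pow i j : sbr false (pow i) (pow j) = 0.
Proof.
rewrite {2}/pow (sbr_jacobi false false true) pow_tpow sbr0r mulr0 addr0.
by rewrite (sbr_sym (comm_d_pow i)) sbr0l.
Qed.

End NewtonRelations.

(** * Lowering operators and their brackets with the power sums *)

Section LoweringRelations.
Variables (K : fieldType) (A : algType K) (al : K) (t d r ta da ra E D : A).
Hypothesis al0 : al != 0.
Hypothesis char0 : forall n, n.+1%:R != 0 :> K.
Hypotheses (tt0 : t * t = 0) (dd0 : d * d = 0) (rr0 : r * r = 0) (tr0 : sbr true t r = 0).
Hypotheses (ta_t : sbr true ta t = 1) (ta_r : sbr true ta r = 0) (ta_d : sbr true ta d = 0).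
Hypotheses (da_t : sbr true da t = 0) (da_r : sbr true da r = 0) (da_d : sbr true da d = al *: D).
Hypotheses (ra_t : sbr true ra t = 0) (ra_r : sbr true ra r = al *: E) (ra_d : sbr true ra d = 0).
Hypotheses (D_t : sbr false D t = t) (D_r : sbr false D r = r) (D_d : sbr false D d = 0).
Hypotheses (E_t : sbr false E t = 0) (E_r : sbr false E r = 0) (E_d : sbr false E d = d).
Local Notation tp := (tpow al t d r).
Local Notation pp := (pow al t d r).

Lemma weight_D k : sbr false D (tp k) = k.+1%:R *: tp k /\ sbr false D (pp k) = k.+1%:R *: pp k.
Proof.
have step j : sbr false D (tp j) = j.+1%:R *: tp j -> sbr false D (pp j) = j.+1%:R *: pp j.
  by move=> e; rewrite /pow (sbr_jacobi false false true) D_d sbr0l add0r expr0 mul1r e sbrZr.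
elim: k => [|k [_ e]]; first by have e : sbr false D (tp 0) = 1%:R *: tp 0; [rewrite D_t scale1r | split; last exact: step].
have e' : sbr false D (tp k.+1) = k.+2%:R *: tp k.+1.
  rewrite /= sbrZr -/(pp k) (sbr_jacobi false false false) D_r e expr0 mul1r sbrZr.
  by rewrite -{1}[sbr _ r _]scale1r -scalerDl nat1r !scalerA mulrC.
by split; last exact: step.
Qed.

Lemma weight_E k : sbr false E (tp k) = k%:R *: tp k /\ sbr false E (pp k) = k.+1%:R *: pp k.
Proof.
have step j : sbr false E (tp j) = j%:R *: tp j -> sbr false E (pp j) = j.+1%:R *: pp j.
  move=> e; rewrite /pow (sbr_jacobi false false true) E_d e expr0 mul1r sbrZr.
  by rewrite -{1}[sbr _ d _]scale1r -scalerDl -natr1 addrC.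
elim: k => [|k [_ e]]; first by have e : sbr false E (tp 0) = 0%:R *: tp 0; [rewrite E_t scale0r | split; last exact: step].
have e' : sbr false E (tp k.+1) = k.+1%:R *: tp k.+1.
  rewrite /= sbrZr -/(pp k) (sbr_jacobi false false false) E_r sbr0l add0r e expr0 mul1r sbrZr.
  by rewrite !scalerA mulrC.
by split; last exact: step.
Qed.

Lemma comm_scalar (a : A) (c : K) : sbr false a (c *: 1) = 0.
Proof. by rewrite sbrZr comm1 scaler0. Qed.

Lemma lower_t k : sbr true ta (tp k) = (k == 0)%:R *: 1 /\ sbr false ta (pp k) = 0.
Proof.
have step j (c : K) : sbr true ta (tp j) = c *: 1 -> sbr false ta (pp j) = 0.
  move=> e; rewrite /pow (sbr_jacobi true true true) ta_d sbr0l add0r e /=.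
  by rewrite comm_scalar mulr0.
elim: k => [|k [_ e]]; first by have e : sbr true ta (tp 0) = 1 *: 1; [rewrite ta_t scale1r | split; last exact: (step _ _ e)].
have e' : sbr true ta (tp k.+1) = 0 *: 1.
  rewrite /= sbrZr -/(pp k) (sbr_jacobi true false false) ta_r e sbr0l sbr0r mulr0 addr0.
  by rewrite scaler0 scale0r.
by split; last exact: (step _ _ e').
Qed.

Lemma lower_d k : sbr true da (tp k) = 0 /\ sbr false da (pp k) = (al * k.+1%:R) *: tp k.
Proof.
have step j : sbr true da (tp j) = 0 -> sbr false da (pp j) = (al * j.+1%:R) *: tp j.
  move=> e; rewrite /pow (sbr_jacobi true true true) da_d e sbr0r mulr0 addr0 /= sbrZl.
  by have [-> _] := weight_D j; rewrite scalerA.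
elim: k => [|k [_ e]]; first by split; last exact: step.
have e' : sbr true da (tp k.+1) = 0.
  rewrite /= sbrZr -/(pp k) (sbr_jacobi true false false) da_r e sbr0l add0r sbrZr /=.
  by rewrite anti_r_tpow // !(scaler0, mulr0).
by split; last exact: step.
Qed.

Lemma lower_r k : sbr true ra (tp k) = (if k is k'.+1 then pp k' else 0) /\ sbr false ra (pp k) = 0.
Proof.
have step j : sbr false d (sbr true ra (tp j)) = 0 -> sbr false ra (pp j) = 0.
  by move=> e; rewrite /pow (sbr_jacobi true true true) ra_d sbr0l add0r /= e mulr0.
elim: k => [|k [_ e]]; first by split=> //; apply: step; rewrite ra_t sbr0r.
have e' : sbr true ra (tp k.+1) = pp k.
  rewrite /= sbrZr -/(pp k) (sbr_jacobi true false false) ra_r e sbr0r mulr0 addr0 /= sbrZl.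
  by have [_ ->] := weight_E k; rewrite !scalerA -mulrA mulVf ?scale1r // mulf_neq0.
by split=> //; apply: step; rewrite e' comm_d_pow.
Qed.

(** The recursion of [tpow] with the factors in reversed order, so that these are the adjoints of
    [tpow] and [pow] as soon as [ta], [da], [ra] are those of [t], [d], [r]. *)
Fixpoint tlow k : A :=
  if k is k'.+1 then (al * k%:R)^-1 *: sbr false (sbr true da (tlow k')) ra else ta.
Definition plow k : A := sbr true da (tlow k).

(** Clifford relations for the odd generators and Heisenberg relations for the even ones. Each is
    reduced along the recursion of [tlow] to the brackets of [ta], [da], [ra] with the raising
    operators; the constants enter through the weights [weight_D] and [weight_E]. *)
Lemma lower_pairs j : [/\ forall k, sbr true (tp k) (tlow j) = (k == j)%:R *: 1,
  forall k, sbr false (pp k) (tlow j) = 0, forall k, sbr false (tp k) (plow j) = 0 &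
  forall k, sbr false (pp k) (plow j) = (- (al * k.+1%:R * (k == j)%:R)) *: 1].
Proof.
have step i : (forall k, sbr true (tp k) (tlow i) = (k == i)%:R *: 1) ->
    (forall k, sbr false (pp k) (tlow i) = 0) ->
    (forall k, sbr false (tp k) (plow i) = 0) /\
    (forall k, sbr false (pp k) (plow i) = (- (al * k.+1%:R * (k == i)%:R)) *: 1).
  move=> e1 e2; split=> k.
    rewrite /plow (sbr_jacobi true true true) e1 /= comm_scalar mulr0 addr0.
    by have [e _] := lower_d k; rewrite (sbr_sym e) sbr0l.
  rewrite /plow (sbr_jacobi false false true) e2 sbr0r mulr0 addr0 /=.
  have [_ e] := lower_d k; rewrite (sbrC false da) e expr0 mulN1r -scaleNr sbrZl e1 scalerA.
  by rewrite mulNr.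
elim: j => [|j [_ _ e3 e4]].
  have e1 k : sbr true (tp k) (tlow 0) = (k == 0)%:R *: 1.
    by rewrite (sbrC true ta) (proj1 (lower_t k)) expr1 opprK mul1r.
  have e2 k : sbr false (pp k) (tlow 0) = 0 by apply: sbr_sym; apply: (proj2 (lower_t k)).
  by have [] := step 0 e1 e2.
have e1 k : sbr true (tp k) (tlow j.+1) = (k == j.+1)%:R *: 1.
  rewrite /= sbrZr -/(plow j) (sbr_jacobi false true false) e3 sbr0l add0r expr0 mul1r /=.
  rewrite (sbrC true ra) expr1 opprK mul1r (proj1 (lower_r k)).
  case: k => [|k]; first by rewrite sbr0r scaler0 scale0r.
  rewrite (sbrC false (pp k)) e4 expr0 mulN1r scaleNr opprK scalerA eqSS.
  case: eqP => [->|_]; last by rewrite mulr0 mulr0.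
  by rewrite mulr1 mulVf // mulf_neq0.
have e2 k : sbr false (pp k) (tlow j.+1) = 0.
  rewrite /= sbrZr -/(plow j) (sbr_jacobi false false false) e4 (sbrC false ra) (proj2 (lower_r k)).
  by rewrite mulr0 sbr0r mulr0 addr0 sbrZl (sbr_sym (comm1 _)) !scaler0.
by have [] := step _ e1 e2.
Qed.

End LoweringRelations.

(** * The Fock model *)

Section BoundedSparts.
Variable M : nat.

(** The bound is on the size of Lambda^circledast. The resulting set is finite and its span is
    preserved by the adjoint operators, so the form can be a finite sum. *)
Definition bounded_sparts : seq spart :=
  [seq L <- undup (flatten [seq sparts n m | n <- iota 0 M.+1, m <- iota 0 M.+1])
     | (deg L + fdeg L <= M)%N].
Local Notation S := bounded_sparts.

Lemma mem_bounded L : (L \in S) = (deg L + fdeg L <= M)%N.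
Proof.
rewrite mem_filter andb_idr // => le; rewrite mem_undup; apply/flattenP.
exists (sparts (deg L) (fdeg L)); last by rewrite mem_sparts !eqxx.
apply/allpairsP; exists (deg L, fdeg L); rewrite !mem_iota /= !ltnS.
by split=> //; lia.
Qed.

Lemma uniq_bounded : uniq S. Proof. by rewrite filter_uniq ?undup_uniq. Qed.

End BoundedSparts.

Section FockModel.
Variables (K : fieldType) (al : K).
Hypothesis al_gen : forall a b : int, al * a%:~R + b%:~R = 0 -> a = 0 /\ b = 0.
Implicit Types (f g u v : spart -> K) (A B : endo K).
Local Notation t := (add_endo al (fun=> 1)).
Local Notation r := (add_endo al id).
Local Notation d := (bump_endo al).
Local Notation ta := (add_adj_endo al (fun=> 1)).
Local Notation ra := (add_adj_endo al id).
Local Notation da := (bump_adj_endo al).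
Local Notation X := (elem_endo al).
Local Notation Y := (telem_endo al).
Local Notation E := (diag_endo (fun L => (deg L)%:R : K)).
Local Notation D := (diag_endo (fun L => (deg L + fdeg L)%:R : K)).

Let al0 : al != 0 := al_neq0 al_gen.
Let char0 n : n.+1%:R != 0 :> K. Proof. by rewrite (natr_gen_eq0 al_gen). Qed.

Lemma natr_inj_gen m n : m%:R = n%:R :> K -> m = n.
Proof.
move=> e; have [] := al_gen (a := 0) (b := m%:Z - n%:Z); last by lia.
by rewrite mulr0 add0r intrD mulrNz -!pmulrn e subrr.
Qed.

Lemma endo_double0 A : A + A = 0 -> A = 0.
Proof.
by move=> A2; apply: (scalerI (char0 1)); rewrite scaler0 scaler_nat mulr2n; exact: A2.
Qed.

Let tt0 : t * t = 0. Proof. by apply: endo_double0; apply: add_endo_anti. Qed.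
Let rr0 : r * r = 0. Proof. by apply: endo_double0; apply: add_endo_anti. Qed.
Let dd0 : d * d = 0. Proof. exact: bump_endo_sqr. Qed.
Let tr0 : sbr true t r = 0. Proof. exact: add_endo_anti. Qed.
Let X0 : X 0 = 1. Proof. by []. Qed.
Let tX n : sbr false t (X n) = 0.
Proof. by rewrite /sbr (elem_endo_add_comm al_gen) subrr. Qed.
Let rX n : sbr false r (X n) = al *: (t * X n - Y n).
Proof. by rewrite /telem_endo /telem_step opprB addrC subrK scalerA divff // scale1r. Qed.
Let dY n : sbr true d (Y n) = n.+1%:R *: X n.+1.
Proof. by rewrite /= scalerA divff // scale1r. Qed.

Definition vtp k : endo K := tpow al t d r k.
(** Indexed like p_k, hence shifted by one against [pow]; the value at 0 merely repeats that at
    1. *)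
Definition vp k : endo K := pow al t d r k.-1.

Lemma telem_newton n : Y n = \sum_(j < n.+1) (-1) ^+ j *: (vtp j * X (n - j)).
Proof. exact: (newtonP al0 char0 tt0 dd0 rr0 tr0 X0 tX rX dY n). Qed.

Lemma elem_newton n :
  n.+1%:R *: X n.+1 = \sum_(j < n.+1) (-1) ^+ j *: (vp j.+1 * X (n - j)).
Proof. exact: (newton_pow char0 dd0 X0 dY (@telem_newton n)). Qed.

Lemma vtp_anti i j : sbr true (vtp i) (vtp j) = 0.
Proof. exact: (tpow_anti al0 char0 tt0 dd0 rr0 tr0 X0 tX rX dY). Qed.
Lemma vp_vtp i j : sbr false (vp i) (vtp j) = 0.
Proof. exact: (pow_tpow al0 char0 tt0 dd0 rr0 tr0 X0 tX rX dY). Qed.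
Lemma vp_vp i j : sbr false (vp i) (vp j) = 0.
Proof. exact: (pow_pow al0 char0 tt0 dd0 rr0 tr0 X0 tX rX dY). Qed.

Lemma grade1 A w : D * A + 0%:R *: A = A * D + w%:R *: A -> sbr false D A = w%:R *: A.
Proof. by rewrite scale0r addr0 /sbr => ->; rewrite addrC addKr. Qed.
Lemma grade1E A w : E * A + 0%:R *: A = A * E + w%:R *: A -> sbr false E A = w%:R *: A.
Proof. by rewrite scale0r addr0 /sbr => ->; rewrite addrC addKr. Qed.

Let D_add h : sbr false D (add_endo al h) = add_endo al h.
Proof.
rewrite -[RHS]scale1r; apply: (grade1 (w := 1)); apply: lift_grade => La k L ek /of_rows_upd[].
by case: (rows La k) ek => a [] //=; lia.
Qed.
Let E_add h : sbr false E (add_endo al h) = 0.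
Proof.
rewrite -(scale0r (add_endo al h)); apply: (grade1E (w := 0)); apply: lift_grade => La k L ek /of_rows_upd[].
by case: (rows La k) ek => a [] //=; lia.
Qed.
Let D_d : sbr false D d = 0.
Proof.
rewrite -(scale0r d); apply: (grade1 (w := 0)); apply: lift_grade => La k L /andP[ek lk] /of_rows_upd[].
by case: (rows La k) ek lk => [[|a] []] //=; lia.
Qed.
Let E_d : sbr false E d = d.
Proof.
rewrite -[RHS]scale1r; apply: (grade1E (w := 1)); apply: lift_grade => La k L /andP[ek lk] /of_rows_upd[].
by case: (rows La k) ek lk => [[|a] []] //=; lia.
Qed.
Let ta_t : sbr true ta t = 1. Proof. exact: add_adj_add_one. Qed.
Let ta_r : sbr true ta r = 0. Proof. exact: add_adj_add_1id. Qed.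
Let ra_t : sbr true ra t = 0. Proof. exact: add_adj_add_id1. Qed.
Let ra_r : sbr true ra r = al *: E. Proof. exact: add_adj_add_idid. Qed.
Let ta_d : sbr true ta d = 0. Proof. exact: add_adj_bump_endo. Qed.
Let ra_d : sbr true ra d = 0. Proof. exact: add_adj_bump_endo. Qed.
Let da_t : sbr true da t = 0. Proof. exact: bump_adj_add_endo. Qed.
Let da_r : sbr true da r = 0. Proof. exact: bump_adj_add_endo. Qed.
Let da_d : sbr true da d = al *: D. Proof. exact: bump_adj_bump_endo. Qed.

Definition vtlow k : endo K := tlow al ta da ra k.
Definition vlow k : endo K := plow al ta da ra k.-1.

Lemma vtlow_vtp j k : sbr true (vtp k) (vtlow j) = (k == j)%:R *: 1.
Proof.
by have [h _ _ _] := lower_pairs al0 char0 dd0 rr0 tr0 ta_t ta_r ta_d da_t da_r da_d ra_t ra_r ra_d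
  (D_add _) (D_add _) D_d (E_add _) (E_add _) E_d j; apply: h.
Qed.
Lemma vtlow_vp j k : sbr false (vp k) (vtlow j) = 0.
Proof.
by have [_ h _ _] := lower_pairs al0 char0 dd0 rr0 tr0 ta_t ta_r ta_d da_t da_r da_d ra_t ra_r ra_d
  (D_add _) (D_add _) D_d (E_add _) (E_add _) E_d j; apply: h.
Qed.
Lemma vlow_vp j k : (0 < j)%N -> (0 < k)%N ->
  sbr false (vp k) (vlow j) = (- (al * k%:R * (k == j)%:R)) *: 1.
Proof.
move=> j0 k0; have [_ _ _ h] := lower_pairs al0 char0 dd0 rr0 tr0 ta_t ta_r ta_d da_t da_r da_d ra_t ra_r ra_d
  (D_add _) (D_add _) D_d (E_add _) (E_add _) E_d j.-1.
by have := h k.-1; rewrite prednK // -eqSS !prednK.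
Qed.

Lemma vtp_weight k : sbr false D (vtp k) = k.+1%:R *: vtp k.
Proof. by have [] := weight_D al (D_add (fun=> 1)) (D_add id) D_d k. Qed.
Lemma vp_weight k : (0 < k)%N -> sbr false D (vp k) = k%:R *: vp k.
Proof. by move=> k0; have [_] := weight_D al (D_add (fun=> 1)) (D_add id) D_d k.-1; rewrite prednK. Qed.

Definition vac : spart -> K := state_delta K zero_rows.

Lemma lift_vac (Q : pred (nat * bool)) (fv : nat * bool -> nat * bool) c :
  (forall w : nat * bool, Q w -> fv w != (0%N, false)) -> lift_op Q fv c vac = fun=> 0.
Proof.
move=> f0; apply/funext=> La; apply: big1 => k Qk.
rewrite /ext; case e: (of_rows _) => [L|] /=; last by rewrite mulr0.
rewrite /vac /state_delta asboolF ?mulr0 //; have /of_rowsP -> := e.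
move=> /(congr1 (fun s => s (k : nat))); rewrite upd_same => e'.
by have := f0 _ Qk; rewrite e' eqxx.
Qed.

Lemma low_vac k : vtlow k vac = (fun=> 0) /\ vlow k.+1 vac = (fun=> 0).
Proof.
have za : forall h, add_adj_endo al h vac = fun=> 0 by move=> h; apply: lift_vac => -[[|a] b].
have zd : da vac = fun=> 0 by apply: lift_vac => -[a b].
have z A : A (fun=> 0) = fun=> 0 by apply/funext=> L; apply: endo0.
have step j : vtlow j vac = (fun=> 0) -> vlow j.+1 vac = (fun=> 0).
  move=> e; apply/funext=> L; rewrite -[LHS]/(da (vtlow j vac) L + vtlow j (da vac) L).
  by rewrite e zd !endo0 addr0.
elim: k => [|k [_ IH]]; first by have e : vtlow 0 vac = (fun=> 0) := za _; split=> //; apply: step.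
have e : vtlow k.+1 vac = (fun=> 0).
  apply/funext=> L; rewrite -[LHS]/((al * k.+1%:R)^-1 * (vlow k.+1 (ra vac) L - ra (vlow k.+1 vac) L)).
  by rewrite IH za !endo0 subrr mulr0.
by split=> //; apply: step.
Qed.

Section Form.
Variable M : nat.
Local Notation S := (bounded_sparts M).

(** A superpartition within the bound has at most [M] rows; the additional empty rows are those on
    which the adjoint coefficients are stable. *)
Definition fnorm L : K := state_norm al M.+3 (rows L).
Definition form u v : K := \sum_(L <- S) u L * v L * fnorm L.
Definition supported v := forall L, v L != 0 -> L \in S.

Lemma form_sym u v : form u v = form v u.
Proof. by apply: eq_bigr => L _; rewrite (mulrC (u L)). Qed.

Lemma ext_sum u s : (forall L, of_rows s = Some L -> u L != 0 -> L \in S) ->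
  ext u s = \sum_(L <- S) u L * `[< s = rows L >]%:R.
Proof.
move=> sS; rewrite /ext; case e: (of_rows s) => [L|] /=; last first.
  by rewrite big1 // => L _; rewrite asboolF ?mulr0 // => e'; rewrite e' of_rowsK in e.
have es : rows L = s by apply/of_rowsP.
have z J : J != L -> u J * `[< s = rows J >]%:R = 0.
  move=> JL; rewrite asboolF ?mulr0 // -es => /rows_inj e'.
  by rewrite e' eqxx in JL.
have [uL|uL] := eqVneq (u L) 0.
  by rewrite uL big1 // => J _; have [->|/z//] := eqVneq J L; rewrite uL mul0r.
rewrite (bigD1_seq L) ?sS ?uniq_bounded //= asboolT // mulr1 big1 ?addr0 // => J; exact: z.
Qed.

(** Only the second argument has to lie within the bound: the form ignores what [u] has outside, but
    [A] could bring it back inside, and this is ruled out by testing against vectors that [B] keeps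
    inside. *)
Definition adjoint A B := (forall u v, supported v -> form (A u) v = form u (B v)) /\
  (forall v, supported v -> supported (B v)).

Lemma size_circ_bounded L : L \in S -> (size (circ L) < M.+3)%N.
Proof. by rewrite mem_bounded => le; have := size_circ_le L; lia. Qed.

(** Both sides are sums over triples of two superpartitions and a move between them. [move_swap]
    reverses the moves, and the last hypothesis exchanges the coefficients by means of the norms. *)
Lemma lift_adjoint (Q Q' : pred (nat * bool)) (f f' : nat * bool -> nat * bool)
    (c c' : nat -> rowstate -> nat -> K) : inverse_moves Q Q' f f' ->
  size_stable (fun N => row_op N Q f (c N)) -> size_stable (fun N => row_op N Q' f' (c' N)) ->
  (forall w : nat * bool, Q' w -> w.1 + w.2 <= (f' w).1 + (f' w).2)%N ->
  (forall Om k, (k < M.+3)%N -> Q' (rows Om k) -> stacked (upd (rows Om) k (f' (rows Om k))) ->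
     let s := upd (rows Om) k (f' (rows Om k)) in
     c M.+3 s k * state_norm al M.+3 s = fnorm Om * c' M.+3 (rows Om) k) ->
  adjoint (lift_op Q f c) (lift_op Q' f' c').
Proof.
move=> inv stab stab' up cc.
have up' (w : nat * bool) : Q w -> ((f w).1 + (f w).2 <= w.1 + w.2)%N.
  by move=> Qw; have [Q'v e] := inv.1 _ Qw; have := up _ Q'v; rewrite e.
split=> [u v sv|v sv Om]; last first.
  rewrite mem_bounded => nz.
  have [k Qk /= nzk] : exists2 k : 'I_(size (circ Om)).+1, Q' (rows Om k) &
      ext v (upd (rows Om) k (f' (rows Om k))) != 0.
    apply: contraPP nz => /forall2NP no; apply/negP; rewrite negbK; apply/eqP.
    by apply: big1 => k Qk; case: (no k) => // /negP; rewrite negbK => /eqP->; rewrite mulr0.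
  move: nzk; rewrite /ext; case e: (of_rows _) => [L|] /=; last by rewrite eqxx.
  move=> /sv; rewrite mem_bounded; have [_ _ eD] := of_rows_upd e.
  by have := up _ Qk; lia.
rewrite /form.
transitivity (\sum_(L <- S) \sum_(Om <- S) \sum_(k < M.+3 | Q (rows L k))
   rsgn K (rows L) k * c M.+3 (rows L) k * v L * fnorm L * u Om *
     `[< upd (rows L) k (f (rows L k)) = rows Om >]%:R).
  rewrite big_seq [RHS]big_seq; apply: eq_bigr => L LS.
  rewrite (@lift_at _ Q f c stab M.+3) ?size_circ_bounded // exchange_big /row_op !mulr_suml.
  apply: eq_bigr => k Qk; rewrite ext_sum ?mulr_sumr ?mulr_suml.
    by apply: eq_bigr => Om _; ring.
  move=> J e _; have [_ _ eD] := of_rows_upd e; have := up' _ Qk.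
  by move: LS; rewrite !mem_bounded; lia.
rewrite exchange_big big_seq [RHS]big_seq; apply: eq_bigr => Om OmS.
rewrite (@lift_at _ Q' f' c' stab' M.+3) ?size_circ_bounded // /row_op mulr_sumr mulr_suml.
transitivity (\sum_(L <- S) \sum_(k < M.+3 | Q' (rows Om k))
  rsgn K (rows Om) k * c' M.+3 (rows Om) k * v L * fnorm Om * u Om *
     `[< upd (rows Om) k (f' (rows Om k)) = rows L >]%:R).
  apply: eq_bigr => L _.
  rewrite (move_swap _ _ _ (fun k => rsgn K (rows L) k * c M.+3 (rows L) k * v L * fnorm L * u Om) inv).
  apply: eq_bigr => k Qk.
  have [e|ne] := pselect (upd (rows Om) k (f' (rows Om k)) = rows L); last by rewrite asboolF ?mulr0.
  rewrite asboolT // !mulr1 /fnorm -e; have := @cc Om k (ltn_ord k) Qk; rewrite /= e.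
  move=> /(_ (@rows_stacked L)) ck; rewrite -{1}e rsgn_upd_le //.
  transitivity (rsgn K (rows Om) k * (c M.+3 (rows L) k * state_norm al M.+3 (rows L)) * v L * u Om); first by ring.
  by rewrite ck /fnorm; ring.
rewrite exchange_big; apply: eq_bigr => k Qk.
rewrite (@ext_sum v); last by move=> J _; apply: sv.
by rewrite !(mulr_sumr, mulr_suml); apply: eq_bigr => L _; ring.
Qed.

Lemma add_adjoint h : adjoint (add_endo al h) (add_adj_endo al h).
Proof.
apply: lift_adjoint add_inverse (@add_stab _ al h) (@add_adj_stab _ al al_gen h) _ _.
  by move=> [a b] /= _; lia.
move=> Om k kM ek st /=; rewrite mulrAC /add_coef ustar_upd_id // -/(add_coef _ _ _) (add_norm al_gen) //.
by rewrite mulrA.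
Qed.

Lemma bump_adjoint : adjoint d da.
Proof.
apply: lift_adjoint bump_inverse (@bump_stab _ al) (@bump_adj_stab _ al al_gen) _ _.
  by move=> [a []] //= _; lia.
move=> Om k kM ek st; cbv zeta; rewrite -(bump_norm al_gen kM ek (@rows_stacked Om) st); congr (_ * _).
rewrite /bump_coef ucirc_upd_id //.
by case: (rows Om k) ek => a [] //= _; lia.
Qed.

Lemma adjoint_mul A B A' B' : adjoint A B -> adjoint A' B' -> adjoint (A * A') (B' * B).
Proof.
move=> [a s] [a' s']; split=> [u v sv|v sv]; last by apply/s'/s.
by rewrite -[LHS]/(form (A (A' u)) v) a // a' //; apply: s.
Qed.

Lemma formDl u u' v : form (fun L => u L + u' L) v = form u v + form u' v.
Proof. by rewrite /form -big_split; apply: eq_bigr => L _; rewrite !mulrDl. Qed.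
Lemma formZl (k : K) u v : form (fun L => k * u L) v = k * form u v.
Proof. by rewrite /form mulr_sumr; apply: eq_bigr => L _; rewrite !mulrA. Qed.

Lemma adjoint_add A B A' B' : adjoint A B -> adjoint A' B' -> adjoint (A + A') (B + B').
Proof.
move=> [a s] [a' s']; split=> [u v sv|v sv L].
  by rewrite (formDl (A u)) a // a' // form_sym (form_sym u) -formDl form_sym.
rewrite endo_addE; have [-> |BL _] := eqVneq (B v L) 0; first by rewrite add0r; apply: s'.
exact: s BL.
Qed.

Lemma adjoint_scale (k : K) A B : adjoint A B -> adjoint (k *: A) (k *: B).
Proof.
move=> [a s]; split=> [u v sv|v sv L].
  by rewrite (formZl k (A u)) a // form_sym -formZl form_sym.
by rewrite -[X in X != 0]/(k * B v L) mulf_eq0 negb_or => /andP[_]; apply: s.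
Qed.

Lemma adjoint_opp A B : adjoint A B -> adjoint (- A) (- B).
Proof. by rewrite -!scaleN1r; apply: adjoint_scale. Qed.

Lemma low_adjoint k : adjoint (vtp k) (vtlow k) /\ adjoint (vp k.+1) (vlow k.+1).
Proof.
have step j : adjoint (vtp j) (vtlow j) -> adjoint (vp j.+1) (vlow j.+1).
  move=> a; rewrite /vp /pow /vlow /plow /sbr [da * _ + _]addrC.
  by apply: adjoint_add; apply: adjoint_mul => //; apply: bump_adjoint.
elim: k => [|k [_ IH]]; first by have a := add_adjoint (fun=> 1); split=> //; apply: step.
have a : adjoint (vtp k.+1) (vtlow k.+1).
  apply: adjoint_scale; apply: adjoint_add; last apply: adjoint_opp; apply: adjoint_mul => //; exact: add_adjoint.
by split=> //; apply: step.
Qed.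


Definition vword (w : seq nat * seq nat) : endo K :=
  (\prod_(k <- w.1) vtp k) * \prod_(k <- w.2) vp k.
Definition vvec w : spart -> K := vword w vac.
Definition word_weight (w : seq nat * seq nat) : nat := (sumn (map succn w.1) + sumn w.2)%N.
Definition positive (b : seq nat) := all (leq 1) b.

Lemma D_vac L : D vac L = 0.
Proof.
rewrite -[LHS]/((deg L + fdeg L)%:R * vac L) /vac /state_delta.
have [e|ne] := pselect (rows L = zero_rows); last by rewrite asboolF ?mulr0.
rewrite (@tdegE _ (size (circ L))) // big1 ?mul0r // => k _.
by rewrite e.
Qed.

Lemma vword_weight w : positive w.2 -> sbr false D (vword w) = (word_weight w)%:R *: vword w.
Proof.
case: w => a b /= pos.
have ea : sbr false D (\prod_(k <- a) vtp k) = (sumn (map succn a))%:R *: \prod_(k <- a) vtp k.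
  elim: a => [|k a IH]; first by rewrite !big_nil comm1 scale0r.
  rewrite !big_cons (sbrMr false false) vtp_weight IH expr0 mul1r.
  by rewrite -scalerAl -scalerAr -scalerDl natrD.
have eb : sbr false D (\prod_(k <- b) vp k) = (sumn b)%:R *: \prod_(k <- b) vp k.
  elim: b pos => [|k b IH] /=; first by rewrite !big_nil comm1 scale0r.
  move=> /andP[k0 pos]; rewrite !big_cons (sbrMr false false) vp_weight // IH // expr0 mul1r.
  by rewrite -scalerAl -scalerAr -scalerDl natrD.
rewrite /vword (sbrMr false false) /= ea eb expr0 mul1r.
by rewrite -scalerAl -scalerAr -scalerDl natrD.
Qed.

Lemma vvec_weight w L : positive w.2 -> vvec w L != 0 -> (deg L + fdeg L)%N = word_weight w.
Proof.
move=> /vword_weight e; have := congr1 (fun A : endo K => A vac L) e.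
rewrite -[LHS]/(D (vvec w) L - vword w (D vac) L) -[RHS]/((word_weight w)%:R * vvec w L).
have -> : D vac = fun=> 0 by apply/funext=> J; apply: D_vac.
rewrite endo0 subr0 -[LHS]/((deg L + fdeg L)%:R * vvec w L) => e' nz.
have {}e' := mulIf nz e'; have [//|ne] := eqVneq (deg L + fdeg L)%N (word_weight w).
exact: natr_inj_gen e'.
Qed.

Lemma low_tword k s : k \notin s -> forall A, exists B,
  vtlow k * ((\prod_(j <- s) vtp j) * A) = B * (vtlow k * A).
Proof.
elim: s => [|j s IH] /= ks A; first by exists 1; rewrite big_nil !mul1r.
move: ks; rewrite inE negb_or => /andP[kj ks]; have [B e] := IH ks A.
exists (- vtp j * B); rewrite big_cons -[RHS]mulrA -e !mulrA; congr (_ * _ * _).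
have := vtlow_vtp k j; rewrite eq_sym (negPf kj) scale0r /sbr => /eqP.
by rewrite addrC addr_eq0 => /eqP->; rewrite mulNr.
Qed.

Lemma vtlow_bword k b : vtlow k * (\prod_(j <- b) vp j) = (\prod_(j <- b) vp j) * vtlow k.
Proof.
elim: b => [|j b IH]; first by rewrite big_nil mul1r mulr1.
rewrite !big_cons -mulrA -IH !mulrA; congr (_ * _).
by have := vtlow_vp k j; rewrite /sbr => /eqP; rewrite subr_eq0 => /eqP.
Qed.

Lemma vtlow_notin k a b : k \notin a -> vtlow k (vvec (a, b)) = fun=> 0.
Proof.
move=> ka; have [B e] := low_tword ka (\prod_(j <- b) vp j).
have ev : vtlow k (vvec (a, b)) = (vtlow k * ((\prod_(j <- a) vtp j) * (\prod_(j <- b) vp j))) vac by [].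
rewrite ev e vtlow_bword -[LHS]/((B * \prod_(j <- b) vp j) (vtlow k vac)).
have [-> _] := low_vac k; apply/funext=> L; exact: endo0.
Qed.

Lemma vvec_cons k a b : vvec (k :: a, b) = vtp k (vvec (a, b)).
Proof. by rewrite /vvec /vword big_cons -mulrA. Qed.

Lemma vtlow_head k a b : k \notin a -> vtlow k (vvec (k :: a, b)) = vvec (a, b).
Proof.
move=> ka; have /= := vtlow_vtp k k; rewrite eqxx scale1r /sbr => e.
have ev : vtlow k (vvec (k :: a, b)) = (vtlow k * vtp k) (vvec (a, b)).
  by rewrite vvec_cons.
have this : vtlow k * vtp k = 1 - vtp k * vtlow k by rewrite -e; ncring.
rewrite ev this; apply/funext=> L.
by rewrite -[LHS]/(vvec (a, b) L - vtp k (vtlow k (vvec (a, b))) L) vtlow_notin // endo0 subr0.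
Qed.

Lemma bword_rem j b : j \in b -> \prod_(i <- b) vp i = vp j * \prod_(i <- rem j b) vp i.
Proof.
elim: b => //= i b IH; rewrite inE eq_sym; case: eqVneq => [->|_] /= jb; first by rewrite big_cons.
rewrite !big_cons IH // !mulrA; congr (_ * _).
by apply/eqP; rewrite -subr_eq0; apply/eqP; apply: vp_vp.
Qed.

Lemma vlow_bword k b : (0 < k)%N -> positive b ->
  vlow k * (\prod_(j <- b) vp j) = (\prod_(j <- b) vp j) * vlow k +
    (al * k%:R * (count_mem k b)%:R) *: \prod_(j <- rem k b) vp j.
Proof.
move=> k0; elim: b => [|j b IH] /=; first by rewrite !big_nil mul1r mulr1 mulr0 scale0r addr0.
move=> /andP[j0 pos]; rewrite big_cons mulrA.
have -> : vlow k * vp j = vp j * vlow k + (al * j%:R * (j == k)%:R) *: 1.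
  by have := vlow_vp k0 j0; rewrite scaleNr /sbr => e; rewrite -[_ *: 1]opprK -e; ncring.
rewrite mulrDl -mulrA IH // mulrDr !mulrA -addrA; congr (_ + _).
rewrite -scalerAl mul1r -scalerAr; case: (eqVneq j k) => [->|jk] /=; last first.
  by rewrite mulr0 scale0r addr0 add0n big_cons.
rewrite mulr1 natrD mulrDr mulr1 scalerDl addrC; congr (_ + _).
have [kb|kb] := boolP (k \in b); first by rewrite (bword_rem kb).
by rewrite (count_memPn kb) mulr0 !scale0r.
Qed.

Lemma vlow_bvec k b : (0 < k)%N -> positive b ->
  vlow k (vvec ([::], b)) = fun L => (al * k%:R * (count_mem k b)%:R) * vvec ([::], rem k b) L.
Proof.
move=> k0 pos; apply/funext=> L; rewrite /vvec /vword !big_nil.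
have -> : vlow k ((1 * \prod_(i <- b) vp i) vac) L = (vlow k * \prod_(i <- b) vp i) vac L by rewrite mul1r.
rewrite vlow_bword // -[LHS]/((\prod_(j <- b) vp j) (vlow k vac) L + al * k%:R * (count_mem k b)%:R * (\prod_(j <- rem k b) vp j) vac L).
by case: k k0 => // k _; have [_ ->] := low_vac k; rewrite endo0 add0r mul1r.
Qed.

Lemma zee_cons r b : zee (r :: b) = (zee b * (r * (count_mem r b).+1))%N.
Proof.
have wide (s c : seq nat) : uniq s -> {subset c <= s} ->
    zee c = (\prod_(i <- s) (i ^ count_mem i c * (count_mem i c)`!))%N.
  move=> us cs; rewrite /zee [RHS](bigID (mem c)) /= [X in (_ * X)%N]big1 ?muln1.
    rewrite -[RHS]big_filter; apply: perm_big; apply: uniq_perm; rewrite ?undup_uniq ?filter_uniq //.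
    by move=> i; rewrite mem_undup mem_filter andb_idr //; apply: cs.
  by move=> i /count_memPn ->.
have us := undup_uniq (r :: b).
rewrite (wide (undup (r :: b))) // => [|i]; last by rewrite mem_undup.
rewrite (wide (undup (r :: b)) b) // => [|i ib]; last by rewrite mem_undup inE ib orbT.
have rin : r \in undup (r :: b) by rewrite mem_undup mem_head.
rewrite (bigD1_seq r) //= [in RHS](bigD1_seq r) //= eqxx add1n factS expnS.
rewrite (eq_bigr (fun i => i ^ count_mem i b * (count_mem i b)`!)%N).
  by ring.
by move=> i ir; rewrite eq_sym (negPf ir) add0n.
Qed.

Lemma weight_supported w : positive w.2 -> (word_weight w <= M)%N -> supported (vvec w).
Proof. by move=> pos le L nz; rewrite mem_bounded (vvec_weight pos nz). Qed.

Lemma form_vtp k u v : supported v -> form (vtp k u) v = form u (vtlow k v).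
Proof. by have [[a _] _] := low_adjoint k; apply: a. Qed.
Lemma form_vp k u v : (0 < k)%N -> supported v -> form (vp k u) v = form u (vlow k v).
Proof. by case: k => // k _; have [_ [a _]] := low_adjoint k; apply: a. Qed.

Lemma form0r u : form u (fun=> 0) = 0.
Proof. by rewrite /form big1 // => L _; rewrite mulr0 mul0r. Qed.

(** The adjoint of p_k acts on words as [al] k times the derivative in p_k: it removes one of the
    copies of [k], with their number as a factor. By [zee_cons] the normalisation obeys the same
    recursion. *)
Lemma form_bvec b b' : positive b -> positive b' -> (sumn b <= M)%N -> (sumn b' <= M)%N ->
  form (vvec ([::], b)) (vvec ([::], b')) =
    (perm_eq b b')%:R * (al ^+ size b * (zee b)%:R) * form vac vac.
Proof.
have v0 : vvec ([::], [::]) = vac by rewrite /vvec /vword !big_nil mulr1.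
elim: b b' => [|k b IH] b'.
  case: b' => [|k b'] _ /=; first by rewrite v0 expr0 /zee big_nil !mul1r.
  move=> /andP[k0 pos] _ le.
  have -> : perm_eq [::] (k :: b') = false by apply/negP => /perm_size.
  rewrite form_sym !mul0r.
  rewrite (_ : vvec ([::], k :: b') = vp k (vvec ([::], b'))); last by rewrite /vvec /vword !big_nil big_cons !mul1r.
  rewrite form_vp //; last by rewrite v0 -v0; apply: weight_supported.
  rewrite v0; case: k k0 {le} => // k _; have [_ ->] := low_vac k; exact: form0r.
move=> /= /andP[k0 pos] pos' le le'.
rewrite (_ : vvec ([::], k :: b) = vp k (vvec ([::], b))); last by rewrite /vvec /vword !big_nil big_cons !mul1r.
rewrite form_vp //; last by apply: weight_supported.
rewrite vlow_bvec // form_sym formZl form_sym IH //; first last.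
- apply: leq_trans le'; have [kb|/rem_id -> //] := boolP (k \in b').
  by rewrite (perm_sumn (perm_to_rem kb)) leq_addl.
- by apply: leq_trans le; rewrite leq_addl.
- by apply/allP => i /mem_rem; apply: (allP pos').
rewrite zee_cons exprS !natrM.
have [kb|kb] := boolP (k \in b'); last first.
  rewrite (count_memPn kb) mulr0 mul0r (_ : perm_eq (k :: b) b' = false) ?mul0r //.
  by apply: contraNF kb => /perm_mem <-; rewrite mem_head.
have -> : perm_eq (k :: b) b' = perm_eq b (rem k b').
  by rewrite (permPr (perm_to_rem kb)) perm_cons.
case: (boolP (perm_eq b (rem k b'))) => [h|]; last by rewrite !(mul0r, mulr0).
have -> : count_mem k b' = (count_mem k b).+1.
  by rewrite (seq.permP (perm_to_rem kb)) /= eqxx (seq.permP h).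
by rewrite !mul1r; ring.
Qed.

Lemma gtn_notin k (a : seq nat) : sorted gtn (k :: a) -> k \notin a.
Proof.
move=> /= so; have /allP h := order_path_min (rev_trans ltn_trans) so.
by apply/negP => /h /=; rewrite ltnn.
Qed.

(** The odd labels decrease, so the heads are the largest ones. If they differ, the lowering
    operator of the larger one annihilates the other word; if they agree, both are removed. *)
Theorem form_vvec a b a' b' : sorted gtn a -> sorted gtn a' -> positive b -> positive b' ->
  (word_weight (a, b) <= M)%N -> (word_weight (a', b') <= M)%N ->
  form (vvec (a, b)) (vvec (a', b')) =
    ((a == a') && perm_eq b b')%:R * (al ^+ size b * (zee b)%:R) * form vac vac.
Proof.
have lead k l s l' s' : sorted gtn (k :: l) -> positive s -> positive s' ->
    (word_weight (k :: l, s) <= M)%N -> (word_weight (l', s') <= M)%N ->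
    k \notin l' -> form (vvec (k :: l, s)) (vvec (l', s')) = 0.
  move=> so pos pos' le le' kl'; rewrite vvec_cons form_vtp; last exact: weight_supported.
  by rewrite vtlow_notin // form0r.
elim: a a' => [|k a IH] [|k' a'] so so' pos pos' le le'.
- exact: form_bvec.
- by rewrite form_sym lead // !mul0r.
- by rewrite lead // !mul0r.
case: (ltngtP k k') => [lt|lt|e]; last first.
- rewrite -{}e in so' le' *; rewrite vvec_cons form_vtp; last exact: weight_supported.
  rewrite vtlow_head ?gtn_notin // IH ?eqseq_cons ?eqxx //.
  + exact: path_sorted so.
  + exact: path_sorted so'.
  + by apply: leq_trans le; rewrite /word_weight /= leq_add2r leq_addl.
  by apply: leq_trans le'; rewrite /word_weight /= leq_add2r leq_addl.
- rewrite lead ?eqseq_cons ?(gtn_eqF lt) ?mul0r // inE negb_or gtn_eqF //=.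
  have /allP h := order_path_min (rev_trans ltn_trans) so'.
  by apply/negP => /h /=; rewrite ltnNge (ltnW lt).
rewrite form_sym lead ?eqseq_cons ?(ltn_eqF lt) ?mul0r // inE negb_or gtn_eqF //=.
have /allP h := order_path_min (rev_trans ltn_trans) so.
by apply/negP => /h /=; rewrite ltnNge (ltnW lt).
Qed.

Lemma form_delta La Om : La \in S -> form (state_delta K (rows La)) (state_delta K (rows Om)) =
  (La == Om)%:R * fnorm La.
Proof.
move=> LS; rewrite /form (bigD1_seq La) ?uniq_bounded //= !state_delta_eq eqxx mul1r.
by rewrite big1 ?addr0 // => L LLa; rewrite state_delta_eq (negPf LLa) !mul0r.
Qed.

Lemma fnorm_neq0 La : fnorm La != 0.
Proof. exact: (state_norm_neq0 al_gen _ (@rows_stacked La)). Qed.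

Lemma form_vac_neq0 : form vac vac != 0.
Proof.
have [L0 e0] := empty_spart; rewrite /vac -e0 form_delta ?eqxx ?mul1r ?fnorm_neq0 //.
by rewrite mem_bounded (@tdegE _ (size (circ L0))) // e0 big1.
Qed.

End Form.
End FockModel.

(** * Superpolynomials *)

Section Superpolynomials.
Variables (N : nat) (K : fieldType).
Local Notation sp := (superpoly N K).
Implicit Types (f g : sp) (p q : {mpoly K[N]}) (i j : 'I_N) (A B S : {set 'I_N}).

Definition spc p : sp := [ffun S => if S == set0 then p else 0].

Lemma spcMl p f S : (spc p * f) S = p * f S.
Proof.
rewrite ffunE (bigD1 set0) ?sub0set //= ffunE eqxx ninv0l expr0 mul1r setD0.
by rewrite big1 ?addr0 // => A /andP[_ A0]; rewrite ffunE (negPf A0) mul0r mulr0.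
Qed.

Lemma spcMr p f S : (f * spc p) S = p * f S.
Proof.
rewrite ffunE (bigD1 S) //= ffunE setDv eqxx ninv0r expr0 mul1r mulrC.
rewrite big1 ?addr0 // => A /andP[AS AnS]; rewrite ffunE setD_eq0; case: ifP => [SA|_]; last by rewrite !mulr0.
by rewrite eqEsubset AS SA in AnS.
Qed.

Lemma spc_comm p f : spc p * f = f * spc p.
Proof. by apply/ffunP=> S; rewrite spcMl spcMr. Qed.

Lemma spcD p q : spc (p + q) = spc p + spc q.
Proof. by apply/ffunP=> S; rewrite !ffunE; case: ifP => // _; rewrite addr0. Qed.
Lemma spc0 : spc 0 = 0.
Proof. by apply/ffunP=> S; rewrite !ffunE; case: ifP. Qed.
Lemma spcM p q : spc (p * q) = spc p * spc q.
Proof. by apply/ffunP=> S; rewrite spcMl !ffunE; case: ifP => // _; rewrite mulr0. Qed.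
Lemma spc1 : spc 1 = 1. Proof. by []. Qed.
Lemma spcX p n : spc (p ^+ n) = spc p ^+ n.
Proof. by elim: n => // n IH; rewrite !exprS spcM IH. Qed.
Lemma spcZ (c : K) p : spc (c *: p) = c *: spc p.
Proof. by apply/ffunP=> S; rewrite !ffunE; case: ifP => // _; rewrite scaler0. Qed.
Lemma spc_sum (I : Type) (s : seq I) (P : pred I) (F : I -> {mpoly K[N]}) :
  spc (\sum_(x <- s | P x) F x) = \sum_(x <- s | P x) spc (F x).
Proof. exact: (big_morph spc spcD spc0). Qed.
Lemma spc_prod (I : Type) (s : seq I) (P : pred I) (F : I -> {mpoly K[N]}) :
  spc (\prod_(x <- s | P x) F x) = \prod_(x <- s | P x) spc (F x).
Proof. exact: (big_morph spc spcM spc1). Qed.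
Lemma spc_inj : injective spc.
Proof. by move=> p q /ffunP/(_ set0); rewrite !ffunE eqxx. Qed.
Lemma zvarE i : zvar i = spc 'X_i. Proof. by []. Qed.

Lemma thetaM i f S : (theta i * f) S =
  if i \in S then (-1) ^+ ninv [set i] (S :\ i) * f (S :\ i) else 0.
Proof.
rewrite ffunE; case: ifP => iS.
  rewrite (bigD1 [set i]) ?sub1set //= ffunE eqxx mul1r big1 ?addr0 // => A /andP[_ Ai].
  by rewrite ffunE (negPf Ai) mul0r mulr0.
apply: big1 => A AS; rewrite ffunE; case: eqP => [e|_]; last by rewrite mul0r mulr0.
by move: AS; rewrite e sub1set iS.
Qed.

Lemma theta_anti i j : theta i * theta j = - (theta j * theta i) :> sp.
Proof.
suff anti : forall f, theta i * (theta j * f) = - (theta j * (theta i * f)).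
  by have := anti 1; rewrite !mulr1.
move=> f; apply/ffunP=> S; rewrite [RHS]ffunE !thetaM !inE.
case: (eqVneq i j) => [<-|ij]; first by rewrite /= !mulr0 !if_same oppr0.
rewrite /=; case: (boolP (i \in S)) => iS; case: (boolP (j \in S)) => jS /=; rewrite ?mulr0 ?oppr0 //.
have nv x y : x \in S -> y \in S -> x != y ->
    ninv [set x] (S :\ x) = ((y < x) + ninv [set x] (S :\ x :\ y))%N.
  move=> xS yS xy; rewrite -(setD1K (_ : y \in S :\ x)) ?inE 1?eq_sym ?xy // ninvUr; last first.
    by apply/pred0P=> z /=; rewrite !inE; case: eqP.
  rewrite [in RHS]setD1K ?inE 1?eq_sym ?xy //; congr (_ + _)%N.
  rewrite /ninv; case: (ltnP y x) => lt.
    rewrite (_ : [set _ in _ | _] = [set (x, y)]) ?cards1 //; apply/setP=> -[a b]; rewrite !inE /= xpair_eqE.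
    by case: eqP => //= ->; case: eqP => //= ->; rewrite lt.
  apply/eqP; rewrite cards_eq0; apply/eqP/setP=> -[a b]; rewrite !inE /=.
  by apply/negP => /andP[/andP[/eqP-> /eqP->]]; rewrite ltnNge lt.
have sw : S :\ i :\ j = S :\ j :\ i by rewrite !setDDl setUC.
rewrite (nv i j) // (nv j i) 1?eq_sym // sw !exprD !mulrA.
case: (ltngtP (i : nat) j) => [lt|lt|e]; last by rewrite (val_inj e) eqxx in ij.
  by rewrite expr0 expr1 !mul1r !mulN1r !mulNr opprK [_ * (-1) ^+ _]mulrC.
by rewrite expr0 expr1 !mul1r !mulN1r !mulNr [_ * (-1) ^+ _]mulrC.
Qed.

Definition spow r : sp := spc (\sum_i 'X_i ^+ r).
Definition stpow k : sp := \sum_i theta i * spc ('X_i ^+ k).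

Lemma stpow_anti k l : stpow k * stpow l = - (stpow l * stpow k).
Proof.
rewrite /stpow !mulr_suml -sumrN; under eq_bigr do rewrite mulr_sumr.
rewrite exchange_big; apply: eq_bigr => j _; rewrite mulr_sumr -sumrN; apply: eq_bigr => i _.
rewrite mulrA -(mulrA (theta i)) spc_comm mulrA theta_anti mulNr mulNr; congr (- _).
by rewrite -!mulrA; congr (_ * _); rewrite [RHS]mulrA spc_comm -mulrA [in RHS]spc_comm.
Qed.

Definition xprod B : {mpoly K[N]} := \prod_(i in B) 'X_i.
Definition esum (n : nat) : {mpoly K[N]} := \sum_(B : {set 'I_N} | #|B| == n) xprod B.
(** The elementary symmetric polynomial in the variables other than z_i, the coefficient of theta_i
    in tilde e_n. *)
Definition esum_at i (n : nat) : {mpoly K[N]} := \sum_(B : {set 'I_N} | (#|B| == n) && (i \notin B)) xprod B.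

Lemma esum0 : esum 0 = 1.
Proof.
rewrite /esum (big_pred1 set0) => [|B]; last by rewrite cards_eq0.
by rewrite /xprod big_set0.
Qed.

Lemma esum_at0 i : esum_at i 0 = 1.
Proof.
rewrite /esum_at (big_pred1 set0) => [|B]; first by rewrite /xprod big_set0.
by rewrite cards_eq0 andb_idr // => /eqP->; rewrite inE.
Qed.

Lemma sum_add_point i n (F : {set 'I_N} -> {mpoly K[N]}) :
  \sum_(C : {set 'I_N} | (#|C| == n.+1) && (i \in C)) F C =
  \sum_(B : {set 'I_N} | (#|B| == n) && (i \notin B)) F (i |: B).
Proof.
rewrite (reindex_onto (fun B => i |: B) (fun C => C :\ i)) /=; last by move=> C /andP[_ /setD1K].
apply: eq_bigl => B; rewrite setU11 andbT cardsU1.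
case: (boolP (i \in B)) => iB /=.
  rewrite andbF; apply/negP => /andP[_ /eqP e]; move: iB.
  by rewrite -e !inE eqxx.
by rewrite setU1K // eqxx add1n eqSS !andbT.
Qed.

Lemma xprod_add i B : i \notin B -> xprod (i |: B) = 'X_i * xprod B.
Proof. by move=> iB; rewrite /xprod big_setU1. Qed.

Lemma esum_split i n : esum n.+1 = esum_at i n.+1 + 'X_i * esum_at i n.
Proof.
rewrite /esum (bigID (fun B : {set 'I_N} => i \in B)) /= addrC; congr (_ + _).
rewrite sum_add_point mulr_sumr; apply: eq_bigr => B /andP[_ iB].
exact: xprod_add.
Qed.

(** Repeated use of e_n = e_n(without z_i) + z_i e_(n-1)(without z_i). Multiplied by theta_i and
    summed over i it is Newton's formula for tilde e_n; with z_i instead, the one for e_(n+1). *)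
Lemma esum_atE i n : esum_at i n = \sum_(j < n.+1) (-1) ^+ j *: ('X_i ^+ j * esum (n - j)).
Proof.
elim: n => [|n IH]; first by rewrite big_ord1 esum_at0 esum0 expr0 scale1r expr0 mulr1.
rewrite big_ord_recl !expr0 scale1r mul1r subn0 (esum_split i) IH -addrA mulr_sumr -big_split /=.
rewrite big1 ?addr0 // => j _; rewrite subSS !exprS -mulrA mulN1r scaleNr -scalerAr.
by rewrite subrr.
Qed.

Lemma esum_points n : n.+1%:R *: esum n.+1 = \sum_i 'X_i * esum_at i n.
Proof.
rewrite /esum scaler_sumr.
transitivity (\sum_i \sum_(C : {set 'I_N} | (#|C| == n.+1) && (i \in C)) xprod C).
  rewrite (exchange_big_dep (fun C : {set 'I_N} => #|C| == n.+1)) /=; last by move=> i C _ /andP[].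
  apply: eq_bigr => C /eqP cC; rewrite (eq_bigl (mem C)) ?sumr_const ?cC ?scaler_nat //.
  by move=> i; rewrite eqxx.
apply: eq_bigr => i _; rewrite sum_add_point /esum_at mulr_sumr.
by apply: eq_bigr => B /andP[_]; apply: xprod_add.
Qed.

Definition selem (n : nat) : sp := spc (esum n).
Definition stelem (n : nat) : sp := \sum_i theta i * spc (esum_at i n).

Lemma stelem_newton n : stelem n = \sum_(j < n.+1) (-1) ^+ j *: (stpow j * selem (n - j)).
Proof.
rewrite /stelem; under eq_bigr do rewrite esum_atE spc_sum mulr_sumr.
rewrite exchange_big; apply: eq_bigr => j _; rewrite /stpow mulr_suml scaler_sumr.
by apply: eq_bigr => i _; rewrite spcZ spcM -scalerAr mulrA.
Qed.

Lemma selem_newton n : n.+1%:R *: selem n.+1 = \sum_(j < n.+1) (-1) ^+ j *: (spow j.+1 * selem (n - j)).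
Proof.
rewrite /selem -spcZ esum_points; under eq_bigr do rewrite esum_atE mulr_sumr.
rewrite exchange_big spc_sum; apply: eq_bigr => j _; rewrite /spow -spcM -spcZ mulr_suml scaler_sumr.
by congr spc; apply: eq_bigr => i _; rewrite -scalerAr mulrA -exprS.
Qed.

Lemma theta_spc i p S : (theta i * spc p) S = if S == [set i] then p else 0.
Proof. by rewrite spcMr ffunE; case: ifP => _; rewrite ?mulr1 ?mulr0. Qed.

Implicit Types m : 'X_{1..N}.

Lemma mcoeff_mulX p (k m : 'X_{1..N}) : ('X_[k] * p)@_m = if (k <= m)%MM then p@_(m - k) else 0.
Proof.
case: ifP => [le|/negP nle]; first by rewrite -[in LHS](submK le) addmC mulrC mcoeffMX.
apply/eqP/negPn; rewrite -mcoeff_msupp mulrC (perm_mem (msuppMX _ _)).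
by apply/negP => /mapP[m' _ e]; apply: nle; rewrite e; apply/mnm_lepP => i; rewrite mnmDE leq_addr.
Qed.

Definition set_mnm B : 'X_{1..N} := [multinom (i \in B : nat) | i < N].

Lemma xprodE B : xprod B = 'X_[set_mnm B].
Proof.
rewrite mpolyXE_id /xprod big_mkcond; apply: eq_bigr => i _.
by rewrite mnmE; case: (i \in B); rewrite ?expr0 ?expr1.
Qed.

Lemma set_mnm_inj : injective set_mnm.
Proof.
move=> B C /mnmP e; apply/setP => i; have := e i; rewrite !mnmE.
by case: (i \in B) (i \in C) => [] [].
Qed.

Lemma exists_perm_prefix B : exists w : 'S_N, forall i : 'I_N, (i < #|B|)%N = (w i \in B).
Proof.
case: (posnP N) => [N0|N0]; first by exists 1%g => i; have := ltn_ord i; rewrite {2}N0.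
pose l := enum B ++ enum (~: B); pose x0 := Ordinal N0.
have sl : size l = N by rewrite size_cat -!cardE cardsC card_ord.
have ul : uniq l.
  rewrite cat_uniq !enum_uniq /= andbT; apply/hasPn => i; rewrite !mem_enum inE.
  by move=> /negPf ->.
have inj : injective (fun i : 'I_N => nth x0 l i).
  by move=> i j /eqP; rewrite nth_uniq ?sl ?ltn_ord // => /eqP/val_inj.
exists (perm inj) => i; rewrite permE nth_cat -cardE; case: ltnP => lt.
  by rewrite -mem_enum mem_nth // -cardE.
have := @mem_nth _ x0 (enum (~: B)) (i - #|B|)%N; rewrite mem_enum inE => h.
apply/esym/negbTE/h; rewrite -cardE -(ltn_add2l #|B|) subnKC // cardsC card_ord.
exact: ltn_ord.
Qed.

(** The sign is left open except for increasing lists: supports of monomials do not need it, and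
    leading coefficients use an increasing product. *)
Lemma theta_list (l : seq 'I_N) : uniq l -> exists b : bool,
  (forall S, (\prod_(i <- l) theta i : sp) S = if S == [set x in l] then (-1) ^+ b else 0) /\
  (sorted ltn (map val l) -> b = false).
Proof.
elim: l => [|x l IH] /=.
  move=> _; exists false; split=> // S; rewrite big_nil ffunE.
  by congr (if S == _ then _ else _); apply/setP => y; rewrite !inE.
move=> /andP[xl /IH[b [hb sb]]]; pose k := ninv [set x] [set y in l].
exists (odd k (+) b); split=> [S|so]; last first.
  rewrite sb ?(path_sorted so) // addbF; suff -> : k = 0%N by [].
  apply/eqP; rewrite cards_eq0; apply/eqP/setP=> -[y z]; rewrite !inE /=.
  apply/negP => /andP[/andP[/eqP-> zl]]; apply/negP; rewrite -leqNgt ltnW //.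
  have /allP := order_path_min ltn_trans so; apply.
  by apply/mapP; exists z.
rewrite big_cons thetaM hb; have <- : ([set x] :|: [set y in l]) = [set y in x :: l].
  by apply/setP => y; rewrite !inE.
case: ifP => xS; last first.
  by case: eqP => // e; move: xS; rewrite e !inE eqxx.
rewrite (_ : (S == x |: [set y in l]) = (S :\ x == [set y in l])).
  by case: eqP => [->|_]; rewrite ?mulr0 // signr_addb signr_odd.
apply/eqP/eqP => [->|<-]; last by rewrite setD1K.
by rewrite setU1K // inE.
Qed.

End Superpolynomials.

(** * Monomials in superspace *)

Lemma filter_iota_lt m n : (m <= n)%N -> [seq k <- iota 0 n | (k < m)%N] = iota 0 m.
Proof.
move=> mn; rewrite -(subnKC mn) iotaD filter_cat (_ : filter _ (iota (0 + m) _) = [::]) ?cats0.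
  by apply/all_filterP/allP => k; rewrite mem_iota.
apply/eqP; rewrite -[_ == _]negbK -has_filter; apply/hasPn => k.
by rewrite mem_iota add0n -leqNgt => /andP[].
Qed.

Section SumOfDistinct.
Variables (V : zmodType) (T : finType) (P : pred T) (g : T -> V) (L : seq V).
Hypothesis g_inj : {in P &, injective g}.
Hypothesis memL : forall v, v \in L <-> exists2 x, P x & v = g x.

(** Turns the sum over the distinct terms of a monomial into a sum over a set that parametrises
    these terms once each. *)
Lemma sum_undup_image : \sum_(v <- undup L) v = \sum_(x | P x) g x.
Proof.
rewrite -[RHS](big_filter _ P) -(big_map g xpredT id); apply: perm_big.
apply: uniq_perm; rewrite ?undup_uniq //.
  rewrite map_inj_in_uniq ?filter_uniq ?index_enum_uniq // => x y.
  by rewrite !mem_filter => /andP[Px _] /andP[Py _]; apply: g_inj.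
move=> v; rewrite mem_undup; apply/idP/mapP => [/memL[x Px ->]|[x + ->]].
  by exists x; rewrite // mem_filter Px mem_index_enum.
by rewrite mem_filter => /andP[Px _]; apply/memL; exists x.
Qed.

End SumOfDistinct.

Section Monomials.
Variables (N : nat).
Local Notation K := Qa.
Local Notation sp := (superpoly N K).
Implicit Types (f g : sp) (p q : {mpoly K[N]}) (i j : 'I_N) (A B S : {set 'I_N}) (m : 'X_{1..N}).

Definition word_exp (a s : seq nat) (w : 'S_N) : 'X_{1..N} :=
  [multinom nth 0%N (a ++ s) ((w^-1)%g i) | i < N].

Definition theta_word (a : seq nat) (w : 'S_N) : sp := \prod_(i < N | (i < size a)%N) theta (w i).

Lemma mtermE a s w : mterm a s w = theta_word a w * spc 'X_[word_exp a s w].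
Proof.
rewrite /mterm -/(theta_word a w) mpolyXE_id; congr (_ * _).
rewrite (reindex_inj (@perm_inj _ w)) spc_prod; apply: eq_bigr => i _.
by rewrite zvarE -spcX mnmE permK.
Qed.

Lemma elemE n : elem n N = selem N K n.
Proof.
rewrite /elem /mono /= size_nseq.
case: leqP => nN; last first.
  rewrite /selem /esum big_pred0 ?spc0 // => B; apply/negP => /eqP e.
  by have := max_card (mem B); rewrite e card_ord leqNgt nN.
have mt w : mterm [::] (nseq n 1%N) w = spc (xprod K [set w i | i : 'I_N & (i < n)%N]).
  rewrite mtermE /theta_word big_pred0 // mul1r xprodE; congr (spc 'X_[_]); apply/mnmP => i.
  rewrite !mnmE /= nth_nseq; congr nat_of_bool; rewrite -{2}[i](permKV w) (mem_imset _ _ (@perm_inj _ w)) inE.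
  by [].
rewrite (@sum_undup_image _ {set 'I_N} (fun B => #|B| == n) (fun B => spc (xprod K B))).
- by rewrite -spc_sum.
- move=> B C _ _ /spc_inj; rewrite !xprodE => /(congr1 (mcoeff (set_mnm B))).
  rewrite !mcoeffX eqxx; case: eqP => [e _|_ /eqP]; last by rewrite oner_eq0.
  by apply: set_mnm_inj.
move=> v; split=> [/imageP[w _ ->]|[B /eqP cB ->]].
  exists [set w i | i : 'I_N & (i < n)%N]; last by rewrite mt.
  rewrite card_imset; last exact: perm_inj.
  by rewrite -sum1dep_card -(big_ord_widen _ (fun=> 1%N) nN) sum1_card card_ord.
have [w hw] := exists_perm_prefix B; apply/imageP; exists w => //; rewrite mt.
congr (spc (xprod K _)); apply/setP => i; rewrite -[i](permKV w) (mem_imset _ _ (@perm_inj _ w)) inE.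
by rewrite -hw cB.
Qed.

Lemma telemE n : telem n N = stelem N K n.
Proof.
rewrite /telem /mono /= size_nseq.
case: ltnP => nN; last first.
  rewrite /stelem big1 // => i _; rewrite /esum_at big_pred0 ?spc0 ?mulr0 // => B.
  apply/negP => /andP[/eqP e iB]; have := max_card (mem (i |: B)).
  by rewrite cardsU1 iB e card_ord add1n ltnNge nN.
pose i0 : 'I_N := Ordinal (leq_ltn_trans (leq0n n) nN).
have mt w : mterm [:: 0%N] (nseq n 1%N) w =
    theta (w i0) * spc (xprod K [set w i | i : 'I_N & (0 < i < n.+1)%N]).
  rewrite mtermE /theta_word (big_pred1 i0) => [|i]; last by rewrite /= ltnS leqn0 -val_eqE.
  rewrite xprodE; congr (_ * spc 'X_[_]); apply/mnmP => i.
  rewrite !mnmE /=; rewrite -{2}[i](permKV w) (mem_imset _ _ (@perm_inj _ w)) inE.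
  by case: (nat_of_ord _) => //= k; rewrite nth_nseq ltnS; case: ifP.
rewrite (@sum_undup_image _ ('I_N * {set 'I_N})%type (fun x => (#|x.2| == n) && (x.1 \notin x.2))
   (fun x => theta x.1 * spc (xprod K x.2))).
- rewrite -(pair_big_dep xpredT (fun i B => (#|B| == n) && (i \notin B)) (fun i B => theta i * spc (xprod K B))) /=.
  by apply: eq_bigr => i _; rewrite -mulr_sumr -spc_sum.
- move=> [i B] [j C] _ _ /= /ffunP e; have := e [set i]; rewrite !theta_spc eqxx.
  case: eqP => [/set1_inj -> |_] /(congr1 (mcoeff (set_mnm B))); rewrite !xprodE !mcoeffX eqxx; last first.
    by rewrite mcoeff0 => /eqP; rewrite oner_eq0.
  case: eqP => [eq _|_ /eqP]; last by rewrite oner_eq0.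
  by congr (_, _); apply: set_mnm_inj.
move=> v; split=> [/imageP[w _ ->]|[[i B] /= /andP[/eqP cB iB] ->]].
  exists (w i0, [set w i | i : 'I_N & (0 < i < n.+1)%N]); last by rewrite mt.
  rewrite /= (mem_imset _ _ (@perm_inj _ w)) inE andbT.
  rewrite card_imset; last exact: perm_inj.
  have : (#|[set i : 'I_N | (0 < i < n.+1)%N]| + 1 = n.+1)%N.
    transitivity (#|[set i : 'I_N | (i < n.+1)%N]|).
      rewrite (cardsD1 i0 [set i : 'I_N | (i < n.+1)%N]) inE addnC; congr (_ + _)%N.
      by apply: eq_card => i; rewrite !inE -val_eqE /= lt0n.
    by rewrite -sum1dep_card -(big_ord_widen _ (fun=> 1%N) nN) sum1_card card_ord.
  by rewrite addn1 => -[->].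
have [w0 hw0] := exists_perm_prefix (i |: B).
pose k := (w0^-1)%g i; have kn : (k < n.+1)%N.
  by have := hw0 k; rewrite permKV setU11 cardsU1 iB cB add1n.
(* [w0] maps the first n + 1 indices onto [i |: B]; the transposition makes [i] the image of the
   index 0, which is the one that carries theta. *)
pose w := (tperm i0 k * w0)%g.
have wi0 : w i0 = i by rewrite permM tpermL permKV.
have hw (x : 'I_N) : (x < n.+1)%N = (w x \in i |: B).
  rewrite permM -hw0 cardsU1 iB cB add1n; case: tpermP => [->|->|//]; first by rewrite kn.
  by rewrite kn.
apply/imageP; exists w => //; rewrite mt wi0; congr (_ * spc (xprod K _)).
apply/setP => x; rewrite -[x](permKV w) (mem_imset _ _ (@perm_inj _ w)) inE.
move: ((w^-1)%g x) => y; rewrite hw !inE -{1}wi0 (inj_eq (@perm_inj _ w)) lt0n.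
rewrite -[y == i0]val_eqE /=; case: eqP => [e|] //=.
have -> : y = i0 by apply: val_inj.
by rewrite wi0; apply: negbTE.
Qed.

Lemma theta_wordE a w : theta_word a w = \prod_(i <- [seq w i | i <- enum 'I_N & (i < size a)%N]) theta i.
Proof.
by rewrite big_map big_filter /theta_word [index_enum _]unlock enumT.
Qed.

Lemma theta_word_uniq (a : seq nat) (w : 'S_N) : uniq [seq w i | i <- enum 'I_N & (i < size a)%N].
Proof. by rewrite (map_inj_uniq (@perm_inj _ w)) filter_uniq ?enum_uniq. Qed.

Definition word_set (a : seq nat) (w : 'S_N) : {set 'I_N} := [set i | ((w^-1)%g i < size a)%N].

Lemma word_setE (a : seq nat) (w : 'S_N) : [set x in [seq w i | i <- enum 'I_N & (i < size a)%N]] = word_set a w.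
Proof.
apply/setP => i; rewrite !inE -{1}[i](permKV w) mem_map; last exact: perm_inj.
by rewrite mem_filter mem_enum andbT.
Qed.

Lemma mterm_coef a s w S m : (mterm a s w S)@_m != 0 -> S = word_set a w /\ m = word_exp a s w.
Proof.
rewrite mtermE spcMr mcoeff_mulX theta_wordE.
have [b [-> _]] := theta_list K (theta_word_uniq a w); rewrite word_setE.
case: ifP => [le|_]; last by rewrite eqxx.
case: (eqVneq S (word_set a w)) => [->|_]; last by rewrite mcoeff0 eqxx.
rewrite -signr_odd oddb => nz; split=> //; apply/mnmP => i.
have : (m - word_exp a s w)%MM = 0%MM.
  apply/eqP; apply: contraNT nz => /negPf ne.
  by case: b; rewrite ?expr1 ?expr0 ?mcoeffN mcoeff1 ne ?oppr0 eqxx.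
move=> /mnmP/(_ i); rewrite mnmBE mnm0E => /eqP; rewrite subn_eq0 => le1.
by apply/eqP; rewrite eqn_leq le1; apply: (mnm_lepP le).
Qed.

Lemma mterm_sorted (a s : seq nat) (w : 'S_N) : sorted ltn (map val [seq w i | i <- enum 'I_N & (i < size a)%N]) ->
  (mterm a s w (word_set a w))@_(word_exp a s w) = 1.
Proof.
rewrite mtermE spcMr mcoeff_mulX theta_wordE lepm_refl => so.
have [b [-> /(_ so) ->]] := theta_list K (theta_word_uniq a w); rewrite word_setE eqxx expr0 mcoeff1.
by rewrite (_ : (_ - _)%MM = 0%MM) ?eqxx //; apply/mnmP => i; rewrite !mnmE subnn.
Qed.

Section RowMonomial.
Variable La : spart.
Hypothesis sizeN : (size (circ La) <= N)%N.
Local Notation l := (size (circ La)).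
Local Notation s := (rows La).

(** Monomials list the exponents of the circled rows first. [row_perm] undoes this, so that the
    variable with index [i] receives row [i]. *)
Definition row_order : seq nat := [seq k <- iota 0 l | (s k).2] ++ [seq k <- iota 0 l | ~~ (s k).2].

Lemma fpart_rows : fpart La = [seq (s k).1 | k <- iota 0 l & (s k).2].
Proof.
rewrite /fpart -[1%N]addn0 iotaDl filter_map -map_comp; congr map.
by apply: eq_filter => k /=; rewrite /rows /part /= eq_sym.
Qed.

Lemma bpart_rows : bpart La = [seq (s k).1 | k <- iota 0 l & ~~ (s k).2].
Proof.
rewrite /bpart -[1%N]addn0 iotaDl filter_map -map_comp; congr map.
by apply: eq_filter => k /=; rewrite /rows /part /= negbK eq_sym.
Qed.

Lemma row_order_perm : perm_eq row_order (iota 0 l).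
Proof. by rewrite perm_filterC. Qed.

Lemma size_row_order : size row_order = l.
Proof. by rewrite (perm_size row_order_perm) size_iota. Qed.

Lemma row_order_lt i : (i < l)%N -> (nth 0%N row_order i < l)%N.
Proof.
move=> il; have : nth 0%N row_order i \in iota 0 l.
  by rewrite -(perm_mem row_order_perm) mem_nth // size_row_order.
by rewrite mem_iota.
Qed.

Fact row_fun_lt (i : 'I_N) : ((if (i < l)%N then nth 0%N row_order i else i) < N)%N.
Proof. by case: ifP => [/row_order_lt/leq_trans->|_]. Qed.

Fact row_fun_inj : injective (fun i => Ordinal (row_fun_lt i)).
Proof.
move=> i j /(congr1 val) /=; case: ifP => il; case: ifP => jl.
- move=> /eqP; rewrite nth_uniq ?size_row_order // => [/eqP/val_inj//|].
  by rewrite (perm_uniq row_order_perm) iota_uniq.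
- by move=> e; have := row_order_lt il; rewrite e jl.
- by move=> e; have := row_order_lt jl; rewrite -e il.
by move=> /val_inj.
Qed.

Definition row_perm : 'S_N := perm row_fun_inj.

Lemma row_permE (i : 'I_N) : row_perm i = (if (i < l)%N then nth 0%N row_order i else i) :> nat.
Proof. by rewrite permE. Qed.

Lemma row_perm_exp (i : 'I_N) : nth 0%N (fpart La ++ bpart La) i = (s (row_perm i)).1.
Proof.
rewrite row_permE fpart_rows bpart_rows -map_cat -/row_order; case: ltnP => il.
  by rewrite (nth_map 0%N) ?size_row_order.
by rewrite nth_default ?size_map ?size_row_order // rows_vanish.
Qed.

Lemma row_perm_flag (i : 'I_N) : (i < size (fpart La))%N = (s (row_perm i)).2.
Proof.
rewrite row_permE fpart_rows size_map; case: (ltnP i l) => il; last first.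
  rewrite rows_vanish //= ltnNge (leq_trans _ il) //.
  by rewrite size_filter (leq_trans (count_size _ _)) ?size_iota.
rewrite nth_cat; case: ltnP => [lt|ge].
  by have := mem_nth 0%N lt; rewrite mem_filter => /andP[-> _].
have : nth 0%N [seq k <- iota 0 l | ~~ (s k).2] (i - size [seq k <- iota 0 l | (s k).2]) \in
    [seq k <- iota 0 l | ~~ (s k).2].
  apply: mem_nth; rewrite -(ltn_add2l (size [seq k <- iota 0 l | (s k).2])) subnKC //.
  by rewrite -size_cat size_row_order.
by rewrite mem_filter => /andP[/negbTE-> _].
Qed.

Lemma smono_sum : smono La N = \sum_(t <- undup [seq mterm (fpart La) (bpart La) w | w : 'S_N]) t.
Proof.
rewrite /smono /mono fpart_rows bpart_rows -map_cat size_map -[_ ++ _]/row_order.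
by rewrite size_row_order sizeN.
Qed.

Lemma mterm_rows w S m : (mterm (fpart La) (bpart La) w S)@_m != 0 ->
  let sg := (w^-1 * row_perm)%g in
  S = [set j : 'I_N | (s (sg j)).2] /\ (forall j, m j = (s (sg j)).1).
Proof.
move=> /mterm_coef[-> ->]; split=> [|j]; last by rewrite mnmE row_perm_exp permM.
by apply/setP => j; rewrite !inE row_perm_flag permM.
Qed.

Lemma smono_support S m : (smono La N S)@_m != 0 -> exists sg : 'S_N,
  S = [set j : 'I_N | (s (sg j)).2] /\ (forall j, m j = (s (sg j)).1).
Proof.
rewrite smono_sum; rewrite sum_ffunE raddf_sum /= => nz.
have [t tl nzt] : exists2 t, t \in undup [seq mterm (fpart La) (bpart La) w | w : 'S_N] & (t S)@_m != 0.
  apply: contraPP nz => no; apply/negP; rewrite negbK big_seq big1 // => t tl.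
  by apply/eqP/negPn/negP => nzt; apply: no; exists t.
move: tl; rewrite mem_undup => /imageP[w _ e]; rewrite e in nzt.
by have := mterm_rows nzt; exists (w^-1 * row_perm)%g.
Qed.

Definition rset : {set 'I_N} := [set j : 'I_N | (s j).2].
Definition rmnm : 'X_{1..N} := [multinom (s j).1 | j < N].

Lemma circled_inj (i j : nat) : (s i).2 -> (s j).2 -> (s i).1 = (s j).1 -> i = j.
Proof.
have strict a b : (a < b)%N -> (s b).2 -> (s b).1 != (s a).1.
  elim: b => // b IH; rewrite ltnS leq_eqVlt => /predU1P[->|ab] eb.
    by have := @rows_stacked La b; rewrite /row_rel eb; lia.
  have := @rows_stacked La b; rewrite /row_rel eb andbF orbF => lt.
  have le : ((s b).1 <= (s a).1)%N.
    elim: b ab {IH eb lt} => // b IH; rewrite ltnS leq_eqVlt => /predU1P[->|/IH].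
      by have := @rows_stacked La b; rewrite /row_rel; lia.
    by have := @rows_stacked La b; rewrite /row_rel; lia.
  by rewrite neq_ltn (leq_trans lt).
move=> ei ej e; case: (ltngtP i j) => // lt.
  by have := strict _ _ lt ej; rewrite e eqxx.
by have := strict _ _ lt ei; rewrite e eqxx.
Qed.

(** A term with this set and these exponents must assign the circled rows as [row_perm] does,
    because their lengths are distinct; it is then the same term, counted once. Its theta product is
    increasing, so there is no sign. *)
Lemma smono_top : (smono La N rset)@_rmnm = 1.
Proof.
have w0set : word_set (fpart La) row_perm = rset.
  by apply/setP => j; rewrite !inE row_perm_flag permKV.
have w0exp : word_exp (fpart La) (bpart La) row_perm = rmnm.
  by apply/mnmP => j; rewrite !mnmE row_perm_exp permKV.
rewrite smono_sum sum_ffunE raddf_sum /=.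
rewrite (bigD1_seq (mterm (fpart La) (bpart La) row_perm)) ?undup_uniq //=; last first.
  by rewrite mem_undup; apply: image_f.
rewrite -{1}w0set -{1}w0exp mterm_sorted; last first.
  rewrite (_ : map _ _ = [seq k <- iota 0 l | (s k).2]).
    by rewrite sorted_filter ?iota_ltn_sorted //; apply: ltn_trans.
  pose F k := if (k < l)%N then nth 0%N row_order k else k.
  transitivity [seq F k | k <- [seq k <- map val (enum 'I_N) | (k < size (fpart La))%N]].
    by rewrite filter_map -!map_comp; apply: eq_map => i; exact: row_permE.
  have le1 : (size (fpart La) <= l)%N by rewrite fpart_rows size_map size_filter (leq_trans (count_size _ _)) ?size_iota.
  rewrite val_enum_ord filter_iota_lt ?(leq_trans le1) //.
  transitivity [seq nth 0%N row_order k | k <- iota 0 (size (fpart La))].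
    by apply/eq_in_map => k; rewrite mem_iota /F => /andP[_ /leq_trans->].
  by rewrite map_nth_iota0 ?size_row_order // fpart_rows size_map take_size_cat.
rewrite big_seq_cond big1 ?addr0 // => t /andP[]; rewrite mem_undup => /imageP[w _ ->] ne.
apply/eqP/negPn/negP => /mterm_rows /= [eS em]; case/negP: ne; apply/eqP.
have e1 (i : 'I_N) : (i < size (fpart La))%N -> w i = row_perm i.
  rewrite row_perm_flag => fi; apply: val_inj; apply: circled_inj => //.
    have : w i \in rset by rewrite eS inE permM permK.
    by rewrite inE.
  by have := em (w i); rewrite mnmE permM permK.
rewrite !mtermE; congr (_ * spc 'X_[_]); first by apply: eq_bigr => i /e1->.
apply/mnmP => j; rewrite !mnmE !row_perm_exp permKV -permM.
by have := em j; rewrite mnmE => e; apply/esym.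
Qed.

End RowMonomial.

Lemma sum_sorted_le (g : nat -> nat) (L : seq nat) : (forall i j : nat, (i <= j)%N -> (g j <= g i)%N) ->
  uniq L -> (\sum_(i <- L) g i <= \sum_(i < size L) g i)%N.
Proof.
move=> anti uL; have -> : (\sum_(i <- L) g i = \sum_(i <- sort leq L) g i)%N.
  by apply: perm_big; rewrite perm_sym; apply: permEl; apply: perm_sort.
rewrite -(size_sort leq).
have : sorted ltn (sort leq L) by rewrite ltn_sorted_uniq_leq sort_uniq uL sort_sorted //; apply: leq_total.
move: (sort leq L) => M so; rewrite (big_nth 0%N) big_mkord leq_sum // => i _; apply: anti.
have : forall k, (k < size M)%N -> (k <= nth 0%N M k)%N.
  elim=> // k IH lt; apply: leq_ltn_trans (IH (ltnW lt)) _.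
  by apply: (sorted_ltn_nth ltn_trans) => //; rewrite inE ?(ltnW lt).
by apply.
Qed.

Lemma prefix_perm_le (g : nat -> nat) (sg : 'S_N) k : (forall i j : nat, (i <= j)%N -> (g j <= g i)%N) ->
  (\sum_(j < N | (j < k)%N) g (sg j) <= \sum_(j < k) g j)%N.
Proof.
move=> anti; pose L := [seq val (sg j) | j <- enum 'I_N & (j < k)%N].
have uL : uniq L.
  rewrite map_inj_uniq => [|i j /val_inj/perm_inj //].
  exact: filter_uniq (enum_uniq _).
have -> : (\sum_(j < N | (j < k)%N) g (sg j) = \sum_(i <- L) g i)%N.
  by rewrite big_map big_filter [RHS]big_mkcond big_enum [LHS]big_mkcond.
apply: leq_trans (sum_sorted_le anti uL) _.
have le : (size L <= k)%N.
  have -> : size L = size [seq j <- iota 0 N | (j < k)%N].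
    by rewrite size_map !size_filter -val_enum_ord count_map.
  case: (leqP k N) => [kN|Nk]; first by rewrite filter_iota_lt ?size_iota.
  by rewrite size_filter (leq_trans (count_size _ _)) // size_iota ltnW.
rewrite (big_ord_widen k g le) [leqRHS](bigID (fun i : 'I_k => (i < size L)%N)) /=.
exact: leq_addr.
Qed.

Lemma stacked_anti (s : rowstate) (i j : nat) : stacked s -> (i <= j)%N ->
  ((s j).1 <= (s i).1)%N /\ (circ_len s j <= circ_len s i)%N.
Proof.
move=> st; elim: j => [|j IH]; first by rewrite leqn0 => /eqP->.
rewrite leq_eqVlt => /predU1P[->//|]; rewrite ltnS => /IH[h1 h2].
have := st j; rewrite /row_rel /circ_len in h2 * => h3.
by move: h1 h2 h3; case: (s j) (s j.+1) (s i) => [a []] [b []] [c []] /=; lia.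
Qed.

End Monomials.

(** * Dominance bounds on the monomials of a superpolynomial, and multiplication by a column *)

Section BoundedSupport.
Variables (N : nat) (K : fieldType).
Local Notation sp := (superpoly N K).
Implicit Types (f g : sp) (p q : {mpoly K[N]}) (i j : 'I_N) (A B S : {set 'I_N}) (m : 'X_{1..N}) (s : rowstate).

(** Dominance for each monomial theta_S z^m, with the exponents taken in the order of the variables:
    [m] is compared with Lambda^star, and [m] plus the indicator of [S] with Lambda^circledast. For
    a symmetric function the sorted exponents are among those tested. *)
Definition bounded_by (s : rowstate) f : Prop := forall S m, (f S)@_m != 0 ->
  forall k, (\sum_(j < N | (j < k)%N) m j <= \sum_(j < k) (s j).1)%N /\
    (\sum_(j < N | (j < k)%N) (m j + (j \in S)) <= \sum_(j < k) circ_len s j)%N.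

Lemma bounded_le (s s' : rowstate) f : (forall k, \sum_(j < k) (s j).1 <= \sum_(j < k) (s' j).1)%N ->
  (forall k, \sum_(j < k) circ_len s j <= \sum_(j < k) circ_len s' j)%N ->
  bounded_by s f -> bounded_by s' f.
Proof.
move=> le1 le2 bf S m nz k; have [h1 h2] := bf S m nz k.
by split; [apply: leq_trans h1 _ | apply: leq_trans h2 _].
Qed.

Lemma bounded_add s f g : bounded_by s f -> bounded_by s g -> bounded_by s (f + g).
Proof.
move=> bf bg S m; rewrite ffunE mcoeffD => nz.
have [e|/bf//] := eqVneq ((f S)@_m) 0; apply: bg.
by rewrite e add0r in nz.
Qed.

Lemma bounded_scale s (c : K) f : bounded_by s f -> bounded_by s (c *: f).
Proof.
by move=> bf S m; rewrite ffunE mcoeffZ mulf_eq0 negb_or => /andP[_]; apply: bf.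
Qed.

Lemma bounded0 s : bounded_by s 0.
Proof. by move=> S m; rewrite ffunE mcoeff0 eqxx. Qed.

Lemma bounded_sum s (I : Type) (r : seq I) (P : pred I) (F : I -> sp) :
  (forall x, P x -> bounded_by s (F x)) -> bounded_by s (\sum_(x <- r | P x) F x).
Proof. by move=> h; elim/big_ind: _ => //; [apply: bounded0 | apply: bounded_add]. Qed.

Lemma sum_split_mnm k (m : 'X_{1..N}) B : (set_mnm B <= m)%MM ->
  (\sum_(j < N | (j < k)%N) m j =
    \sum_(j < N | (j < k)%N) (m - set_mnm B)%MM j + \sum_(j < N | (j < k)%N) (j \in B))%N.
Proof.
move=> le; rewrite -big_split /=; apply: eq_bigr => j _; rewrite mnmBE mnmE subnK //.
by have := mnm_lepP le j; rewrite mnmE.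
Qed.

Lemma count_prefix k B n : (#|B| <= n)%N -> (\sum_(j < N | (j < k)%N) (j \in B) <= \sum_(j < k) (j < n))%N.
Proof.
move=> Bn; have e2 : (\sum_(j < k) (j < n) = minn k n)%N.
  elim: k => [|k IH]; first by rewrite big_ord0 min0n.
  by rewrite big_ord_recr /= IH; case: ltnP; lia.
rewrite e2 leq_min; apply/andP; split; last first.
  apply: leq_trans Bn; rewrite -sum1_card [leqRHS]big_mkcond [leqLHS]big_mkcond.
  by apply: leq_sum => j _; case: ifP => // _; case: (j \in B).
apply: leq_trans (_ : \sum_(j < N | (j < k)%N) 1 <= k)%N; first by apply: leq_sum => j _; case: (j \in B).
case: (leqP k N) => kN; first by rewrite -(big_ord_widen _ (fun=> 1%N) kN) sum1_card card_ord.
by rewrite sum1_card (leq_trans (max_card _)) // card_ord ltnW.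
Qed.


Lemma mcoeff_sign k p m : ((-1) ^+ k * p)@_m = (-1) ^+ k * p@_m.
Proof. by rewrite -signr_odd -[in RHS]signr_odd; case: (odd k); rewrite ?mulN1r ?mul1r ?mcoeffN. Qed.

Lemma mcoeff_xsum (P : pred {set 'I_N}) p m :
  (\sum_(B | P B) xprod K B * p)@_m = \sum_(B | P B) if (set_mnm B <= m)%MM then p@_(m - set_mnm B) else 0.
Proof. by rewrite raddf_sum; apply: eq_bigr => B _; rewrite /= xprodE mcoeff_mulX. Qed.

Lemma sum_neq0 (I : Type) (r : seq I) (P : pred I) (F : I -> K) :
  \sum_(x <- r | P x) F x != 0 -> exists2 x, P x & F x != 0.
Proof.
elim: r => [|x r IH]; first by rewrite big_nil eqxx.
rewrite big_cons; case: ifP => // Px; have [-> |Fx] := eqVneq (F x) 0; last by exists x.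
by rewrite add0r.
Qed.

Lemma selem_coef n f S m : ((selem N K n * f) S)@_m =
  \sum_(B : {set 'I_N} | #|B| == n) if (set_mnm B <= m)%MM then (f S)@_(m - set_mnm B) else 0.
Proof. by rewrite spcMl /esum mulr_suml mcoeff_xsum. Qed.

Lemma stelem_coef n f S m : ((stelem N K n * f) S)@_m =
  \sum_(i in S) (-1) ^+ ninv [set i] (S :\ i) *
    \sum_(B : {set 'I_N} | (#|B| == n) && (i \notin B))
      if (set_mnm B <= m)%MM then (f (S :\ i))@_(m - set_mnm B) else 0.
Proof.
rewrite /stelem mulr_suml sum_ffunE raddf_sum [RHS]big_mkcond; apply: eq_bigr => i _ /=.
rewrite -mulrA thetaM; case: ifP => iS; last by rewrite mcoeff0.
by rewrite mcoeff_sign spcMl /esum_at mulr_suml mcoeff_xsum.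
Qed.

(** A new first column of [n] squares, closed by a circle if [b], for states without rows from [n]
    on. This is the top state reached by e_n, respectively tilde e_n. *)
Definition add_column s n (b : bool) : rowstate := fun j : nat =>
  if (j < n)%N then ((s j).1.+1, (s j).2) else (0%N, b && (j == n)).

Section AddColumn.
Variables (s : rowstate) (n : nat) (b : bool).
Hypothesis van : vanishes_from n s.
Local Notation s' := (add_column s n b).

Lemma add_column_star k : (\sum_(j < k) (s' j).1 = \sum_(j < k) (s j).1 + \sum_(j < k) (j < n))%N.
Proof.
rewrite -big_split; apply: eq_bigr => j _ /=; rewrite /add_column; case: ltnP => /= jn; first by rewrite addn1.
by rewrite van.
Qed.

Lemma add_column_circ k : (\sum_(j < k) circ_len s' j = \sum_(j < k) circ_len s j + \sum_(j < k) (j < n + b))%N.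
Proof.
rewrite -big_split; apply: eq_bigr => j _ /=; rewrite /circ_len /add_column; case: ltnP => /= jn.
  by rewrite (ltn_addr _ jn) addn1.
by rewrite van //= !add0n; case: b => /=; lia.
Qed.

Lemma prefix_bound S m B k : (#|B| <= n)%N -> (set_mnm B <= m)%MM ->
  (\sum_(j < N | (j < k)%N) (m - set_mnm B)%MM j <= \sum_(j < k) (s j).1)%N ->
  (\sum_(j < N | (j < k)%N) m j <= \sum_(j < k) (s' j).1)%N.
Proof.
move=> cB le h; rewrite (sum_split_mnm _ le) add_column_star leq_add //.
exact: count_prefix.
Qed.

Lemma selem_bounded f : b = false -> bounded_by s f -> bounded_by s' (selem N K n * f).
Proof.
move=> b0 bf S m; rewrite selem_coef => /sum_neq0[B /eqP cB].
case: ifP => [le nz k|_]; last by rewrite eqxx.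
have [h1 h2] := bf S _ nz k; split; first by apply: prefix_bound h1; rewrite ?cB.
rewrite add_column_circ b0 addn0 big_split /= (sum_split_mnm _ le) addnAC -big_split leq_add //.
by rewrite count_prefix ?cB.
Qed.

Lemma stelem_bounded f : b = true -> bounded_by s f -> bounded_by s' (stelem N K n * f).
Proof.
move=> b1 bf S m; rewrite stelem_coef => /sum_neq0[i iS]; rewrite mulf_eq0 negb_or => /andP[_].
move=> /sum_neq0[B /andP[/eqP cB iB]]; case: ifP => [le nz k|_]; last by rewrite eqxx.
have [h1 h2] := bf _ _ nz k; split; first by apply: prefix_bound h1; rewrite ?cB.
rewrite add_column_circ b1 addn1; apply: leq_trans (leq_add h2 (@count_prefix k (i |: B) n.+1 _)).
  rewrite big_split /= (sum_split_mnm _ le) -addnA -[leqRHS]big_split -[X in (_ + X <= _)%N]big_split /=.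
  rewrite -big_split /= leq_sum // => j _; rewrite !inE.
  case: (eqVneq j i) => [->|ji] /=; first by rewrite iS (negPf iB); lia.
  by case: (j \in B) (j \in S) => [] [] /=; lia.
by rewrite cardsU1 iB cB.
Qed.

Definition state_set s0 : {set 'I_N} := [set j : 'I_N | (s0 j).2].
Definition state_mnm s0 : 'X_{1..N} := [multinom (s0 j).1 | j < N].

Hypothesis nN : (n + b <= N)%N.
Let B0 : {set 'I_N} := [set j : 'I_N | (j < n)%N].

Lemma card_B0 : #|B0| = n.
Proof.
by rewrite -sum1dep_card -(big_ord_widen _ (fun=> 1%N) (leq_trans (leq_addr b n) nN)) sum1_card card_ord.
Qed.

Lemma top_sub : (set_mnm B0 <= state_mnm s')%MM /\ (state_mnm s' - set_mnm B0)%MM = state_mnm s.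
Proof.
split; first by apply/mnm_lepP => j; rewrite !mnmE inE /add_column; case: ltnP.
apply/mnmP => j; rewrite mnmBE !mnmE inE /add_column; case: ltnP => jn /=; first by rewrite subn1.
by rewrite van.
Qed.

(** At the prefix of length [n] the bound is exhausted: the target exceeds [s] by n there, and only
    the first [n] variables can supply this. *)
Lemma top_only f S B : bounded_by s f -> #|B| = n -> (set_mnm B <= state_mnm s')%MM ->
  (f S)@_(state_mnm s' - set_mnm B) != 0 -> B = B0.
Proof.
move=> bf cB le nz; have [h _] := bf S _ nz n.
have := sum_split_mnm n le.
have -> : (\sum_(j < N | (j < n)%N) state_mnm s' j = \sum_(j < n) (s j).1 + n)%N.
  rewrite (eq_bigr (fun j : 'I_N => (s' j).1)) => [|j _]; last by rewrite mnmE.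
  rewrite -(big_ord_widen _ (fun j : nat => (s' j).1) (leq_trans (leq_addr b n) nN)) add_column_star; congr (_ + _)%N.
  by rewrite (eq_bigr (fun=> 1%N)) ?sum1_card ?card_ord // => j _; rewrite ltn_ord.
move=> e; have cI : (n <= \sum_(j < N | (j < n)%N) (j \in B))%N by lia.
apply/eqP; rewrite eq_sym eqEcard cB card_B0 leqnn andbT; apply/setIidPl/eqP.
rewrite eqEcard subsetIl card_B0 (leq_trans cI) // -sum1_card [leqRHS]big_mkcond [leqLHS]big_mkcond /=.
by apply: leq_sum => j _; rewrite !inE; case: ltnP => //= _; case: (j \in B).
Qed.

Lemma selem_top f : b = false -> bounded_by s f ->
  ((selem N K n * f) (state_set s'))@_(state_mnm s') = (f (state_set s))@_(state_mnm s).
Proof.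
move=> b0 bf; have -> : state_set s' = state_set s.
  apply/setP => j; rewrite !inE /add_column; case: ltnP => //= jn.
  by rewrite b0 van.
rewrite selem_coef (bigD1 B0) ?card_B0 //=; have [-> ->] := top_sub.
rewrite big1 ?addr0 // => B /andP[/eqP cB BB0]; case: ifP => // le.
by apply/eqP/negPn/negP => /(top_only bf cB le)/eqP; apply/negP.
Qed.

(** The new theta belongs to row [n], below all the circled rows of [s], and stands to the left of
    their thetas; moving it to its place gives the sign. *)
Lemma stelem_top f : b = true -> bounded_by s f ->
  ((stelem N K n * f) (state_set s'))@_(state_mnm s') =
  (-1) ^+ #|state_set s| * (f (state_set s))@_(state_mnm s).
Proof.
move=> b1 bf; have ltn_N : (n < N)%N by rewrite -addn1 -[1%N]/(nat_of_bool true) -b1.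
pose i0 : 'I_N := Ordinal ltn_N.
have i0s : i0 \notin state_set s by rewrite inE van.
have eS : state_set s' = i0 |: state_set s.
  apply/setP => j; rewrite !inE /add_column -val_eqE /=; case: (ltnP j n) => /= jn; first by rewrite ltn_eqF.
  by rewrite b1 van //= orbF.
have eS0 : state_set s' :\ i0 = state_set s by rewrite eS setU1K.
rewrite stelem_coef (bigD1 i0) ?eS ?setU11 //= -eS eS0 [X in _ + X]big1 ?addr0 => [|i /andP[iS ii0]].
  congr (_ ^+ _ * _).
    rewrite /ninv -(card_imset (state_set s) (_ : injective (fun z => (i0, z)))) => [|x y []//].
    apply: eq_card => -[x y]; rewrite !inE /=; apply/andP/imsetP => [[/andP[/eqP-> ys] _]|[z zs [-> ->]]].
      by exists y; rewrite ?inE.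
    rewrite eqxx; move: zs; rewrite inE => zs; split=> //; rewrite ltnNge; apply: contraTN zs => le.
    by rewrite van.
  rewrite (bigD1 B0) ?card_B0 ?eqxx ?inE ?ltnn //=; have [-> ->] := top_sub.
  rewrite big1 ?addr0 // => B /andP[/andP[/eqP cB _] BB0]; case: ifP => // le.
  by apply/eqP/negPn/negP => /(top_only bf cB le)/eqP; apply/negP.
rewrite big1 ?mulr0 // => B /andP[/eqP cB iB]; case: ifP => // le.
apply/eqP/negPn/negP => /(top_only bf cB le) eB; case/negP: ii0.
move: iB iS; rewrite eB !inE -leqNgt -val_eqE /= => ni; rewrite /add_column ltnNge ni /=.
by rewrite b1.
Qed.

End AddColumn.
End BoundedSupport.

Section BoundedMonomials.
Variable N : nat.

Lemma smono_bounded La : (size (circ La) <= N)%N -> bounded_by (rows La) (smono La N).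
Proof.
move=> sz S m /(@smono_support N _ sz)[sg [-> em]] k.
have st := @rows_stacked La.
rewrite (eq_bigr (fun j => (rows La (sg j)).1)) => [|j _]; last exact: em.
rewrite [X in (X <= _)%N /\ _](_ : _ = \sum_(j < N | (j < k)%N) (fun i => (rows La i).1) (sg j))%N //.
split; first by apply: prefix_perm_le => i j ij; have [] := stacked_anti st ij.
rewrite (eq_bigr (fun j => circ_len (rows La) (sg j))) => [|j _]; last by rewrite em inE.
by apply: prefix_perm_le => i j ij; have [] := stacked_anti st ij.
Qed.


End BoundedMonomials.

(** * From symmetric functions to the Fock model *)

Section Words.
Variable K : fieldType.
Hypothesis char0 : forall n, n.+1%:R != 0 :> K.

Lemma anti_insert k (s : seq nat) : sorted gtn s -> exists (c : K) (s' : seq nat),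
  [/\ sorted gtn s', {subset s' <= k :: s} & forall (A : algType K) (T : nat -> A),
    (forall i j, T i * T j = - (T j * T i)) ->
    T k * \prod_(i <- s) T i = c *: \prod_(i <- s') T i].
Proof.
elim: s => [|j s IH] so.
  by exists 1, [:: k]; split=> // A T _; rewrite big_seq1 big_nil mulr1 scale1r.
have /allP sj := order_path_min (rev_trans ltn_trans) so.
case: (ltngtP k j) => [lt|lt|->].
- have [c [s' [so' sub e]]] := IH (path_sorted so).
  exists (- c), (j :: s'); split=> [|i|A T anti].
  + rewrite /= path_sortedE; last exact: rev_trans ltn_trans.
    rewrite so' andbT; apply/allP => i /sub; rewrite inE => /predU1P[->//|/sj].
    exact.
  + by rewrite !inE => /predU1P[->|/sub]; rewrite ?inE ?eqxx ?orbT // => /predU1P[->|->]; rewrite ?eqxx ?orbT.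
  by rewrite !big_cons mulrA anti mulNr -mulrA e // -scalerAr scaleNr.
- exists 1, (k :: j :: s); split=> //; first by rewrite /= lt.
  by move=> A T _; rewrite scale1r [RHS]big_cons.
exists 0, [::]; split=> // A T anti; rewrite scale0r big_cons mulrA.
have -> : T j * T j = 0; last by rewrite mul0r.
apply: (scalerI (char0 1)); rewrite scaler0 scaler_nat mulr2n {1}anti.
exact: addNr.
Qed.

Lemma anti_sort (a : seq nat) : exists (c : K) (a' : seq nat), sorted gtn a' /\
  forall (A : algType K) (T : nat -> A), (forall i j, T i * T j = - (T j * T i)) ->
    \prod_(i <- a) T i = c *: \prod_(i <- a') T i.
Proof.
elim: a => [|k a [c [a1 [so e]]]].
  by exists 1, [::]; split=> // A T _; rewrite scale1r.
have [c' [a' [so' _ e']]] := anti_insert k so; exists (c * c'), a'; split=> // A T anti.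
by rewrite big_cons e // -scalerAr e' // scalerA.
Qed.

Lemma comm_prod_rem (A : nzRingType) (T : nat -> A) j b : (forall i k, T i * T k = T k * T i) ->
  j \in b -> \prod_(i <- b) T i = T j * \prod_(i <- rem j b) T i.
Proof.
move=> com; elim: b => //= i b IH; rewrite inE eq_sym; case: eqVneq => [->|_] /= jb; first by rewrite big_cons.
by rewrite !big_cons IH // !mulrA com.
Qed.

Lemma comm_prod_perm (A : nzRingType) (T : nat -> A) b b' : (forall i k, T i * T k = T k * T i) ->
  perm_eq b b' -> \prod_(i <- b) T i = \prod_(i <- b') T i.
Proof.
move=> com; elim: b b' => [|j b IH] b'; first by rewrite perm_sym => /perm_nilP ->.
move=> pe.
have jb' : j \in b' by rewrite -(perm_mem pe) mem_head.
rewrite big_cons (comm_prod_rem com jb') (IH (rem j b')) //.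
by rewrite -(perm_cons j) (permPl pe) perm_to_rem.
Qed.

End Words.

Section Bridge.
Variables (K : fieldType) (al : K).
Hypothesis al_gen : forall a b : int, al * a%:~R + b%:~R = 0 -> a = 0 /\ b = 0.
Implicit Types (v : spart -> K) (w : seq nat * seq nat).
Local Notation family := (forall N, superpoly N K).
Local Notation wvec := (vvec al).

Let char0 n : n.+1%:R != 0 :> K. Proof. by rewrite (natr_gen_eq0 al_gen). Qed.

Definition sword w : family := fun N =>
  (\prod_(k <- w.1) stpow N K k) * \prod_(r <- w.2) spow N K r.

(** One combination of words in the power sums, read as superpolynomials in every number of
    variables and as vectors of the Fock model. It is a relation and not a map, so that being well
    defined in both directions becomes a theorem ([corr_faithful], [corr_unique]). *)
Definition corr (f : family) v := exists s : seq (K * (seq nat * seq nat)),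
  [/\ all (fun x => positive x.2.2) s, forall N, f N = \sum_(x <- s) x.1 *: sword x.2 N
    & forall L, v L = \sum_(x <- s) x.1 * wvec x.2 L].

Lemma corr_eq (f f' : family) v v' : (forall N, f N = f' N) -> (forall L, v L = v' L) ->
  corr f v -> corr f' v'.
Proof. by move=> ef ev [s [ps hf hv]]; exists s; split=> // [N|L]; rewrite -?ef -?ev. Qed.

Lemma corr_word w : positive w.2 -> corr (sword w) (wvec w).
Proof.
by move=> pw; exists [:: (1, w)]; split=> [|N|L]; rewrite /= ?pw // big_seq1 ?scale1r ?mul1r.
Qed.

Lemma corr_add f v f' v' : corr f v -> corr f' v' ->
  corr (fun N => f N + f' N) (fun L => v L + v' L).
Proof.
move=> [s [ps hf hv]] [s' [ps' hf' hv']]; exists (s ++ s').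
by split=> [|N|L]; rewrite ?all_cat ?ps ?ps' // big_cat -?hf -?hf' -?hv -?hv'.
Qed.

Lemma corr_scale (c : K) f v : corr f v -> corr (fun N => c *: f N) (fun L => c * v L).
Proof.
move=> [s [ps hf hv]]; exists [seq (c * x.1, x.2) | x <- s].
split=> [|N|L]; first by rewrite all_map.
  by rewrite hf scaler_sumr big_map; apply: eq_bigr => x _; rewrite scalerA.
by rewrite hv mulr_sumr big_map; apply: eq_bigr => x _; rewrite mulrA.
Qed.

Lemma corr0 : corr (fun=> 0) (fun=> 0).
Proof. by exists [::]; split=> // [N|L]; rewrite big_nil. Qed.

Lemma corr_sum (I : Type) (r : seq I) (P : pred I) (f : I -> family) (v : I -> spart -> K) :
  (forall i, P i -> corr (f i) (v i)) ->
  corr (fun N => \sum_(i <- r | P i) f i N) (fun L => \sum_(i <- r | P i) v i L).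
Proof.
move=> h; elim: r => [|i r IH].
  by apply: corr_eq corr0 => [N|L]; rewrite big_nil.
case Pi: (P i); last by apply: corr_eq IH => [N|L]; rewrite big_cons Pi.
by apply: corr_eq (corr_add (h i Pi) IH) => [N|L]; rewrite big_cons Pi.
Qed.

Lemma corr_tpow k f v : corr f v -> corr (fun N => stpow N K k * f N) (vtp al k v).
Proof.
move=> [s [ps hf hv]]; exists [seq (x.1, (k :: x.2.1, x.2.2)) | x <- s].
split=> [|N|L]; first by rewrite all_map.
  rewrite hf mulr_sumr big_map; apply: eq_bigr => x _; rewrite -scalerAr; congr (_ *: _).
  by rewrite /sword big_cons mulrA.
have -> : v = fun L => \sum_(x <- s) x.1 * wvec x.2 L by apply/funext.
rewrite endo_sum big_map; apply: eq_bigr => x _; congr (_ * _) => /=.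
by rewrite vvec_cons -surjective_pairing.
Qed.

Lemma vp_tword k (a : seq nat) : vp al k * (\prod_(i <- a) vtp al i) = (\prod_(i <- a) vtp al i) * vp al k.
Proof.
elim: a => [|i a IH]; first by rewrite big_nil mul1r mulr1.
rewrite !big_cons -[RHS]mulrA -IH !mulrA; congr (_ * _).
by apply/eqP; rewrite -subr_eq0; apply/eqP; apply: (vp_vtp al_gen).
Qed.

Lemma corr_pow k f v : (0 < k)%N -> corr f v -> corr (fun N => spow N K k * f N) (vp al k v).
Proof.
move=> k0 [s [ps hf hv]]; exists [seq (x.1, (x.2.1, k :: x.2.2)) | x <- s].
split=> [|N|L].
- by rewrite all_map; apply: sub_all ps => x /= px; rewrite k0.
- rewrite hf mulr_sumr big_map; apply: eq_bigr => x _; rewrite -scalerAr; congr (_ *: _).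
  by rewrite /sword /= big_cons !mulrA; congr (_ * _); apply: spc_comm.
have -> : v = fun L => \sum_(x <- s) x.1 * wvec x.2 L by apply/funext.
rewrite endo_sum big_map; apply: eq_bigr => x _; congr (_ * _).
have e : vp al k * vword al x.2 = vword al (x.2.1, k :: x.2.2).
  by rewrite /vword /= big_cons !mulrA vp_tword.
exact: (congr1 (fun A : endo K => A (vac K) L) e).
Qed.

Lemma corr_elem n f v : corr f v -> corr (fun N => selem N K n * f N) (elem_endo al n v).
Proof.
move=> fv; elim/ltn_ind: n => -[_|n IH].
  by apply: corr_eq fv => [N|L] //; rewrite /selem esum0 spc1 mul1r.
have h := corr_scale (n.+1%:R^-1) (corr_sum (index_enum 'I_n.+1) (P := xpredT)
  (fun (j : 'I_n.+1) _ => corr_scale ((-1) ^+ j) (corr_pow (ltn0Sn j) (IH (n - j)%N (leq_subr j n))))).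
apply: corr_eq h => [N|L].
  transitivity (n.+1%:R^-1 *: (n.+1%:R *: selem N K n.+1) * f N); last by rewrite scalerA mulVf ?scale1r.
  rewrite selem_newton -scalerAl mulr_suml; congr (_ *: _); apply: eq_bigr => j _.
  by rewrite -scalerAl mulrA.
transitivity (n.+1%:R^-1 * ((n.+1%:R *: elem_endo al n.+1) v L)); last by rewrite mulrA mulVf // mul1r.
rewrite (elem_newton al_gen); congr (_ * _).
elim/big_ind2: _ => // a A b B -> ->; rewrite endo_addE //.
Qed.

Lemma corr_telem n f v : corr f v -> corr (fun N => stelem N K n * f N) (telem_endo al n v).
Proof.
move=> fv; have h := (corr_sum (index_enum 'I_n.+1) (P := xpredT)
  (fun (j : 'I_n.+1) _ => corr_scale ((-1) ^+ j) (corr_tpow j (corr_elem (n - j) fv)))).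
apply: corr_eq h => [N|L].
  rewrite stelem_newton mulr_suml; apply: eq_bigr => j _.
  by rewrite -scalerAl mulrA.
rewrite (telem_newton al_gen).
elim/big_ind2: _ => // a A b B -> ->; rewrite endo_addE //.
Qed.

Definition normal w := [&& sorted gtn w.1, sorted geq w.2 & positive w.2].

Lemma word_normal w : positive w.2 -> exists (c : K) w', [/\ normal w',
  forall N, sword w N = c *: sword w' N & forall L, wvec w L = c * wvec w' L].
Proof.
case: w => a b /= pos; have [c [a' [so e]]] := anti_sort char0 a.
exists c, (a', sort geq b); split=> [|N|L].
- rewrite /normal /= so /positive all_sort -/(positive b) pos andbT.
  by apply: sort_sorted => i j; apply: leq_total.
- rewrite /sword (e _ (stpow N K)) => [|i j]; last exact: stpow_anti.
  rewrite -scalerAl; congr (_ *: (_ * _)); apply: comm_prod_perm.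
    by move=> i j; apply: spc_comm.
  by rewrite perm_sym; apply: permEl; apply: perm_sort.
rewrite /vvec /vword (e _ (vtp al)) => [|i j]; last first.
  by apply/eqP; rewrite -addr_eq0; apply/eqP; apply: (vtp_anti al_gen).
rewrite (comm_prod_perm (T := vp al) (b' := sort geq b)) => [|i j|].
- by rewrite -scalerAl.
- by apply/eqP; rewrite -subr_eq0; apply/eqP; apply: (vp_vp al_gen).
by rewrite perm_sym; apply: permEl; apply: perm_sort.
Qed.

Lemma zee_gt0 b : positive b -> (0 < zee b)%N.
Proof.
move=> /allP pos; rewrite /zee big_seq prodn_cond_gt0 // => i; rewrite mem_undup => /pos i0.
by rewrite muln_gt0 expn_gt0 i0 fact_gt0.
Qed.

Lemma corr_normal f v : corr f v -> exists (W : seq (seq nat * seq nat)) (c : seq nat * seq nat -> K),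
  [/\ uniq W, all normal W, forall N, f N = \sum_(w <- W) c w *: sword w N
    & forall L, v L = \sum_(w <- W) c w * wvec w L].
Proof.
move=> [s [ps hf hv]].
have [s' [ps' hf' hv']] : exists s' : seq (K * (seq nat * seq nat)),
    [/\ all (fun x => normal x.2) s', forall N, f N = \sum_(x <- s') x.1 *: sword x.2 N
    & forall L, v L = \sum_(x <- s') x.1 * wvec x.2 L].
  elim: s f v ps hf hv => [|x s IH] f v /=.
    by move=> _ hf hv; exists [::]; split=> // [N|L]; rewrite ?hf ?hv !big_nil.
  move=> /andP[px ps] hf hv; have [c [w' [nw ew ew']]] := word_normal px.
  have [s' [ps' h1 h2]] := IH _ _ ps (fun=> erefl) (fun=> erefl).
  exists ((x.1 * c, w') :: s'); split=> [|N|L] /=; first by rewrite nw.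
    by rewrite hf !big_cons h1 ew scalerA.
  by rewrite hv !big_cons h2 ew' mulrA.
exists (undup (map snd s')), (fun w => \sum_(x <- s' | x.2 == w) x.1).
have group (V : nmodType) (F : K * (seq nat * seq nat) -> V) :
    \sum_(x <- s') F x = \sum_(w <- undup (map snd s')) \sum_(x <- s' | x.2 == w) F x.
  rewrite (exchange_big_dep xpredT) //= big_seq [RHS]big_seq; apply: eq_bigr => x xs.
  rewrite -big_filter (_ : [seq _ <- _ | _] = [:: x.2]) ?big_seq1 //.
  rewrite -(filter_pred1_uniq (undup_uniq (map snd s'))) ?mem_undup ?map_f //.
  by apply: eq_filter => w; rewrite -[LHS]/(x.2 == w) eq_sym.
split=> [||N|L]; first exact: undup_uniq.
- apply/allP => w; rewrite mem_undup => /mapP[x xs ->]; exact: (allP ps').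
- rewrite hf' group; apply: eq_bigr => w _; rewrite scaler_suml.
  by apply: eq_bigr => x /eqP->.
rewrite hv' group; apply: eq_bigr => w _; rewrite mulr_suml.
by apply: eq_bigr => x /eqP->.
Qed.

Lemma normal_perm w w' : normal w -> normal w' -> (w.1 == w'.1) && perm_eq w.2 w'.2 = (w == w').
Proof.
case: w w' => [a b] [a' b'] /and3P[_ /= so _] /and3P[_ /= so' _].
rewrite xpair_eqE; congr andb; apply/idP/eqP => [pe|->//].
by apply: (sorted_eq geq_trans) => // i j; rewrite /geq => /anti_leq.
Qed.

Lemma form_sum M (I : Type) (r : seq I) (c : I -> K) (u : I -> spart -> K) v :
  form al M (fun L => \sum_(i <- r) c i * u i L) v = \sum_(i <- r) c i * form al M (u i) v.
Proof.
rewrite /form; under eq_bigr do rewrite !mulr_suml.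
rewrite exchange_big; apply: eq_bigr => i _; rewrite mulr_sumr.
by apply: eq_bigr => L _; rewrite !mulrA.
Qed.

(** After sorting, the words are distinct and their Gram matrix is diagonal with nonzero entries.
    Pairing the zero vector with a word isolates its coefficient; the bound [M] has only to exceed
    the finitely many weights. *)
Theorem corr_faithful f : corr f (fun=> 0) -> forall N, f N = 0.
Proof.
move=> /corr_normal[W [c [uW nW hf hv]]] N; rewrite hf big_seq big1 // => w0 w0W.
suff -> : c w0 = 0 by rewrite scale0r.
pose M := \max_(w <- W) word_weight w.
have wM w : w \in W -> (word_weight w <= M)%N by move=> wW; rewrite /M (leq_bigmax_seq w).
have nrm w : w \in W -> normal w by move/(allP nW).
have : form al M (fun L => \sum_(w <- W) c w * wvec w L) (wvec w0) = 0.
  rewrite /form big1 // => L _; by rewrite -hv mul0r mul0r.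
rewrite form_sum (bigD1_seq w0) //= big1_seq ?addr0 => [|w /andP[ww0 wW]].
  have /and3P[n1 _ n3] := nrm _ w0W.
  rewrite [w0]surjective_pairing (form_vvec al_gen) -?surjective_pairing ?wM //.
  rewrite eqxx perm_refl mul1r => /eqP; rewrite !mulf_eq0 (negPf (form_vac_neq0 al_gen M)) orbF.
  rewrite expf_eq0 (negPf (al_neq0 al_gen)) andbF /= (natr_gen_eq0 al_gen).
  by rewrite eqn0Ngt zee_gt0 //= orbF => /eqP.
have /and3P[n1 _ n3] := nrm _ w0W; have /and3P[m1 _ m3] := nrm _ wW.
rewrite [w]surjective_pairing [w0]surjective_pairing (form_vvec al_gen) -?surjective_pairing ?wM //.
by rewrite normal_perm ?nrm // (negPf ww0) !mul0r mulr0.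
Qed.

End Bridge.

(** * Leading terms *)

Section TopStrip.
Variables (K : fieldType) (al : K).
Hypothesis al_gen : forall a b : int, al * a%:~R + b%:~R = 0 -> a = 0 /\ b = 0.
Variables (N n : nat) (b : bool) (s : rowstate).
Hypothesis van : vanishes_from n s.
Hypothesis nN : (n + b <= N)%N.
Local Notation s' := (add_column s n b).

Lemma top_star_inc k : star_inc s s' k = (k < n)%N.
Proof.
rewrite /star_inc /add_column; case: ltnP => /= kn; first by rewrite eqxx.
by rewrite van.
Qed.

Lemma top_circ_inc k : circ_inc s s' k = (k < n + b)%N.
Proof.
rewrite /circ_inc /add_column; case: ltnP => /= kn; first by rewrite addSn eqxx ltn_addr.
by rewrite van //= !add0n; case: b => /=; lia.
Qed.

Lemma top_strip : strip N s s'.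
Proof.
apply/allP => k _; rewrite /strip_at /strip_row /add_column.
case: ltnP => /= kn; first by case: (s k) => a c /=; lia.
by rewrite van //=; case: (b && _).
Qed.

Lemma top_strip_prod : strip_prod al N s s' = 1.
Proof.
rewrite /strip_prod /pair_prod big1 // => i _; rewrite big1 // => j _.
rewrite /strip_factor !top_star_inc !top_circ_inc.
have ji := ltn_ord j; case: ifP => [/andP[h1 h2]|_].
  by exfalso; move: h1 h2 ji; case: b => /=; lia.
case: ifP => [/andP[h1 h2]|_]; last by rewrite mulr1.
by exfalso; move: h1 h2 ji; case: b => /=; lia.
Qed.

Lemma top_star_num : star_num N s s' = n.
Proof.
rewrite /star_num (eq_count top_star_inc) -size_filter filter_iota_lt ?size_iota //.
exact: leq_trans (leq_addr b n) nN.
Qed.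

Lemma circ_rows_below M k : k \in circ_rows M s -> (k < n)%N.
Proof.
rewrite mem_circ_rows [(k < n)%N]ltnNge => /andP[ek _]; apply/negP => nk.
by rewrite van in ek.
Qed.

Lemma top_circ_rows : circ_rows N s' = circ_rows N s ++ nseq b n.
Proof.
rewrite /circ_rows -(subnKC nN) -addnA !iotaD add0n !filter_cat.
have e1 (t : rowstate) : (forall k, (k < n)%N -> (t k).2 = (s k).2) ->
    [seq k <- iota 0 n | (t k).2] = [seq k <- iota 0 n | (s k).2].
  by move=> h; apply: eq_in_filter => k; rewrite mem_iota => /h.
have e2 (t : rowstate) m M : (forall k, (m <= k)%N -> (t k).2 = false) -> [seq k <- iota m M | (t k).2] = [::].
  by move=> h; rewrite (eq_in_filter (a2 := pred0)) ?filter_pred0 // => k; rewrite mem_iota => /andP[/h->].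
rewrite e1 => [|k kn]; last by rewrite /add_column kn.
rewrite (e2 s n) => [|k nk]; last by rewrite van.
rewrite (e2 s (n + b)%N) => [|k kn]; last by rewrite van // (leq_trans (leq_addr b n)).
rewrite (e2 s' (n + b)%N) => [|k kn]; last first.
  by rewrite /add_column ltnNge (leq_trans (leq_addr b n) kn) /=; apply/negbTE; move: kn; case: b => /=; lia.
rewrite !cats0; congr (_ ++ _); rewrite /add_column; case: b => //=.
by rewrite ltnn eqxx.
Qed.

Lemma top_star_mx v i j : (i < n)%N -> star_mx al s (star_inc s s') v (Some i) (Some j) =
  if (n <= j)%N then move_coef al s i j else (Some i == Some j)%:R.
Proof. by move=> lt; rewrite /star_mx !top_star_inc lt -leqNgt. Qed.

Lemma elem_top : b = false -> elem_amp al N n s s' = 1.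
Proof.
move=> b0; have eb : nseq b n = [::] by rewrite b0.
rewrite /elem_amp top_strip top_star_num top_circ_rows eb cats0 !eqxx top_strip_prod mul1r /=.
rewrite (eq_minor (B := fun i j => (i == j)%:R)) ?size_map ?minor_id ?size_map //.
  by rewrite map_inj_uniq ?circ_rows_uniq // => i j [].
move=> i j /mapP[i' /circ_rows_below i'n ->] /mapP[j' /circ_rows_below j'n ->].
by rewrite top_star_mx // leqNgt j'n.
Qed.

(** The border is nonzero only in the last column, that of row [n]. Its position is the number of
    circles of [s], which gives the same sign as in [stelem_top]. *)
Lemma telem_top : b = true -> telem_amp al N n s s' = (-1) ^+ size (circ_rows N s).
Proof.
move=> b1; have eb : nseq b n = [:: n] by rewrite b1.
rewrite /telem_amp top_strip top_star_num.
rewrite top_circ_rows eb /= size_cat addn1 !eqxx top_strip_prod mul1r /star_minor.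
rewrite top_circ_rows eb /= size_cat addn1 map_cat /=.
set l := map Some _; have sl : size l = size (circ_rows N s) by rewrite size_map.
have nin : Some n \notin l.
  by apply/mapP => -[k /circ_rows_below kn [e]]; rewrite -e ltnn in kn.
have ul : uniq l by rewrite map_inj_uniq ?circ_rows_uniq // => i j [].
rewrite minor_cons ?size_cat ?sl ?addn1 //; last by rewrite cat_uniq ul /= orbF nin.
rewrite big_cat big_seq1 /= big_seq big1 ?add0r; last first.
  move=> k /mapP[k' /circ_rows_below kn ->].
  by rewrite top_star_inc kn !(mulr0, mul0r).
rewrite top_star_inc ltnn /= mulr1 index_cat (negPf nin) /= eqxx addn0 sl.
have -> : rem (Some n) (l ++ [:: Some n]) = l.
  by rewrite remE index_cat (negPf nin) /= eqxx addn0 take_size_cat // drop_oversize ?cats0 // size_cat addn1.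
rewrite (eq_minor (B := fun i j => (i == j)%:R)) ?minor_id ?mulr1 //.
move=> i j /mapP[i' /circ_rows_below i'n ->] /mapP[j' /circ_rows_below j'n ->].
by rewrite top_star_mx // leqNgt j'n.
Qed.

End TopStrip.

Definition prefix_le (s s' : rowstate) : Prop := forall k,
  (\sum_(j < k) (s j).1 <= \sum_(j < k) (s' j).1)%N /\ (\sum_(j < k) circ_len s j <= \sum_(j < k) circ_len s' j)%N.

(** A number that increases strictly along [prefix_le] ([height_eq]), so that induction on the
    dominance order becomes induction on a natural number. *)
Definition height N (s : rowstate) : nat :=
  (\sum_(k < N.+1) (\sum_(j < k) (s j).1 + \sum_(j < k) circ_len s j))%N.

Lemma prefix_le_height N s s' : prefix_le s s' -> (height N s <= height N s')%N.
Proof. by move=> h; apply: leq_sum => k _; have [h1 h2] := h k; apply: leq_add. Qed.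

Lemma height_eq N s s' : vanishes_from N s -> vanishes_from N s' -> prefix_le s s' ->
  (height N s' <= height N s)%N -> s = s'.
Proof.
move=> van van' h le.
have eqk k : (k <= N)%N -> (\sum_(j < k) (s j).1 = \sum_(j < k) (s' j).1)%N /\
    (\sum_(j < k) circ_len s j = \sum_(j < k) circ_len s' j)%N.
  move=> kN; have kN1 : (k < N.+1)%N by [].
  have : height N s = height N s' by apply/eqP; rewrite eqn_leq le prefix_le_height.
  rewrite /height (bigD1 (Ordinal kN1)) //= [RHS](bigD1 (Ordinal kN1)) //=.
  have le2 : (\sum_(i < N.+1 | i != Ordinal kN1) (\sum_(j < i) (s j).1 + \sum_(j < i) circ_len s j) <=
     \sum_(i < N.+1 | i != Ordinal kN1) (\sum_(j < i) (s' j).1 + \sum_(j < i) circ_len s' j))%N.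
    by apply: leq_sum => i _; have [h1 h2] := h i; apply: leq_add.
  have fin a a' c c' C C' : (a <= a')%N -> (c <= c')%N -> (C <= C')%N -> (a + c + C = a' + c' + C')%N ->
    a = a' /\ c = c' by lia.
  by have [h1 h2] := h k; apply: fin.
apply/funext=> k; case: (ltnP k N) => kN; last by rewrite van ?van'.
have [a1 a2] := eqk k (ltnW kN); have [] := eqk k.+1 kN; rewrite !big_ord_recr /= a1 a2 => /addnI e1 /addnI e2.
rewrite /circ_len e1 in e2; have {}e2 := addnI e2.
rewrite [s k]surjective_pairing [s' k]surjective_pairing e1.
by case: (s k).2 (s' k).2 e2 => [] [].
Qed.

Lemma prefix_le_trans s1 s2 s3 : prefix_le s1 s2 -> prefix_le s2 s3 -> prefix_le s1 s3.
Proof.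
move=> h h' k; have [a1 a2] := h k; have [b1 b2] := h' k.
by split; [apply: leq_trans a1 b1 | apply: leq_trans a2 b2].
Qed.

Section StripOrder.
Variables (K : fieldType) (al : K).
Variables (N n : nat) (s s' : rowstate).
Hypotheses (van : vanishes_from N s) (van' : vanishes_from N s').

Lemma strip_inc k : strip N s s' ->
  ((s' k).1 = (s k).1 + star_inc s s' k)%N /\ (circ_len s' k = circ_len s k + circ_inc s s' k)%N.
Proof.
move=> /allP st; case: (ltnP k N) => kN; last first.
  by rewrite /star_inc /circ_inc /circ_len van ?van'.
have := st k; rewrite mem_iota kN => /(_ isT); rewrite /strip_at /strip_row /star_inc /circ_inc /circ_len.
by case: (s k) (s' k) => [a []] [c []] /=; lia.
Qed.

Lemma sum_prefix_bool (p : pred nat) k M : (forall i, (N <= i)%N -> ~~ p i) -> count p (iota 0 N) = M ->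
  (\sum_(j < k) p j <= \sum_(j < k) (j < M))%N.
Proof.
move=> pN cM; have e2 : (\sum_(j < k) (j < M) = minn k M)%N.
  elim: k => [|k IH]; first by rewrite big_ord0 min0n.
  by rewrite big_ord_recr /= IH; case: ltnP; lia.
have ec m : (\sum_(j < m) p j = count p (iota 0 m))%N.
  by rewrite -sum1_count [RHS]big_mkcond /= (big_iota_ord _ _ xpredT); apply: eq_bigr => j _; case: (p j).
rewrite e2 leq_min ec; apply/andP; split; first by rewrite (leq_trans (count_size _ _)) ?size_iota.
rewrite -cM; case: (leqP k N) => kN; first by rewrite -(subnKC kN) iotaD count_cat leq_addr.
rewrite -(subnKC (ltnW kN)) iotaD count_cat [X in (_ + X)%N](_ : _ = 0%N) ?addn0 //.
apply/eqP; rewrite -leqn0 leqNgt -has_count; apply/hasPn => i.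
by rewrite mem_iota => /andP[/pN].
Qed.

Lemma sum_inc (p : pred nat) : (\sum_(j < N) p j = count p (iota 0 N))%N.
Proof.
by rewrite -sum1_count [RHS]big_mkcond /= (big_iota_ord _ _ xpredT); apply: eq_bigr => j _; case: (p j).
Qed.

Lemma strip_counts : strip N s s' ->
  (count (circ_inc s s') (iota 0 N) + size (circ_rows N s) = star_num N s s' + size (circ_rows N s'))%N.
Proof.
move=> st; rewrite !size_filter -!sum_inc /star_num -sum_inc -!big_split /=; apply: eq_bigr => k _.
by have [] := strip_inc k st; rewrite /circ_len; case: (s k) (s' k) => [a c] [a' c'] /=; lia.
Qed.

(** The increments of a strip are bits with a prescribed total, and their prefix sums are largest
    when they fill the first rows. *)
Lemma strip_prefix_le b : strip N s s' -> star_num N s s' = n ->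
  size (circ_rows N s') = (size (circ_rows N s) + nat_of_bool b)%N -> vanishes_from n s ->
  prefix_le s' (add_column s n b).
Proof.
move=> st sn sc vn k; split.
  rewrite (add_column_star _ vn) (eq_bigr (fun j : 'I_k => (s j).1 + star_inc s s' j)%N) => [|j _]; last by have [-> _] := strip_inc j st.
  rewrite big_split leq_add2l; apply: sum_prefix_bool sn => i Ni.
  by rewrite /star_inc van ?van'.
rewrite (add_column_circ _ vn) (eq_bigr (fun j : 'I_k => circ_len s j + circ_inc s s' j)%N) => [|j _]; last by have [_ ->] := strip_inc j st.
rewrite big_split leq_add2l; apply: sum_prefix_bool => [i Ni|].
  by rewrite /circ_inc van ?van'.
by have := strip_counts st; rewrite sn sc; lia.
Qed.

End StripOrder.

Definition leading (K : fieldType) (La : spart) (f : forall N, superpoly N K) : Prop :=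
  (forall N, bounded_by (rows La) (f N)) /\
  (forall N, (size (circ La) <= N)%N ->
     (f N (state_set N (rows La)))@_(state_mnm N (rows La)) = 1).

Section LeadingTerms.
Variables (K : fieldType) (al : K).
Hypothesis al_gen : forall a b : int, al * a%:~R + b%:~R = 0 -> a = 0 /\ b = 0.
Local Notation family := (forall N, superpoly N K).

Lemma rows_vanish_le La N : (size (circ La) <= N)%N -> vanishes_from N (rows La).
Proof. by move=> le; apply: vanishes_le (@rows_vanish La). Qed.

Lemma top_bounded N La s (f : superpoly N K) : (size (circ La) <= N)%N -> bounded_by s f ->
  (f (state_set N (rows La)))@_(state_mnm N (rows La)) != 0 -> prefix_le (rows La) s.
Proof.
move=> le bf nz k; have [h1 h2] := bf _ _ nz k.
have pre (g : nat -> nat) : (forall j, (N <= j)%N -> g j = 0%N) ->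
    (\sum_(j < N | (j < k)%N) g j = \sum_(j < k) g j)%N.
  move=> g0; case: (leqP k N) => kN; first by rewrite -(big_ord_widen _ g kN).
  rewrite (eq_bigl xpredT) => [|j]; last by rewrite (ltn_trans (ltn_ord j) kN).
  rewrite (big_ord_widen k g (ltnW kN)) [RHS](bigID (fun j : 'I_k => (j < N)%N)) /=.
  by rewrite [X in (_ = _ + X)%N]big1 ?addn0 // => j; rewrite -leqNgt => /g0.
have van := rows_vanish_le le; split.
  apply: leq_trans h1; rewrite -(pre (fun j => (rows La j).1)) => [|j Nj]; last by rewrite van.
  by apply: leq_sum => j _; rewrite mnmE.
apply: leq_trans h2; rewrite -(pre (circ_len (rows La))) => [|j Nj]; last by rewrite /circ_len van.
by apply: leq_sum => j _; rewrite mnmE inE.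
Qed.

Lemma prefix_le_anti La Om : prefix_le (rows La) (rows Om) -> prefix_le (rows Om) (rows La) -> La = Om.
Proof.
move=> h h'; pose N := maxn (size (circ La)) (size (circ Om)).
apply: rows_inj; apply: (@height_eq N) => //; try exact: prefix_le_height.
  by apply: rows_vanish_le; rewrite leq_maxl.
by apply: rows_vanish_le; rewrite leq_maxr.
Qed.

Lemma prefix_le_tdeg La Om : prefix_le (rows La) (rows Om) -> (deg La + fdeg La <= deg Om + fdeg Om)%N.
Proof.
move=> h; pose N := maxn (size (circ La)) (size (circ Om)).
rewrite (@tdegE La N) ?leq_maxl // (@tdegE Om N) ?leq_maxr //.
by have [] := h N.
Qed.

Lemma star_gt0 La k : (0 < (rows La k).1)%N = (k < size (star La))%N.
Proof.
rewrite -[(rows La k).1]/(nth 0%N (star La) k); case: (ltnP k (size (star La))) => k_lt; last by rewrite nth_default.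
have /andP[_] := star_part La; rewrite lt0n; apply: contraNneq => <-.
exact: mem_nth.
Qed.

Lemma remove_column La : exists Ga n (b : bool), [/\ vanishes_from n (rows Ga), rows La = add_column (rows Ga) n b &
    (deg La + fdeg La = deg Ga + fdeg Ga + (n + b))%N].
Proof.
pose n := size (star La); pose b := (rows La n).2; pose s : rowstate := fun k => if (k < n)%N then ((rows La k).1.-1, (rows La k).2) else (0%N, false).
have van : vanishes_from n s by move=> k nk; rewrite /s ltnNge nk.
have st : stacked s.
  move=> k; have := @rows_stacked La k; rewrite /s /row_rel.
  have := star_gt0 La k; have := star_gt0 La k.+1; rewrite -/n.
  case: (ltnP k.+1 n) => h1; first by rewrite (ltnW h1); case: (rows La k) (rows La k.+1) => [a []] [c []] /=; lia.
  by case: (ltnP k n) => h2; case: (rows La k) (rows La k.+1) => [a []] [c []] /=; lia.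
have [Ga eGa] := rows_surj st van.
have eLa : rows La = add_column s n b.
  apply/funext=> k; rewrite /add_column /s; have := star_gt0 La k; rewrite -/n.
  case: (ltnP k n) => kn gt0; first by cbn [fst snd]; rewrite prednK // -surjective_pairing.
  have e1 : (rows La k).1 = 0%N by apply/eqP; rewrite -leqn0 leqNgt gt0.
  rewrite [LHS]surjective_pairing e1; congr (_, _).
  case: (eqVneq k n) => [->|kn']; first by rewrite andbT.
  rewrite andbF; case: k kn gt0 e1 kn' => [|k] kn gt0 e1 kn'.
    by move: kn; rewrite leqn0 eq_sym (negPf kn').
  have nk : (n <= k)%N by move: kn; rewrite leq_eqVlt eq_sym (negPf kn').
  have e2 : (rows La k).1 = 0%N by apply/eqP; rewrite -leqn0 leqNgt star_gt0 -/n -leqNgt.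
  by have := @rows_stacked La k; rewrite /row_rel e1 e2; case: (rows La k.+1).2.
exists Ga, n, b; rewrite eGa; split=> //.
pose N := (n + b + size (circ La) + size (circ Ga))%N.
have LaN : (size (circ La) <= N)%N by rewrite /N; lia.
have GaN : (size (circ Ga) <= N)%N by rewrite /N; lia.
rewrite (tdegE LaN) (tdegE GaN) -[LHS]/(\sum_(k < N) circ_len (rows La) k)%N eLa.
rewrite (add_column_circ _ van) eGa; congr (_ + _)%N.
have nb : (n + b <= N)%N by rewrite /N; lia.
rewrite (sum_inc N (fun j => (j < n + b)%N)) -size_filter filter_iota_lt // size_iota.
by [].
Qed.

Definition column_endo n (b : bool) : endo K := if b then telem_endo al n else elem_endo al n.
Definition column_elem n (b : bool) : family := fun N => if b then stelem N K n else selem N K n.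

Lemma corr_column n b f v : corr al f v -> corr al (fun N => column_elem n b N * f N) (column_endo n b v).
Proof. by rewrite /column_elem /column_endo; case: b; [apply: corr_telem | apply: corr_elem]. Qed.

Lemma column_amp n b N La Om : vanishes_from N (rows La) -> vanishes_from N (rows Om) ->
  column_endo n b (state_delta K (rows La)) Om =
  if b then telem_amp al N n (rows La) (rows Om) else elem_amp al N n (rows La) (rows Om).
Proof.
move=> van van'; have [hX hY] := elem_endo_amp al_gen n.
by rewrite /column_endo; case: b; [apply: hY | apply: hX].
Qed.

Lemma column_support n b Ga Om La : vanishes_from n (rows Ga) -> rows La = add_column (rows Ga) n b ->
  column_endo n b (state_delta K (rows Ga)) Om != 0 -> prefix_le (rows Om) (rows La).
Proof.
move=> van eLa; pose N := maxn (size (circ Ga)) (size (circ Om)).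
have v1 : vanishes_from N (rows Ga) by apply: rows_vanish_le; rewrite leq_maxl.
have v2 : vanishes_from N (rows Om) by apply: rows_vanish_le; rewrite leq_maxr.
rewrite (column_amp n b v1 v2) eLa => nz.
have [st sn sz] : [/\ strip N (rows Ga) (rows Om), star_num N (rows Ga) (rows Om) = n &
    size (circ_rows N (rows Om)) = (size (circ_rows N (rows Ga)) + nat_of_bool b)%N].
  move: nz; rewrite /elem_amp /telem_amp; case: (b) => /=.
    by case: ifP => [/and3P[-> /eqP-> /eqP->] _|]; rewrite ?eqxx // addn1.
  by case: ifP => [/and3P[-> /eqP-> /eqP->] _|]; rewrite ?eqxx // addn0.
exact: strip_prefix_le v1 v2 _ st sn sz van.
Qed.

Lemma column_top n b Ga La : vanishes_from n (rows Ga) -> rows La = add_column (rows Ga) n b ->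
  column_endo n b (state_delta K (rows Ga)) La = if b then (-1) ^+ size (circ_rows n (rows Ga)) else 1.
Proof.
move=> van eLa; pose N := (n + b + size (circ La))%N.
have nb : (n + b <= N)%N by rewrite leq_addr.
have v1 : vanishes_from N (rows Ga) by apply: vanishes_le van; rewrite /N; lia.
have v2 : vanishes_from N (rows La) by apply: rows_vanish_le; rewrite leq_addl.
rewrite (column_amp n b v1 v2) eLa; case: ifP => b1.
  rewrite (telem_top al van nb) //; congr (_ ^+ size _).
  rewrite /circ_rows -{1}(subnKC (leq_trans (leq_addr b n) nb)) iotaD filter_cat.
  rewrite [X in _ ++ X](_ : _ = [::]) ?cats0 //; rewrite (eq_in_filter (a2 := pred0)) ?filter_pred0 // => k.
  by rewrite mem_iota add0n => /andP[nk _]; rewrite van.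
exact: elem_top.
Qed.

Lemma card_state_set N n s : vanishes_from n s -> (n <= N)%N ->
  #|state_set N s| = size (circ_rows n s).
Proof.
move=> van nN; have -> : size (circ_rows n s) = size (circ_rows N s).
  rewrite /circ_rows -(subnKC nN) iotaD filter_cat.
  rewrite [X in _ ++ X](_ : _ = [::]) ?cats0 //; rewrite (eq_in_filter (a2 := pred0)) ?filter_pred0 // => k.
  by rewrite mem_iota add0n => /andP[nk _]; rewrite van.
rewrite /circ_rows size_filter -sum_inc -sum1_card big_mkcond; apply: eq_bigr => j _.
by rewrite inE; case: (s j).2.
Qed.

Lemma seq_argmax (T : eqType) (J : seq T) (h : T -> nat) x : x \in J ->
  exists2 y, y \in J & forall z, z \in J -> (h z <= h y)%N.
Proof.
elim: J x => // a J IH x _; case: J IH => [|b J] IH.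
  by exists a; rewrite ?mem_head // => z; rewrite inE => /eqP->.
have [y yJ hy] := IH b (mem_head _ _); case: (leqP (h a) (h y)) => le.
  by exists y; [rewrite in_cons yJ orbT | move=> z; rewrite in_cons => /predU1P[->|/hy]].
exists a; rewrite ?mem_head // => z; rewrite in_cons => /predU1P[->//|/hy h1].
exact: leq_trans h1 (ltnW le).
Qed.

(** Among the superpartitions above [Om] with nonzero coefficient, take one of largest height: no
    other summand contains its leading monomial, which therefore cannot cancel. *)
Lemma leading_top (I : seq spart) (c : spart -> K) (Q : spart -> family) (f : family) Om :
  uniq I -> (forall L, L \in I -> leading L (Q L)) ->
  (forall N, f N = \sum_(L <- I) c L *: Q L N) -> Om \in I -> c Om != 0 ->
  exists Ga N, [/\ prefix_le (rows Om) (rows Ga), (size (circ Ga) <= N)%N &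
    (f N (state_set N (rows Ga)))@_(state_mnm N (rows Ga)) != 0].
Proof.
move=> uI lead hf OmI cOm; pose H := \max_(L <- I) size (circ L).
pose J := [seq L <- I | (c L != 0) && `[< prefix_le (rows Om) (rows L) >]].
have OmJ : Om \in J by rewrite mem_filter cOm OmI andbT; apply/asboolP.
have [Ga GaJ mx] := seq_argmax (fun L => height H (rows L)) OmJ.
move: GaJ; rewrite mem_filter => /andP[/andP[cGa /asboolP le] GaI].
have szH L : L \in I -> (size (circ L) <= H)%N by move=> LI; rewrite /H (leq_bigmax_seq L).
exists Ga, H; split=> //; first exact: szH.
rewrite hf sum_ffunE raddf_sum /= (bigD1_seq Ga) //= ffunE mcoeffZ.
have [_ ->] := lead _ GaI; last exact: szH.
rewrite mulr1 big1_seq ?addr0 // => L /andP[LGa LI]; rewrite ffunE mcoeffZ.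
have [-> |cL] := eqVneq (c L) 0; first by rewrite mul0r.
have [-> |nz] := eqVneq ((Q L H (state_set H (rows Ga)))@_(state_mnm H (rows Ga))) 0; first by rewrite mulr0.
have leGL := top_bounded (szH _ GaI) (proj1 (lead _ LI) H) nz.
have LJ : L \in J.
  rewrite mem_filter cL LI andbT; apply/asboolP; exact: prefix_le_trans le leGL.
have /rows_inj e := height_eq (rows_vanish_le (szH _ GaI)) (rows_vanish_le (szH _ LI)) leGL (mx _ LJ).
by rewrite e eqxx in LGa.
Qed.

(** The outer induction is on the size of Lambda^circledast and provides the superpartition without
    its first column. Multiplication by the column gives [La] up to sign plus terms below it, which
    the inner induction on [height] subtracts. *)
Theorem leading_basis La : exists Q : family, corr al Q (state_delta K (rows La)) /\ leading La Q.
Proof.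
suff main d : forall La, (deg La + fdeg La <= d)%N ->
    exists Q : family, corr al Q (state_delta K (rows La)) /\ leading La Q by exact: (main (deg La + fdeg La)%N).
elim/ltn_ind: d => d IHd {}La led; have [h] := ubnP (height d (rows La)).
elim: h La led => // h IHh La led; rewrite ltnS => leh.
have [Ga [n [b [van eLa etot]]]] := remove_column La; case: (posnP (n + b)) => [nb0|nb0].
  have eb : b = false by move: nb0; case: (b) => //; rewrite addn1.
  have en : n = 0%N by lia.
  have e0 : rows La = zero_rows.
    by rewrite eLa eb en; apply/funext=> k; rewrite /add_column.
  exists (fun=> 1); split.
    apply: corr_eq (corr_word al (w := ([::], [::])) isT) => [N|L].
      by rewrite /sword !big_nil mulr1.
    by rewrite /vvec /vword !big_nil mulr1 /vac e0.
  have one_coef N S m : ((1 : superpoly N K) S)@_m = (if S == set0 then (m == 0%MM)%:R else 0).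
    by rewrite ffunE; case: ifP => _; rewrite ?mcoeff1 ?mcoeff0.
  split=> [N S m|N _]; rewrite one_coef.
    have [->|_] := eqVneq S set0; last by rewrite eqxx.
    have [-> _ k|_] := eqVneq m 0%MM; last by rewrite eqxx.
    by split; rewrite big1 // => j _; rewrite mnm0E ?inE.
  have -> : state_set N (rows La) = set0 by apply/setP => j; rewrite !inE e0.
  have -> : state_mnm N (rows La) = 0%MM by apply/mnmP => j; rewrite mnmE mnm0E e0.
  by rewrite !eqxx.
have [QG [cG lG]] : exists Q : family, corr al Q (state_delta K (rows Ga)) /\ leading Ga Q.
  by apply: (IHd (deg Ga + fdeg Ga)%N) => //; lia.
pose v0 := column_endo n b (state_delta K (rows Ga)).
have cf0 : corr al (fun N => column_elem n b N * QG N) v0 := corr_column n b cG.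
have supp Om : v0 Om != 0 -> prefix_le (rows Om) (rows La) by apply: column_support.
(* The condition is moved inside the existential, with an arbitrary value where it fails, so that
   the axiom of choice applies. *)
have ex Om : exists Q : family, (Om != La) && (v0 Om != 0) ->
    corr al Q (state_delta K (rows Om)) /\ leading Om Q.
  case: (boolP ((Om != La) && (v0 Om != 0))) => [/andP[ne nz]|_]; last by exists (fun=> 0).
  have leOm := prefix_le_tdeg (supp _ nz).
  have [|Q hQ] := IHh Om (leq_trans leOm led); last by exists Q.
  rewrite (leq_trans _ leh) // ltnNge; apply/negP => le; case/negP: ne; apply/eqP/rows_inj.
  apply: (height_eq (N := d)) le => //; try exact: supp.
    by apply: rows_vanish_le; rewrite (leq_trans (size_circ_le Om)) // (leq_trans leOm).
  by apply: rows_vanish_le; rewrite (leq_trans (size_circ_le La)).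
have [F hF] := choice ex.
(* The coefficient of [La] in the model; the leading coefficient of the product of superpolynomials
   is the same sign, so one division normalises both. *)
pose a := v0 La.
have aE : a = if b then (-1) ^+ size (circ_rows n (rows Ga)) else 1 by apply: column_top.
have a0 : a != 0 by rewrite aE; case: ifP => _; rewrite ?signr_eq0 ?oner_eq0.
pose P Om := (Om != La) && (v0 Om != 0).
exists (fun N => a^-1 *: (column_elem n b N * QG N + \sum_(Om <- bounded_sparts d | P Om) (- v0 Om) *: F Om N)).
split.
  have h1 : corr al (fun N => \sum_(Om <- bounded_sparts d | P Om) (- v0 Om) *: F Om N)
      (fun L => \sum_(Om <- bounded_sparts d | P Om) (- v0 Om) * state_delta K (rows Om) L).
    by apply: corr_sum => Om POm; apply: corr_scale; have [] := hF _ POm.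
  apply: corr_eq (corr_scale a^-1 (corr_add cf0 h1)) => // L.
  rewrite state_delta_eq; have [->|LLa] := eqVneq L La.
    rewrite big1 ?addr0 ?mulVf // => Om /andP[OmLa _].
    by rewrite state_delta_eq eq_sym (negPf OmLa) mulr0.
  apply/eqP; rewrite mulf_eq0 invr_eq0 (negPf a0) /=.
  have [e0|vL] := eqVneq (v0 L) 0.
    rewrite e0 add0r big1 // => Om /andP[_ nz]; rewrite state_delta_eq.
    by case: eqP => [e|_]; rewrite ?mulr0 //; rewrite -e e0 eqxx in nz.
  have LS : L \in bounded_sparts d by rewrite mem_bounded (leq_trans (prefix_le_tdeg (supp _ vL))).
  rewrite big_mkcond (bigD1_seq L) ?uniq_bounded //= /P LLa vL /= state_delta_eq eqxx mulr1.
  rewrite big1_seq ?addr0 ?subrr // => M /andP[ML _]; case: ifP => // _.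
  by rewrite state_delta_eq eq_sym (negPf ML) mulr0.
have bG N : bounded_by (rows La) (column_elem n b N * QG N).
  rewrite eLa /column_elem; case: (b); [apply: stelem_bounded | apply: selem_bounded] => //; apply: (proj1 lG).
split=> [N|N LaN].
  apply: bounded_scale; apply: bounded_add => //; apply: bounded_sum => Om POm; apply: bounded_scale.
  have [_ [bF _]] := hF _ POm; have /andP[_ nz] := POm; have leOm := supp _ nz.
  by apply: bounded_le (bF N) => k; have [h1 h2] := leOm k.
have nb : (n + b <= N)%N.
  rewrite leqNgt; apply/negP => lt; have := rows_vanish_le LaN (k := (n + b).-1); rewrite eLa /add_column.
  case: (b) lt nb0 => /=; rewrite ?addn1 ?addn0 /= ?ltnn ?eqxx ?ltnS => h1 h2; first by move=> /(_ h1).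
  by rewrite ltn_predL h2 => H; have le : (N <= n.-1)%N; [lia | have := H le].
rewrite ffunE mcoeffZ ffunE mcoeffD sum_ffunE raddf_sum /= big1 ?addr0 => [|Om POm]; last first.
  rewrite ffunE mcoeffZ; have [_ [bF _]] := hF _ POm; have /andP[ne nz] := POm.
  have [-> |nzc] := eqVneq ((F Om N (state_set N (rows La)))@_(state_mnm N (rows La))) 0; first by rewrite mulr0.
  have le1 := top_bounded LaN (bF N) nzc.
  by rewrite (prefix_le_anti le1 (supp _ nz)) eqxx in ne.
have GaN : (size (circ Ga) <= N)%N by rewrite (leq_trans (size_circ_vanish van)) // (leq_trans (leq_addr b n)).
suff -> : ((column_elem n b N * QG N) (state_set N (rows La)))@_(state_mnm N (rows La)) = a by rewrite mulVf.
have topG := proj2 lG _ GaN; have bdG := proj1 lG N.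
rewrite aE eLa /column_elem; case: (b) nb => nb.
  by rewrite (stelem_top van nb) // topG mulr1 (card_state_set van) // (leq_trans (leq_addr true n)).
by rewrite (selem_top van nb).
Qed.

End LeadingTerms.

(** * Jack superpolynomials *)

Section Identification.
Variables (K : fieldType) (al : K).
Hypothesis al_gen : forall a b : int, al * a%:~R + b%:~R = 0 -> a = 0 /\ b = 0.
Local Notation family := (forall N, superpoly N K).
Local Notation delta La := (state_delta K (rows La)).
Variable Q : spart -> family.
Hypothesis corrQ : forall La, corr al (Q La) (delta La).
Hypothesis leadQ : forall La, leading La (Q La).

Lemma delta_expand M v L : (forall Om, v Om != 0 -> Om \in bounded_sparts M) ->
  v L = \sum_(Om <- bounded_sparts M) v Om * delta Om L.
Proof.
move=> sv; case: (boolP (L \in bounded_sparts M)) => [LS|LS].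
  rewrite (bigD1_seq L) ?uniq_bounded //= state_delta_eq eqxx mulr1.
  by rewrite big1 ?addr0 // => Om OmL; rewrite state_delta_eq eq_sym (negPf OmL) mulr0.
have -> : v L = 0 by apply/eqP; apply: contraNT LS; apply: sv.
rewrite big1_seq // => Om /andP[_ OmS]; rewrite state_delta_eq; case: eqP => [e|]; rewrite ?mulr0 //.
by rewrite e OmS in LS.
Qed.

Lemma corr_expand f v : corr al f v -> exists M, forall M', (M <= M')%N ->
  (forall L, v L != 0 -> L \in bounded_sparts M') /\
  forall N, f N = \sum_(L <- bounded_sparts M') v L *: Q L N.
Proof.
move=> fv; have [W [c [_ nW _ hv]]] := corr_normal al_gen fv.
exists (\max_(w <- W) word_weight w)%N => M' leM.
have sv L : v L != 0 -> L \in bounded_sparts M'.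
  rewrite hv big_seq => /sum_neq0[w wW]; rewrite mulf_eq0 negb_or => /andP[_ nz].
  have /and3P[_ _ pos] := allP nW _ wW.
  by rewrite mem_bounded (vvec_weight al_gen pos nz) (leq_trans _ leM) // (leq_bigmax_seq w).
split=> // N; apply/eqP; rewrite -subr_eq0; apply/eqP.
pose g : family := fun N => f N + (-1) *: \sum_(L <- bounded_sparts M') v L *: Q L N.
suff /(corr_faithful al_gen)/(_ N) : corr al g (fun=> 0) by rewrite /g scaleN1r.
have h := corr_sum (bounded_sparts M') (P := xpredT) (fun L _ => corr_scale (v L) (corrQ L)).
apply: corr_eq (corr_add fv (corr_scale (-1) h)) => // L.
by rewrite (delta_expand L sv) mulN1r subrr.
Qed.

Lemma corr_unique f v v' : corr al f v -> corr al f v' -> forall L, v L = v' L.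
Proof.
move=> h h' L; apply/eqP; rewrite -subr_eq0; apply: contraT => nz.
have hd : corr al (fun=> 0) (fun L => v L - v' L).
  by apply: corr_eq (corr_add h (corr_scale (-1) h')) => [N|L']; rewrite ?scaleN1r ?subrr ?mulN1r.
have [M hM] := corr_expand hd; have [sv e] := hM M (leqnn M).
have [Ga [N [_ _ ]]] := leading_top (uniq_bounded M) (fun L _ => leadQ L) e (sv _ nz) nz.
by rewrite ffunE mcoeff0 eqxx.
Qed.

(** A nonzero coefficient at [Om] forces by [leading_top] a monomial of [f] above [Om], and all
    monomials of [f] lie below [La]. *)
Lemma corr_support f v La Om : leading La f -> corr al f v -> v Om != 0 -> prefix_le (rows Om) (rows La).
Proof.
move=> lf fv nz; have [M hM] := corr_expand fv; have [sv e] := hM M (leqnn M).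
have [Ga [N [le sz nzc]]] := leading_top (uniq_bounded M) (fun L _ => leadQ L) e (sv _ nz) nz.
exact: prefix_le_trans le (top_bounded sz (proj1 lf N) nzc).
Qed.

Lemma corr_lead f v La : leading La f -> corr al f v -> v La = 1.
Proof.
move=> lf fv; have [M hM] := corr_expand fv.
have [sv e] := hM _ (leq_maxl M (deg La + fdeg La)).
have LaS : La \in bounded_sparts (maxn M (deg La + fdeg La)) by rewrite mem_bounded leq_maxr.
have := proj2 lf _ (leqnn _); rewrite e sum_ffunE raddf_sum /= (bigD1_seq La) ?uniq_bounded //=.
rewrite ffunE mcoeffZ (proj2 (leadQ La)) // mulr1 big1_seq ?addr0 // => L /andP[LLa LS].
rewrite ffunE mcoeffZ; apply/eqP; rewrite mulf_eq0; apply: contraNT LLa; rewrite negb_or => /andP[vL nz].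
apply/eqP/prefix_le_anti; first exact: corr_support lf fv vL.
exact: top_bounded (leqnn _) (proj1 (leadQ L) _) nz.
Qed.

Variable P : spart -> family.
Hypothesis leadP : forall La, leading La (P La).
Definition power_word (G : spart) := (fpart G, bpart G).
Hypothesis orthP : forall La Om, La <> Om -> exists (I : seq spart) (a b : spart -> K),
  [/\ uniq I, forall N, P La N = \sum_(G <- I) a G *: sword K (power_word G) N,
      forall N, P Om N = \sum_(G <- I) b G *: sword K (power_word G) N
    & 0 = \sum_(G <- I) a G * b G * (al ^+ size (bpart G) * (zee (bpart G))%:R)].
Hypothesis power_word_inj : injective power_word.
Hypothesis power_word_normal : forall G, normal (power_word G).

Let corr_words (I : seq spart) (a : spart -> K) f : (forall N, f N = \sum_(G <- I) a G *: sword K (power_word G) N) ->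
  corr al f (fun L => \sum_(G <- I) a G * vvec al (power_word G) L).
Proof.
move=> e; have h := corr_sum I (P := xpredT) (fun G _ => corr_scale (a G) (corr_word al (w := power_word G) _)).
by apply: corr_eq (h _) => [N|L|G]; rewrite ?e //; have /and3P[] := power_word_normal G.
Qed.

Lemma orth_form La Om v v' : La <> Om -> corr al (P La) v -> corr al (P Om) v' ->
  exists M, forall M', (M <= M')%N -> form al M' v v' = 0.
Proof.
move=> ne cv cv'; have [I [a [b [uI ea eb e0]]]] := orthP ne.
pose M := \max_(G <- I) word_weight (power_word G); exists M => M' leM.
have wM G : G \in I -> (word_weight (power_word G) <= M')%N.
  by move=> GI; apply: leq_trans leM; rewrite /M (leq_bigmax_seq G).
have -> : v = fun L => \sum_(G <- I) a G * vvec al (power_word G) L.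
  by apply/funext => L; apply: corr_unique cv (corr_words ea) L.
have -> : v' = fun L => \sum_(G <- I) b G * vvec al (power_word G) L.
  by apply/funext => L; apply: corr_unique cv' (corr_words eb) L.
rewrite form_sum; transitivity ((\sum_(G <- I) a G * b G * (al ^+ size (bpart G) * (zee (bpart G))%:R)) *
    form al M' (vac K) (vac K)); last by rewrite -e0 mul0r.
rewrite mulr_suml.
rewrite big_seq [RHS]big_seq; apply: eq_bigr => G GI.
rewrite form_sym form_sum (bigD1_seq G) //= big1_seq => [|H /andP[HG HI]].
  have /and3P[n1 _ n3] := power_word_normal G.
  rewrite addr0 (form_vvec al_gen) ?wM // eqxx perm_refl mul1r; move: (form _ _ _ _) => F; ring.
have /and3P[n1 _ n3] := power_word_normal G; have /and3P[m1 _ m3] := power_word_normal H.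
rewrite (form_vvec al_gen) ?wM //.
rewrite -[_ == _]/((power_word H).1 == (power_word G).1) -[perm_eq _ _]/(perm_eq (power_word H).2 (power_word G).2).
by rewrite normal_perm // (inj_eq power_word_inj) (negPf HG) !mul0r mulr0.
Qed.

(** Orthogonality concerns pairs of different superpartitions and contains the expansion of both
    functions in power sums. A second superpartition gives access to this expansion for [P La]. *)
Lemma spart_other (La : spart) : exists Om : spart, La <> Om.
Proof.
pose s : rowstate := fun k => if k == 0%N then ((deg La).+1, false) else (0%N, false).
have st : stacked s by move=> k; rewrite /row_rel /s; case: k.
have [|Om e] := rows_surj (N := 1) st; first by case.
exists Om => e'.
have := degE (leqnn (size (circ La))).
have : (deg La < (rows La 0).1)%N by have -> : rows La = s by [rewrite e' e]; rewrite /s ltnS.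
have := @rows_vanish La; case: (size (circ La)) => [|l] van lt; first by move: lt; rewrite van.
by rewrite big_ord_recl => eD; move: lt; rewrite eD ltnNge leq_addr.
Qed.

(** Let [V La'] be the vector of [P La']. It has coefficient 1 at [La'] and support below [La']. For
    a smaller [Om] the vector of [P Om] is by induction on [height] the basis vector, so
    orthogonality of [P La'] and [P Om] says that [V La' Om] times a nonzero norm is zero. *)
Theorem corr_delta La : corr al (P La) (delta La).
Proof.
have exV La' : exists v, corr al (P La') v.
  have [Om /orthP[I [a [b [_ ea _ _]]]]] := spart_other La'.
  by exists (fun L => \sum_(G <- I) a G * vvec al (power_word G) L); apply: corr_words.
have [V cV] := choice exV.
suff main N : forall La', (deg La' + fdeg La' <= N)%N -> forall Om, V La' Om = delta La' Om.
  by apply: corr_eq (cV La) => // L; apply: main (leqnn _) L.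
move=> La'; have [h] := ubnP (height N (rows La')).
elim: h La' => // h IH La'; rewrite ltnS => leh leN Om; rewrite state_delta_eq.
have [->|OmLa] := eqVneq Om La'; first exact: corr_lead (leadP La') (cV La').
apply/eqP; apply: contraT => nz; have le := corr_support (leadP La') (cV La') nz.
have leOm : (deg Om + fdeg Om <= N)%N := leq_trans (prefix_le_tdeg le) leN.
have VOm : V Om = delta Om.
  apply/funext => L; apply: IH => //; rewrite (leq_trans _ leh) // ltnNge; apply/negP => le'.
  case/negP: OmLa; apply/eqP/rows_inj; apply: (height_eq (N := N)) le' => //.
    by apply: rows_vanish_le; rewrite (leq_trans (size_circ_le Om)).
  by apply: rows_vanish_le; rewrite (leq_trans (size_circ_le La')).
have [M hM] := orth_form (fun e : La' = Om => negP OmLa (introT eqP (esym e))) (cV La') (cV Om).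
have := hM (maxn M (deg Om + fdeg Om)) (leq_maxl _ _).
have OmS : Om \in bounded_sparts (maxn M (deg Om + fdeg Om)) by rewrite mem_bounded leq_maxr.
rewrite VOm /form (bigD1_seq Om) ?uniq_bounded //= state_delta_eq eqxx mulr1.
rewrite big1_seq ?addr0 => [/eqP|L /andP[LOm _]]; last by rewrite state_delta_eq (negPf LOm) mulr0 mul0r.
by rewrite mulf_eq0 (negPf nz) (negPf (fnorm_neq0 al_gen _ _)).
Qed.

End Identification.

(** * Cells of a strip *)

Section CellLists.

(** Normal form for the lists of distinguished cells of a strip, which have at most one cell in each
    row. States number their rows from 0, cells from 1. *)
Definition row_cells N (p : pred nat) (col : nat -> nat) : seq cell := [seq (i.+1, col i) | i <- iota 0 N & p i].

Lemma filter_cells la N (P : pred cell) p col : (size la <= N)%N ->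
  (forall i j, (i < N)%N -> ((i.+1, j) \in cells la) && P (i.+1, j) = p i && (j == col i)) ->
  [seq c <- cells la | P c] = row_cells N p col.
Proof.
move=> sz h; rewrite /cells /allpairs_dep filter_flatten -map_comp.
pose g i := if p i then [:: (i.+1, col i)] else [::].
have -> : row_cells N p col = flatten [seq g i | i <- iota 0 N].
  rewrite /row_cells; elim: (iota 0 N) => //= i I IH; rewrite /g; case: ifP => /= _; by rewrite IH.
have -> : flatten [seq g i | i <- iota 0 N] = flatten [seq g i | i <- iota 0 (size la)].
  rewrite -(subnKC sz) iotaD map_cat flatten_cat [X in _ ++ X](_ : _ = [::]) ?cats0 //.
  have : all (fun i => size la <= i < N)%N (iota (0 + size la) (N - size la)).
    by apply/allP => i; rewrite mem_iota; lia.
  elim: (iota _ _) => //= i I IH /andP[/andP[li iN] /IH ->]; rewrite /g; case: ifP => // pi.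
  have := h i (col i) iN; rewrite pi eqxx mem_cells /= /part /= nth_default // => /andP[/andP[]].
  by case: (col i).
rewrite -[1%N]addn0 iotaDl -map_comp; congr flatten.
have : all (fun i => i < N)%N (iota 0 (size la)).
  by apply/allP => i; rewrite mem_iota add0n => /andP[_ /leq_trans->].
elim: (iota 0 (size la)) => // i I IH /= /andP[iN /IH ->]; congr (_ :: _).
apply: perm_small_eq; first by rewrite /g; case: ifP.
apply: uniq_perm; first by rewrite filter_uniq // map_inj_uniq ?iota_uniq // => a b [].
  by rewrite /g; case: ifP.
move=> c; rewrite mem_filter.
have -> : (c \in [seq (i.+1, y) | y <- iota 1 (part la i.+1)]) = (c.1 == i.+1) && (c \in cells la).
  case: c => a j; rewrite mem_cells; apply/mapP/andP => [[y + [-> ->]]|[/= /eqP->]] /=.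
    by rewrite mem_iota; case: y => //= y; rewrite eqxx.
  by case: j => // j /= le; exists j.+1; rewrite // mem_iota /= ltnS.
rewrite andbCA; case: (eqVneq c.1 i.+1) => [e|ne] /=; last first.
  by rewrite /g; case: ifP => // _; rewrite inE; apply/esym/negP => /eqP e; rewrite e eqxx in ne.
have -> : c = (i.+1, c.2) by rewrite -e -surjective_pairing.
rewrite andbC h // /g; case: ifP => //= _; by rewrite inE xpair_eqE eqxx.
Qed.

End CellLists.

Section StripCells.
Variables (La Om : spart) (N : nat).
Hypotheses (leLa : (size (circ La) <= N)%N) (leOm : (size (circ Om) <= N)%N).
Local Notation s := (rows La).
Local Notation s' := (rows Om).
Local Notation X := (star_inc s s').
Local Notation Y := (circ_inc s s').

Lemma part_star (G : spart) i : part (star G) i.+1 = (rows G i).1. Proof. by []. Qed.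
Lemma part_circ (G : spart) i : part (circ G) i.+1 = circ_len (rows G) i.
Proof. by rewrite /part /= -rows_circ. Qed.

Let van : vanishes_from N s := rows_vanish_le leLa.
Let van' : vanishes_from N s' := rows_vanish_le leOm.

Lemma vstrip_rows a b : vstrip_part a (star Om) (star La) && vstrip_part b (circ Om) (circ La) =
  [&& strip N s s', star_num N s s' == a & count Y (iota 0 N) == b].
Proof.
have sumS : sumn (star Om) = (\sum_(k < N) (s' k).1)%N := degE leOm.
have sumS0 : sumn (star La) = (\sum_(k < N) (s k).1)%N := degE leLa.
have sumC G : (size (circ G) <= N)%N -> sumn (circ G) = (\sum_(k < N) circ_len (rows G) k)%N.
  by move=> le; rewrite (@sumn_nth _ N) //; apply: eq_bigr => k _; rewrite -rows_circ.
rewrite /vstrip_part; apply/idP/idP.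
  move=> /andP[/and3P[/containedP c1 /eqP e1 /rows_uniqP u1] /and3P[/containedP c2 /eqP e2 /rows_uniqP u2]].
  have st : strip N s s'.
    apply/allP => k _; rewrite /strip_at /strip_row !rows_circ.
    by rewrite c2 u2 c1 u1.
  rewrite st; have inc k := strip_inc van van' k st.
  move: e1 e2; rewrite sumS sumS0 !sumC //.
  rewrite (eq_bigr (fun k : 'I_N => (s k).1 + X k)%N) => [|k _]; last by have [] := inc k.
  rewrite big_split /= => /addnI; rewrite sum_inc -/(star_num N s s') => ->; rewrite eqxx.
  rewrite (eq_bigr (fun k : 'I_N => circ_len s k + Y k)%N) => [|k _]; last by have [] := inc k.
  by rewrite big_split /= => /addnI; rewrite sum_inc => ->; rewrite eqxx.
move=> /and3P[st /eqP e1 /eqP e2]; have inc k := strip_inc van van' k st.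
have i1 k : nth 0%N (star Om) k = (nth 0%N (star La) k + X k)%N by have [] := inc k.
have i2 k : nth 0%N (circ Om) k = (nth 0%N (circ La) k + Y k)%N.
  by rewrite -!rows_circ; have [] := inc k.
apply/andP; split; apply/and3P; split.
- by apply/containedP => k; rewrite i1 leq_addr.
- rewrite sumS sumS0 -e1 /star_num -sum_inc -big_split /=; apply/eqP; apply: eq_bigr => k _.
  by have [] := inc k.
- by apply/rows_uniqP => k; rewrite i1; case: (X k); lia.
- by apply/containedP => k; rewrite i2 leq_addr.
- rewrite !sumC // -e2 -sum_inc -big_split /=; apply/eqP; apply: eq_bigr => k _.
  by have [] := inc k.
by apply/rows_uniqP => k; rewrite i2; case: (Y k); lia.
Qed.

Lemma size_circ_rows_fdeg G : (size (circ G) <= N)%N -> size (circ_rows N (rows G)) = fdeg G.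
Proof. by move=> le; rewrite (fdegE le) size_filter -sum_inc. Qed.

(** For a strip with [n] squares, the number of rows that grow in Lambda^circledast and the change
    in the number of circles determine each other ([strip_counts]). *)
Lemma strip_guard n (b : bool) :
  [&& strip N s s', star_num N s s' == n & size (circ_rows N s') == (size (circ_rows N s) + b)%N] =
  (vstrip_part n (star Om) (star La) && vstrip_part (n + b) (circ Om) (circ La)) &&
    (Om \in sparts (deg La + n) (fdeg La + b)).
Proof.
rewrite vstrip_rows mem_sparts !size_circ_rows_fdeg //.
case st: (strip N s s') => //=; case: eqP => //= sn.
have := strip_counts van van' st; rewrite !size_circ_rows_fdeg // sn => e.
have -> : deg Om = (deg La + n)%N.
  rewrite (degE leOm) (degE leLa) -sn /star_num -sum_inc -big_split /=; apply: eq_bigr => k _.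
  by have [] := strip_inc van van' k st.
rewrite eqxx /=; apply/eqP/andP => [e1|[_ /eqP//]].
by split; apply/eqP; lia.
Qed.

Hypothesis st : strip N s s'.
Let inc k := strip_inc van van' k st.

Lemma inc_rel k : (X k + (s' k).2 = (s k).2 + Y k)%N.
Proof.
have [h1 h2] := inc k; rewrite /circ_len h1 in h2; move: h2.
by case: (X k) (Y k) (s k).2 (s' k).2 => [] [] [] []; lia.
Qed.

Let memC k j (G : spart) : ((k.+1, j) \in cells (circ G)) = (0 < j <= circ_len (rows G) k)%N.
Proof. by rewrite mem_cells part_circ. Qed.
Let memS k j (G : spart) : ((k.+1, j) \in cells (star G)) = (0 < j <= (rows G k).1)%N.
Proof. by rewrite mem_cells part_star. Qed.
Let memK k j (G : spart) : ((k.+1, j) \in circles G) = ((rows G k).1 < j <= circ_len (rows G) k)%N.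
Proof. by rewrite mem_skew part_star part_circ. Qed.
Let size_star G : (size (circ G) <= N)%N -> (size (star G) <= N)%N := leq_trans (size_star_circ G).

Lemma new_squares_rows : new_squares Om La = row_cells N (fun i => X i && ~~ (s i).2) (fun i => (s i).1.+1).
Proof.
rewrite /new_squares -?filter_predI; apply: filter_cells; rewrite ?size_star // => k j _.
rewrite [LHS]/= ?memK ?memS ?memC; have [] := inc k; have := inc_rel k; rewrite /circ_len.
by case: (X k) (Y k) (s k) (s' k) => [] [] [a []] [a' []] /=; lia.
Qed.

Lemma bumping_squares_rows : bumping_squares Om La = row_cells N (fun i => X i && (s i).2) (fun i => (s i).1.+1).
Proof.
rewrite /bumping_squares -?filter_predI; apply: filter_cells; rewrite ?size_star // => k j _.
rewrite [LHS]/= ?memK ?memS ?memC; have [] := inc k; have := inc_rel k; rewrite /circ_len.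
by case: (X k) (Y k) (s k) (s' k) => [] [] [a []] [a' []] /=; lia.
Qed.

Lemma preexisting_circles_rows : preexisting_circles Om La = row_cells N (fun i => ~~ X i && (s i).2) (fun i => (s i).1.+1).
Proof.
rewrite /preexisting_circles -?filter_predI; apply: filter_cells; rewrite ?size_star // => k j _.
rewrite [LHS]/= ?memK ?memS ?memC; have [] := inc k; have := inc_rel k; rewrite /circ_len.
by case: (X k) (Y k) (s k) (s' k) => [] [] [a []] [a' []] /=; lia.
Qed.

Lemma new_circles_rows : new_circles Om La = row_cells N (fun i => (s' i).2 && ~~ ((s i).2 && ~~ X i)) (fun i => (s' i).1.+1).
Proof.
rewrite /new_circles -?filter_predI; apply: filter_cells; rewrite ?size_star // => k j _.
rewrite [LHS]/= ?memK ?memS ?memC; have [] := inc k; have := inc_rel k; rewrite /circ_len.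
by case: (X k) (Y k) (s k) (s' k) => [] [] [a []] [a' []] /=; lia.
Qed.

Lemma xcells_rows : xcells Om La = row_cells N (fun i => X i) (fun i => (s i).1.+1).
Proof.
rewrite /xcells -?filter_predI; apply: filter_cells; rewrite ?size_star // => k j _.
rewrite [LHS]/= !mem_filter ?memK ?memS ?memC; have [] := inc k; have := inc_rel k; rewrite /circ_len.
by case: (X k) (Y k) (s k) (s' k) => [] [] [a []] [a' []] /=; lia.
Qed.

Lemma ycells_rows : ycells Om La = row_cells N (fun i => Y i) (fun i => (circ_len s i).+1).
Proof.
rewrite /ycells -?filter_predI; apply: filter_cells; rewrite ?size_star // => k j _.
rewrite [LHS]/= !mem_filter ?memK ?memS ?memC; have [] := inc k; have := inc_rel k; rewrite /circ_len.
by case: (X k) (Y k) (s k) (s' k) => [] [] [a []] [a' []] /=; lia.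
Qed.

End StripCells.

(** * The product over columns *)

Section ColumnCount.
Variables (g g' : nat -> nat) (p : pred nat) (N b : nat).
Hypothesis g_anti : forall i j, (i <= j)%N -> (g j <= g i)%N.
Hypothesis g'_anti : forall i j, (i <= j)%N -> (g' j <= g' i)%N.
Hypothesis g'E : forall i, g' i = (g i + p i)%N.

(* The column length [b] after the first [k] rows have been moved from [g] to [g']. *)
Definition col_count k : nat := count (fun i => b <= (if (i < k)%N then g' i else g i))%N (iota 0 N).

Lemma col_count_step k : (k < N)%N -> col_count k.+1 = (col_count k + (p k && ((g k).+1 == b)))%N.
Proof.
move=> kN; rewrite /col_count.
have -> : iota 0 N = iota 0 k ++ k :: iota k.+1 (N - k.+1) by rewrite -{1}(subnKC kN) -addn1 -addnA iotaD add1n /= add0n addn1.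
rewrite !count_cat /= ltnn ltnSn.
have -> : count (fun i => (b <= (if (i < k.+1)%N then g' i else g i))%N) (iota 0 k) =
    count (fun i => (b <= (if (i < k)%N then g' i else g i))%N) (iota 0 k).
  by apply: eq_in_count => i; rewrite mem_iota add0n => /= ik; rewrite ik ltnS (ltnW ik).
have -> : count (fun i => (b <= (if (i < k.+1)%N then g' i else g i))%N) (iota k.+1 (N - k.+1)) =
    count (fun i => (b <= (if (i < k)%N then g' i else g i))%N) (iota k.+1 (N - k.+1)).
  by apply: eq_in_count => i; rewrite mem_iota => /andP[ik _]; rewrite !ifF //; apply/negP; lia.
by rewrite g'E; case: (p k); lia.
Qed.

(** When row [k] is about to receive its cell in column [b], exactly the [k] rows above it reach
    that column. *)
Lemma col_count_at k : (k < N)%N -> p k -> (g k).+1 = b -> col_count k = k.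
Proof.
move=> kN pk e; rewrite /col_count -(subnKC (ltnW kN)) iotaD count_cat.
have -> : count (fun i => (b <= (if (i < k)%N then g' i else g i))%N) (iota 0 k) = k.
  rewrite -[RHS](size_iota 0) -count_predT; apply: eq_in_count => i; rewrite mem_iota add0n => /= ik.
  by rewrite ik (leq_trans _ (g'_anti (ltnW ik))) // g'E pk -e addn1.
apply/eqP; rewrite -[X in _ == X]addn0 eqn_add2l -leqn0 leqNgt -has_count; apply/hasPn => i.
by rewrite mem_iota add0n => /andP[ki _]; rewrite ltnNge ki /= -ltnNge -e ltnS g_anti.
Qed.

Lemma col_count_le k l : (k <= l <= N)%N -> (col_count k <= col_count l)%N.
Proof.
move=> /andP[kl]; elim: l kl => [|l IH]; first by rewrite leqn0 => /eqP->.
rewrite leq_eqVlt => /predU1P[->//|]; rewrite ltnS => kl lN.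
by rewrite col_count_step // (leq_trans (IH kl (ltnW lN))) ?leq_addr.
Qed.

Lemma col_count_const k : (k <= N)%N -> (forall i, (i < k)%N -> (b <= g i)%N) -> col_count k = col_count 0.
Proof.
elim: k => // k IH kN h; rewrite col_count_step // IH ?(ltnW kN) // => [|i ik]; last by apply: h; rewrite ltnW.
by have := h k (ltnSn k); case: (p k); lia.
Qed.

Lemma col_count_ge k : (k <= N)%N -> (forall i, (i < k)%N -> (b <= g' i)%N) -> (k <= col_count k)%N.
Proof.
move=> kN h; rewrite /col_count -(subnKC kN) iotaD count_cat (leq_trans _ (leq_addr _ _)) //.
rewrite (eq_in_count (a2 := predT)) ?count_predT ?size_iota // => i; rewrite mem_iota add0n => /= ik.
by rewrite ik h.
Qed.

(** The count changes only at the rows that grow into column [b], and at row [i] it passes from [i]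
    to [i + 1]. The ratio of the final to the initial value is thus a product over these rows. *)
Lemma col_count_telescope (K : fieldType) (z : K) k : (k <= N)%N ->
  (forall l, (k <= l <= N)%N -> z + (col_count l)%:R != 0) ->
  z + (col_count N)%:R = (z + (col_count k)%:R) *
    \prod_(k <= i < N) (if p i && ((g i).+1 == b) then (z + i.+1%:R) / (z + i%:R) else 1).
Proof.
move=> kN nz; suff main M : (k <= M <= N)%N -> z + (col_count M)%:R = (z + (col_count k)%:R) *
    \prod_(k <= i < M) (if p i && ((g i).+1 == b) then (z + i.+1%:R) / (z + i%:R) else 1).
  by apply: main; rewrite kN leqnn.
elim: M => [|M IH]; first by rewrite leqn0 => /andP[/eqP-> _]; rewrite big_geq ?mulr1.
rewrite leq_eqVlt => /andP[/predU1P[-> _|]]; first by rewrite big_geq ?mulr1.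
rewrite ltnS => kM MN; rewrite big_nat_recr //= mulrA -IH ?kM ?(ltnW MN) // col_count_step //.
have := nz M; rewrite kM (ltnW MN) => /(_ isT).
case: ifP => [/andP[pM /eqP e]|_] /=; last by rewrite addn0 mulr1.
by rewrite (col_count_at MN pM e) addn1 => nzM; rewrite mulrCA divff ?mulr1.
Qed.

End ColumnCount.

Lemma conj_part_count la N b : (size la <= N)%N -> (0 < b)%N ->
  conj_part la b = count (fun i => b <= nth 0 la i)%N (iota 0 N).
Proof.
move=> sz b0; rewrite -(subnKC sz) iotaD count_cat [X in (_ + X)%N](_ : _ = 0%N) ?addn0; last first.
  apply/eqP; rewrite -leqn0 leqNgt -has_count; apply/hasPn => i; rewrite mem_iota => /andP[li _].
  by rewrite nth_default // leqNgt b0.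
by rewrite /conj_part -{1}(mkseq_nth 0%N la) count_map.
Qed.

Lemma stacked_lt (s : rowstate) i j : stacked s -> (i < j)%N -> (circ_len s j <= (s i).1)%N.
Proof.
move=> st; case: j => // j; rewrite ltnS => ij; have [h _] := stacked_anti st ij; apply: leq_trans h.
by have := st j; rewrite /row_rel /circ_len; case: (s j) (s j.+1) => [a []] [c []] /=; lia.
Qed.

Lemma has_row_cells N p col (P : pred cell) :
  has P (row_cells N p col) = has (fun i => p i && P (i.+1, col i)) (iota 0 N).
Proof. by rewrite /row_cells has_map; elim: (iota 0 N) => //= i I <-; case: (p i). Qed.

Lemma has_orb (T : Type) (a b : pred T) r : has a r || has b r = has (fun x => a x || b x) r.
Proof. by elim: r => //= x r <-; case: (a x) (b x) => [] [] //=; rewrite orbT. Qed.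

Lemma same_row_cells N p col j b : (j < N)%N -> has (same_row (j.+1, b)) (row_cells N p col) = p j.
Proof.
move=> jN; rewrite has_row_cells; apply/hasP/idP => [[i _ /andP[pi]]|pj].
  by rewrite /same_row /= eqSS => /eqP->.
by exists j; rewrite ?mem_iota // pj /same_row eqxx.
Qed.

Section PsiProduct.
Variables (K : fieldType) (al : K).
Hypothesis al_gen : forall a b : int, al * a%:~R + b%:~R = 0 -> a = 0 /\ b = 0.
Variables (La Om : spart).

(** The hooks and products of the statement over a general field; at [alpha] they are convertible to
    the given ones, so the last step needs no translation. *)
Definition lower_hook (G : spart) (c : cell) : K :=
  (leg (circ G) c)%:~R + al * (arm (star G) c + 1)%:~R.
Definition upper_hook (G : spart) (c : cell) : K :=
  if c \in cells (star G)
  then (leg (star G) c + 1)%:~R + al * (arm (circ G) c)%:~R else 1.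
Definition lower_ratio c := lower_hook La c / lower_hook Om c.
Definition upper_ratio c := upper_hook Om c / upper_hook La c.
Definition cell_factor (c : cell) : K :=
  if has (same_row c) (new_squares Om La) then 1 else
  match has (same_row c) (bumping_squares Om La), has (same_row c) (new_circles Om La) with
  | false, false => lower_ratio c * upper_ratio c
  | false, true => lower_ratio c
  | true, false => upper_ratio c
  | true, true => 1
  end.
Definition col_product : K := \prod_(c <- col_cells Om La) cell_factor c.

Variable N : nat.
Hypotheses (leLa : (size (circ La) <= N)%N) (leOm : (size (circ Om) <= N)%N).
Local Notation s := (rows La).
Local Notation s' := (rows Om).
Local Notation X := (star_inc s s').
Local Notation Y := (circ_inc s s').
Local Notation us := (ustar al s).
Local Notation uc := (ucirc al s).
Hypothesis st : strip N s s'.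

Let inc k : (s' k).1 = ((s k).1 + X k)%N /\ circ_len s' k = (circ_len s k + Y k)%N :=
  strip_inc (rows_vanish_le leLa) (rows_vanish_le leOm) k st.

Definition active_col b : bool :=
  has (fun i => (X i && ((s i).1.+1 == b)) || (Y i && ((circ_len s i).+1 == b))) (iota 0 N).

Lemma active_colE (c : cell) : has (same_col c) (non_preexisting Om La) = active_col c.2.
Proof.
rewrite /non_preexisting !has_cat (new_squares_rows leLa leOm st) (bumping_squares_rows leLa leOm st).
rewrite (new_circles_rows leLa leOm st) !has_row_cells !has_orb; apply: eq_has => k.
rewrite /same_col; cbn [snd]; have [] := inc k; have := inc_rel leLa leOm st k; rewrite /circ_len.
by case: (X k) (Y k) (s k) (s' k) => [] [] [a []] [a' []] /=; lia.
Qed.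

(** A preexisting circle closes its column: the rows above already cover that column in Lambda^star,
    and the rows below may not reach it in Omega, so no new cell can lie there. *)
Lemma active_square j b : ~~ X j -> (b <= circ_len s j)%N -> active_col b -> (b <= (s j).1)%N.
Proof.
move=> xj ble /hasP[i _ act]; rewrite leqNgt; apply/negP => lt.
have [hj1 hj2] := inc j; have [hi1 hi2] := inc i; rewrite (negPf xj) addn0 in hj1.
have hs : circ_len s j = (s j).1.+1.
  by move: ble lt; rewrite /circ_len; case: (s j) => [a []] /=; lia.
case: (ltngtP i j) => [ij|ji|e].
- have h := stacked_lt (@rows_stacked La) ij; have h2 : ((s i).1 <= circ_len s i)%N := leq_addr _ _.
  by move: act h h2; move: (circ_len s i) (s i).1 => A B; lia.
- have h := stacked_lt (@rows_stacked Om) ji; have h2 : ((s' i).1 <= circ_len s' i)%N := leq_addr _ _.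
  by move: act h h2; rewrite hj1 hi1 hi2; move: (circ_len s i) (s i).1 => A B; lia.
by move: act; rewrite e (negPf xj) /=; lia.
Qed.

Let anti_star G i j : (i <= j)%N -> ((rows G j).1 <= (rows G i).1)%N.
Proof. by move=> ij; have [] := stacked_anti (@rows_stacked G) ij. Qed.
Let anti_circ G i j : (i <= j)%N -> (circ_len (rows G) j <= circ_len (rows G) i)%N.
Proof. by move=> ij; have [] := stacked_anti (@rows_stacked G) ij. Qed.

Let gen_neq0 (m k l : nat) : (0 < m)%N || (l < k)%N -> al * m%:R - l%:R + k%:R != 0.
Proof.
move=> pos; apply/eqP => e; have [] := al_gen (a := m%:Z) (b := k%:Z - l%:Z).
  by rewrite rmorphB /= -!pmulrn -e; ring.
by move: pos => /orP[]; lia.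
Qed.

(** The arm is unchanged when row [j] gains no square, so only the length of column [b] in the
    circled diagram matters. Rows up to [j] already reach this column, and the rows below contribute
    one factor each time one of them grows into it. *)
Lemma lower_ratioE j b : (j < N)%N -> ~~ X j -> (0 < b <= circ_len s j)%N -> active_col b ->
  lower_ratio (j.+1, b) =
  \prod_(j.+1 <= i < N) (if Y i && ((circ_len s i).+1 == b) then 1 - (us j - uc i)^-1 else 1).
Proof.
move=> jN xj /andP[b0 ble] act; have bs := active_square xj ble act.
pose m := ((s j).1.+1 - b)%N; pose z : K := al * m%:R - j.+1%:R.
pose cnt := col_count (circ_len s) (circ_len s') N b.
have nz k : z + k%:R != 0 by apply: gen_neq0; rewrite subn_gt0 ltnS bs.
have lowE G k : (size (circ G) <= N)%N -> (rows G j).1 = (s j).1 ->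
    k = count (fun i => b <= circ_len (rows G) i)%N (iota 0 N) -> lower_hook G (j.+1, b) = z + k%:R.
  move=> le eG ->; rewrite /lower_hook /leg /arm /= -[part _ _]/((rows G j).1) eG.
  rewrite (conj_part_count le b0) (eq_count (a2 := fun i => b <= circ_len (rows G) i)%N) => [|i]; last by rewrite -rows_circ.
  rewrite /z /m natrB ?(leq_trans bs) // !rmorphD !rmorphN /= -!pmulrn -!natr1; ring.
have c0 : cnt 0%N = count (fun i => b <= circ_len s i)%N (iota 0 N) by [].
have cN : cnt N = count (fun i => b <= circ_len s' i)%N (iota 0 N).
  by apply: eq_in_count => i; rewrite mem_iota add0n => /= ->.
have [hj _] := inc j; rewrite (negPf xj) addn0 in hj.
rewrite /lower_ratio (lowE _ _ leLa _ c0) // (lowE _ _ leOm _ cN) //.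
have := @col_count_telescope _ _ Y N b (@anti_circ La) (@anti_circ Om) (fun i => proj2 (inc i)) K z j.+1 jN (fun l _ => nz _).
have cj : cnt j.+1 = cnt 0%N.
  apply: (@col_count_const _ _ Y) => // [i|i ij]; first by have [] := inc i.
  exact: leq_trans ble (@anti_circ _ i j ij).
rewrite -/cnt cj => ->.
rewrite invfM mulrA divff // mul1r -prodfV; apply: eq_bigr => i _.
case: ifP => [/andP[_ /eqP e]|_]; last by rewrite invr1.
(* Column [b] comes right after the end of row [i] in Lambda^circledast, so the hook value is a
   difference of contents. *)
have -> : us j - uc i = z + i.+1%:R.
  rewrite /ustar /ucirc -/(circ_len s i) /z /m -e subSS natrB; last by rewrite -ltnS e ltnW.
  by rewrite -!natr1; ring.
by have := nz i.+1; have := nz i; rewrite -natr1 => n0 n1; field; rewrite n0 n1.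
Qed.

Lemma upper_ratioE j b : (j < N)%N -> ~~ Y j -> (0 < b <= circ_len s j)%N -> active_col b ->
  upper_ratio (j.+1, b) =
  \prod_(j.+1 <= i < N) (if X i && ((s i).1.+1 == b) then 1 + (uc j - us i - al)^-1 else 1).
Proof.
move=> jN yj /andP[b0 ble] act; have [hj1 hj2] := inc j; rewrite (negPf yj) addn0 in hj2.
pose m := (circ_len s j - b)%N; pose z : K := al * m%:R - j%:R.
pose cnt := col_count (fun i => (s i).1) (fun i => (s' i).1) N b.
have bs' : (b <= (s' j).1)%N.
  case xj: (X j); last by rewrite hj1 (leq_trans (active_square (negbT xj) ble act)) ?leq_addr.
  by move: ble; rewrite hj1 xj /circ_len; case: (s j) => [a []] /=; lia.
have nz k : (j < k)%N -> z + k%:R != 0 by move=> jk; apply: gen_neq0; rewrite jk orbT.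
have upE G k : (size (circ G) <= N)%N -> (b <= (rows G j).1)%N -> circ_len (rows G) j = circ_len s j ->
    k = count (fun i => b <= (rows G i).1)%N (iota 0 N) -> upper_hook G (j.+1, b) = z + k%:R.
  move=> le bG eG ->; rewrite /upper_hook mem_cells part_star b0 bG /leg /arm; cbn [fst snd].
  rewrite part_circ eG (conj_part_count (leq_trans (size_star_circ G) le) b0).
  rewrite /z /m natrB // !rmorphD !rmorphN /= -!pmulrn -!natr1; ring.
have c0 : cnt 0%N = count (fun i => b <= (s i).1)%N (iota 0 N) by [].
have cN : cnt N = count (fun i => b <= (s' i).1)%N (iota 0 N).
  by apply: eq_in_count => i; rewrite mem_iota add0n => /= ->.
have cj : (j < cnt j.+1)%N.
  by apply: col_count_ge => // i ij; apply: leq_trans bs' (@anti_star _ i j ij).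
have incX i : (s' i).1 = ((s i).1 + X i)%N by have [] := inc i.
have nzc l : (j.+1 <= l <= N)%N -> z + (cnt l)%:R != 0.
  move=> lN; apply: nz; apply: leq_trans cj _; apply: (@col_count_le _ _ X) => //.
rewrite /upper_ratio (upE _ _ leOm bs' hj2 cN).
rewrite (@col_count_telescope _ _ X N b (@anti_star La) (@anti_star Om) incX K z j.+1 jN nzc) -/cnt.
have -> : upper_hook La (j.+1, b) = z + (cnt j.+1)%:R.
  case: (leqP b (s j).1) => bs.
    rewrite (upE _ _ leLa bs erefl c0) /cnt (@col_count_const _ _ X) // => i ij.
    exact: leq_trans bs (@anti_star _ i j ij).
  (* The cell is a circle of [La] that gets bumped. Its upper hook is 1 by convention, and this is
     also the value of the formula after row [j] has been moved: arm 0 and column length j + 1. *)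
  have xj : X j by apply: contraTT bs => xj; rewrite -leqNgt active_square.
  have e : (s j).1.+1 = b by move: ble bs; rewrite /circ_len; case: (s j) => [a []] /=; lia.
  rewrite /upper_hook mem_cells part_star; cbn [fst snd]; rewrite [(b <= _)%N]leqNgt bs !andbF.
  rewrite /cnt (col_count_step _ incX) // (col_count_at (@anti_star La) (@anti_star Om) incX jN xj e) xj e eqxx addn1.
  have m0 : m = 0%N by rewrite /m; move: ble bs e; rewrite /circ_len; case: (s j) => [a []] /=; lia.
  by rewrite /z m0 mulr0 sub0r -natr1 addrA addNr add0r.
rewrite mulrAC divff ?mul1r; last by apply: nzc; rewrite leqnn.
apply: eq_big_nat => i /andP[ji _]; case: ifP => [/andP[_ /eqP e]|//].
have -> : uc j - us i - al = z + i%:R.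
  rewrite /ustar /ucirc -/(circ_len s j) /z /m -e natrB; last by rewrite e.
  by rewrite -!natr1; ring.
have := nz i ji => n0; rewrite -natr1; field; exact: n0.
Qed.

(** The cases of psi' are governed by two independent bits: growth in Lambda^star suppresses the
    lower ratio, growth in Lambda^circledast the upper one. *)
Lemma cell_factorE j b : (j < N)%N -> cell_factor (j.+1, b) =
  (if X j then 1 else lower_ratio (j.+1, b)) * (if Y j then 1 else upper_ratio (j.+1, b)).
Proof.
move=> jN; rewrite /cell_factor (new_squares_rows leLa leOm st) (bumping_squares_rows leLa leOm st).
rewrite (new_circles_rows leLa leOm st) !same_row_cells //.
have := inc_rel leLa leOm st j.
by case: (X j) (Y j) (s j).2 (s' j).2 => [] [] [] [] //= _; rewrite ?mul1r ?mulr1.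
Qed.

Lemma prod_iota_pick (F : K) (C : bool) c L : (C -> (0 < c <= L)%N) ->
  \prod_(b <- iota 1 L) (if C && (c == b) then F else 1) = if C then F else 1.
Proof.
case: C => [/(_ isT) cL|_]; last by rewrite big1.
have cI : c \in iota 1 L by rewrite mem_iota add1n ltnS.
rewrite (bigD1_seq c) ?iota_uniq //=; by rewrite eqxx big1 ?mulr1 // => b; rewrite eq_sym => /negPf->.
Qed.

Let low i j : K := 1 - (us j - uc i)^-1.
Let upp i j : K := 1 + (uc j - us i - al)^-1.

Lemma active_factor j b : (j < N)%N -> (0 < b <= circ_len s j)%N ->
  (if active_col b then cell_factor (j.+1, b) else 1) =
  \prod_(j.+1 <= i < N) ((if (Y i && ~~ X j) && ((circ_len s i).+1 == b) then low i j else 1) *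
    (if (X i && ~~ Y j) && ((s i).1.+1 == b) then upp i j else 1)).
Proof.
move=> jN bL; case act: (active_col b); last first.
  rewrite big_nat big1 // => i /andP[_ iN].
  have : ~~ active_col b by rewrite act.
  move=> /hasPn/(_ i); rewrite mem_iota => /(_ iN); rewrite negb_or => /andP[/negbTE hX /negbTE hY].
  by rewrite andbAC hY andbAC hX mulr1.
rewrite cell_factorE // big_split; congr (_ * _).
  case xj: (X j); first by rewrite big1 // => i _; rewrite andbF.
  by rewrite (lower_ratioE jN) ?xj //; apply: eq_bigr => i _; rewrite andbT.
case yj: (Y j); first by rewrite big1 // => i _; rewrite andbF.
by rewrite (upper_ratioE jN) ?yj //; apply: eq_bigr => i _; rewrite andbT.
Qed.

(** Exchange the product over the cells of row [j] with that over the rows [i] below. A row that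
    grows does so in one column of each diagram, so each pair of rows meets every factor exactly
    once. *)
Theorem col_productE : col_product = strip_prod al N s s'.
Proof.
pose F i j := strip_factor al s X Y i j.
have swap : strip_prod al N s s' = \prod_(j < N) \prod_(j.+1 <= i < N) F i j.
  rewrite /strip_prod /pair_prod.
  rewrite (eq_bigr (fun i : 'I_N => \prod_(j < N | (j < i)%N) F i j)) => [|i _]; last first.
    by rewrite (big_ord_widen N (F i) (ltnW (ltn_ord i))).
  rewrite (exchange_big_dep xpredT) //=; apply: eq_bigr => j _.
  by rewrite (@big_nat_widenl _ _ _ _ 0) // big_mkord.
rewrite swap /col_product /col_cells big_filter big_mkcond.
pose G (c : cell) := if has (same_col c) (non_preexisting Om La) then cell_factor c else 1.
rewrite -/G /cells big_allpairs_dep -[X in iota X]addn0 iotaDl big_map.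
pose H i := \prod_(b <- iota 1 (part (circ La) i.+1)) G (i.+1, b).
have -> : \prod_(i <- iota 0 (size (circ La))) H i = \prod_(i < N) H i.
  rewrite -(big_mkord xpredT H) /index_iota subn0 -{1}(subnKC leLa) iotaD big_cat [X in _ = _ * X]big1_seq ?mulr1 //.
  move=> i /andP[_]; rewrite mem_iota => /andP[li _].
  by rewrite /H /part nth_default // big_nil.
apply: eq_bigr => j _; rewrite /H part_circ.
transitivity (\prod_(b <- iota 1 (circ_len s j)) \prod_(j.+1 <= i < N)
   ((if (Y i && ~~ X j) && ((circ_len s i).+1 == b) then low i j else 1) *
    (if (X i && ~~ Y j) && ((s i).1.+1 == b) then upp i j else 1))).
  rewrite big_seq [RHS]big_seq; apply: eq_bigr => b; rewrite mem_iota add1n ltnS => bL.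
  by rewrite /G active_colE active_factor.
rewrite exchange_big big_nat [RHS]big_nat; apply: eq_bigr => i /andP[ji _].
have [hj1 hj2] := inc j; have [hi1 hi2] := inc i.
rewrite big_split !prod_iota_pick //.
  move=> /andP[xi /negbTE yj]; rewrite xi addn1 in hi1; rewrite yj addn0 in hj2.
  apply/andP; split=> //; rewrite -hi1 -hj2.
  exact: leq_trans (@anti_star Om _ _ (ltnW ji)) (leq_addr _ _).
move=> /andP[yi /negbTE xj]; rewrite yi addn1 in hi2; rewrite xj addn0 in hj1.
apply/andP; split=> //; rewrite -hi2.
by rewrite (leq_trans (stacked_lt (@rows_stacked Om) ji)) // hj1 leq_addr.
Qed.

End PsiProduct.

(** * Determinant and sign *)

Lemma count_iotaS (p : pred nat) d : count p (iota 0 d.+1) = (count p (iota 0 d) + p d)%N.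
Proof. by rewrite -addn1 iotaD count_cat /= addn0. Qed.

Section PeelAll.
Variables (K : fieldType) (N : nat) (b : bool).
Implicit Types (A : option nat -> option nat -> K) (p q : pred nat).

Definition row_list p : seq (option nat) := nseq b None ++ map Some [seq i <- iota 0 N | p i].
Definition col_list q : seq (option nat) := map Some [seq i <- iota 0 N | q i].
Definition pred_minor A p q : K := minor (count q (iota 0 N)) A (row_list p) (col_list q).

Lemma size_row_list p : size (row_list p) = (b + count p (iota 0 N))%N.
Proof. by rewrite size_cat size_nseq size_map size_filter. Qed.
Lemma size_col_list q : size (col_list q) = count q (iota 0 N).
Proof. by rewrite size_map size_filter. Qed.
Lemma uniq_col_list q : uniq (col_list q).
Proof. by rewrite map_inj_uniq ?filter_uniq ?iota_uniq // => i j []. Qed.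
Lemma uniq_row_list p : uniq (row_list p).
Proof.
rewrite cat_uniq uniq_col_list andbT; apply/andP; split; first by case: b.
by apply/hasPn => _ /mapP[i _ ->]; case: b.
Qed.
Lemma mem_col_list q d : (Some d \in col_list q) = q d && (d < N)%N.
Proof. by rewrite mem_map ?mem_filter ?mem_iota // => i j []. Qed.
Lemma mem_row_list p d : (Some d \in row_list p) = p d && (d < N)%N.
Proof. by rewrite mem_cat mem_col_list; case: b. Qed.

Lemma index_col_list q d : q d -> (d < N)%N -> index (Some d) (col_list q) = count q (iota 0 d).
Proof. by move=> qd dN; rewrite index_map; [rewrite index_filter_iota // sum_inc | move=> i j []]. Qed.
Lemma index_row_list p d : p d -> (d < N)%N -> index (Some d) (row_list p) = (b + count p (iota 0 d))%N.
Proof.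
move=> pd dN; rewrite index_cat -[map _ _]/(col_list p) index_col_list // size_nseq.
by case: b.
Qed.

Let drop p d : pred nat := fun i => p i && (i != d).

Lemma rem_col_list q d : rem (Some d) (col_list q) = col_list (drop q d).
Proof.
rewrite rem_filter ?uniq_col_list // filter_map -filter_predI; congr map; apply: eq_filter => i /=.
by rewrite andbC; congr andb.
Qed.
Lemma rem_row_list p d : rem (Some d) (row_list p) = row_list (drop p d).
Proof.
have := rem_col_list p d; rewrite !rem_filter ?uniq_row_list ?uniq_col_list // /col_list /row_list.
by rewrite filter_cat => ->; case: b.
Qed.

Lemma count_drop p d k : p d -> count p (iota 0 k) = (count (drop p d) (iota 0 k) + (d < k))%N.
Proof.
move=> pd; elim: k => // k IH; rewrite !count_iotaS IH /drop ltnS.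
by case: (ltngtP d k) => [_|_|<-]; rewrite ?pd ?eqxx ?andbT ?andbF; lia.
Qed.

(** The exponent refers to positions in the full lists. This is harmless: deleting a label lowers
    both the row position and the column position of every later label by one, and the parity of
    their sum stays. *)
Lemma minor_peel_all A p q (D : seq nat) : uniq D ->
  (forall d, d \in D -> [/\ p d, q d & (d < N)%N]) ->
  (forall d, d \in D -> (forall j, A (Some d) (Some j) = (d == j)%:R) \/
     (forall i, A i (Some d) = (i == Some d)%:R)) ->
  (b + count p (iota 0 N))%N = count q (iota 0 N) ->
  pred_minor A p q = (-1) ^+ (\sum_(d <- D) (b + count p (iota 0 d) + count q (iota 0 d)))%N *
    pred_minor A (fun i => p i && (i \notin D)) (fun i => q i && (i \notin D)).
Proof.
elim: D p q => [|d D IH] p q.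
  have e (r : pred nat) : r =1 (fun i => r i && (i \notin [::])) by move=> i; rewrite andbT.
  rewrite big_nil mul1r => _ _ _ _.
  by rewrite /pred_minor /row_list /col_list -(eq_count (e q)) -(eq_filter (e p)) -(eq_filter (e q)).
move=> /andP[dD uD] mem un sz; have [pd qd dN] := mem d (mem_head _ _).
have szp := count_drop N pd; have szq := count_drop N qd; rewrite dN /= addn1 in szp; rewrite dN /= addn1 in szq.
have IHd : pred_minor A (drop p d) (drop q d) =
    (-1) ^+ (\sum_(k <- D) (b + count (drop p d) (iota 0 k) + count (drop q d) (iota 0 k)))%N *
    pred_minor A (fun i => drop p d i && (i \notin D)) (fun i => drop q d i && (i \notin D)).
  apply: IH => // [k kD|k kD|]; last by lia.
    have kD' : k \in d :: D by rewrite inE kD orbT.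
    have [pk qk kN] := mem k kD'; rewrite /drop pk qk kN; split=> //;
    by apply: contraNneq dD => <-.
  by apply: un; rewrite inE kD orbT.
rewrite {1}/pred_minor szq (minor_peel (d := Some d)) ?uniq_row_list ?uniq_col_list ?mem_row_list ?mem_col_list ?pd ?qd //.
- rewrite rem_row_list rem_col_list -/(pred_minor A (drop p d) (drop q d)) IHd mulrA -exprD.
  rewrite index_row_list // index_col_list //; congr (_ * _).
    rewrite -signr_odd -[RHS]signr_odd big_cons !oddD; congr (_ ^+ nat_of_bool (_ (+) _)).
    elim: (D) => [|k E IHE]; first by rewrite !big_nil.
    by rewrite !big_cons !oddD IHE !(count_drop _ pd) !(count_drop _ qd) !oddD; case: (d < k)%N; case: (odd _) (odd _) (odd _) => [] [] [].
  have ed (r : pred nat) i : drop r d i && (i \notin D) = r i && (i \notin d :: D) by rewrite /drop inE negb_or andbA.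
  by rewrite /pred_minor /row_list /col_list (eq_count (ed q)) (eq_filter (ed p)) (eq_filter (ed q)).
- by rewrite size_row_list sz szq.
- by rewrite size_col_list szq.
case: (un d (mem_head _ _)) => h; [left|right].
  by move=> _ /mapP[j _ ->]; rewrite h.
by move=> i _; apply: h.
Qed.

End PeelAll.

Section SignBalance.
Variables (x y c c' : pred nat) (b : bool).
Hypothesis rel : forall i, (x i + c' i = c i + y i)%N.
Local Notation cnt p i := (count p (iota 0 i)).

(** The rows of preexisting circles and new squares, which the sign counts; [moving_row] is the
    number of new circles and bumping squares in a row. *)
Definition fixed_row i := (~~ x i && c i) || (x i && ~~ c i).
Definition moving_row i := (c' i && ~~ (c i && ~~ x i) + (x i && c i))%N.
(** The contributions of row [i] to three exponents: the sign of the strip, the deletion from Det of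
    a row with both an x and a y label, and the deletion from the minor of a row circled on both
    sides. *)
Definition sign_weight i : nat := (moving_row i * cnt fixed_row i +
  (x i && y i) * (b + cnt x i + cnt y i) + (c i && c' i) * (b + cnt c i + cnt c' i))%N.

(** The statement for partial sums has a correction term, which makes the induction over rows a
    finite check of parities. For a complete strip the counts of [x] and [y] differ by [b], and the
    correction vanishes. *)
Lemma sign_balance N : odd (\sum_(0 <= i < N) sign_weight i) =
  odd (cnt fixed_row N) && (odd (cnt x N + cnt y N) (+) b).
Proof.
have par i : odd (cnt c i + cnt c' i) = odd (cnt x i + cnt y i).
  elim: i => // i IH; rewrite !count_iotaS !addnA !oddD !oddb in IH *; move: IH (rel i).
  by case: (x i) (y i) (c i) (c' i) => [] [] [] [] //;
     case: (odd (cnt x i)) (odd (cnt y i)) (odd (cnt c i)) (odd (cnt c' i)) => [] [] [] [].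
elim: N => [|N IH]; first by rewrite big_geq.
rewrite big_nat_recr // -[X in odd X]/(_ + _)%N oddD IH /sign_weight /moving_row !count_iotaS !oddD !oddM !oddD !oddb.
have := par N; rewrite !oddD; have := rel N; move: (odd (cnt fixed_row N)) => e; rewrite /fixed_row.
case: (x N) (y N) (c N) (c' N) => [] [] [] [] //= _;
by case: (odd (cnt x N)) (odd (cnt y N)) (odd (cnt c N)) (odd (cnt c' N)) e (b) => [] [] [] [] [] [].
Qed.

End SignBalance.

Section StripDeterminant.
Variables (K : fieldType) (al : K).
Variables (La Om : spart).

Definition cell_label (c : cell) : K := al * c.2%:R - c.1%:R.
Definition cell_bracket (x y : cell) : K :=
  if ~~ has (same_row x) (ycells Om La) then
    al / ((cell_label x - cell_label y + al) * (cell_label x - cell_label y))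
  else if same_row x y then 1 else 0.
Definition cell_bracket_at (i j : nat) : K :=
  cell_bracket (nth (0, 0)%N (xcells Om La) i) (nth (0, 0)%N (ycells Om La) j).
Definition strip_det (n : nat) : K := \det (\matrix_(i < n, j < n) cell_bracket_at i j).
Definition strip_tdet (n : nat) : K := \det (\matrix_(i < n.+1, j < n.+1)
  (if nat_of_ord i is i'.+1 then cell_bracket_at i' j else 1)).

Variable N : nat.
Hypotheses (leLa : (size (circ La) <= N)%N) (leOm : (size (circ Om) <= N)%N).
Local Notation s := (rows La).
Local Notation s' := (rows Om).
Local Notation X := (star_inc s s').
Local Notation Y := (circ_inc s s').
Local Notation us := (ustar al s).
Hypothesis st : strip N s s'.
Local Notation cnt p i := (count p (iota 0 i)).
Let c i := (s i).2.
Let c' i := (s' i).2.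
Let rel i : (X i + c' i = c i + Y i)%N := inc_rel leLa leOm st i.

Definition label_mx (i j : option nat) : K :=
  match i, j with
  | Some i, Some j => if Y i then (i == j)%:R else
      al / ((cell_label (i.+1, (s i).1.+1) - cell_label (j.+1, (circ_len s j).+1) + al) *
         (cell_label (i.+1, (s i).1.+1) - cell_label (j.+1, (circ_len s j).+1)))
  | None, _ => 1
  | _, _ => 0
  end.

Lemma cell_bracket_atE i j : (i < cnt X N)%N -> (j < cnt Y N)%N -> cell_bracket_at i j =
  label_mx (Some (nth 0%N [seq k <- iota 0 N | X k] i)) (Some (nth 0%N [seq k <- iota 0 N | Y k] j)).
Proof.
move=> iX jY; rewrite /cell_bracket_at (xcells_rows leLa leOm st) (ycells_rows leLa leOm st) /row_cells.
rewrite !(nth_map 0%N) ?size_filter //.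
set k := nth 0%N [seq k <- iota 0 N | X k] i; set l := nth 0%N _ j.
have : k \in [seq k <- iota 0 N | X k] by rewrite mem_nth ?size_filter.
rewrite mem_filter mem_iota add0n => /and3P[_ _ ltN].
rewrite /cell_bracket (ycells_rows leLa leOm st) same_row_cells // /label_mx.
by case: (Y k) => //=; rewrite /same_row /= eqSS; case: (k == l).
Qed.

Lemma strip_det_minor n : cnt X N = n -> cnt Y N = n -> strip_det n = pred_minor N false label_mx X Y.
Proof.
move=> eX eY; rewrite /pred_minor eY /strip_det /minor; congr (\det _); apply/matrixP => i j.
by rewrite !mxE cell_bracket_atE ?eX ?eY //= /row_list /col_list !(nth_map 0%N) ?size_filter ?eX ?eY.
Qed.

Lemma strip_tdet_minor n : cnt X N = n -> cnt Y N = n.+1 -> strip_tdet n = pred_minor N true label_mx X Y.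
Proof.
move=> eX eY; rewrite /pred_minor eY /strip_tdet /minor; congr (\det _); apply/matrixP => i j.
rewrite !mxE /row_list /col_list [nth None (map _ _) j](nth_map 0%N) ?size_filter ?eY //.
case: i => -[|i] //= lt; rewrite cell_bracket_atE ?eX ?eY //.
by rewrite (nth_map 0%N) // size_filter eX.
Qed.

Lemma strip_signE : strip_sign Om La = (\sum_(0 <= i < N) moving_row X c c' i * cnt (fixed_row X c) i)%N.
Proof.
have below p q col col' i : (i < N)%N -> count (fun d : cell => d.1 < i.+1)%N (row_cells N p col ++ row_cells N q col') =
    (cnt p i + cnt q i)%N.
  move=> iN; have one r cl : count (fun d : cell => d.1 < i.+1)%N (row_cells N r cl) = cnt r i.
    rewrite /row_cells count_map count_filter -(subnKC (ltnW iN)) iotaD count_cat.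
    rewrite [X in (_ + X)%N](_ : _ = 0%N) ?addn0.
      by apply: eq_in_count => k; rewrite mem_iota add0n /= ltnS => ->.
    apply/eqP; rewrite -leqn0 leqNgt -has_count; apply/hasPn => k; rewrite mem_iota add0n /= ltnS => /andP[ik _].
    by rewrite ltnNge ik.
  by rewrite count_cat !one.
rewrite /strip_sign (new_squares_rows leLa leOm st) (bumping_squares_rows leLa leOm st).
rewrite (new_circles_rows leLa leOm st) (preexisting_circles_rows leLa leOm st) big_cat.
rewrite /row_cells !big_map !big_filter -!/(row_cells _ _ _).
rewrite !(big_mkcond (fun i => _ && _)) /= -big_split /= /index_iota subn0.
rewrite big_seq [RHS]big_seq; apply: eq_bigr => i; rewrite mem_iota add0n => /= iN.
rewrite below // /moving_row -/(c i) -/(c' i).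
have -> : (cnt (fun i => ~~ X i && (s i).2) i + cnt (fun i => X i && ~~ (s i).2) i)%N = cnt (fixed_row X c) i.
  elim: (i) => // k IH; rewrite !count_iotaS -IH /fixed_row -/(c k).
  by case: (X k) (c k) => [] []; lia.
by case: (c' i && _) (X i && c i) => [] [] /=; lia.
Qed.

(** Once the unit labels are deleted on both sides, the same labels remain: the rows whose circle is
    bumped away and the rows without a square that acquire a circle. There the entries agree,
    because the label of a cell is the content of its row shifted by the constant al - 1. *)
Lemma peel_core (b : bool) (v : nat -> K) : (forall j, v j = (~~ X j)%:R) -> (b + cnt X N)%N = cnt Y N ->
  (-1) ^+ strip_sign Om La * pred_minor N b label_mx X Y = pred_minor N b (star_mx al s X v) c c'.
Proof.
move=> vE sz.
have sz2 : (b + cnt c N)%N = cnt c' N.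
  have : (cnt X N + cnt c' N = cnt c N + cnt Y N)%N.
    by elim: N => // k IH; rewrite !count_iotaS; have := rel k; lia.
  by lia.
rewrite (minor_peel_all (D := [seq i <- iota 0 N | X i && Y i])) ?filter_uniq ?iota_uniq //; last first.
- move=> d; rewrite mem_filter => /andP[/andP[_ yd] _]; left=> j; by rewrite /label_mx yd.
- by move=> d; rewrite mem_filter mem_iota => /and3P[/andP[xd yd] _ dN].
rewrite (minor_peel_all (A := star_mx al s X v) (D := [seq i <- iota 0 N | c i && c' i])) ?filter_uniq ?iota_uniq //; last first.
- move=> d; rewrite mem_filter => /andP[/andP[cd cd'] _]; case xd: (X d).
    by right=> -[i|]; rewrite /star_mx ?xd ?andbF // vE xd.
  by left=> j; rewrite /star_mx xd.
- by move=> d; rewrite mem_filter mem_iota => /and3P[/andP[xd yd] _ dN].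
rewrite mulrA -exprD; congr (_ * _).
  rewrite -signr_odd -[RHS]signr_odd; congr (_ ^+ nat_of_bool _).
  set D1 := \sum_(d <- _) _; set D2 := \sum_(d <- _) _.
  suff : odd (strip_sign Om La + D1 + D2) = false by rewrite oddD; case: (odd _) (odd _) => [] [].
  transitivity (odd (\sum_(0 <= i < N) sign_weight X Y c c' b i)); last first.
    by rewrite sign_balance // -sz !oddD oddb; case: (odd _) (odd _) (b) => [] [] [].
  rewrite /sign_weight !big_split /= strip_signE; congr (odd (_ + _ + _));
    rewrite /D1 /D2 big_filter big_mkcond /= /index_iota subn0; apply: eq_bigr => i _;
    by case: ifP => _; rewrite ?mul1n.
have rowsE : [seq i <- iota 0 N | X i && (i \notin [seq i <- iota 0 N | X i && Y i])] =
    [seq i <- iota 0 N | c i && (i \notin [seq i <- iota 0 N | c i && c' i])].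
  apply: eq_in_filter => i iN; rewrite !mem_filter iN !andbT.
  by have := rel i; case: (X i) (Y i) (c i) (c' i) => [] [] [] [].
have colsE : [seq i <- iota 0 N | Y i && (i \notin [seq i <- iota 0 N | X i && Y i])] =
    [seq i <- iota 0 N | c' i && (i \notin [seq i <- iota 0 N | c i && c' i])].
  apply: eq_in_filter => i iN; rewrite !mem_filter iN !andbT.
  by have := rel i; case: (X i) (Y i) (c i) (c' i) => [] [] [] [].
have sizeE : (b + size [seq i <- iota 0 N | X i && (i \notin [seq i <- iota 0 N | X i && Y i])] =
    size [seq i <- iota 0 N | Y i && (i \notin [seq i <- iota 0 N | X i && Y i])])%N.
  rewrite !size_filter.
  rewrite (eq_in_count (a2 := fun i => X i && ~~ Y i)) => [|i iN]; last first.
    by rewrite /= mem_filter iN andbT; case: (X i) (Y i) => [] [].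
  rewrite [RHS](eq_in_count (a2 := fun i => Y i && ~~ X i)) => [|i iN]; last first.
    by rewrite /= mem_filter iN andbT; case: (X i) (Y i) => [] [].
  have : (cnt (fun i => X i && ~~ Y i) N + cnt Y N = cnt (fun i => Y i && ~~ X i) N + cnt X N)%N.
    by elim: (N) => // k IH; rewrite !count_iotaS; case: (X k) (Y k) => [] [] /=; lia.
  by rewrite -sz addnCA addnA => /addIn.
rewrite /pred_minor /row_list /col_list -!size_filter -rowsE -colsE.
apply: eq_minor; rewrite ?size_cat ?size_nseq ?size_map //.
move=> i j iR /mapP[l + ->]; rewrite mem_filter mem_iota add0n => /andP[/andP[yl nl] lN].
have xl : ~~ X l by apply: contra nl => xl; rewrite mem_filter mem_iota xl yl.
have cl : c l = false by have := rel l; rewrite yl (negbTE xl); case: (c l) (c' l) => [] [].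
move: iR; rewrite mem_cat => /orP[|/mapP[k + ->]].
  by rewrite mem_nseq => /andP[_ /eqP->]; rewrite /star_mx vE xl.
rewrite mem_filter mem_iota add0n => /andP[/andP[xk nk] kN].
have yk : Y k = false by apply: contraNF nk => yk; rewrite mem_filter mem_iota xk yk.
rewrite /star_mx /label_mx yk xk xl /=.
have -> : cell_label (k.+1, (s k).1.+1) - cell_label (l.+1, (circ_len s l).+1) = us k - us l.
  rewrite /cell_label /ustar /circ_len -/(c l) cl addn0; cbn [fst snd]; rewrite -!natr1; ring.
by rewrite /move_coef [(us k - us l + al) * _]mulrC.
Qed.

End StripDeterminant.

(** * Specialisation to [alpha] and to the Jack superpolynomials *)

Lemma alpha_gen (a b : int) : alpha * a%:~R + b%:~R = 0 -> a = 0 /\ b = 0.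
Proof.
have ci (c : int) : (c%:~R : Qa) = tofrac ((c%:~R)%:P : {poly rat}).
  by rewrite -[(c%:~R)%:P]/(polyC (intr c)) rmorph_int rmorph_int.
rewrite !ci /alpha -tofracM -tofracD => /eqP; rewrite tofrac_eq0 => /eqP/polyP h.
have := h 1%N; have := h 0%N; rewrite !coefD !coefMC !coefX !coefC /= mul0r mul1r add0r addr0.
by move=> /eqP + /eqP; rewrite !intr_eq0 => /eqP-> /eqP->.
Qed.

Lemma power_word_normal La : normal (power_word La).
Proof.
have st := @rows_stacked La; apply/and3P; split; rewrite /power_word; cbn [fst snd].
- rewrite fpart_rows sorted_map.
  apply: (sub_in_sorted (P := [pred k | (rows La k).2]) (e := ltn)); last first.
  + by apply: sorted_filter; [exact: ltn_trans | exact: iota_ltn_sorted].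
  + by rewrite filter_all.
  move=> i j ei ej ij; rewrite /= ltn_neqAle; have [-> _] := stacked_anti st (ltnW ij).
  by rewrite andbT; apply: contraTneq (ij) => /(@circled_inj _ _ (leqnn _) _ _ ej ei) ->; rewrite -leqNgt.
- rewrite bpart_rows sorted_map.
  apply: (sub_sorted (e := ltn)); last by apply: sorted_filter; [exact: ltn_trans | exact: iota_ltn_sorted].
  by move=> i j /ltnW ij; have [] := stacked_anti st ij.
rewrite bpart_rows /positive all_map; apply/allP => k; rewrite mem_filter mem_iota => /and3P[ek _ kl].
have := rows_circ La k; rewrite (negPf ek) addn0 => e; rewrite -[preim _ _ _]/(0 < (rows La k).1)%N e lt0n.
have /andP[_] := circ_part La; apply: contraNneq => <-; exact: mem_nth.
Qed.

(** The monomial [smono] depends on the two lists of parts only, and its leading term determines the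
    superpartition. *)
Lemma power_word_inj : injective power_word.
Proof.
move=> La Om [ea eb]; pose N := maxn (size (circ La)) (size (circ Om)).
have e : smono La N = smono Om N by rewrite /smono ea eb.
have nz L : (size (circ L) <= N)%N -> (smono L N (state_set N (rows L)))@_(state_mnm N (rows L)) != 0.
  by move=> le; rewrite (smono_top le) oner_eq0.
have leL : (size (circ La) <= N)%N := leq_maxl _ _; have leO : (size (circ Om) <= N)%N := leq_maxr _ _.
apply: prefix_le_anti.
  by apply: (top_bounded leL (smono_bounded leO)); rewrite -e nz.
by apply: (top_bounded leO (smono_bounded leL)); rewrite e nz.
Qed.

Lemma swordE (K : fieldType) w N : sword K w N =
  (\prod_(k <- w.1) \sum_(i < N) theta i * zvar i ^+ k) * \prod_(r <- w.2) \sum_(i < N) zvar i ^+ r.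
Proof.
rewrite /sword; congr (_ * _); apply: eq_bigr => k _.
  by apply: eq_bigr => i _; rewrite zvarE -spcX.
by rewrite /spow spc_sum; apply: eq_bigr => i _; rewrite zvarE -spcX.
Qed.

Lemma spsumE : spsum = fun G => sword Qa (power_word G).
Proof.
apply/funext => G; apply: functional_extensionality_dep => N.
exact: (esym (@swordE Qa (power_word G) N)).
Qed.

Lemma sdom_prefix_le Om La : sdom Om La -> prefix_le (rows Om) (rows La).
Proof.
move=> /and4P[_ _ dstar dcirc] k.
have take_sum (la : seq nat) : (\sum_(j < k) nth 0 la j)%N = sumn (take k la).
  rewrite (@sumn_nth (take k la) k) ?size_take_min ?geq_minl //.
  by apply: eq_bigr => j _; rewrite nth_take.
have dom mu la : dom_part mu la -> (sumn (take k mu) <= sumn (take k la))%N.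
  move=> /andP[/eqP e /allP h]; case: (ltnP k (size mu + size la).+1) => lt.
    by apply: h; rewrite mem_iota.
  by rewrite !take_oversize ?e //; lia.
split; first by have := dom _ _ dstar; rewrite -!take_sum.
have circE L : (\sum_(j < k) circ_len (rows L) j)%N = sumn (take k (circ L)).
  by rewrite -take_sum; apply: eq_bigr => j _; rewrite -rows_circ.
by rewrite !circE; apply: dom.
Qed.

Section Jack.
Variable P : spart -> sfun.
Hypothesis jackP : is_jack P.

Lemma jack_leading La : leading La (P La).
Proof.
have [c hP] := proj1 jackP La.
have size_bound Om N : smono Om N != 0 -> (size (circ Om) <= N)%N.
  rewrite /smono /mono; case: ifP => [le _|]; last by rewrite eqxx.
  move: le; rewrite fpart_rows bpart_rows -map_cat size_map.
  by rewrite -[_ ++ _]/(row_order Om) size_row_order.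
have bd Om N : bounded_by (rows Om) (smono Om N).
  case: (leqP (size (circ Om)) N) => le; first exact: smono_bounded.
  have -> : smono Om N = 0 by apply/eqP; apply: contraLR le => /size_bound; rewrite -leqNgt.
  exact: bounded0.
split=> N; first rewrite hP.
  apply: bounded_add => //; apply: bounded_sum => Om /andP[_ le]; apply: bounded_scale.
  by apply: bounded_le (bd Om N) => k; have [] := sdom_prefix_le le k.
move=> leN; rewrite hP ffunE mcoeffD (smono_top leN) sum_ffunE raddf_sum /= big1 ?addr0 // => Om /andP[ne le].
rewrite ffunE mcoeffZ; apply/eqP; rewrite mulf_eq0; apply: contraNT ne; rewrite negb_or => /andP[_ nz].
apply/eqP; apply: prefix_le_anti; first exact: sdom_prefix_le.
exact: top_bounded leN (bd _ _) nz.
Qed.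

Theorem jack_corr La : corr alpha (P La) (state_delta Qa (rows La)).
Proof.
have [Q hQ] := choice (leading_basis alpha_gen).
apply: (corr_delta alpha_gen (fun L => proj1 (hQ L)) (fun L => proj2 (hQ L)) jack_leading) => //.
- by move=> L M ne; have := proj2 jackP L M ne; rewrite /scalar_product spsumE.
- exact: power_word_inj.
exact: power_word_normal.
Qed.

End Jack.

(** * The Pieri rules *)

Section PieriAmplitudes.
Variables (K : fieldType) (al : K).
Hypothesis al_gen : forall a b : int, al * a%:~R + b%:~R = 0 -> a = 0 /\ b = 0.
Variables (La Om : spart) (N : nat).
Hypotheses (leLa : (size (circ La) <= N)%N) (leOm : (size (circ Om) <= N)%N).

Lemma elem_amp_pieri n : elem_amp al N n (rows La) (rows Om) =
  if vstrip Om La n && (Om \in sparts (deg La + n) (fdeg La))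
  then (-1) ^+ strip_sign Om La * col_product al La Om * strip_det al La Om n else 0.
Proof.
have := strip_guard leLa leOm n false; rewrite /= !addn0 -[X in _ = X && _]/(vstrip Om La n) => guard.
rewrite /elem_amp guard; case: ifP => // /andP[vs pin].
move: vs guard pin; rewrite /vstrip (vstrip_rows leLa leOm) => /and3P[st /eqP sn /eqP cy].
move=> + pin; rewrite st sn cy !eqxx pin => /eqP sz.
rewrite (col_productE al_gen leLa leOm st) (strip_det_minor al leLa leOm st sn cy).
rewrite -mulrA mulrCA (peel_core _ _ _ st (v := fun j => (~~ star_inc (rows La) (rows Om) j)%:R)) ?sn ?cy //.
rewrite /pred_minor -size_filter -[size _]sz; congr (_ * _).
apply: eq_minor; rewrite ?size_map //.
by move=> i j /mapP[k _ ->].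
Qed.

Lemma telem_amp_pieri n : telem_amp al N n (rows La) (rows Om) =
  if tvstrip Om La n && (Om \in sparts (deg La + n) (fdeg La).+1)
  then (-1) ^+ strip_sign Om La * col_product al La Om * strip_tdet al La Om n else 0.
Proof.
have := strip_guard leLa leOm n true; rewrite /= !addn1 -[X in _ = X && _]/(tvstrip Om La n) => guard.
rewrite /telem_amp guard; case: ifP => // /andP[vs _].
move: vs; rewrite /tvstrip (vstrip_rows leLa leOm) => /and3P[st /eqP sn /eqP cy].
rewrite (col_productE al_gen leLa leOm st) (strip_tdet_minor al leLa leOm st sn cy).
rewrite -mulrA mulrCA (peel_core _ _ _ st (v := fun j => (~~ star_inc (rows La) (rows Om) j)%:R)) ?[count (star_inc _ _) _]sn ?cy //.
by rewrite /pred_minor -size_filter.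
Qed.

End PieriAmplitudes.

Section Pieri.
Variables (P : spart -> sfun) (La : spart) (n : nat).
Hypothesis jackP : is_jack P.

(** Both sides correspond to the same vector of the model, since by [jack_corr] the Jack
    superpolynomials correspond to the basis vectors; their difference vanishes by
    [corr_faithful]. *)
Lemma amp_combination (A : endo Qa) (f : sfun) (L : seq spart) (Q : pred spart) (c : spart -> Qa) :
  uniq L -> corr alpha f (A (state_delta Qa (rows La))) ->
  (forall Om, A (state_delta Qa (rows La)) Om = if Q Om && (Om \in L) then c Om else 0) ->
  forall N, f N = \sum_(Om <- L | Q Om) c Om *: P Om N.
Proof.
move=> uL cf hA N.
have h := corr_sum L (P := Q) (fun Om _ => corr_scale (c Om) (jack_corr jackP Om)).
have hd := corr_add cf (corr_scale (-1) h).
have := corr_faithful alpha_gen (corr_eq (fun=> erefl) _ hd) N.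
rewrite scaleN1r => /(_ _)/subr0_eq; apply => M; rewrite hA mulN1r; apply/eqP; rewrite subr_eq0; apply/eqP.
rewrite -big_filter; case: ifP => [/andP[QM ML]|no].
  rewrite (bigD1_seq M) ?filter_uniq ?mem_filter ?QM //= state_delta_eq eqxx mulr1.
  by rewrite big1 ?addr0 // => Om OmM; rewrite state_delta_eq eq_sym (negPf OmM) mulr0.
rewrite big1_seq // => Om /andP[_]; rewrite mem_filter state_delta_eq => yes.
by case: eqP => [e|]; [rewrite e yes in no | rewrite mulr0].
Qed.

Lemma elem_pieri N : elem n N * P La N =
  \sum_(Om <- sparts (deg La + n) (fdeg La) | vstrip Om La n) pieri_coef Om La n *: P Om N.
Proof.
apply: (amp_combination (f := fun N => elem n N * P La N) (A := elem_endo alpha n)) => //; first exact: sparts_uniq.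
  apply: corr_eq (corr_elem alpha_gen n (jack_corr jackP La)) => [M|M]; last by [].
  by rewrite elemE.
move=> Om; pose M := maxn (size (circ La)) (size (circ Om)).
rewrite (proj1 (elem_endo_amp alpha_gen n) M) ?(@elem_amp_pieri _ _ alpha_gen) ?leq_maxl ?leq_maxr //.
- by apply: rows_vanish_le; rewrite leq_maxl.
by apply: rows_vanish_le; rewrite leq_maxr.
Qed.

Lemma telem_pieri N : telem n N * P La N =
  \sum_(Om <- sparts (deg La + n) (fdeg La).+1 | tvstrip Om La n) tpieri_coef Om La n *: P Om N.
Proof.
apply: (amp_combination (f := fun N => telem n N * P La N) (A := telem_endo alpha n)) => //; first exact: sparts_uniq.
  apply: corr_eq (corr_telem alpha_gen n (jack_corr jackP La)) => [M|M]; last by [].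
  by rewrite telemE.
move=> Om; pose M := maxn (size (circ La)) (size (circ Om)).
rewrite (proj2 (elem_endo_amp alpha_gen n) M) ?(@telem_amp_pieri _ _ alpha_gen) ?leq_maxl ?leq_maxr //.
- by apply: rows_vanish_le; rewrite leq_maxl.
by apply: rows_vanish_le; rewrite leq_maxr.
Qed.

End Pieri.

Theorem theorem3p1 (P : spart -> sfun) (jackP : is_jack P) (La : spart)
    (n : nat) :
  ((0 < n)%N -> forall N : nat,
     elem n N * P La N =
     \sum_(Om <- sparts (deg La + n) (fdeg La) | vstrip Om La n)
        pieri_coef Om La n *: P Om N)
  /\
  (forall N : nat,
     telem n N * P La N =
     \sum_(Om <- sparts (deg La + n) (fdeg La).+1 | tvstrip Om La n)
        tpieri_coef Om La n *: P Om N).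
Proof. by split=> [_|] N; [apply: elem_pieri | apply: telem_pieri]. Qed.
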